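(* Let $\mathbb{X}$ be a Banach space, $T>0$, $1\le p\le\infty$, $0<\alpha_0<\alpha_1<1$, $P\subset\mathbb{R}^k$ compact, $\nu,\mu_1,\dots,\mu_k\in(0,1]$, $\kappa_1>0$, and $\Delta_T=\{(t,s,\alpha,z):\ 0\le s\le t\le T,\ \alpha\in[\alpha_0,\alpha_1],\ z\in P\}$. For $z=(\beta_1,\dots,\beta_k)$, $z'=(\beta_1',\dots,\beta_k')$ write $|z'-z|^\mu=\sum_{j=1}^k|\beta_j'-\beta_j|^{\mu_j}$. Let $K_0:\Delta_T\to\mathbb{R}$ satisfy (i) $K_0\in C(\Delta_T)$ and $K_0(t,t,\alpha,z)=1$; (ii) $\bigl\|\frac{\partial K_0}{\partial t}\bigr\|_{L^\infty(\Delta_T)}\le M$; (iii) $\sup_{0\le s\le t\le T}\bigl|\frac{\partial K_0}{\partial t}(t,s,\alpha',z')-\frac{\partial K_0}{\partial t}(t,s,\alpha,z)\bigr|\le\kappa_1(|\alpha'-\alpha|^\nu+|z'-z|^\mu)$ for all $(\alpha,z),(\alpha',z')\in[\alpha_0,\alpha_1]\times P$. For $\alpha\in[\alpha_0,\alpha_1]$, $z\in P$ consider the linear Abel equation of the first kind $$\mathcal{A}_{\alpha,z}v(t):=\frac1{\Gamma(\alpha)}\int_0^t\frac{K_0(t,s,\alpha,z)v(s)}{(t-s)^{1-\alpha}}\,ds=f(t),\qquad 0\le t\le T,\quad(\ast)$$ and put $H(t,s,\alpha,z)=K_0(t,s,\alpha,z)-K_0(s,s,\alpha,z)$, $$L_{\alpha,z}(t,s)=-\frac{\sin\pi\alpha}{\pi}\int_s^t(t-\tau)^{-\alpha}(\tau-s)^{\alpha-1}\Bigl((\alpha-1)(\tau-s)^{-1}H(\tau,s,\alpha,z)+\frac{\partial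 H}{\partial t}(\tau,s,\alpha,z)\Bigr)d\tau,$$ $$B_{\alpha,z}u(t)=\int_0^tu(s)L_{\alpha,z}(t,s)\,ds.$$ (a) Let $f\in L^1(0,T;\mathbb{X})$ satisfy $D_t^\alpha f\in L^p(0,T;\mathbb{X})$. Then $(\ast)$ has a unique solution $u_{\alpha,z}\in L^p(0,T;\mathbb{X})$ such that $$u_{\alpha,z}=D_t^\alpha f+B_{\alpha,z}u_{\alpha,z}.$$ This solution satisfies $$\|u_{\alpha,z}\|_{L^p(0,T;\mathbb{X})}\le C(MT,p)\|D_t^\alpha f\|_{L^p(0,T;\mathbb{X})},\qquad M=\Bigl\|\frac{\partial K_0}{\partial t}\Bigr\|_{L^\infty(\Delta_T)}.$$ (b) If there is $\alpha_2\in(\alpha_1,1)$ such that $D_t^{\alpha_2}f\in L^p(0,T;\mathbb{X})$, then there is a constant $C=C(\alpha_0,\alpha_1,P)$ such that $$\|u_{\alpha',z'}-u_{\alpha,z}\|_{L^p(0,T;\mathbb{X})}\le C(|\alpha'-\alpha|^\nu+|z'-z|^\mu)$$ for $(\alpha,z),(\alpha',z')\in[\alpha_0,\alpha_1]\times P$. In addition, if $(\alpha_n,z_n)$, $z_n=(z_{1n},\dots,z_{kn})$, are random variables with $(\alpha_n,z_n)\in[\alpha_0,\alpha_1]\times P$, and $\lambda\ge\nu$, $\rho\ge\mu_j$ for $j=1,\dots,k$, then $$\mathbb{E}\|u_{\alpha_n,z_n}-u_{\alpha,z}\|_{L^p(0,T;\mathbb{X})}\le C\Bigl((\mathbb{E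}|\alpha_n-\alpha|^\lambda)^{\nu/\lambda}+\sum_{j=1}^k(\mathbb{E}|z_{jn}-\beta_j|^{\rho})^{\mu_j/\rho}\Bigr).$$
   Context: $J^\alpha h(t)=\frac1{\Gamma(\alpha)}\int_0^t(t-s)^{\alpha-1}h(s)\,ds$ is the Riemann–Liouville integral. For $0<\alpha<1$ and $f\in L^1(0,T;\mathbb{X})$ such that $J^{1-\alpha}f$ is absolutely continuous, the Riemann–Liouville derivative is $D_t^\alpha f=\frac{d}{dt}J^{1-\alpha}f$. $\mathbb{E}$ is expectation.
   Formalization: In (b) the constant C may depend on all fixed data (f, K_0, T, p, α_2, M, κ_1, …), not only on α_0, α_1, P, since u is linear in f; it is uniform in (α,z), (α',z'), the random variables, λ and ρ. *)

(* Defs.v *)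
From HB Require Import structures.
From mathcomp Require Import all_boot all_order all_algebra.
From mathcomp Require Import all_classical all_reals all_analysis.
From mathcomp Require Import ess_sup_inf hoelder.

Set Implicit Arguments.
Unset Strict Implicit.
Unset Printing Implicit Defensive.

Import Order.TTheory GRing.Theory Num.Theory.
Import numFieldNormedType.Exports.

Local Open Scope classical_set_scope.
Local Open Scope ring_scope.

Definition simple {R : realType} {X : normedModType R} (s : R -> X) : Prop :=
  finite_set (range s) /\ forall x, measurable (s @^-1` [set x]).

(* Used only for bounded D, so that every measure below is finite. *)
Definition simple_integral {R : realType} {X : normedModType R}
    (D : set R) (s : R -> X) : X :=
  \sum_(x \in range s) fine (lebesgue_measure (D `&` s @^-1` [set x])) *: x.

Definition strongly_measurable {R : realType} {X : normedModType R}
    (D : set R) (f : R -> X) : Prop :=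
  exists2 s : nat -> R -> X, (forall n, simple (s n)) &
    {ae lebesgue_measure, forall t, D t -> (fun n => s n t) @ \oo --> f t}.

Definition is_bochner_integral {R : realType} {X : normedModType R}
    (D : set R) (f : R -> X) (v : X) : Prop :=
  strongly_measurable D f /\
  exists s : nat -> R -> X,
    [/\ forall n, simple (s n),
        (fun n => \int[lebesgue_measure]_(t in D) (`|f t - s n t|)%R%:E)%E @ \oo
          --> 0%E &
        (fun n => simple_integral D (s n)) @ \oo --> v].

Definition bochner {R : realType} {X : normedModType R}
    (D : set R) (f : R -> X) : X :=
  xget 0 [set v | is_bochner_integral D f v].

(* Elements of L^p(0, T; X) are represented by functions on R of which only
   the values on [0, T] matter; equality in L^p is eq_on. *)
Definition LpN {R : realType} {X : normedModType R} (T : R) (p : \bar R)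
    (u : R -> X) : \bar R :=
  Lnorm lebesgue_measure p ((fun t => (`|u t|)%:E) \_ `[0, T]).

Definition in_Lp {R : realType} {X : normedModType R} (T : R) (p : \bar R)
    (u : R -> X) : Prop :=
  strongly_measurable `[0, T] u /\ (LpN T p u < +oo)%E.

Definition eq_on {R : realType} {X : normedModType R} (T : R)
    (u v : R -> X) : Prop :=
  {ae lebesgue_measure, forall t, t \in `[0, T] -> u t = v t}.

Definition Gamma {R : realType} (a : R) : R :=
  \int[lebesgue_measure]_(x in `]0, +oo[) (x `^ (a - 1) * expR (- x)).

Definition RL_integral {R : realType} {X : normedModType R} (a : R)
    (h : R -> X) (t : R) : X :=
  (Gamma a)^-1 *: bochner `]0, t[ (fun s => (t - s) `^ (a - 1) *: h s).

Definition absolutely_continuous {R : realType} {X : normedModType R}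
    (a b : R) (F : R -> X) : Prop :=
  forall e : R, 0 < e -> exists2 d : R, 0 < d &
    forall (n : nat) (l r : 'I_n -> R),
      (forall i, [/\ a <= l i, l i <= r i & r i <= b]) ->
      trivIset [set: 'I_n] (fun i => `]l i, r i[%classic) ->
      \sum_(i < n) (r i - l i) < d ->
      \sum_(i < n) `|F (r i) - F (l i)| < e.

(* Outside spaces with the Radon-Nikodym property, absolute continuity does not
   provide the derivative; for X = R the second clause is redundant. *)
Definition ac_derivable {R : realType} {X : normedModType R}
    (a b : R) (F : R -> X) : Prop :=
  absolutely_continuous a b F /\
  {ae lebesgue_measure, forall t, t \in `]a, b[ -> derivable F t 1}.

Definition RL_derivative {R : realType} {X : normedModType R} (a : R)
    (f : R -> X) : R -> X :=
  derive1 (RL_integral (1 - a) f).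

(* "D_t^a f exists and belongs to L^p(0, T; X)".  Absolute continuity is that
   of the function given by the integral at every t in [0, T]: its value at 0
   is 0, which excludes f(t) = t^(a - 1). *)
Definition RL_derivative_in_Lp {R : realType} {X : normedModType R} (T : R)
    (p : \bar R) (a : R) (f : R -> X) : Prop :=
  ac_derivable 0 T (RL_integral (1 - a) f) /\ in_Lp T p (RL_derivative a f).

(* Here and below kap stands for K_0( . , . , a, z). *)
Definition abel_op {R : realType} {X : normedModType R} (a : R)
    (kap : R -> R -> R) (v : R -> X) (t : R) : X :=
  (Gamma a)^-1 *:
    bochner `]0, t[ (fun s => (kap t s / (t - s) `^ (1 - a)) *: v s).

Definition abel_H {R : realType} (kap : R -> R -> R) (t s : R) : R :=
  kap t s - kap s s.

Definition abel_L {R : realType} (a : R) (kap : R -> R -> R) (t s : R) : R :=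
  - (sin (pi * a) / pi) *
  \int[lebesgue_measure]_(tau in `]s, t[)
    ((t - tau) `^ (- a) * (tau - s) `^ (a - 1) *
     ((a - 1) * (tau - s)^-1 * abel_H kap tau s
      + derive1 (fun t' => abel_H kap t' s) tau)).

Definition abel_B {R : realType} {X : normedModType R} (a : R)
    (kap : R -> R -> R) (u : R -> X) (t : R) : X :=
  bochner `]0, t[ (fun s => abel_L a kap t s *: u s).

Definition abel_solution {R : realType} {X : normedModType R} (T : R)
    (p : \bar R) (a : R) (kap : R -> R -> R) (f v : R -> X) : Prop :=
  in_Lp T p v /\ eq_on T (abel_op a kap v) f.

Definition parameters {R : realType} {k : nat} (a0 a1 : R) (P : set 'rV[R]_k) :
    set (R * 'rV[R]_k) :=
  [set q | [/\ a0 <= q.1, q.1 <= a1 & P q.2]].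

Definition Delta {R : realType} {k : nat} (T a0 a1 : R) (P : set 'rV[R]_k) :
    set (R * R * R * 'rV[R]_k) :=
  [set q | let: (t, s, a, z) := q in
    [/\ 0 <= s, s <= t, t <= T & parameters a0 a1 P (a, z)]].

Definition dt {R : realType} {k : nat} (K : R -> R -> R -> 'rV[R]_k -> R)
    (t s a : R) (z : 'rV[R]_k) : R :=
  derive1 (fun t' => K t' s a z) t.

Definition triangle_norm {R : realType} (T : R) (g : R -> R -> R) : \bar R :=
  ess_sup (lebesgue_measure \x lebesgue_measure)%E
    ((fun q : R * R => (`|g q.1 q.2|)%:E) \_
       [set q | [/\ 0 <= q.2, q.2 <= q.1 & q.1 <= T]]).

(* The L^oo norm over Delta is essential in (t, s) only: P may be a null set
   of R^k, in which case an essential supremum over z would be vacuous. *)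
Definition Delta_norm {R : realType} {k : nat} (T a0 a1 : R)
    (P : set 'rV[R]_k) (g : R -> R -> R -> 'rV[R]_k -> R) : \bar R :=
  ereal_sup [set triangle_norm T (fun t s => g t s q.1 q.2)
            | q in parameters a0 a1 P].

Definition distmu {R : realType} {k : nat} (mu : 'I_k -> R)
    (z' z : 'rV[R]_k) : R :=
  \sum_(j < k) `|z' 0 j - z 0 j| `^ mu j.

Definition admissible_kernel {R : realType} {k : nat} (T a0 a1 : R)
    (P : set 'rV[R]_k) (nu : R) (mu : 'I_k -> R) (kappa1 M : R)
    (K : R -> R -> R -> 'rV[R]_k -> R) : Prop :=
  [/\ {within Delta T a0 a1 P,
        continuous (fun q : R * R * R * 'rV[R]_k =>
          K q.1.1.1 q.1.1.2 q.1.2 q.2)},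
      forall t a z, 0 <= t <= T -> parameters a0 a1 P (a, z) -> K t t a z = 1,
      (* meaning of "dK/dt is a function of class L^oo": without absolute
         continuity a.e. differentiability would allow Cantor functions *)
      forall s a z, 0 <= s <= T -> parameters a0 a1 P (a, z) ->
        ac_derivable s T (fun t => K t s a z : R^o),
      (Delta_norm T a0 a1 P (dt K) <= M%:E)%E &
      forall a z a' z',
        parameters a0 a1 P (a, z) -> parameters a0 a1 P (a', z') ->
        (triangle_norm T (fun t s => dt K t s a' z' - dt K t s a z)%R
         <= (kappa1 * (`|a' - a| `^ nu + distmu mu z' z))%R%:E)%E].

(* Main.v *)
(* Write K_0(t, s) = 1 + int_s^t h(r, s) dr, with h a Borel version of dK_0/dt bounded by M.
   By Fubini and the Beta integral, J^(1-a) A_a = J^1 (1 - B_a), and the kernel of B_a is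
   bounded by 2 M. As J^(1-a) is injective, A_a u = f is equivalent to u = D^a f + B_a u, a
   Volterra equation with bounded kernel: a Neumann series solves it, and Gronwall's argument in
   a weighted norm gives uniqueness and the L^p bound. For (b), f = J^(a_2) g, hence
   D^a f = J^(a_2 - a) g, which is Lipschitz in a because an arbitrarily small loss in the
   exponent of the kernel absorbs the logarithm. In the kernel of B_a the powers of t - s cancel,
   so it is Lipschitz in (a, h) for the sup norm. Subtracting the two equations and applying the
   L^p bound to the difference gives the stability estimate, and Jensen's inequality turns it
   into the bound on expectations. Vector-valued identities are reduced to scalar ones by
   expanding a Bochner integrable function as an absolutely convergent series of scalar functions
   with constant vector coefficients. *)
Require Import Defs.
From HB Require Import structures.
From mathcomp Require Import all_boot all_order all_algebra.
From mathcomp Require Import all_classical all_reals all_analysis.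
From mathcomp Require Import ess_sup_inf hoelder.
From mathcomp Require Import measurable_realfun ring lra.

Set Implicit Arguments.
Unset Strict Implicit.
Unset Printing Implicit Defensive.

Import Order.TTheory GRing.Theory Num.Theory.
Import numFieldNormedType.Exports.

Local Open Scope classical_set_scope.
Local Open Scope ring_scope.

(** * Lower integrals and iterated integrals over triangles *)

(** The norm of a strongly measurable function agrees with a Borel function only almost everywhere,
    so integrals of norms are lower integrals, and they have to be compared without measurability.
    The kernel [abel_L] carries sin(pi a) / pi, which must become 1 / (Gamma(a) Gamma(1 - a)): hence
    Euler's reflection formula, obtained from a three-term functional equation. A general X lacks
    the Radon-Nikodym property, so recovering J^(1-a) f from D^a f rests on two facts about vector
    functions: absolutely continuous functions with derivative 0 almost everywhere are constant, and
    Bochner primitives are differentiable almost everywhere. Absolute continuity concerns J^(1-a) f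
    at every t, so operator identities are needed at every t; this is possible because kernels whose
    orders add up to at least 1 compose to bounded kernels. Finally, for each parameter the
    t-derivative of K_0 is controlled for almost every (t, s) only, and is replaced by functions h
    that are jointly Borel, bounded everywhere and, for two parameters, close to each other
    everywhere. *)

Section almost_everywhere.
Context {R : realType}.
Local Notation mu := (@lebesgue_measure R).
Implicit Types P Q S : R -> Prop.

Lemma ae_impl P Q : {ae mu, forall x, P x} -> (forall x, P x -> Q x) -> {ae mu, forall x, Q x}.
Proof.
by move=> aP PQ; move: aP; apply: filterS; first exact: (ae_filter_ringOfSetsType mu).
Qed.

Lemma ae_impl2 P Q S : {ae mu, forall x, P x} -> {ae mu, forall x, Q x} ->
  (forall x, P x -> Q x -> S x) -> {ae mu, forall x, S x}.
Proof.
by move=> aP aQ PQ; move: aP aQ; apply: filterS2; first exact: (ae_filter_ringOfSetsType mu).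
Qed.

Lemma ae_impl3 P Q S (U : R -> Prop) :
  {ae mu, forall x, P x} -> {ae mu, forall x, Q x} -> {ae mu, forall x, S x} ->
  (forall x, P x -> Q x -> S x -> U x) -> {ae mu, forall x, U x}.
Proof.
move=> aP aQ aS h; have a2 := ae_impl2 aP aQ (fun x p q => conj p q).
by apply: (ae_impl2 a2 aS) => x [p q]; exact: h.
Qed.

End almost_everywhere.

Section lower_integral.
Context d (T : measurableType d) (R : realType) (m : {measure set T -> \bar R}).
Local Open Scope ereal_scope.
Import HBNNSimple.

(** The integral of a nonnegative function is the supremum over the simple functions below it, and a
    simple function below [f] can be cut to 0 on the exceptional null set without changing its
    integral. The comparison thus applies to norms of functions that are only almost everywhere
    limits of simple ones. *)
Lemma ge0_ae_le_integral (D : set T) (f g : T -> \bar R) : measurable D ->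
  (forall x, D x -> 0 <= f x) -> (forall x, D x -> 0 <= g x) ->
  {ae m, forall x, D x -> f x <= g x} ->
  \int[m]_(x in D) f x <= \int[m]_(x in D) g x.
Proof.
move=> mD f0 g0 [N [mN N0 fgN]].
have patch0 (h : T -> \bar R) : (forall x, D x -> 0 <= h x) ->
    forall x, 0 <= (h \_ D) x.
  by move=> h0 x; rewrite patchE; case: ifPn => // /set_mem; exact: h0.
rewrite integral_mkcond [leRHS]integral_mkcond.
rewrite !ge0_integralTE; [|exact: patch0|exact: patch0].
apply: ge_ereal_sup => _ [h hf <-].
have mNC : measurable (~` N) by exact: measurableC.
have -> : sintegral m h = sintegral m (proj_nnsfun h mNC).
  have i1 := integral_nnsfun m measurableT h.
  have i2 := integral_nnsfun m measurableT (proj_nnsfun h mNC).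
  rewrite !patch_setT in i1 i2; rewrite -i1 -i2.
  apply: ge0_ae_eq_integral => //.
  - exact/measurable_EFinP.
  - exact/measurable_EFinP.
  - by move=> x _; rewrite lee_fin.
  - by move=> x _; rewrite lee_fin.
  - exists N; split => // x /= /not_implyP[_ hx]; apply: contrapT => Nx; apply: hx.
    rewrite /= /mindic indicE mem_set ?mulr1//.
apply: ereal_sup_ubound; exists (proj_nnsfun h mNC) => //= x.
rewrite /= /mindic indicE; case: (pselect (N x)) => Nx.
  by rewrite memNset ?mulr0//=; exact: patch0.
rewrite mem_set// mulr1; apply: le_trans (hf x) _.
rewrite !patchE; case: ifPn => // /set_mem Dx.
by apply: contrapT => fg; apply: Nx; apply: fgN => /= /(_ Dx).
Qed.

Lemma ge0_ae_eq_integral_lower (D : set T) (f g : T -> \bar R) : measurable D ->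
  (forall x, D x -> 0 <= f x) -> (forall x, D x -> 0 <= g x) ->
  {ae m, forall x, D x -> f x = g x} ->
  \int[m]_(x in D) f x = \int[m]_(x in D) g x.
Proof.
move=> mD f0 g0 fg; apply/eqP; rewrite eq_le; apply/andP; split.
  by apply: ge0_ae_le_integral => //; apply: filterS fg => x fg /fg ->.
by apply: ge0_ae_le_integral => //; apply: filterS fg => x fg /fg ->.
Qed.

End lower_integral.

Section affine.
Context {R : realType}.
Local Notation mu := (@lebesgue_measure R).
Local Open Scope ereal_scope.

Lemma measurable_affine (r c : R) :
  measurable_fun setT ((fun x => r * x + c)%R : measurableTypeR R -> measurableTypeR R).
Proof. by apply: measurable_funD => //; apply: measurable_funM. Qed.

(** The pushforward of Lebesgue measure under the affine map, scaled by [r], agrees with Lebesgue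
    measure on half-open intervals, hence everywhere. *)
Lemma ge0_integral_affine (f : R -> \bar R) (r c : R) : (0 < r)%R ->
  measurable_fun setT f -> (forall x, 0 <= f x) ->
  \int[mu]_x f x = r%:E * \int[mu]_x f (r * x + c)%R.
Proof.
move=> r0 mf f0.
have mphi := measurable_affine r c.
have pE : \int[pushforward mu (fun x => r * x + c : measurableTypeR R)%R]_x f x =
    \int[mu]_x f (r * x + c)%R.
  by rewrite ge0_integral_pushforward.
rewrite -pE -(@ge0_integral_mscale _ _ _ _ _ measurableT (NngNum (ltW r0)))//.
apply: eq_measure_integral => A mA _.
apply: lebesgue_measure_unique => // _ [[a b]/=] ab <-.
rewrite /mscale/= /pushforward.
have -> : (fun x : R => r * x + c)%R @^-1` `]a, b]%classic =
    `]((a - c) / r)%R, ((b - c) / r)%R]%classic.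
  by apply/seteqP; split => x /=; rewrite !in_itv/= ltr_pdivrMr// ler_pdivlMr// mulrC
    ltrBlDr lerBrDr.
rewrite !lebesgue_measure_itv/= !lte_fin.
rewrite ltr_pdivrMr// divfK ?gt_eqF// ltrD2r.
case: ifPn => _; last by rewrite mule0.
rewrite -EFinD -EFinM; congr EFin; field; exact: lt0r_neq0.
Qed.

End affine.

Section parameter_integral.
Context d (T : measurableType d) (R : realType).
Local Notation mu := (@lebesgue_measure R).
Variables (l u : T -> R).
Hypotheses (ml : measurable_fun setT l) (mu_ : measurable_fun setT u).

Lemma measurable_between :
  measurable [set q : T * R | l q.1 < q.2 < u q.1].
Proof.
have -> : [set q : T * R | l q.1 < q.2 < u q.1] =
   (fun q : T * R => q.2 - l q.1) @^-1` `]0, +oo[ `&`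
   (fun q : T * R => u q.1 - q.2) @^-1` `]0, +oo[.
  by apply/seteqP; split => -[x y]/=; rewrite !in_itv/= !andbT !subr_gt0 => /andP.
apply: measurableI.
- have m : measurable_fun setT (fun q : T * R => q.2 - l q.1).
    by apply: measurable_funB => //; apply: measurableT_comp.
  by rewrite -[X in measurable X]setTI; exact: m.
- have m : measurable_fun setT (fun q : T * R => u q.1 - q.2).
    by apply: measurable_funB => //; apply: measurableT_comp.
  by rewrite -[X in measurable X]setTI; exact: m.
Qed.

Lemma patch_between (U : pointedType) (f g : T * R -> U) x :
  (fun y => patch f [set q : T * R | l q.1 < q.2 < u q.1] g (x, y)) =
  patch (fun y => f (x, y)) `]l x, u x[ (fun y => g (x, y)).
Proof.
apply/funext => y; rewrite /patch; congr (if _ then _ else _).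
Qed.

(** Extending the integrand by 0 off a measurable set turns variable limits into a fixed domain,
    where the measurability part of Tonelli's theorem applies. *)
Lemma measurable_integral_between (f : T * R -> \bar R) :
  measurable_fun setT f -> (forall q, 0 <= f q)%E ->
  measurable_fun setT (fun x => \int[mu]_(y in `]l x, u x[) f (x, y))%E.
Proof.
move=> mf f0.
have mb := measurable_between.
pose g := f \_ [set q : T * R | l q.1 < q.2 < u q.1].
have mg : measurable_fun setT g by apply/(measurable_restrictT f) => //; exact: measurable_funTS.
have g0 q : (0 <= g q)%E by rewrite /g patchE; case: ifPn.
have : measurable_fun setT (fubini_F mu g) by exact: measurable_fun_fubini_tonelli_F.
apply: eq_measurable_fun => x _; rewrite /fubini_F [RHS]integral_mkcond.
by rewrite /g patch_between.
Qed.

(** Positive and negative parts are treated separately, so that the dependence on the parameter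
    stays measurable even where the integral is infinite and [fine] takes its default value. *)
Lemma measurable_Rintegral_between (f : T * R -> R) :
  measurable_fun setT f ->
  measurable_fun setT (fun x => \int[mu]_(y in `]l x, u x[) f (x, y)).
Proof.
move=> mf; rewrite /Rintegral.
have mb := measurable_between.
apply: measurableT_comp => //.
pose g := (EFin \o f) \_ [set q : T * R | l q.1 < q.2 < u q.1].
have mg : measurable_fun setT g.
  by apply/(measurable_restrictT (EFin \o f)) => //; apply: measurable_funTS; exact/measurable_EFinP.
have mg1 : measurable_fun setT (fun x => \int[mu]_y g^\+ (x, y))%E.
  by apply: measurable_fun_fubini_tonelli_F => //; exact: measurable_funepos.
have mg2 : measurable_fun setT (fun x => \int[mu]_y g^\- (x, y))%E.
  by apply: measurable_fun_fubini_tonelli_F => //; exact: measurable_funeneg.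
have := emeasurable_funB mg1 mg2.
apply: eq_measurable_fun => x _; rewrite integral_mkcond integralE.
rewrite -/(fubini_F _ _) /g; congr (_ - _)%E; apply: eq_integral => y _.
  by rewrite !funeposE; congr maxe; exact: (congr1 (fun h => h y) (@patch_between _ _ _ x)).
by rewrite !funenegE; congr (maxe (- _) _)%E; exact: (congr1 (fun h => h y) (@patch_between _ _ _ x)).
Qed.

End parameter_integral.

Section triangle.
Context {R : realType}.
Local Notation mu := (@lebesgue_measure R).
Implicit Types (a : R) (b : itv_bound R).

Definition jmeasurable (k : R -> R -> R) := measurable_fun setT (fun q : R * R => k q.1 q.2).

(** The upper end is an [itv_bound], so that one statement serves both []a, T[], through [BLeft T],
    and the half line on which the Gamma function lives. *)
Definition triangle a b := [set q : R * R | a < q.2 < q.1 /\ (BRight q.1 <= b)%O].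

Lemma measurable_triangle a b : measurable (triangle a b).
Proof.
have -> : triangle a b = [set q : R * R | a < q.2 < q.1] `&` (fun q : R * R => q.1) @^-1`
    [set` Interval -oo%O b].
  by apply/seteqP; split => -[x y]/= [h1 h2]; split => //; move: h2;
    rewrite itv_boundlr /= bound_lexx.
apply: measurableI.
  exact: (@measurable_between _ R R (fun=> a) (fun x => x)).
by rewrite -[X in measurable X]setTI; apply: measurable_fst => //; exact: measurable_itv.
Qed.

Lemma triangle_xE (U : pointedType) (F G : R * R -> U) a b x :
  (fun y => patch F (triangle a b) G (x, y)) =
  if x \in Interval (BRight a) b then
    patch (fun y => F (x, y)) `]a, x[ (fun y => G (x, y)) else (fun y => F (x, y)).
Proof.
apply/funext => y; rewrite /patch; have [xab|xab] := boolP (x \in _).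
  congr (if _ then _ else _); apply/idP/idP => /set_mem h; apply/mem_set; move: h.
    by move=> [/= + _]; rewrite in_itv.
  rewrite /= in_itv/= => h; split => //=.
  by move: xab; rewrite itv_boundlr => /andP[].
rewrite memNset//= => -[/andP[/= ay yx] xb].
by move/negP: xab; apply; rewrite itv_boundlr/= (xb : (BRight x <= b)%O) bnd_simp (lt_trans ay).
Qed.

Lemma triangle_yE (U : pointedType) (F G : R * R -> U) a b y :
  (fun x => patch F (triangle a b) G (x, y)) =
  if y \in Interval (BRight a) b then
    patch (fun x => F (x, y)) [set` Interval (BRight y) b] (fun x => G (x, y))
  else (fun x => F (x, y)).
Proof.
apply/funext => x; rewrite /patch; have [yab|yab] := boolP (y \in _).
  congr (if _ then _ else _); apply/idP/idP => /set_mem h; apply/mem_set; move: h.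
    by move=> [/= /andP[_ yx] xb]; rewrite itv_boundlr/= bnd_simp yx.
  rewrite /= itv_boundlr => /andP[/=]; rewrite bnd_simp => yx xb; split => //=.
  by move: yab; rewrite itv_boundlr => /andP[/=]; rewrite bnd_simp => ->; rewrite yx.
rewrite memNset//= => -[/andP[/= ay yx] xb].
move/negP: yab; apply; rewrite itv_boundlr/= bnd_simp ay/=.
by apply: le_trans xb; rewrite bnd_simp ltW.
Qed.

Lemma tonelli_triangle (F : R * R -> \bar R) a b :
  measurable_fun setT F -> (forall q, 0 <= F q)%E ->
  (\int[mu]_(x in [set` Interval (BRight a) b]) \int[mu]_(y in `]a, x[) F (x, y) =
   \int[mu]_(y in [set` Interval (BRight a) b])
     \int[mu]_(x in [set` Interval (BRight y) b]) F (x, y))%E.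
Proof.
move=> mF F0; pose G := F \_ (triangle a b).
have mG : measurable_fun setT G.
  apply/(measurable_restrictT F); first exact: measurable_triangle.
  exact: measurable_funTS.
have G0 q : (0 <= G q)%E by rewrite /G patchE; case: ifPn.
transitivity (\int[mu]_x \int[mu]_y G (x, y))%E.
  rewrite integral_mkcond; apply: eq_integral => x _; rewrite /G triangle_xE patchE mem_setE.
  case: ifPn => _; first by rewrite integral_mkcond.
  by rewrite integral0.
apply: etrans (@fubini_tonelli _ _ _ _ _ mu mu G mG G0) _.
rewrite [RHS]integral_mkcond; apply: eq_integral => y _; rewrite /G triangle_yE patchE mem_setE.
have [yb|yb] := boolP (y \in Interval (BRight a) b).
  by rewrite [RHS]integral_mkcond.
by rewrite integral0.
Qed.

Lemma fubini_triangle (F : R * R -> R) a b :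
  measurable_fun setT F ->
  (\int[mu]_(x in [set` Interval (BRight a) b]) \int[mu]_(y in `]a, x[) (`|F (x, y)|)%:E
    < +oo)%E ->
  \int[mu]_(x in [set` Interval (BRight a) b]) (\int[mu]_(y in `]a, x[) F (x, y)) =
  \int[mu]_(y in [set` Interval (BRight a) b])
     (\int[mu]_(x in [set` Interval (BRight y) b]) F (x, y)).
Proof.
move=> mF Foo; pose G := (EFin \o F) \_ (triangle a b).
have mG : measurable_fun setT G.
  apply/(measurable_restrictT (EFin \o F)); first exact: measurable_triangle.
  by apply: measurable_funTS; exact/measurable_EFinP.
have iG : (mu \x mu)%E.-integrable setT G.
  apply/integrable12ltyP => //; apply: le_lt_trans Foo.
  rewrite [leRHS]integral_mkcond; apply: ge0_ae_le_integral => //.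
  - by move=> x _; apply: integral_ge0.
  - by move=> x _; rewrite patchE; case: ifPn => // _; exact: integral_ge0.
  apply: aeW => /= x _; rewrite /G.
  rewrite [X in (_ <= X)%E]patchE mem_setE.
  have := @triangle_xE _ (fun=> point : \bar R) (EFin \o F) a b x.
  case: ifPn => _ E; last first.
    under eq_integral do rewrite (congr1 (fun h => h _) E) abse0.
    by rewrite integral0.
  under eq_integral do rewrite (congr1 (fun h => h _) E).
  rewrite [leRHS]integral_mkcond le_eqVlt; apply/orP; left; apply/eqP.
  by apply: eq_integral => y _; rewrite !patchE; case: ifPn => //; rewrite abse0.
have int1 : (mu).-integrable setT (fubini_F mu G) by exact: integrable_fubini_F.
have int2 : (mu).-integrable setT (fubini_G mu G).
  apply/integrableP; split; first by apply: measurable_fubini_G iG.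
  have := (@integrable21ltyP _ _ _ _ _ mu mu G mG).1 iG; apply: le_lt_trans.
  apply: ge0_ae_le_integral => //; first by move=> y _; exact: integral_ge0.
  apply: aeW => y _; apply: le_abse_integral => //.
  exact: measurableT_comp mG (measurable_pair2 _).
have e1 : (fubini_F mu G) = (fun x => \int[mu]_(y in `]a, x[) (F (x, y))%:E)%E
    \_ [set` Interval (BRight a) b].
  apply/funext => x; rewrite /fubini_F /G triangle_xE patchE mem_setE.
  have [xb|xb] := boolP (x \in Interval (BRight a) b).
    by rewrite [RHS]integral_mkcond.
  by rewrite integral0.
have e2 : (fubini_G mu G) = (fun y => \int[mu]_(x in [set` Interval (BRight y) b]) (F (x, y))%:E)%E
    \_ [set` Interval (BRight a) b].
  apply/funext => y; rewrite /fubini_G /G triangle_yE patchE mem_setE.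
  have [yb|yb] := boolP (y \in Interval (BRight a) b).
    by rewrite [RHS]integral_mkcond.
  by rewrite integral0.
have := @Fubini _ _ _ _ _ mu mu G iG; rewrite -/(fubini_F mu G) -/(fubini_G mu G).
(* The inner integrals are finite only almost everywhere; [fine] may still be passed through the
   outer integral. *)
have aefine (h : R -> \bar R) : mu.-integrable setT (h \_ [set` Interval (BRight a) b]) ->
    fine (\int[mu]_x (h \_ [set` Interval (BRight a) b]) x)%E =
    \int[mu]_(x in [set` Interval (BRight a) b]) fine (h x).
  move=> ih; rewrite /Rintegral; congr fine; rewrite [RHS]integral_mkcond.
  have fin := integrable_ae measurableT ih.
  have mh : measurable_fun setT (h \_ [set` Interval (BRight a) b]) by case/integrableP: ih.
  apply: ae_eq_integral => //.
    rewrite (_ : _ \_ _ = EFin \o (fine \o (h \_ [set` Interval (BRight a) b]))).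
      by apply/measurable_EFinP; exact: measurableT_comp.
    by apply/funext => x; rewrite /= !patchE; case: ifPn.
  by apply: filterS fin => x /(_ I) + _; rewrite !patchE; case: ifPn => // _ /fineK.
move=> /(congr1 fine); rewrite e1 e2 in int1 int2 *.
by rewrite (aefine _ int1) (aefine _ int2).
Qed.

End triangle.

Section measurability.
Context d (T : measurableType d) (R : realType).
Implicit Types f g : T -> R.

Lemma measurable_fun_EFin f : measurable_fun setT f -> measurable_fun setT (fun x => (f x)%:E).
Proof. by move=> mf; exact/measurable_EFinP. Qed.

Lemma measurable_fun_opp f : measurable_fun setT f -> measurable_fun setT (fun x => - f x).
Proof. by move=> mf; exact: measurableT_comp. Qed.

Lemma measurable_fun_powR f a : measurable_fun setT f -> measurable_fun setT (fun x => f x `^ a).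
Proof. by move=> mf; exact: (measurableT_comp (measurable_powR a)). Qed.

Lemma measurable_fun_expR f : measurable_fun setT f -> measurable_fun setT (fun x => expR (f x)).
Proof. by move=> mf; exact: measurableT_comp. Qed.

Lemma measurable_fun_normr f : measurable_fun setT f -> measurable_fun setT (fun x => `|f x|).
Proof. by move=> mf; exact: measurableT_comp. Qed.

End measurability.

Ltac mf := repeat match goal with
  | |- measurable_fun _ (fun=> _) => exact: measurable_cst
  | |- measurable_fun _ (fun x => x) => exact: measurable_id
  | |- measurable_fun _ (fun x => fst x) => exact: measurable_fst
  | |- measurable_fun _ (fun x => snd x) => exact: measurable_snd
  | H : measurable_fun _ ?f |- measurable_fun _ ?f => exact: H
  | |- measurable_fun _ (fun x => EFin _) => apply: measurable_fun_EFin
  | |- measurable_fun _ (fun x => GRing.mul _ _) => apply: measurable_funM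
  | |- measurable_fun _ (fun x => GRing.add _ (GRing.opp _)) => apply: measurable_funB
  | |- measurable_fun _ (fun x => GRing.add _ _) => apply: measurable_funD
  | |- measurable_fun _ (fun x => GRing.opp _) => apply: measurable_fun_opp
  | |- measurable_fun _ (fun x => powR _ _) => apply: measurable_fun_powR
  | |- measurable_fun _ (fun x => expR _) => apply: measurable_fun_expR
  | |- measurable_fun _ (fun x => Num.norm _) => apply: measurable_fun_normr
  end; try done.

(** * Power integrals and the Gamma function *)

Section affine_sets.
Context {R : realType}.
Local Notation mu := (@lebesgue_measure R).
Local Open Scope ereal_scope.

Lemma ge0_integral_affine_set (A : set R) (f : R -> \bar R) (r c : R) : (0 < r)%R ->
  measurable A -> measurable_fun setT f -> (forall x, 0 <= f x) ->
  \int[mu]_(x in A) f x =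
  r%:E * \int[mu]_(x in (fun x => r * x + c)%R @^-1` A) f (r * x + c)%R.
Proof.
move=> r0 mA mf_ f0; rewrite integral_mkcond (ge0_integral_affine c r0).
- by congr *%E; rewrite [RHS]integral_mkcond.
- by apply/(measurable_restrictT f) => //; exact: measurable_funTS.
- by move=> x; rewrite patchE; case: ifPn.
Qed.

Lemma ge0_integral_affine_oo (f : R -> \bar R) (s t : R) : (s < t)%R ->
  measurable_fun setT f -> (forall x, 0 <= f x) ->
  \int[mu]_(x in `]s, t[) f x =
  (t - s)%:E * \int[mu]_(x in `]0%R, 1%R[) f ((t - s) * x + s)%R.
Proof.
move=> st mf_ f0; rewrite (@ge0_integral_affine_set _ _ (t - s) s)//; last by rewrite subr_gt0.
congr *%E; congr (integral _ _ _); apply/seteqP; split => x /=; rewrite !in_itv/=; nra.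
Qed.

Lemma ge0_integral_scale_oo (f : R -> \bar R) (t : R) : (0 < t)%R ->
  measurable_fun setT f -> (forall x, 0 <= f x) ->
  \int[mu]_(x in `]0%R, t[) f x =
  t%:E * \int[mu]_(x in `]0%R, 1%R[) f (t * x)%R.
Proof.
move=> t0 mf_ f0; rewrite ge0_integral_affine_oo// subr0.
by congr *%E; apply: eq_integral => x _; rewrite addr0.
Qed.

Lemma ge0_integral_shift_oy (f : R -> \bar R) (s : R) :
  measurable_fun setT f -> (forall x, 0 <= f x) ->
  \int[mu]_(x in `]s, +oo[) f x = \int[mu]_(x in `]0%R, +oo[) f (x + s)%R.
Proof.
move=> mf_ f0; rewrite (@ge0_integral_affine_set _ _ 1 s)// mul1e.
under eq_integral do rewrite mul1r.
congr (integral _ _ _); apply/seteqP; split => x /=; rewrite !in_itv/= mul1r !andbT; lra.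
Qed.

Lemma ge0_integral_scale_oy (f : R -> \bar R) (r : R) : (0 < r)%R ->
  measurable_fun setT f -> (forall x, 0 <= f x) ->
  \int[mu]_(x in `]0%R, +oo[) f x = r%:E * \int[mu]_(x in `]0%R, +oo[) f (r * x)%R.
Proof.
move=> r0 mf_ f0; rewrite (@ge0_integral_affine_set _ _ r 0)//.
under eq_integral do rewrite addr0.
congr *%E.
congr (integral _ _ _); apply/seteqP; split => x /=; rewrite !in_itv/= !andbT addr0 pmulr_rgt0//.
Qed.

End affine_sets.

Section power_integral.
Context {R : realType}.
Local Notation mu := (@lebesgue_measure R).

Lemma powRD1 (x a b : R) : 0 < x -> x `^ (a + b) = x `^ a * x `^ b.
Proof. by move=> x0; rewrite powRD// (gt_eqF x0) implybT. Qed.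

Lemma powRB1 (x a : R) : 0 < x -> x * x `^ (a - 1) = x `^ a.
Proof.
move=> x0; rewrite powRD1// powR_inv1 ?ltW//; field; exact: lt0r_neq0.
Qed.

Lemma continuous_powR_gt0 (a x : R) : 0 < x -> {for x, continuous (fun y : R => y `^ a)}.
Proof.
move=> x0; have [d _] := is_derive1_powR a x0.
exact/differentiable_continuous/derivable1_diffP.
Qed.

Lemma powR_cvg_0 (a : R) (u : nat -> R) : 0 < a -> (forall n, 0 <= u n) ->
  u @ \oo --> 0 -> (fun n => u n `^ a) @ \oo --> 0.
Proof.
move=> a0 u0 ucvg; apply/cvgrPdist_lt => e e0.
have ea : 0 < e `^ a^-1 by rewrite powR_gt0.
move/cvgrPdist_lt : ucvg => /(_ _ ea); apply: filterS => n.
rewrite !sub0r !normrN ger0_norm// ger0_norm ?powR_ge0// => une.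
rewrite (_ : e = (e `^ a^-1) `^ a); last first.
  by rewrite -powRrM mulVf ?powRr1 ?(ltW e0)// gt_eqF.
by apply: gt0_ltr_powR; rewrite ?nnegrE ?powR_ge0.
Qed.

Lemma integral_powR (a t : R) : 0 < a -> 0 < t ->
  (\int[mu]_(x in `]0%R, t[) (x `^ (a - 1))%:E = (t `^ a / a)%:E)%E.
Proof.
move=> a0 t0.
(* The primitive is used away from 0 only, so []0, t]] is exhausted by segments; [n.+2] keeps the
   left end point below [t] already for [n = 0]. *)
pose F (n : nat) := `[t / n.+2%:R, t]%classic.
have mpow : measurable_fun setT (fun x : R => (x `^ (a - 1))%:E) by mf.
have tn n : 0 < t / n.+2%:R by rewrite divr_gt0.
have tnt n : t / n.+2%:R < t by rewrite ltr_pdivrMr// ltr_pMr// ltr1n.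
have UF : \bigcup_n F n = `]0%R, t]%classic.
  apply/seteqP; split => [x [n _]|x]; rewrite /F /= !in_itv/=.
    by move=> /andP[nx ->]; rewrite andbT (lt_le_trans _ nx).
  move=> /andP[x0 xt]; exists (Num.truncn (t / x)) => //=.
  rewrite in_itv/= xt andbT ler_pdivrMr// mulrC -ler_pdivrMr//.
  by rewrite ltW// (lt_trans (truncnS_gt _))// ltr_nat.
have FE n : (\int[mu]_(x in F n) (x `^ (a - 1))%:E =
    (t `^ a / a - (t / n.+2%:R) `^ a / a)%:E)%E.
  rewrite (@continuous_FTC2 _ _ (fun x => x `^ a / a))//.
  - apply: continuous_in_subspaceT => x; rewrite inE/= in_itv/= => /andP[nx _].
    by apply: continuous_powR_gt0; apply: lt_le_trans nx.
  - split.
    + move=> x; rewrite in_itv/= => /andP[nx _].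
      have x0 := lt_trans (tn n) nx.
      have [d _] := is_derive1_powR a x0.
      by apply: derivableM; [exact: d|exact: derivable_cst].
    + apply: cvg_at_right_filter; apply: cvgMl; apply: continuous_powR_gt0.
      exact: tn.
    + apply: cvg_at_left_filter; apply: cvgMl; exact: continuous_powR_gt0.
  - move=> x; rewrite in_itv/= => /andP[nx _].
    have x0 := lt_trans (tn n) nx.
    have [d e] := is_derive1_powR a x0.
    rewrite derive1E deriveMr//; last first.
    rewrite e /GRing.scale/=; field; exact: lt0r_neq0.
rewrite (_ : (\int[mu]_(x in `]0%R, t[) _ = \int[mu]_(x in `]0%R, t]) (x `^ (a - 1))%:E)%E); last first.
  by rewrite -integral_itv_bndo_bndc//; exact: measurable_funTS.
rewrite -UF.
have lim1 : (\int[mu]_(x in F i) (x `^ (a - 1))%:E @[i --> \oo] -->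
    \int[mu]_(x in \bigcup_i F i) (x `^ (a - 1))%:E)%E.
  apply: ge0_nondecreasing_set_cvg_integral => //.
  - apply/nondecreasing_seqP => n; rewrite subsetEset => x; rewrite /F /= !in_itv/=.
    move=> /andP[nx ->]; rewrite andbT; apply: le_trans nx.
    by rewrite ler_pM2l// lef_pV2 ?posrE// ler_nat.
  - by move=> n; exact: measurable_itv.
  - by move=> n; exact: measurable_funTS.
  - by move=> n x _; rewrite lee_fin powR_ge0.
suff lim2 : (\int[mu]_(x in F i) (x `^ (a - 1))%:E @[i --> \oo] --> (t `^ a / a)%:E)%E.
  by apply: (cvg_unique _ lim1 lim2).
rewrite (funext FE).
apply: cvg_EFin; first exact: nearW.
rewrite -[X in _ --> X]subr0; apply: cvgB; first exact: cvg_cst.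
rewrite -(mul0r a^-1); apply: cvgMl; apply: powR_cvg_0 => //.
  by move=> n; rewrite ltW.
rewrite -(mulr0 t); apply: cvgMr.
by rewrite (cvg_shiftS (fun n => n.+1%:R^-1 : R)); exact: cvg_harmonic.
Qed.

End power_integral.

Section gamma_beta.
Context {R : realType}.
Local Notation mu := (@lebesgue_measure R).
Local Open Scope ereal_scope.
Implicit Types (a b c s t x y : R).

Lemma is_derive_expRN x : is_derive x 1%R (fun x : R => - expR (- x))%R (expR (- x)).
Proof.
have h1 : is_derive x 1%R (@GRing.opp R) (- 1)%R by exact: is_deriveN.
have h : is_derive x 1%R (expR \o (@GRing.opp R)) (expR (- x) * - 1)%R.
  exact: is_derive1_comp.
rewrite (_ : expR (- x) = - (expR (- x) * - 1))%R; last by rewrite mulrN1 opprK.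
exact: is_deriveN.
Qed.

Lemma integral_expRN : \int[mu]_(x in `]0%R, +oo[) (expR (- x))%:E = 1.
Proof.
have mE : measurable_fun setT (fun x : R => (expR (- x))%:E) by mf.
have cE (x : R) : {for x, continuous (fun x : R => expR (- x))}.
  by apply: continuous_comp; [exact: opp_continuous|exact: continuous_expR].
rewrite integral_itv_obnd_cbnd; last exact: measurable_funTS.
rewrite (@ge0_continuous_FTC2y _ _ (fun x => - expR (- x))%R _ 0%R).
- by rewrite oppr0 expR0 sub0e EFinN oppeK.
- by move=> x _; exact: expR_ge0.
- by apply: continuous_subspaceT => x; exact: cE.
- by rewrite -oppr0; apply: cvgN; exact: cvgr_expR.
- by move=> x _; have [] := is_derive_expRN x.
- by apply: cvg_at_right_filter; apply: cvgN; exact: cE.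
- by move=> x _; rewrite derive1E; have [_ ->] := is_derive_expRN x.
Qed.

Lemma integral_expRM c : (0 < c)%R ->
  \int[mu]_(x in `]0%R, +oo[) (expR (- (c * x)))%:E = (c^-1)%:E.
Proof.
move=> c0; have mE : measurable_fun setT (fun x : R => (expR (- x))%:E) by mf.
have := @ge0_integral_scale_oy R (fun x => (expR (- x))%:E) c c0 mE (fun x => expR_ge0 _).
rewrite integral_expRN => /(congr1 (fun z => c^-1%:E * z)).
by rewrite mule1 muleA -EFinM mulVf ?gt_eqF// mul1e => <-.
Qed.

Lemma integral_expR_above y :
  \int[mu]_(x in `]y, +oo[) (expR (- x))%:E = (expR (- y))%:E.
Proof.
rewrite ge0_integral_shift_oy; [|by mf|by move=> x; rewrite lee_fin expR_ge0].
under eq_integral do rewrite opprD expRD mulrC EFinM.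
rewrite ge0_integralZl_EFin ?expR_ge0//; last by apply: measurable_funTS; mf.
by rewrite integral_expRN mule1.
Qed.

(** Gamma as an extended real: Tonelli's theorem yields its functional equations before finiteness
    is known, and [GammaE] transfers them to [Gamma]. *)
Definition gammae a := \int[mu]_(x in `]0%R, +oo[) (x `^ (a - 1) * expR (- x))%:E.

Lemma gammae_ge0 a : 0 <= gammae a.
Proof. by apply: integral_ge0 => x _; rewrite lee_fin mulr_ge0 ?powR_ge0 ?expR_ge0. Qed.

(** Integration by parts in the guise of Tonelli: x^b is the integral of b y^(b-1) over y < x, and
    after swapping the inner integral is a tail of the exponential. *)
Lemma gammaeS b : (0 < b)%R -> gammae (b + 1) = b%:E * gammae b.
Proof.
move=> b0; rewrite /gammae.
pose F (q : R * R) := (b * (q.2 `^ (b - 1)) * expR (- q.1))%:E.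
have mF : measurable_fun setT F by rewrite /F; mf.
have F0 q : 0 <= F q by rewrite lee_fin !mulr_ge0 ?powR_ge0 ?expR_ge0 ?ltW.
transitivity (\int[mu]_(x in `]0%R, +oo[) \int[mu]_(y in `]0%R, x[) F (x, y)).
  apply: eq_integral => x; rewrite inE/= in_itv/= andbT => x0.
  under eq_integral do rewrite /F/= mulrC mulrA EFinM.
  rewrite ge0_integralZl_EFin ?mulr_ge0 ?expR_ge0 ?ltW//; last 2 first.
  - by move=> y _; rewrite lee_fin powR_ge0.
  - by apply: measurable_funTS; mf.
  rewrite integral_powR// -EFinM addrK; congr EFin; field; exact: lt0r_neq0.
rewrite tonelli_triangle//.
have inner y : \int[mu]_(x in `]y, +oo[) F (x, y) =
    b%:E * (y `^ (b - 1) * expR (- y))%:E.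
  under eq_integral do rewrite /F/= EFinM.
  rewrite ge0_integralZl_EFin ?mulr_ge0 ?powR_ge0 ?ltW//; last by apply: measurable_funTS; mf.
  by rewrite integral_expR_above -!EFinM mulrA.
under eq_integral do rewrite inner.
rewrite ge0_integralZl_EFin ?ltW//.
- by move=> x _; rewrite lee_fin mulr_ge0 ?powR_ge0 ?expR_ge0.
- by apply: measurable_funTS; mf.
Qed.

(** On []0, 1[] the integrand is at least exp(-1) whatever the order. This uniform lower bound is
    what makes 1 / Gamma bounded in [invGamma_le]. *)
Lemma gammae_gt0 a : (0 < a <= 1)%R -> (expR (- 1))%:E <= gammae a.
Proof.
move=> /andP[a0 a1].
have m1 : measurable_fun setT (fun x : R => (x `^ (a - 1) * expR (- x))%:E) by mf.
have p0 x : 0 <= (x `^ (a - 1) * expR (- x))%:E by rewrite lee_fin mulr_ge0 ?powR_ge0 ?expR_ge0.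
apply: (@le_trans _ _ (\int[mu]_(x in `]0%R, 1%R[) (expR (- 1))%:E)).
  by rewrite integral_cst//= lebesgue_measure_itv/= lte01 oppr0 adde0 mule1.
apply: (@le_trans _ _ (\int[mu]_(x in `]0%R, 1%R[) (x `^ (a - 1) * expR (- x))%:E)).
  apply: ge0_ae_le_integral => //.
  apply: aeW => x; rewrite /= in_itv/= => /andP[x0 x1]; rewrite lee_fin.
  rewrite -[leLHS]mul1r ler_pM ?expR_ge0//; last by rewrite ler_expR lerN2 ltW.
  have := @ger_powR _ x _ (a - 1)%R 0%R; rewrite powRr0 x0 ltW//; apply => //.
  by rewrite subr_le0.
apply: ge0_subset_integral => //; first by apply: measurable_funTS.
by move=> x; rewrite /= !in_itv/= => /andP[->].
Qed.

Lemma gammae_lty a : (0 < a <= 1)%R -> gammae a < +oo.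
Proof.
move=> /andP[a0 a1].
pose f (x : R) := ((x `^ (a - 1)) * \1_(`]0%R, 1%R[%classic) x)%:E.
have mi : measurable_fun setT (\1_(`]0%R, 1%R[%classic) : R -> R) by exact: measurable_indic.
have mf_ : measurable_fun setT f by rewrite /f; mf.
apply: (@le_lt_trans _ _ (\int[mu]_(x in `]0%R, +oo[) (f x + (expR (- x))%:E))).
  apply: ge0_le_integral => //.
  - by move=> x _; rewrite lee_fin mulr_ge0 ?powR_ge0 ?expR_ge0.
  - by apply: measurable_funTS; mf.
  - apply: emeasurable_funD; apply: measurable_funTS => //; mf.
  - move=> x; rewrite /= in_itv/= andbT => x0; rewrite /f -EFinD lee_fin indicE.
    have e1 : (expR (- x) <= 1)%R by rewrite -expR0 ler_expR oppr_le0 ltW.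
    have [x1|x1] := ltP x 1%R.
      rewrite mem_set/= ?in_itv/= ?x0// mulr1.
      rewrite (le_trans (ler_wpM2l (powR_ge0 _ _) e1))// mulr1 lerDl expR_ge0//.
    rewrite memNset/= ?in_itv/= ?x0/= ?(ltNge x) ?x1// mulr0 add0r.
    rewrite -[leRHS]mul1r ler_pM ?powR_ge0 ?expR_ge0//.
    by have := @ler_powR _ _ x1 (a - 1)%R 0%R; rewrite powRr0; apply; rewrite subr_le0.
rewrite ge0_integralD//=; last 3 first.
- by move=> x _; rewrite lee_fin mulr_ge0 ?powR_ge0.
- exact: measurable_funTS.
- by apply: measurable_funTS; mf.
rewrite integral_expRN lte_add_pinfty// ?ltry//.
have -> : f = (fun x : R => (x `^ (a - 1))%:E) \_ `]0%R, 1%R[.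
  apply/funext => x; rewrite /f patchE indicE; case: ifPn => _; rewrite ?mulr1 ?mulr0//.
rewrite -integral_mkcondr (_ : _ `&` _ = `]0%R, 1%R[%classic); last first.
  by apply/seteqP; split => x /=; rewrite !in_itv/=; [case|move=> /andP[-> ->]].
by rewrite integral_powR// ltry.
Qed.

Definition betae a b := \int[mu]_(x in `]0%R, 1%R[) ((1 - x) `^ (b - 1) * x `^ (a - 1))%:E.

Lemma betae_ge0 a b : 0 <= betae a b.
Proof. by apply: integral_ge0 => x _; rewrite lee_fin mulr_ge0 ?powR_ge0. Qed.

Lemma integral_beta a b s t : (s < t)%R ->
  \int[mu]_(x in `]s, t[) ((t - x) `^ (b - 1) * (x - s) `^ (a - 1))%:E =
  ((t - s) `^ (a + b - 1))%:E * betae a b.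
Proof.
move=> st; have st0 : (0 < t - s)%R by rewrite subr_gt0.
rewrite ge0_integral_affine_oo; last first.
- by move=> x; rewrite lee_fin mulr_ge0 ?powR_ge0.
- by mf.
- exact: st.
have -> : (a + b - 1 = 1 + ((a - 1) + (b - 1)))%R by ring.
rewrite powRD1; last by [].
rewrite powRr1; last exact: ltW.
rewrite EFinM -muleA; apply: congr1.
rewrite /betae -ge0_integralZl_EFin; last first.
- exact: powR_ge0.
- by apply: measurable_funTS; mf.
- by move=> x _; rewrite lee_fin mulr_ge0 ?powR_ge0.
- exact: measurable_itv.
apply: eq_integral => x; rewrite inE/= in_itv/= => /andP[x0 x1].
rewrite -EFinM; congr EFin.
have -> : (t - ((t - s) * x + s) = (t - s) * (1 - x))%R by ring.
rewrite addrK powRM; [|exact: ltW|by rewrite subr_ge0 ltW].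
by rewrite powRM; [|exact: ltW|exact: ltW]; rewrite (powRD1 (a - 1) (b - 1) st0); ring.
Qed.

(** Shifting the second variable by the first turns the product into the integral of x^(a-1)
    (t-x)^(b-1) exp(-t) over x < t, whose inner integral is a Beta integral. *)
Lemma gammae_mul a b : (0 < a)%R -> (0 < b)%R ->
  gammae a * gammae b = gammae (a + b) * betae a b.
Proof.
move=> a0 b0.
pose F (q : R * R) := (q.2 `^ (a - 1) * (q.1 - q.2) `^ (b - 1) * expR (- q.1))%:E.
have mF : measurable_fun setT F by rewrite /F; mf.
have F0 q : 0 <= F q by rewrite lee_fin !mulr_ge0 ?powR_ge0 ?expR_ge0.
transitivity (\int[mu]_(x in `]0%R, +oo[) \int[mu]_(t in `]x, +oo[) F (t, x)).
  rewrite {1}/gammae -ge0_integralZr//; last 3 first.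
  - by apply: measurable_funTS; mf.
  - by move=> x _; rewrite lee_fin mulr_ge0 ?powR_ge0 ?expR_ge0.
  - exact: gammae_ge0.
  apply: eq_integral => x _.
  rewrite ge0_integral_shift_oy//; last by rewrite /F/=; mf.
  rewrite -ge0_integralZl_EFin ?mulr_ge0 ?powR_ge0 ?expR_ge0//; last 2 first.
  - by move=> y _; rewrite lee_fin mulr_ge0 ?powR_ge0 ?expR_ge0.
  - by apply: measurable_funTS; mf.
  apply: eq_integral => y _; rewrite /F/= -EFinM addrK opprD expRD; congr EFin; ring.
rewrite -tonelli_triangle//.
rewrite [in RHS]/gammae -ge0_integralZr//; last 3 first.
- by apply: measurable_funTS; mf.
- by move=> x _; rewrite lee_fin mulr_ge0 ?powR_ge0 ?expR_ge0.
- exact: betae_ge0.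
apply: eq_integral => t; rewrite inE/= in_itv/= andbT => t0.
have := @integral_beta a b 0 t t0; rewrite subr0.
under eq_integral do rewrite subr0.
rewrite mulrC EFinM -muleA => <-.
rewrite -ge0_integralZl_EFin ?expR_ge0//; last 2 first.
- by move=> y _; rewrite lee_fin mulr_ge0 ?powR_ge0.
- by apply: measurable_funTS; mf.
by apply: eq_integral => y _; rewrite /F/= -EFinM; congr EFin; ring.
Qed.

End gamma_beta.

(** * Euler's reflection formula *)

Section reflection.
Context {R : realType}.
Local Notation mu := (@lebesgue_measure R).
Local Open Scope ereal_scope.
Implicit Types (a b c s t x y : R).

Lemma measurable_integral_above (F : R * R -> \bar R) :
  measurable_fun setT F -> (forall q, 0 <= F q) ->
  measurable_fun setT (fun y => \int[mu]_(x in `]y, +oo[) F (x, y)).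
Proof.
move=> mF F0; pose D := [set q : R * R | (q.2 < q.1)%R].
have mD : measurable D.
  have -> : D = (fun q : R * R => q.1 - q.2)%R @^-1` `]0%R, +oo[.
    by apply/seteqP; split => q; rewrite /D/= in_itv/= andbT subr_gt0.
  rewrite -[X in measurable X]setTI.
  have m : measurable_fun setT (fun q : R * R => q.1 - q.2)%R by mf.
  exact: m.
have mFD : measurable_fun setT (F \_ D).
  by apply/(measurable_restrictT F) => //; exact: measurable_funTS.
have FD0 q : 0 <= (F \_ D) q by rewrite patchE; case: ifPn.
have : measurable_fun setT (fubini_G mu (F \_ D)) by exact: measurable_fun_fubini_tonelli_G.
apply: eq_measurable_fun => y _; rewrite /fubini_G [RHS]integral_mkcond.
apply: eq_integral => x _; rewrite !patchE; congr (if _ then _ else _).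
by apply/idP/idP => /set_mem h; apply/mem_set; move: h; rewrite /D/= in_itv/= andbT.
Qed.

(** Half of the classical integral of x^(a-1) / (1 + x) over the half line: substituting 1/x maps
    the part above 1 to [phie (1 - a)], so the whole is [phie a + phie (1 - a)]. *)
Definition phie a := \int[mu]_(x in `]0%R, 1%R[) (x `^ (a - 1) / (1 + x))%:E.

(** Scaling x by y leaves an exponential integral in y with rate 1 + x. The left side is the part x
    < y of the double integral for Gamma(a) Gamma(1 - a). *)
Lemma gammae_half a : (0 < a < 1)%R ->
  \int[mu]_(y in `]0%R, +oo[) \int[mu]_(x in `]0%R, y[)
     (x `^ (a - 1) * y `^ (- a) * expR (- x - y))%:E = phie a.
Proof.
move=> /andP[a0 a1].
pose F (q : R * R) := (q.1 `^ (a - 1) * expR (- ((1 + q.1) * q.2)))%:E.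
have mF : measurable_fun setT F by rewrite /F; mf.
have F0 q : 0 <= F q by rewrite lee_fin !mulr_ge0 ?powR_ge0 ?expR_ge0.
transitivity (\int[mu]_(y in `]0%R, +oo[) \int[mu]_(x in `]0%R, 1%R[) F (x, y)).
  apply: eq_integral => y; rewrite inE/= in_itv/= andbT => y0.
  rewrite ge0_integral_scale_oo; last first.
  - by move=> x; rewrite lee_fin !mulr_ge0 ?powR_ge0 ?expR_ge0.
  - by mf.
  - exact: y0.
  rewrite -ge0_integralZl_EFin; last first.
  - exact: ltW.
  - by apply: measurable_funTS; mf.
  - by move=> x _; rewrite lee_fin !mulr_ge0 ?powR_ge0 ?expR_ge0.
  - exact: measurable_itv.
  apply: eq_integral => x; rewrite inE/= in_itv/= => /andP[x0 x1].
  rewrite /F -EFinM; congr EFin => /=.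
  rewrite powRM; [|exact: ltW|exact: ltW].
  have e1 : (y * (y `^ (a - 1) * y `^ (- a)) = 1)%R.
    rewrite -powRD1// (_ : a - 1 - a = - 1)%R; last by ring.
    by rewrite powR_inv1 ?ltW// divff// gt_eqF.
  rewrite (_ : - (y * x) - y = - ((1 + x) * y))%R; last by ring.
  transitivity (x `^ (a - 1) * expR (- ((1 + x) * y)) *
    (y * (y `^ (a - 1) * y `^ (- a))))%R; first by ring.
  by rewrite e1 mulr1.
pose G := F \_ (setX `]0%R, 1%R[%classic `]0%R, +oo[%classic).
have mX : measurable (setX (`]0%R, 1%R[%classic : set R) (`]0%R, +oo[%classic : set R)).
  exact: measurableX.
have mG : measurable_fun setT G.
  by apply/(measurable_restrictT F) => //; exact: measurable_funTS.
have G0 q : 0 <= G q by rewrite /G patchE; case: ifPn.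
have GE (x y : R) : G (x, y) = if x \in `]0%R, 1%R[%classic then
    (if y \in `]0%R, +oo[%classic then F (x, y) else 0) else 0.
  rewrite /G patchE; case: ifPn => [/set_mem[/= h1 h2]|h].
    by rewrite !mem_set.
  case: ifPn => // h1; case: ifPn => // h2.
  by case/negP: h; apply/mem_set; split => /=; [exact: set_mem h1|exact: set_mem h2].
transitivity (\int[mu]_y \int[mu]_x G (x, y)).
  rewrite integral_mkcond; apply: eq_integral => y _; rewrite patchE.
  case: ifPn => yy.
    by rewrite integral_mkcond; apply: eq_integral => x _; rewrite GE patchE yy.
  rewrite integral0_eq// => x _; rewrite GE (negbTE yy); by case: ifPn.
rewrite -(@fubini_tonelli _ _ _ _ _ mu mu G mG G0).
rewrite /phie [RHS]integral_mkcond; apply: eq_integral => x _; rewrite patchE.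
case: ifPn => xx; last first.
  by rewrite integral0_eq// => y _; rewrite GE (negbTE xx).
have x0 : (0 < 1 + x)%R.
  by move/set_mem : xx; rewrite /= in_itv/= => /andP[x0 _]; rewrite addr_gt0.
transitivity (\int[mu]_(y in `]0%R, +oo[) F (x, y)).
  by rewrite [RHS]integral_mkcond; apply: eq_integral => y _; rewrite GE patchE xx.
rewrite EFinM -(integral_expRM x0) -ge0_integralZl_EFin; last first.
- exact: powR_ge0.
- by apply: measurable_funTS; mf.
- by move=> y _; rewrite lee_fin expR_ge0.
- exact: measurable_itv.
by apply: eq_integral => y _; rewrite /F -EFinM.
Qed.

(** The quadrant is split along the diagonal, and replacing a by 1 - a exchanges the two halves. *)
Lemma gammae_mul_phie a : (0 < a < 1)%R ->
  gammae a * gammae (1 - a) = phie a + phie (1 - a).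
Proof.
move=> /andP[a0 a1].
pose F (q : R * R) := (q.1 `^ (a - 1) * q.2 `^ (- a) * expR (- q.1 - q.2))%:E.
have mF : measurable_fun setT F by rewrite /F; mf.
have F0 q : 0 <= F q by rewrite lee_fin !mulr_ge0 ?powR_ge0 ?expR_ge0.
pose F' (q : R * R) := F (q.2, q.1).
have mF' : measurable_fun setT F' by rewrite /F'/F/=; mf.
transitivity (\int[mu]_(x in `]0%R, +oo[)
   (\int[mu]_(y in `]0%R, x[) F (x, y) + \int[mu]_(y in `]x, +oo[) F (x, y))).
  rewrite {1}/gammae -ge0_integralZr; last first.
  - exact: gammae_ge0.
  - by move=> x _; rewrite lee_fin mulr_ge0 ?powR_ge0 ?expR_ge0.
  - by apply: measurable_funTS; mf.
  - exact: measurable_itv.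
  apply: eq_integral => x; rewrite inE/= in_itv/= andbT => x0.
  rewrite -ge0_integralZl_EFin; last first.
  - by rewrite mulr_ge0 ?powR_ge0 ?expR_ge0.
  - by apply: measurable_funTS; mf.
  - by move=> y _; rewrite lee_fin mulr_ge0 ?powR_ge0 ?expR_ge0.
  - exact: measurable_itv.
  transitivity (\int[mu]_(y in `]0%R, +oo[) F (x, y)).
    apply: eq_integral => y _; rewrite /F/= -EFinM; congr EFin.
    by rewrite (_ : 1 - a - 1 = - a)%R ?expRD; ring.
  have -> : `]0%R, +oo[%classic = `]0%R, x[%classic `|` `[x, +oo[%classic.
    apply/seteqP; split => y /=; rewrite !in_itv/= ?andbT.
      by move=> y0; rewrite y0/=; case: (ltP y x) => h; [left|right].
    by case=> [/andP[]//|]; apply: lt_le_trans.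
  rewrite ge0_integral_setU//=.
  - by congr (_ + _); rewrite -integral_itv_obnd_cbnd//; apply: measurable_funTS; rewrite /F/=; mf.
  - by apply: measurable_funTS; rewrite /F/=; mf.
  - rewrite disj_set2E; apply/eqP; rewrite -subset0 => y []/=; rewrite !in_itv/= andbT.
    by move=> /andP[_ yx]; rewrite leNgt yx.
rewrite ge0_integralD//; last 4 first.
- by move=> x _; exact: integral_ge0.
- apply: measurable_funTS.
  by apply: (@measurable_integral_between _ R R (fun=> 0%R) (fun x => x)).
- by move=> x _; exact: integral_ge0.
- apply: measurable_funTS; apply: (measurable_integral_above mF') => q; exact: F0.
rewrite addeC; congr (_ + _).
  rewrite -[LHS]/(\int[mu]_(x in `]0%R, +oo[) \int[mu]_(y in `]x, +oo[) F' (y, x)).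
  rewrite -tonelli_triangle//; last by move=> q; exact: F0.
  by apply: gammae_half; rewrite a0.
rewrite -gammae_half; last by rewrite subr_gt0 a1 ltrBlDl ltrDr.
apply: eq_integral => x _; apply: eq_integral => y _; rewrite /F/=; congr EFin.
rewrite (_ : 1 - a - 1 = - a)%R; last by ring.
rewrite (_ : - (1 - a) = a - 1)%R; last by ring.
by rewrite (addrC (- y)%R); congr (_ * _)%R; exact: mulrC.
Qed.

Local Close Scope ereal_scope.

Lemma phie_def a : phie a = (\int[mu]_(x in `]0%R, 1%R[) (x `^ (a - 1) / (1 + x))%:E)%E.
Proof. by []. Qed.

Lemma phie_ge0 a : (0 <= phie a)%E.
Proof.
apply: integral_ge0 => x; rewrite /= in_itv/= => /andP[x0 x1].
by rewrite lee_fin divr_ge0 ?powR_ge0// addr_ge0// ltW.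
Qed.

Lemma measurable_phie a :
  measurable_fun (`]0, 1[ : set R) (fun x : R => (x `^ (a - 1) / (1 + x))%:E).
Proof.
apply: (eq_measurable_fun (fun x : R => (x `^ (a - 1) * (x + 1) `^ (-1))%:E)).
  move=> x; rewrite inE/= in_itv/= => /andP[x0 x1].
  by rewrite powR_inv1 ?(addrC 1)// addr_ge0// ltW.
by apply: measurable_funTS; mf.
Qed.

Lemma phieS a : 0 < a -> (phie a + phie (a + 1) = (a^-1)%:E)%E.
Proof.
move=> a0; have := integral_powR a0 ltr01; rewrite powR1 mul1r => <-.
rewrite /phie -ge0_integralD//.
- apply: eq_integral => x; rewrite inE/= in_itv/= => /andP[x0 x1].
  rewrite addrK -EFinD -(powRB1 a x0); congr EFin; field.
  by rewrite gt_eqF// addr_gt0.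
- move=> x; rewrite /= in_itv/= => /andP[x0 x1].
  by rewrite lee_fin divr_ge0 ?powR_ge0// addr_ge0// ltW.
- exact: measurable_phie.
- move=> x; rewrite /= in_itv/= => /andP[x0 x1].
  by rewrite lee_fin divr_ge0 ?powR_ge0// addr_ge0// ltW.
- exact: measurable_phie.
Qed.

Definition phi a := fine (phie a).

Lemma phieE a : 0 < a -> phie a = (phi a)%:E.
Proof.
move=> a0; rewrite /phi fineK// ge0_fin_numE ?phie_ge0//.
apply: (@le_lt_trans _ _ (phie a + phie (a + 1))%E); first by rewrite leeDl ?phie_ge0.
by rewrite phieS// ltry.
Qed.

Lemma phiS a : 0 < a -> phi a + phi (a + 1) = a^-1.
Proof.
move=> a0; apply: EFin_inj.
by rewrite EFinD -!phieE// ?phieS// addr_gt0.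
Qed.

Lemma phi_ge0 a : 0 <= phi a.
Proof. by rewrite fine_ge0// phie_ge0. Qed.

Lemma phi_le a : 0 < a -> phi a <= a^-1.
Proof. by move=> a0; rewrite -phiS// lerDl phi_ge0. Qed.

Opaque phi phie.

(** Iterating [phiS] gives the alternating series of phi with its exact remainder, which avoids
    limits of series. *)
Lemma phi_series a n : 0 < a ->
  phi a = \sum_(i < n) (-1) ^+ i / (a + i%:R) + (-1) ^+ n * phi (a + n%:R).
Proof.
move=> a0; elim: n => [|n ih]; first by rewrite big_ord0 add0r mul1r addr0.
rewrite big_ord_recr/= {1}ih -addrA; congr +%R.
have an0 : 0 < a + n%:R by rewrite ltr_wpDr.
rewrite -(phiS an0) exprS -natr1 addrA; ring.
Qed.

Lemma phi_series3 a n : 0 < a ->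
  \sum_(i < n) (-1) ^+ i / (a / 3 + i%:R) - \sum_(i < n) (-1) ^+ i / ((a + 1) / 3 + i%:R)
  + \sum_(i < n) (-1) ^+ i / ((a + 2) / 3 + i%:R) =
  3 * \sum_(i < 3 * n) (-1) ^+ i / (a + i%:R) :> R.
Proof.
move=> a0; elim: n => [|n ih]; first by rewrite muln0 !big_ord0; ring.
rewrite mulnS addnC addn3 !big_ord_recr/=.
have sg : (-1) ^+ (3 * n) = (-1) ^+ n :> R.
  by rewrite -signr_odd oddM/= signr_odd.
move: ih; set s0 := \sum_(i < n) _; set s1 := \sum_(i < n) _; set s2 := \sum_(i < n) _.
set s3 := \sum_(i < 3 * n) _ => ih.
rewrite (_ : s0 + _ - _ + _ = (s0 - s1 + s2) + ((-1) ^+ n / (a / 3 + n%:R) -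
  (-1) ^+ n / ((a + 1) / 3 + n%:R) + (-1) ^+ n / ((a + 2) / 3 + n%:R))); last by ring.
rewrite ih !exprS sg -!natr1 natrM !mulrDr -!addrA; congr +%R.
have n0 : 0 <= n%:R :> R by [].
field; rewrite !gt_eqF//; nra.
Qed.

(** Sorting the alternating series by the index modulo 3 gives a triplication formula; 3 being odd,
    the signs still alternate within each class. With finitely many terms the two sides differ by
    remainders only, and these decay like 1/n. *)
Lemma phi3 a : 0 < a -> 3 * phi a = phi (a / 3) - phi ((a + 1) / 3) + phi ((a + 2) / 3).
Proof.
move=> a0; apply/eqP; rewrite -subr_eq0; apply/eqP.
set d := _ - _.
(* Four remainders, each at most 1/(n+1), enter with coefficients 3, 1, 1 and 1. *)
have dn n : `|d| * n.+1%:R <= 6.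
  have n0 : 0 < n.+1%:R :> R by [].
  have a1 : 0 < a / 3 by rewrite divr_gt0.
  have a2 : 0 < (a + 1) / 3 by rewrite divr_gt0// addr_gt0.
  have a3 : 0 < (a + 2) / 3 by rewrite divr_gt0// addr_gt0.
  rewrite /d (phi_series (3 * n.+1) a0) (phi_series n.+1 a1) (phi_series n.+1 a2)
    (phi_series n.+1 a3) mulrDr -phi_series3//.
  set s0 := \sum_(i < n.+1) _; set s1 := \sum_(i < n.+1) _; set s2 := \sum_(i < n.+1) _.
  have e x (m : nat) : 0 < x -> (n.+1 <= m)%N -> exists2 r : R,
      (-1) ^+ m * phi (x + m%:R) = r & `|r| * n.+1%:R <= 1.
    move=> x0 nm; eexists; first by [].
    rewrite normrM normrX normrN1 expr1n mul1r ger0_norm ?phi_ge0//.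
    have xm : 0 < x + m%:R by rewrite ltr_wpDr.
    rewrite -ler_pdivlMr// mul1r (le_trans (phi_le xm))// lef_pV2// ?posrE//.
    by rewrite (le_trans (_ : n.+1%:R <= m%:R))// ?ler_nat// lerDr ltW.
  have [|r0 -> h0] := e a (3 * n.+1)%N a0; first by rewrite leq_pmull.
  have [|r1 -> h1] := e _ n.+1 a1; first exact: leqnn.
  have [|r2 -> h2] := e _ n.+1 a2; first exact: leqnn.
  have [|r3 -> h3] := e _ n.+1 a3; first exact: leqnn.
  rewrite (_ : _ - _ = 3 * r0 - r1 + r2 - r3); last by ring.
  rewrite (le_trans (_ : _ <= (3 * `|r0| + `|r1| + `|r2| + `|r3|) * n.+1%:R))//; last by nra.
  rewrite ler_wpM2r//.
  rewrite (le_trans (ler_normB _ _))// lerD2r (le_trans (ler_normD _ _))// lerD2r.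
  by rewrite (le_trans (ler_normB _ _))// lerD2r normrM ger0_norm.
have [->//|d0] := eqVneq d 0.
have := dn (Num.truncn (6 / `|d|)); rewrite leNgt mulrC -ltr_pdivrMr ?normr_gt0//.
by rewrite truncnS_gt.
Qed.

Lemma ge0_nondecreasing_derive (f df : R -> R) x : 0 <= x ->
  (forall z : R, is_derive z 1 f (df z)) -> (forall z, 0 <= z <= x -> 0 <= df z) -> f 0 <= f x.
Proof.
move=> x0 fdf df0.
have cf : {within `[0, x], continuous f}.
  apply: continuous_subspaceT => z; have [d _] := fdf z.
  exact/differentiable_continuous/derivable1_diffP.
have [c cx h] := MVT_segment x0 (fun z _ => fdf z) cf.
rewrite -subr_ge0 h subr0 mulr_ge0// df0//.
Qed.

Lemma sin_le_id x : 0 <= x -> sin x <= x.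
Proof.
move=> x0; rewrite -subr_ge0 -(subr0 0) -{2}sin0.
apply: (@ge0_nondecreasing_derive (fun z => z - sin z) (fun z => 1 - cos z)) => // z _.
Qed.

Lemma cos_ge x : 0 <= x -> 1 - x ^+ 2 / 2 <= cos x.
Proof.
move=> x0; rewrite lerBlDr.
have {1}-> : 1 = cos 0 + 0 ^+ 2 / 2 :> R by rewrite cos0 expr0n/= mul0r addr0.
apply: (@ge0_nondecreasing_derive (fun z => cos z + z ^+ 2 / 2) (fun z => - sin z + z)) => //.
  move=> z; apply: is_deriveD.
  have h1 : is_derive z 1 (2^-1 *: (fun z : R => z ^+ 2)) (2^-1 *: (z *+ 2 *: 1)).
    apply: is_deriveZ; have h0 := @is_deriveX R R (fun z => z) 2%N z 1 1 (is_derive_id z 1).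
    apply: (is_derive_eq h0).
    by rewrite /GRing.scale/= expr1 !mulr1 mulr2n; ring.
  rewrite (_ : (fun _ => _) = 2^-1 *: (fun z : R => z ^+ 2)); last first.
    by apply/funext => y /=; rewrite mulrC.
  rewrite [X in is_derive _ _ _ X](_ : z = 2^-1 *: (z *+ 2 *: 1))//.
  by rewrite /GRing.scale/= mulr1 mulr2n; field.
by move=> z /andP[z0 _]; rewrite addrC subr_ge0 sin_le_id.
Qed.

Lemma sin_ge x : 0 <= x -> x - x ^+ 3 / 2 <= sin x.
Proof.
move=> x0; rewrite (_ : x - _ = (1 - x ^+ 2 / 2) * x); last by field.
rewrite -subr_ge0 (_ : 0 = sin 0 - (1 - x ^+ 2 / 2) * 0); last by rewrite sin0 mulr0 subr0.
apply: (@ge0_nondecreasing_derive (fun z => sin z - (1 - x ^+ 2 / 2) * z)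
  (fun z => cos z - (1 - x ^+ 2 / 2))) => // [z|z /andP[z0 zx]].
  apply: is_deriveB.
  rewrite [X in is_derive _ _ _ X](_ : _ = (1 - x ^+ 2 / 2) *: 1); last first.
    by rewrite /GRing.scale/= mulr1.
  exact: is_deriveZ.
rewrite subr_ge0 (le_trans _ (cos_ge z0))// lerD2l lerN2 ler_pM2r//.
by rewrite ler_pXn2r// nnegrE.
Qed.

Lemma sin_third x : sin (3 * x) = sin x * (3 - 4 * sin x ^+ 2).
Proof.
rewrite (_ : 3 * x = x *+ 2 + x); last by rewrite mulr2n; ring.
rewrite sinD sin_mulr2n cos_mulr2n.
transitivity (sin x * (4 * (cos x ^+ 2) - 1)); first by rewrite !mulr2n; ring.
have -> : cos x ^+ 2 = 1 - sin x ^+ 2 by rewrite -(cos2Dsin2 x); ring.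
by ring.
Qed.

Lemma cos_third : cos (pi / 3) = 1 / 2 :> R.
Proof.
have c3 : cos (3 * (pi / 3)) = - 1 :> R by rewrite mulrCA divff// mulr1 cospi.
move: c3; rewrite (_ : 3 * (pi / 3) = (pi / 3) *+ 2 + pi / 3); last by rewrite mulr2n; field.
rewrite cosD sin_mulr2n cos_mulr2n.
have c0 : 0 < cos (pi / 3 : R).
  apply: cos_gt0_pihalf; have := @pi_gt0 R; lra.
have := cos2Dsin2 (pi / 3 : R).
move: c0; set c := cos _; set s := sin _ => c0 sc e.
have : (c + 1) * (2 * c - 1) ^+ 2 = 0.
  have s2 : s ^+ 2 = 1 - c ^+ 2 by rewrite -sc; ring.
  transitivity (2 * c ^+ 3 - c - 2 * c * (1 - c ^+ 2) + 1); first by ring.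
  rewrite -s2; transitivity ((c ^+ 2 *+ 2 - 1) * c - c * s *+ 2 * s + 1).
    by rewrite !mulr2n; ring.
  by rewrite e; ring.
move/eqP; rewrite mulf_eq0 expf_eq0/= => /orP[/eqP|/eqP]; lra.
Qed.

(* [pi / sin (pi a)] satisfies the same functional equation as [phi a + phi (1 - a)] *)
Lemma csc3 a : 0 < a < 1 -> 3 * (pi / sin (pi * a)) =
  pi / sin (pi * (a / 3)) - pi / sin (pi * ((a + 1) / 3)) + pi / sin (pi * ((a + 2) / 3)) :> R.
Proof.
move=> /andP[a0 a1]; have p0 := @pi_gt0 R.
have sp (y : R) : 0 < y < 1 -> 0 < sin (pi * y).
  move=> /andP[y0 y1]; apply: sin_gt0_pi; rewrite mulr_gt0//=.
  by rewrite -[ltRHS]mulr1 ltr_pM2l.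
have s0 : 0 < sin (pi * (a / 3)) by apply: sp; lra.
have s1 : 0 < sin (pi * ((a + 1) / 3)) by apply: sp; lra.
have s2 : 0 < sin (pi * ((a + 2) / 3)) by apply: sp; lra.
have s3 : 0 < sin (pi * a) by apply: sp; lra.
move: s0 s1 s2 s3.
rewrite (_ : pi * a = 3 * (pi * (a / 3))); last by field.
rewrite sin_third.
rewrite (_ : pi * ((a + 1) / 3) = pi * (a / 3) + pi / 3); last by field.
rewrite (_ : pi * ((a + 2) / 3) = pi - (pi / 3 - pi * (a / 3))); last by field.
rewrite [sin (pi - _)]sinB sinpi cospi mul0r sub0r mulN1r opprK sinB sinD cos_third.
have sc := cos2Dsin2 (pi / 3 : R); rewrite cos_third in sc.
have xy := cos2Dsin2 (pi * (a / 3)).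
move: sc xy; set q := sin (pi / 3); set u := sin (pi * (a / 3)); set v := cos (pi * (a / 3)).
move=> sc uv u0 u1 u2 u3.
(* This is sin(3x) = 4 sin(x) sin(pi/3 + x) sin(pi/3 - x) for x = pi a / 3, freed of the factor
   sin(x). *)
have e12 : (u * (1 / 2) + v * q) * (q * v - 1 / 2 * u) = (3 - 4 * u ^+ 2) / 4.
  transitivity (v ^+ 2 * q ^+ 2 - u ^+ 2 / 4); first by field.
  rewrite (_ : q ^+ 2 = 3 / 4); last by lra.
  rewrite (_ : v ^+ 2 = 1 - u ^+ 2); last by lra.
  by field.
have u4 : 3 - 4 * u ^+ 2 != 0 by apply: contraTneq u3 => ->; rewrite mulr0 ltxx.
rewrite (_ : _ - _ + _ = pi / u + pi * u / ((u * (1 / 2) + v * q) * (q * v - 1 / 2 * u))).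
  by rewrite e12; field; rewrite u4 gt_eqF.
move: u1 u2; set A := u * (1 / 2) + v * q; set B := q * v - 1 / 2 * u => u1 u2.
rewrite (_ : u = A - B); last by rewrite /A /B; field.
have AB0 : A - B != 0 by rewrite (_ : A - B = u) ?gt_eqF// /A /B; field.
by field; rewrite AB0 !gt_eqF.
Qed.

(** Once the singularity 1/a is removed, O(a) remains. [phi_near0] does the same for the other side
    of the reflection formula, so that [csc_defect] is O(a) at 0. *)
Lemma csc_near0 a : 0 < a <= 1 / 2 -> `|pi / sin (pi * a) - 1 / a| <= 2 * pi ^+ 2 * a.
Proof.
move=> /andP[a0 a1]; have p0 := @pi_gt0 R; have p4 : pi < 4 :> R by have := @pihalf_lt2 R; lra.
set x := pi * a; have x0 : 0 < x by rewrite mulr_gt0.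
have x2 : x / 2 <= 1 by rewrite /x; nra.
have x20 : 0 < x / 2 by rewrite divr_gt0.
have sx : x / 4 <= sin x.
  rewrite (_ : x = (x / 2) *+ 2); last by rewrite mulr2n; field.
  rewrite sin_mulr2n.
  have c2 : 1 / 2 <= cos (x / 2) by have := cos_ge (ltW x20); nra.
  have s2 : x / 2 / 2 <= sin (x / 2).
    apply: le_trans (sin_ge (ltW x20)).
    have : (x / 2) ^+ 3 <= x / 2 by rewrite exprS; nra.
    lra.
  rewrite mulr2n; nra.
have s0 : 0 < sin x by nra.
rewrite (_ : _ - _ = (x - sin x) / (a * sin x)); last by rewrite /x; field; rewrite !gt_eqF.
rewrite ger0_norm; last first.
  by rewrite divr_ge0 ?subr_ge0 ?sin_le_id ?mulr_ge0// ltW.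
rewrite ler_pdivrMr ?mulr_gt0//.
have := sin_ge (ltW x0).
have : 2 * pi ^+ 2 * a * (a * (x / 4)) <= 2 * pi ^+ 2 * a * (a * sin x).
  by rewrite ler_pM2l ?ler_pM2l// !mulr_gt0// exprn_gt0.
rewrite (_ : 2 * pi ^+ 2 * a * (a * (x / 4)) = x ^+ 3 / 2); first by lra.
by rewrite /x; field.
Qed.

Definition csc_defect a := phi a + phi (1 - a) - pi / sin (pi * a).

Lemma csc_defect3 a : 0 < a < 1 -> 3 * csc_defect a =
  csc_defect (a / 3) - csc_defect ((a + 1) / 3) + csc_defect ((a + 2) / 3).
Proof.
move=> a01; have /andP[a0 a1] := a01.
rewrite /csc_defect mulrBr csc3// mulrDr phi3// phi3 ?subr_gt0//.
rewrite (_ : 1 - a / 3 = (1 - a + 2) / 3); last by field.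
rewrite (_ : 1 - (a + 1) / 3 = (1 - a + 1) / 3); last by field.
rewrite (_ : 1 - (a + 2) / 3 = (1 - a) / 3); last by field.
move: (phi _) (phi _) (phi _) (phi _) (phi _) (phi _) (pi / _) (pi / _) (pi / _).
by move=> *; ring.
Qed.

(** By [phiS] the quantity is phi(1 - a) - phi(a + 1). It is nonnegative since x^a <= x^(-a) on the
    unit interval, and as 1/(1 + x) <= 1 it is at most the integral of x^(-a) - x^a. *)
Lemma phi_near0 a : 0 < a <= 1 / 2 -> `|phi a + phi (1 - a) - 1 / a| <= 3 * a.
Proof.
move=> /andP[a0 a1].
have d0 : 0 < 1 - a by lra.
have -> : phi a + phi (1 - a) - 1 / a = phi (1 - a) - phi (a + 1).
  by rewrite div1r -(phiS a0); move: (phi a) (phi (1 - a)) (phi (a + 1)) => u v w; ring.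
have m1 b : measurable_fun (`]0, 1[ : set R) (fun x : R => (x `^ (b - 1))%:E).
  by apply: measurable_funTS; mf.
have le01 (x : R) : 0 < x < 1 -> x `^ (a + 1 - 1) <= x `^ (1 - a - 1).
  by move=> /andP[x0 x1]; apply: ger_powR; [rewrite x0 ltW|lra].
have lo : phi (a + 1) <= phi (1 - a).
  rewrite -lee_fin -!phieE//; last lra.
  rewrite !phie_def; apply: ge0_ae_le_integral => //.
  - by move=> x; rewrite /= in_itv/= => /andP[x0 x1]; rewrite lee_fin divr_ge0 ?powR_ge0// addr_ge0// ltW.
  - by move=> x; rewrite /= in_itv/= => /andP[x0 x1]; rewrite lee_fin divr_ge0 ?powR_ge0// addr_ge0// ltW.
  apply: aeW => x; rewrite /= in_itv/= => x01; have /andP[x0 x1] := x01.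
  by rewrite lee_fin ler_pM2r ?le01// invr_gt0 addr_gt0.
have hi : phi (1 - a) + (a + 1)^-1 <= phi (a + 1) + (1 - a)^-1.
  have a10 : 0 < a + 1 by lra.
  rewrite -lee_fin !EFinD -!phieE//.
  have := integral_powR a10 ltr01; have := integral_powR d0 ltr01.
  rewrite !powR1 !mul1r => <- <-.
  rewrite !phie_def -!ge0_integralD//.
  - apply: ge0_ae_le_integral => //.
    + by move=> x; rewrite /= in_itv/= => /andP[x0 x1]; rewrite lee_fin addr_ge0 ?powR_ge0// divr_ge0 ?powR_ge0// addr_ge0// ltW.
    + by move=> x; rewrite /= in_itv/= => /andP[x0 x1]; rewrite lee_fin addr_ge0 ?powR_ge0// divr_ge0 ?powR_ge0// addr_ge0// ltW.
    apply: aeW => x; rewrite /= in_itv/= => x01; have /andP[x0 x1] := x01.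
    rewrite -!EFinD lee_fin; have := le01 x x01.
    set u := x `^ _; set v := x `^ _ => uv.
    have i0 : 0 < (1 + x)^-1 by rewrite invr_gt0 addr_gt0.
    have i1 : (1 + x)^-1 <= 1 by rewrite invf_le1 ?addr_gt0// lerDl ltW.
    by move: i0 i1; set w := _^-1 => i0 i1; nra.
  - by move=> x; rewrite /= in_itv/= => /andP[x0 x1]; rewrite lee_fin divr_ge0 ?powR_ge0// addr_ge0// ltW.
  - exact: measurable_phie.
  - by move=> x _; rewrite lee_fin powR_ge0.
  - exact: m1.
  - by move=> x; rewrite /= in_itv/= => /andP[x0 x1]; rewrite lee_fin divr_ge0 ?powR_ge0// addr_ge0// ltW.
  - exact: measurable_phie.
  - by move=> x _; rewrite lee_fin powR_ge0.
  - exact: m1.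
clear m1 le01; move: (phi (1 - a)) (phi (a + 1)) lo hi => u v lo hi.
rewrite ger0_norm ?subr_ge0// (@le_trans _ _ ((1 - a)^-1 - (a + 1)^-1))//; first by lra.
rewrite (_ : _ - _ = 2 * a / ((1 - a) * (a + 1))); last by field; rewrite !gt_eqF//; lra.
rewrite ler_pdivrMr; last by rewrite mulr_gt0//; lra.
nra.
Qed.

Lemma csc_defect_sym a : csc_defect (1 - a) = csc_defect a.
Proof.
rewrite /csc_defect (_ : 1 - (1 - a) = a); last by ring.
by rewrite mulrBr mulr1 sinB sinpi cospi mul0r sub0r mulN1r opprK (addrC (phi a)).
Qed.

(** Herglotz's trick, with a supremum m of the defect that need not be attained. In the three-term
    equation the argument closest to 0 is treated by induction and the other two terms are bounded
    by m; n rounds give m <= C / 9^n + (1 - 3^-n) m, that is m <= C / 3^n. *)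
Lemma csc_defect_eq0 a : 0 < a < 1 -> csc_defect a = 0.
Proof.
pose C := 3 + 2 * (pi : R) ^+ 2.
have C0 : 0 < C by rewrite /C addr_gt0// mulr_gt0// exprn_gt0// pi_gt0.
have near0 (b : R) : 0 < b < 1 -> `|csc_defect b| <= C * b.
  have near0' (c : R) : 0 < c <= 1 / 2 -> `|csc_defect c| <= C * c.
    move=> c2; have := phi_near0 c2; have := csc_near0 c2; rewrite /csc_defect /C.
    rewrite [X in _ -> _ -> _ <= X]mulrDl; move: (pi / _) (2 * _ * _) => u v h1 h2.
    rewrite (_ : _ - u = (phi c + phi (1 - c) - 1 / c) - (u - 1 / c)).
      exact: le_trans (ler_normB _ _) (lerD h2 h1).
    by rewrite opprB addrA subrK.
  move=> /andP[b0 b1]; have [b2|b2] := leP b (1 / 2); first by rewrite near0'// b0.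
  rewrite -csc_defect_sym (le_trans (near0' _ _))//; first by lra.
  by rewrite ler_pM2l//; lra.
pose S := [set `|csc_defect b| | b in [set b | 0 < b < 1]].
have ubS : ubound S C.
  move=> _ [b b01 <-]; rewrite (le_trans (near0 _ b01))// -[leRHS]mulr1 ler_pM2l//.
  by case/andP: b01 => _ /ltW.
pose m := sup S.
have hm b : 0 < b < 1 -> `|csc_defect b| <= m.
  by move=> b01; apply: ub_le_sup; [exists C|exists b].
have key n : forall b, 0 < b < 1 ->
    `|csc_defect b| <= C * b / 9 ^+ n + (1 - 1 / 3 ^+ n) * m.
  elim: n => [|n ih] b b01; first by rewrite !expr0 !divr1 subrr mul0r addr0 near0.
  have /andP[b0 b1] := b01.
  have h1 := ih (b / 3) ltac:(lra).
  have h2 := hm ((b + 1) / 3) ltac:(lra).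
  have h3 := hm ((b + 2) / 3) ltac:(lra).
  have : 3 * `|csc_defect b| <= `|csc_defect (b / 3)| + m + m.
    have -> : 3 * `|csc_defect b| = `|3 * csc_defect b| by rewrite normrM (@gtr0_norm _ (3 : R)).
    rewrite csc_defect3// (le_trans (ler_normD _ _))// lerD//.
    by rewrite (le_trans (ler_normB _ _))// lerD2l.
  rewrite !exprS; move: h1.
  rewrite (_ : C * (b / 3) / 9 ^+ n = C * b / 9 ^+ n / 3); last by field; rewrite expf_neq0.
  rewrite (_ : C * b / (9 * 9 ^+ n) = C * b / 9 ^+ n / 9); last by field; rewrite expf_neq0.
  rewrite (_ : 1 / (3 * 3 ^+ n) = 1 / 3 ^+ n / 3); last by field; rewrite expf_neq0.
  set p := C * b / _; set q := 1 / _; nra.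
have m0 n : m <= C / 3 ^+ n.
  have : m <= C / 9 ^+ n + (1 - 1 / 3 ^+ n) * m.
    apply: ge_sup; first by exists `|csc_defect (1 / 2)|; exists (1 / 2) => //=; lra.
    move=> _ [b b01 <-]; rewrite (le_trans (key n _ b01))// lerD2r ler_pM2r ?invr_gt0 ?exprn_gt0//.
    by rewrite -[leRHS]mulr1 ler_pM2l//; case/andP: b01 => _ /ltW.
  have -> : 9 = 3 * 3 :> R by ring.
  rewrite exprMn => h.
  have e0 : 0 < 3 ^+ n :> R by rewrite exprn_gt0.
  have : m / 3 ^+ n <= C / (3 ^+ n * 3 ^+ n) by lra.
  by rewrite invfM mulrA ler_pM2r// invr_gt0.
move=> a01; apply/normr0_eq0/eqP; rewrite eq_le normr_ge0 andbT.
apply/ler_addgt0Pl => e e0; rewrite addr0 (le_trans (hm _ a01))//.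
apply: le_trans (m0 (Num.truncn (C / e))) _.
set n := Num.truncn _.
rewrite ler_pdivrMr ?exprn_gt0// mulrC -ler_pdivrMr//.
apply: le_trans (ltW (truncnS_gt _)) _.
by rewrite -natrX ler_nat ltn_expl.
Qed.

Lemma phi_csc a : 0 < a < 1 -> phi a + phi (1 - a) = pi / sin (pi * a).
Proof. by move=> /csc_defect_eq0 /eqP; rewrite subr_eq0 => /eqP. Qed.

End reflection.

(** * Real values of Gamma, Beta integrals, and powers with varying exponent *)

Section gamma_real.
Context {R : realType}.
Local Notation mu := (@lebesgue_measure R).
Implicit Types (a b c s t x y : R).

(** The range up to 2 accommodates sums of two orders from []0, 1]], which arise when kernels are
    composed. *)
Lemma gammae_bounds a : 0 < a <= 2 -> (0 < gammae a < +oo)%E.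
Proof.
move=> /andP[a0 a2].
have small c : 0 < c <= 1 -> (0 < gammae c < +oo)%E.
  move=> c1; rewrite gammae_lty// andbT; apply: lt_le_trans (gammae_gt0 c1).
  by rewrite lte_fin expR_gt0.
have [a1|a1] := leP a 1; first by apply: small; rewrite a0.
have b0 : 0 < a - 1 by rewrite subr_gt0.
have /small/andP[l u] : 0 < a - 1 <= 1 by lra.
rewrite -(subrK 1 a) gammaeS// mule_gt0//= lte_mul_pinfty//.
by rewrite lee_fin ltW.
Qed.

Lemma GammaE a : 0 < a <= 2 -> gammae a = (Gamma a)%:E.
Proof.
move=> /gammae_bounds/andP[l u]; rewrite /Gamma /Rintegral -/(gammae a) fineK//.
by rewrite ge0_fin_numE// ltW.
Qed.

Lemma Gamma_gt0 a : 0 < a <= 2 -> 0 < Gamma a.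
Proof.
move=> a2; have /andP[l _] := gammae_bounds a2.
by rewrite -lte_fin -GammaE.
Qed.

Lemma Gamma_ge a : 0 < a <= 1 -> expR (- 1) <= Gamma a.
Proof.
move=> a1; have := gammae_gt0 a1; rewrite GammaE ?lee_fin//.
by case/andP: a1 => -> /le_trans; apply; rewrite ler1n.
Qed.

Lemma GammaS a : 0 < a <= 1 -> Gamma (a + 1) = a * Gamma a.
Proof.
move=> /andP[a0 a1]; apply: EFin_inj.
by rewrite EFinM -!GammaE ?gammaeS//; lra.
Qed.

Lemma Gamma1 : Gamma 1 = 1 :> R.
Proof.
apply: EFin_inj; rewrite -GammaE ?ltr01 ?ler1n//= /gammae -[RHS]integral_expRN.
apply: eq_integral => x; rewrite inE/= in_itv/= andbT => x0.
by rewrite subrr powRr0 mul1r.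
Qed.

Lemma betaeE a b : 0 < a <= 1 -> 0 < b <= 1 ->
  betae a b = (Gamma a * Gamma b / Gamma (a + b))%:E.
Proof.
move=> /andP[a0 a1] /andP[b0 b1].
have ab : 0 < a + b <= 2 by lra.
have g0 := Gamma_gt0 ab.
have := gammae_mul a0 b0.
rewrite (@GammaE a); last lra.
rewrite (@GammaE b); last lra.
rewrite (@GammaE (a + b))//.
(* An infinite Beta value would make one side of [gammae_mul] infinite, while the other is
   finite. *)
move=> h; have bfin : betae a b \is a fin_num.
  rewrite ge0_fin_numE ?betae_ge0// ltey; apply/eqP => boo.
  by move: h; rewrite boo gt0_muley.
have [r br] : exists r, betae a b = r%:E by exists (fine (betae a b)); rewrite fineK.
have hr : Gamma a * Gamma b = Gamma (a + b) * r.
  by apply: EFin_inj; rewrite !EFinM h br.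
rewrite br hr; congr EFin.
by rewrite mulrAC divff ?mul1r// gt_eqF.
Qed.

Lemma Gamma_reflection a : 0 < a < 1 -> Gamma a * Gamma (1 - a) = pi / sin (pi * a).
Proof.
move=> a01; have /andP[a0 a1] := a01.
rewrite -phi_csc//; apply: EFin_inj; rewrite EFinD -!phieE ?subr_gt0//.
by rewrite -gammae_mul_phie// EFinM !GammaE//; lra.
Qed.

Lemma integral_pow_conv a b s t : s < t -> 0 < a <= 1 -> 0 < b <= 1 ->
  (\int[mu]_(x in `]s, t[) ((t - x) `^ (b - 1) * (x - s) `^ (a - 1))%:E =
   (Gamma a * Gamma b / Gamma (a + b) * (t - s) `^ (a + b - 1))%:E)%E.
Proof. by move=> st a1 b1; rewrite integral_beta// betaeE// -EFinM mulrC. Qed.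

Lemma integral_pow_left a s t : s < t -> 0 < a ->
  (\int[mu]_(x in `]s, t[) ((x - s) `^ (a - 1))%:E = ((t - s) `^ a / a)%:E)%E.
Proof.
move=> st a0; have st0 : 0 < t - s by rewrite subr_gt0.
rewrite -(integral_powR a0 st0).
rewrite ge0_integral_affine_oo; last first.
- by move=> x; rewrite lee_fin powR_ge0.
- by mf.
- exact: st.
rewrite ge0_integral_scale_oo; last first.
- by move=> x; rewrite lee_fin powR_ge0.
- by mf.
- exact: st0.
by apply: congr1; apply: eq_integral => x _; rewrite addrK.
Qed.

Lemma integral_pow_right b s t : s < t -> 0 < b <= 1 ->
  (\int[mu]_(x in `]s, t[) ((t - x) `^ (b - 1))%:E = ((t - s) `^ b / b)%:E)%E.
Proof.
move=> st b1; have /andP[b0 b1'] := b1.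
have := @integral_pow_conv 1 b s t st _ b1; rewrite ltr01 lexx => /(_ isT).
rewrite Gamma1 mul1r (addrC 1 b) GammaS// addrK.
under eq_integral do rewrite subrr powRr0 mulr1.
move=> ->; congr EFin.
have g0 : 0 < Gamma b by apply: Gamma_gt0; lra.
by field; rewrite !gt_eqF.
Qed.

(* The loss [e] in the exponent pays for the factor [ln x] of the derivative in the exponent. *)
Lemma powR_lipschitz_exponent (m n e x p q : R) : 0 < e -> 0 < x -> m <= p <= n -> m <= q <= n ->
  `|x `^ p - x `^ q| <= `|p - q| / e * (x `^ (m - e) + x `^ (n + e)).
Proof.
wlog pq : p q / q <= p.
  move=> h e0 x0 hp hq; have [|/ltW qp] := leP q p; first by move=> qp; exact: h.
  by rewrite distrC (distrC p); exact: h.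
move=> e0 x0 /andP[mp pn] /andP[mq qn].
rewrite (@ger0_norm _ (p - q)) ?subr_ge0//.
have ln_le (y : R) : 0 < y -> e * ln y <= y `^ e.
  by move=> y0; rewrite -ln_powR ltW// ln_sublinear// powR_gt0.
have bern (y c : R) : 0 < y -> 1 - y `^ c <= - (c * ln y).
  move=> y0; have yc : 0 < y `^ c by rewrite powR_gt0.
  have := @le_ln1Dx R (y `^ c - 1); rewrite ltrBrDl subrr addrC subrK ln_powR => /(_ yc).
  lra.
have d0 : 0 <= p - q by rewrite subr_ge0.
have de0 : 0 <= (p - q) / e by rewrite divr_ge0// ltW.
have [x1|/ltW x1] := leP 1 x.
- have xpq : x `^ q <= x `^ p by exact: ler_powR.
  rewrite ger0_norm ?subr_ge0//.
  have -> : x `^ p - x `^ q = x `^ p * (1 - x `^ (- (p - q))).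
    by rewrite mulrBr mulr1 -powRD1//; congr (_ - x `^ _); ring.
  apply: (@le_trans _ _ (x `^ p * ((p - q) / e * x `^ e))).
    rewrite ler_wpM2l ?powR_ge0//; apply: le_trans (bern _ _ x0) _.
    rewrite mulNr opprK -mulrA ler_wpM2l// ler_pdivlMl// ln_le//.
  rewrite mulrCA; apply: ler_wpM2l => //; rewrite -powRD1// ler_wpDl ?powR_ge0//.
  by apply: ler_powR => //; rewrite lerD2r.
- have x01 : 0 < x <= 1 by rewrite x0.
  have xpq : x `^ p <= x `^ q by exact: ger_powR.
  rewrite ler0_norm ?subr_le0// opprB.
  have -> : x `^ q - x `^ p = x `^ q * (1 - x `^ (p - q)).
    by rewrite mulrBr mulr1 -powRD1//; congr (_ - x `^ _); ring.
  apply: (@le_trans _ _ (x `^ q * ((p - q) / e * x `^ (- e)))).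
    rewrite ler_wpM2l ?powR_ge0//; apply: le_trans (bern _ _ x0) _.
    rewrite -mulrN -mulrA ler_wpM2l// ler_pdivlMl// -lnV ?posrE//.
    by apply: le_trans (ln_le _ _) _; rewrite ?invr_gt0// -powR_inv1 ?(ltW x0)// -powRrM mulN1r.
  rewrite mulrCA; apply: ler_wpM2l => //; rewrite -powRD1// ler_wpDr ?powR_ge0//.
  by apply: ger_powR => //; rewrite lerD2r.
Qed.

End gamma_real.

(** * The Bochner integral *)

Section fibered.
Context {R : realType}.
Local Notation mu := (@lebesgue_measure R).

(** This is [simple] with an arbitrary codomain. It admits pairs of simple functions, on whose
    fibres both components are constant. *)
Definition fibered (Y : Type) (q : R -> Y) :=
  finite_set (range q) /\ forall y, measurable (q @^-1` [set y]).

Lemma fibered_cst (Y : Type) (y : Y) : fibered (fun _ : R => y).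
Proof.
split; first exact: finite_image_cst.
move=> z; have [->|zy] := pselect (y = z).
  by rewrite (_ : _ @^-1` _ = setT)//; apply/seteqP; split.
by rewrite (_ : _ @^-1` _ = set0)//; apply/seteqP; split.
Qed.

Lemma fibered_preimage (Y : Type) (q : R -> Y) (A : set Y) : fibered q ->
  measurable (q @^-1` A).
Proof.
move=> [fq mq].
have -> : q @^-1` A = \bigcup_(y in range q `&` A) q @^-1` [set y].
  apply/seteqP; split => [t At|t [y [_ Ay] /= ->]//].
  by exists (q t) => //; split => //; exists t.
by apply: fin_bigcup_measurable => // ; exact: finite_setIl.
Qed.

Lemma fibered_comp (Y Z : Type) (g : Y -> Z) (q : R -> Y) : fibered q -> fibered (g \o q).
Proof.
move=> fq; split; last first.
  by move=> z; rewrite comp_preimage; exact: fibered_preimage.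
rewrite (_ : range _ = g @` range q); last by rewrite image_comp.
by apply: finite_image; case: fq.
Qed.

Lemma fibered_pair (Y Z : Type) (q : R -> Y) (r : R -> Z) :
  fibered q -> fibered r -> fibered (fun t => (q t, r t)).
Proof.
move=> [fq mq] [fr mr]; split.
  apply: sub_finite_set (finite_setX fq fr) => _ [t _ <-].
  by split => /=; exists t.
move=> [y z]; rewrite (_ : _ @^-1` _ = q @^-1` [set y] `&` r @^-1` [set z]).
  exact: measurableI.
by apply/seteqP; split => t /=; [case=> <- <-|case=> <- <-].
Qed.

Lemma fibered_comp2 (Y Z U : Type) (g : Y -> Z -> U) (q : R -> Y) (r : R -> Z) :
  fibered q -> fibered r -> fibered (fun t => g (q t) (r t)).
Proof.
by move=> fq fr; exact: (fibered_comp (fun p => g p.1 p.2) (fibered_pair fq fr)).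
Qed.

Lemma fibered_measurable (q : R -> R) : fibered q -> measurable_fun setT q.
Proof. by move=> fq _ A mA; rewrite setTI; exact: fibered_preimage. Qed.

Lemma fibered_sum (V : zmodType) I (r : seq I) (q : I -> R -> V) :
  (forall i, fibered (q i)) -> fibered (fun t => \sum_(i <- r) q i t).
Proof.
move=> fq; elim: r => [|i r ih].
  by under eq_fun do rewrite big_nil; exact: fibered_cst.
under eq_fun do rewrite big_cons.
exact: (fibered_comp2 +%R).
Qed.

End fibered.

Section simple_integral.
Context {R : realType} {X : normedModType R}.
Local Notation mu := (@lebesgue_measure R).
Variable D : set R.
Hypotheses (mD : measurable D) (Doo : (mu D < +oo)%E).

Lemma measure_subset_fin (A : set R) : measurable A -> (mu (D `&` A) \is a fin_num).
Proof.
move=> mA; rewrite ge0_fin_numE//; apply: le_lt_trans Doo; apply: le_measure; rewrite ?inE//.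
exact: measurableI.
Qed.

(** The sum over the values of [g \o q] is regrouped along the finer fibres of [q]. Taking for [q] a
    pair of simple functions gives additivity. *)
Lemma simple_integral_comp (Y : choiceType) (q : R -> Y) (g : Y -> X) : fibered q ->
  simple_integral D (g \o q) =
  \sum_(y \in range q) fine (mu (D `&` q @^-1` [set y])) *: g y.
Proof.
move=> fq; have fgq := fibered_comp g fq.
rewrite /simple_integral !fsbig_finite; [|by case: fq|by case: fgq].
pose m y := fine (mu (D `&` q @^-1` [set y])).
have mE y : mu (D `&` q @^-1` [set y]) = (m y)%:E.
  by rewrite fineK//; apply: measure_subset_fin; case: fq.
transitivity (\sum_(x <- finmap.enum_fset (fset_set (range (g \o q))))
       \sum_(y <- finmap.enum_fset (fset_set (range q)) | g y == x) m y *: g y).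
  apply: eq_bigr => x _.
  rewrite (_ : D `&` _ = \bigcup_(y in range q `&` [set y | g y = x]) (D `&` q @^-1` [set y]));
    last first.
    apply/seteqP; split => [t [Dt /= tx]|t [y [_ /= yx] [Dt /= ty]]].
      by exists (q t) => //; split => //; exists t.
    by split => //=; rewrite ty.
  rewrite measure_fin_bigcup//; last 3 first.
  - by apply: finite_setIl; case: fq.
  - by move=> y z _ _ [t [[_ /= <-] [_ /= <-]]].
  - by move=> y _; apply: measurableI => //; exact: fq.2.
  rewrite fsbig_mkcondr fsbig_finite; last by case: fq.
  rewrite (eq_bigr (fun y => (if g y == x then m y else 0)%:E)); last first.
    move=> y _; case: ifPn => [/set_mem/= ->|]; first by rewrite eqxx; exact: mE.
    by move=> /negP yx; case: eqP => // gyx; exfalso; apply: yx; apply/mem_set.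
  rewrite sumEFin/= scaler_suml [RHS]big_mkcond/=.
  by apply: eq_bigr => y _; case: eqP => [->//|_]; rewrite scale0r.
rewrite (exchange_big_dep xpredT)//=; apply: eq_big_seq => y yB.
have gyA : g y \in finmap.enum_fset (fset_set (range (g \o q))).
  rewrite in_fset_set; last by case: fgq.
  move: yB; rewrite in_fset_set; last by case: fq.
  by move=> /set_mem[t _ <-]; apply/mem_set; exists t.
rewrite (eq_bigl (fun x => x == g y)); last by move=> x; rewrite eq_sym.
by rewrite -big_filter filter_pred1_uniq ?big_seq1// finmap.fset_uniq.
Qed.

Lemma simple_integralD (s r : R -> X) : simple s -> simple r ->
  simple_integral D (fun t => s t + r t) = simple_integral D s + simple_integral D r.
Proof.
move=> fs fr; have fp := fibered_pair fs fr.
rewrite (simple_integral_comp (fun p : X * X => p.1 + p.2) fp).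
have -> : simple_integral D s = simple_integral D (fst \o (fun t => (s t, r t))) by [].
have -> : simple_integral D r = simple_integral D (snd \o (fun t => (s t, r t))) by [].
rewrite (simple_integral_comp fst fp) (simple_integral_comp snd fp).
rewrite !fsbig_finite; [|by case: fp..].
by rewrite -big_split/=; apply: eq_bigr => p _; rewrite scalerDr.
Qed.

Lemma simple_integral0 : simple_integral D (fun=> 0 : X) = 0.
Proof.
rewrite /simple_integral fsbig_finite; last exact: (fibered_cst (0 : X)).1.
rewrite big_seq big1// => x; rewrite in_fset_set; last exact: (fibered_cst (0 : X)).1.
by move=> /set_mem[t _ <-]; rewrite scaler0.
Qed.

Lemma simple_integral_sum I (r : seq I) (s : I -> R -> X) : (forall i, simple (s i)) ->
  simple_integral D (fun t => \sum_(i <- r) s i t) = \sum_(i <- r) simple_integral D (s i).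
Proof.
move=> fs; elim: r => [|i r ih].
  by under eq_fun do rewrite big_nil; rewrite big_nil simple_integral0.
under eq_fun do rewrite big_cons.
by rewrite simple_integralD// ?ih ?big_cons//; exact: fibered_sum.
Qed.

Lemma simple_integralZ (c : R) (s : R -> X) : simple s ->
  simple_integral D (fun t => c *: s t) = c *: simple_integral D s.
Proof.
move=> fs; rewrite (simple_integral_comp ( *:%R c) fs).
rewrite [in RHS]/simple_integral !fsbig_finite; [|by case: fs..].
by rewrite scaler_sumr; apply: eq_bigr => x _; rewrite !scalerA mulrC.
Qed.

Lemma integral_norm_simple (s : R -> X) : simple s ->
  (\int[mu]_(t in D) (`|s t|)%:E =
   (\sum_(x <- finmap.enum_fset (fset_set (range s))) fine (mu (D `&` s @^-1` [set x])) * `|x|)%:E)%E.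
Proof.
move=> fs.
transitivity (\int[mu]_(t in D) (\sum_(x <- finmap.enum_fset (fset_set (range s)))
    (`|x| * \1_(s @^-1` [set x]) t)%:E))%E.
  apply: eq_integral => t _; rewrite sumEFin; congr EFin.
  rewrite (bigD1_seq (s t))/=; last 2 first.
  - by rewrite in_fset_set; [apply/mem_set; exists t|case: fs].
  - exact: finmap.fset_uniq.
  rewrite indicE mem_set// mulr1 big1 ?addr0// => x xs.
  by rewrite indicE memNset ?mulr0//= => sx; rewrite -sx eqxx in xs.
have mi x : measurable_fun D (fun t => (`|x| * \1_(s @^-1` [set x]) t)%:E).
  apply/measurable_EFinP; apply: measurable_funM => //.
  by apply: measurable_funTS; apply: measurable_indic; case: fs.
rewrite ge0_integral_sum//.
rewrite -sumEFin; apply: eq_bigr => x _.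
have ms : measurable (s @^-1` [set x]) by case: fs.
have e : (\int[mu]_(t in D) (\1_(s @^-1` [set x]) t)%:E = (fine (mu (D `&` s @^-1` [set x])))%:E)%E.
  by rewrite integral_indic// setIC fineK//; exact: measure_subset_fin.
under eq_integral do rewrite EFinM.
rewrite ge0_integralZl_EFin//; last by apply/measurable_EFinP/measurable_funTS/measurable_indic.
by apply: etrans (congr1 _ e) _; rewrite -EFinM mulrC.
Qed.

Lemma le_norm_simple_integral (s : R -> X) : simple s ->
  ((`|simple_integral D s|)%:E <= \int[mu]_(t in D) (`|s t|)%:E)%E.
Proof.
move=> fs; rewrite integral_norm_simple// lee_fin /simple_integral fsbig_finite; last by case: fs.
apply: le_trans (ler_norm_sum _ _ _) _; apply: ler_sum => x _.
by rewrite normrZ ger0_norm// fine_ge0.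
Qed.

Lemma simple_integral_scalar (c : R -> R) (x : X) : fibered c ->
  simple_integral D (fun t => c t *: x) = (\int[mu]_(t in D) c t) *: x.
Proof.
move=> fc; rewrite (simple_integral_comp (fun y => y *: x) fc) fsbig_finite; last by case: fc.
have -> : \int[mu]_(t in D) c t = \sum_(y <- finmap.enum_fset (fset_set (range c)))
    fine (mu (D `&` c @^-1` [set y])) * y; last first.
  by rewrite scaler_suml; apply: eq_bigr => y _; rewrite scalerA.
rewrite /Rintegral.
transitivity (fine (\int[mu]_(t in D) (\sum_(y <- finmap.enum_fset (fset_set (range c)))
    (y * \1_(c @^-1` [set y]) t)%:E))%E).
  congr fine; apply: eq_integral => t _; rewrite sumEFin; congr EFin.
  rewrite (bigD1_seq (c t))/=; last 2 first.
  - by rewrite in_fset_set; [apply/mem_set; exists t|case: fc].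
  - exact: finmap.fset_uniq.
  rewrite indicE mem_set// mulr1 big1 ?addr0// => y yc.
  by rewrite indicE memNset ?mulr0//= => cy; rewrite -cy eqxx in yc.
have ii y : mu.-integrable D (EFin \o (\1_(c @^-1` [set y]))).
  have mc : measurable (c @^-1` [set y]) by case: fc.
  apply/integrableP; split; first by apply/measurable_EFinP/measurable_funTS/measurable_indic.
  apply: le_lt_trans Doo; rewrite -[leRHS]mul1e -integral_cst//.
  apply: ge0_ae_le_integral => //; apply: aeW => t _ /=.
  by rewrite lee_fin indicE ger0_norm// lern1 leq_b1.
rewrite integral_sum//; last first.
  move=> y; have := @integrableZl _ _ _ mu D mD y _ (ii y).
  by apply: eq_integrable => //; exact: mD.
rewrite (eq_bigr (fun y => (fine (mu (D `&` c @^-1` [set y])) * y)%:E)); first by rewrite sumEFin.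
move=> y _; have mc : measurable (c @^-1` [set y]) by case: fc.
have e : (\int[mu]_(t in D) (\1_(c @^-1` [set y]) t)%:E = (fine (mu (D `&` c @^-1` [set y])))%:E)%E.
  by rewrite integral_indic// setIC fineK//; exact: measure_subset_fin.
under eq_integral do rewrite EFinM.
rewrite integralZl//; last exact: ii.
by apply: etrans (congr1 _ e) _; rewrite -EFinM mulrC.
Qed.

End simple_integral.

Section strongly_measurable.
Context {R : realType} {X : normedModType R}.
Local Notation mu := (@lebesgue_measure R).
Implicit Types (D : set R) (f g : R -> X).

Lemma simple_strongly_measurable D (s : R -> X) : simple s -> strongly_measurable D s.
Proof. by move=> fs; exists (fun _ => s) => //; apply: aeW => t _; exact: cvg_cst. Qed.

Lemma strongly_measurableB D f g : strongly_measurable D f -> strongly_measurable D g ->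
  strongly_measurable D (fun t => f t - g t).
Proof.
move=> [s fs sf] [r fr rg]; exists (fun n t => s n t - r n t).
  by move=> n; exact: (fibered_comp2 (fun x y => x - y) (fs n) (fr n)).
by apply: (ae_impl2 sf rg) => t hf hg Dt; apply: cvgB; [exact: hf|exact: hg].
Qed.

Lemma strongly_measurable_ae D f g : strongly_measurable D f ->
  {ae mu, forall t, D t -> f t = g t} -> strongly_measurable D g.
Proof.
move=> [s fs sf] fg; exists s => //.
by apply: (ae_impl2 sf fg) => t hf hg Dt; rewrite -hg//; exact: hf.
Qed.

(** The norms of the approximating simple functions are Borel and converge almost everywhere, so
    their upper limit is a Borel version of the norm. *)
Lemma strongly_measurable_norm D f : strongly_measurable D f ->
  exists N : R -> R, [/\ measurable_fun setT N, forall t, 0 <= N t &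
    {ae mu, forall t, D t -> `|f t| = N t}].
Proof.
move=> [s fs sf]; pose N t := `|fine (limn_esup (fun n => (`|s n t|)%:E))|.
exists N; split.
- apply: measurable_fun_normr; apply: (@measurableT_comp _ _ _ _ _ _ fine) => //.
  apply: measurable_fun_limn_esup => n; apply: measurable_fun_EFin.
  by apply: fibered_measurable; exact: (fibered_comp Num.norm (fs n)).
- by move=> t; rewrite /N.
- apply: (ae_impl sf) => t h Dt; rewrite /N.
  have c : (fun n => (`|s n t|)%:E) @ \oo --> (`|f t|)%:E.
    by apply: cvg_EFin; [exact: nearW|apply: cvg_norm; exact: h].
  by rewrite (cvg_limn_einf_sup c).2/= normr_id.
Qed.

Lemma ge0_integral_normD D f g : measurable D ->
  strongly_measurable D f -> strongly_measurable D g ->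
  (\int[mu]_(t in D) (`|f t| + `|g t|)%:E =
   \int[mu]_(t in D) (`|f t|)%:E + \int[mu]_(t in D) (`|g t|)%:E)%E.
Proof.
move=> mD /strongly_measurable_norm[N [mN N0 fN]] /strongly_measurable_norm[N' [mN' N'0 gN']].
rewrite (@ge0_ae_eq_integral_lower _ _ _ mu D (fun t => (`|f t|)%:E) (fun t => (N t)%:E))//;
  [|by move=> t _; rewrite lee_fin|by apply: (ae_impl fN) => t h /h ->].
rewrite (@ge0_ae_eq_integral_lower _ _ _ mu D (fun t => (`|g t|)%:E) (fun t => (N' t)%:E))//;
  [|by move=> t _; rewrite lee_fin|by apply: (ae_impl gN') => t h /h ->].
rewrite (@ge0_ae_eq_integral_lower _ _ _ mu D (fun t => (`|f t| + `|g t|)%:E)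
  (fun t => (N t + N' t)%:E))//; last 2 first.
- by move=> t _; rewrite lee_fin addr_ge0.
- by apply: (ae_impl2 fN gN') => t h h' Dt; rewrite h// h'.
under eq_integral do rewrite EFinD.
rewrite ge0_integralD//.
- by move=> t _; rewrite lee_fin.
- by apply: measurable_funTS; mf.
- by move=> t _; rewrite lee_fin.
- by apply: measurable_funTS; mf.
Qed.

Lemma integral_normB_le D f g h : measurable D ->
  strongly_measurable D f -> strongly_measurable D g -> strongly_measurable D h ->
  (\int[mu]_(t in D) (`|f t - h t|)%:E <=
   \int[mu]_(t in D) (`|f t - g t|)%:E + \int[mu]_(t in D) (`|g t - h t|)%:E)%E.
Proof.
move=> mD sf sg sh; rewrite -ge0_integral_normD//; [|exact: strongly_measurableB..].
apply: ge0_ae_le_integral => //.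
by apply: aeW => t _; rewrite lee_fin ler_distD.
Qed.

End strongly_measurable.

Lemma ecvg0_near {R : realType} (u : nat -> \bar R) (e : R) : 0 < e ->
  u @ \oo --> 0%E -> \forall n \near \oo, (u n <= e%:E)%E.
Proof.
move=> e0 /fine_cvgP[fu /cvgrPdist_le/(_ _ e0)]; apply: filterS2 fu => n /fineK <-.
by rewrite sub0r normrN /= lee_fin; apply: le_trans; rewrite ler_norm.
Qed.

Section bochner_integral.
Context {R : realType} {X : normedModType R}.
Local Notation mu := (@lebesgue_measure R).
Variable D : set R.
Hypotheses (mD : measurable D) (Doo : (mu D < +oo)%E).
Implicit Types (f g : R -> X) (v w : X).

(** Epsilon form of the defining sequence: sums and multiples then combine one approximant for each
    tolerance instead of whole sequences. *)
Definition bochner_approx f v := forall e : R, 0 < e -> exists s : R -> X,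
  [/\ simple s, `|v - simple_integral D s| <= e &
      (\int[mu]_(t in D) (`|f t - s t|)%:E <= e%:E)%E].

Lemma is_bochner_integralP f v :
  is_bochner_integral D f v <-> strongly_measurable D f /\ bochner_approx f v.
Proof.
split=> [[sf [s [fs Is Sv]]]|[sf h]].
  split=> // e e0.
  have h1 : \forall n \near \oo, (\int[mu]_(t in D) (`|f t - s n t|)%:E <= e%:E)%E.
    exact: ecvg0_near.
  have h2 : \forall n \near \oo, `|v - simple_integral D (s n)| <= e.
    by move/cvgrPdist_le : Sv; exact.
  have [n [? ?]] := filter_ex (filterI h1 h2).
  by exists (s n).
have /choice[s hs] (n : nat) : exists s : R -> X,
    [/\ simple s, `|v - simple_integral D s| <= n.+1%:R^-1 &
      (\int[mu]_(t in D) (`|f t - s t|)%:E <= (n.+1%:R^-1)%:E)%E].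
  exact: h.
split=> //; exists s; split.
- by move=> n; case: (hs n).
- apply: (@squeeze_cvge _ _ _ _ (cst 0%E) _ (fun n => (n.+1%:R^-1)%:E)).
  + by apply: nearW => n; rewrite integral_ge0//=; case: (hs n).
  + exact: cvg_cst.
  + by apply: cvg_EFin; [exact: nearW|exact: cvg_harmonic].
- apply/cvgrPdist_le => e e0.
  have := @cvg_harmonic R => /cvgrPdist_le /(_ _ e0); apply: filterS => n.
  rewrite sub0r normrN ger0_norm ?invr_ge0// => ne.
  by case: (hs n) => _ /le_trans + _; apply.
Qed.

Lemma bochner_approxD f g v w : strongly_measurable D f -> strongly_measurable D g ->
  bochner_approx f v -> bochner_approx g w ->
  bochner_approx (fun t => f t + g t) (v + w).
Proof.
move=> sf sg hf hg e e0; have e20 : 0 < e / 2 by rewrite divr_gt0.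
have [s [fs vs Is]] := hf _ e20; have [r [fr wr Ir]] := hg _ e20.
exists (fun t => s t + r t); split.
- exact: (fibered_comp2 +%R fs fr).
- rewrite simple_integralD// opprD addrACA (splitr e).
  by rewrite (le_trans (ler_normD _ _))// lerD.
- apply: (@le_trans _ _ (\int[mu]_(t in D) (`|f t - s t| + `|g t - r t|)%:E)%E).
    apply: ge0_ae_le_integral => //.
    by apply: aeW => t _; rewrite lee_fin opprD addrACA ler_normD.
  rewrite (@ge0_integral_normD _ _ D (fun t => f t - s t) (fun t => g t - r t))//.
  + by rewrite (splitr e) EFinD leeD.
  + exact/strongly_measurableB/simple_strongly_measurable.
  + exact/strongly_measurableB/simple_strongly_measurable.
Qed.

Lemma ge0_integral_normZ f (c : R) : 0 <= c -> strongly_measurable D f ->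
  (\int[mu]_(t in D) (c * `|f t|)%:E = c%:E * \int[mu]_(t in D) (`|f t|)%:E)%E.
Proof.
move=> c0 /strongly_measurable_norm[N [mN N0 fN]].
rewrite (@ge0_ae_eq_integral_lower _ _ _ mu D (fun t => (`|f t|)%:E) (fun t => (N t)%:E))//;
  [|by move=> t _; rewrite lee_fin|by apply: (ae_impl fN) => t h /h ->].
rewrite (@ge0_ae_eq_integral_lower _ _ _ mu D (fun t => (c * `|f t|)%:E)
  (fun t => c%:E * (N t)%:E)%E)//; last 3 first.
- by move=> t _; rewrite lee_fin mulr_ge0.
- by move=> t _; rewrite lee_fin mulr_ge0.
- by apply: (ae_impl fN) => t h Dt; rewrite h.
rewrite ge0_integralZl_EFin//; first by move=> t _; rewrite lee_fin.
by apply: measurable_funTS; mf.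
Qed.

Lemma bochner_approxZ f v (c : R) : strongly_measurable D f -> bochner_approx f v ->
  bochner_approx (fun t => c *: f t) (c *: v).
Proof.
move=> sf hf e e0; have c0 : 0 < `|c| + 1 by rewrite ltr_wpDl.
have ce : (`|c| + 1) * (e / (`|c| + 1)) = e by rewrite mulrC divfK// gt_eqF.
have [s [fs vs Is]] := hf _ (divr_gt0 e0 c0).
exists (fun t => c *: s t); split.
- exact: (fibered_comp ( *:%R c) fs).
- rewrite simple_integralZ// -scalerBr normrZ -[leRHS]ce.
  by rewrite ler_pM// lerDl.
- rewrite -ce EFinM.
  apply: (@le_trans _ _ ((`|c| + 1)%:E * \int[mu]_(t in D) (`|f t - s t|)%:E)%E); last first.
    by rewrite lee_pmul2l// lte_fin.
  rewrite -(@ge0_integral_normZ (fun t => f t - s t))//; last first.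
    exact/strongly_measurableB/simple_strongly_measurable.
  apply: ge0_ae_le_integral => //.
  by apply: aeW => t _; rewrite lee_fin -scalerBr normrZ ler_wpM2r// lerDl.
Qed.

Lemma bochner_approx_norm f v : strongly_measurable D f -> bochner_approx f v ->
  ((`|v|)%:E <= \int[mu]_(t in D) (`|f t|)%:E)%E.
Proof.
move=> sf hf; apply/lee_addgt0Pr => e e0; have e20 : 0 < e / 2 by rewrite divr_gt0.
have [s [fs vs Is]] := hf _ e20.
apply: (@le_trans _ _ ((e / 2)%:E + (`|simple_integral D s|)%:E)%E).
  by rewrite -EFinD lee_fin -{1}(subrK (simple_integral D s) v) (le_trans (ler_normD _ _))// lerD2r.
apply: (@le_trans _ _ ((e / 2)%:E + (\int[mu]_(t in D) (`|f t|)%:E + (e / 2)%:E))%E); last first.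
  by rewrite {3}(splitr e) EFinD addeCA.
apply: leeD2l.
apply: le_trans (le_norm_simple_integral mD Doo fs) _.
apply: (@le_trans _ _ (\int[mu]_(t in D) (`|f t| + `|f t - s t|)%:E)%E).
  apply: ge0_ae_le_integral => //.
  apply: aeW => t _; rewrite lee_fin distrC -{1}(subrK (f t) (s t)) addrC.
  exact: ler_normD.
rewrite (@ge0_integral_normD _ _ D f (fun t => f t - s t))//; first by rewrite leeD2l.
exact/strongly_measurableB/simple_strongly_measurable.
Qed.

(** [v - w] is an integral of [f - f = 0], and [bochner_approx_norm] bounds its norm by 0. *)
Lemma is_bochner_integral_unique f v w :
  is_bochner_integral D f v -> is_bochner_integral D f w -> v = w.
Proof.
move=> /is_bochner_integralP[sf hv] /is_bochner_integralP[_ hw].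
have sNf : strongly_measurable D (fun t => -1 *: f t).
  have [s fs sl] := sf; exists (fun n t => -1 *: s n t).
    by move=> n; exact: (fibered_comp ( *:%R (-1)) (fs n)).
  by apply: (ae_impl sl) => t h Dt; apply: cvgZr; exact: h.
have := bochner_approxD sf sNf hv (bochner_approxZ (-1) sf hw).
have s0 : strongly_measurable D (fun t => f t + -1 *: f t).
  apply: (strongly_measurable_ae (simple_strongly_measurable D (fibered_cst (0 : X)))).
  by apply: aeW => t _; rewrite scaleN1r subrr.
move=> /(bochner_approx_norm s0).
rewrite integral0_eq; last by move=> t _; rewrite scaleN1r subrr normr0.
by rewrite lee_fin normr_le0 scaleN1r subr_eq0 => /eqP.
Qed.

Lemma bochnerE f v : is_bochner_integral D f v -> bochner D f = v.
Proof.
move=> h; rewrite /bochner; apply: xget_unique => // w hw.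
exact: is_bochner_integral_unique hw h.
Qed.

End bochner_integral.

Section normal_convergence.
Context {R : realType} {X : normedModType R}.
Local Notation mu := (@lebesgue_measure R).
Implicit Types (D : set R) (l : nat -> R -> R) (x : nat -> X).

Lemma nneseries_cvgn (u : nat -> R) : (forall n, 0 <= u n) ->
  (\sum_(0 <= n <oo) (u n)%:E < +oo)%E -> cvgn (series u).
Proof.
move=> u0; set S := (\sum_(0 <= n <oo) _)%E => Soo.
apply: nondecreasing_is_cvgn.
  by apply/nondecreasing_seqP => n; rewrite /series/= big_nat_recr//= lerDl.
have S0 : (0 <= S)%E by apply: nneseries_ge0 => n _ _; rewrite lee_fin.
exists (fine S) => _ [n _ <-].
rewrite -lee_fin fineK; last by rewrite ge0_fin_numE.
by rewrite -sumEFin; apply: nneseries_lim_ge => k _ _; rewrite lee_fin.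
Qed.

Lemma nneseries_EFin_lty (u : nat -> R) : cvgn (series u) ->
  (\sum_(0 <= n <oo) (u n)%:E < +oo)%E.
Proof.
move=> cu; rewrite (_ : (fun N => \sum_(0 <= n < N) (u n)%:E)%E = EFin \o series u).
  by rewrite EFin_lim// ltry.
by apply/funext => N; rewrite /= sumEFin.
Qed.

(** By monotone convergence the sum of the norms has a finite integral, hence is finite almost
    everywhere. *)
Lemma ae_normal_convergence D l x : measurable D ->
  (forall n, measurable_fun setT (l n)) ->
  (\sum_(0 <= n <oo) (\int[mu]_(t in D) (`|l n t|)%:E * (`|x n|)%:E) < +oo)%E ->
  {ae mu, forall t, D t -> (\sum_(0 <= n <oo) (`|l n t| * `|x n|)%:E < +oo)%E}.
Proof.
move=> mD ml sl.
have m1 n : measurable_fun D (fun t => (`|l n t| * `|x n|)%:E).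
  by apply: measurable_funTS; have := ml n => h; mf.
have I1 : (\int[mu]_(t in D) \sum_(0 <= n <oo) (`|l n t| * `|x n|)%:E < +oo)%E.
  rewrite integral_nneseries//.
  apply: le_lt_trans sl; apply: lee_nneseries => n _.
    by move=> _; apply: integral_ge0 => t _; rewrite lee_fin mulr_ge0.
  under eq_integral do rewrite EFinM.
  rewrite ge0_integralZr//.
  by apply: measurable_funTS; have := ml n => h; mf.
have mS : measurable_fun D (fun t => \sum_(0 <= n <oo) (`|l n t| * `|x n|)%:E)%E.
  apply: ge0_emeasurable_sum => [n t _ _|n _]; first by rewrite lee_fin mulr_ge0.
  exact: m1.
have iS : mu.-integrable D (fun t => \sum_(0 <= n <oo) (`|l n t| * `|x n|)%:E)%E.
  apply/integrableP; split => //.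
  under eq_integral do rewrite gee0_abs ?nneseries_ge0//.
  exact: I1.
have := @integrable_ae _ _ _ mu D mD _ iS.
move=> /ae_impl; apply => t h Dt.
by rewrite -ge0_fin_numE ?h//; apply: nneseries_ge0 => n _ _; rewrite lee_fin mulr_ge0.
Qed.

End normal_convergence.

Section mikusinski.
Context {R : realType} {X : completeNormedModType R}.
Local Notation mu := (@lebesgue_measure R).
Implicit Types (D : set R) (f g : R -> X) (v w : X) (l : nat -> R -> R) (x : nat -> X).

(* Mikusinski's description of Bochner integrable functions, as absolutely convergent series of
   scalar functions with constant vector coefficients; it reduces vector-valued integral
   identities to scalar ones. *)
Definition mikusinski D f l x :=
  [/\ forall n, measurable_fun setT (l n),
      forall n, mu.-integrable D (EFin \o l n),
      (\sum_(0 <= n <oo) (\int[mu]_(t in D) (`|l n t|)%:E * (`|x n|)%:E) < +oo)%E &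
      {ae mu, forall t, D t -> series (fun n => l n t *: x n) @ \oo --> f t}].

Lemma integrable_norm_fin D (h : R -> R) : measurable D -> mu.-integrable D (EFin \o h) ->
  (\int[mu]_(t in D) (`|h t|)%:E)%E = (\int[mu]_(t in D) `|h t|)%:E.
Proof.
move=> mD /integrableP[_ ih]; rewrite /Rintegral fineK// ge0_fin_numE//.
exact: integral_ge0.
Qed.

Lemma le_norm_series_tail (u : nat -> X) v m : series u @ \oo --> v ->
  ((`|v - series u m|)%:E <= \sum_(m <= n <oo) (`|u n|)%:E)%E.
Proof.
move=> uv; apply/lee_addgt0Pr => e e0.
move/cvgrPdist_le : uv => /(_ _ e0) h.
have [N [vN mN]] := filter_ex (filterI h (nbhs_infty_ge m)).
apply: (@le_trans _ _ (\sum_(m <= n < N) (`|u n|)%:E + e%:E)%E); last first.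
  by apply: leeD2r; apply: nneseries_lim_ge => k _ _; rewrite lee_fin.
rewrite sumEFin -EFinD lee_fin -(subrK (series u N) v) -addrA.
rewrite (le_trans (ler_normD _ _))// [leRHS]addrC; apply: lerD => //.
rewrite (_ : series u N - series u m = \sum_(m <= k < N) u k); first exact: ler_norm_sum.
by rewrite sub_series_geq.
Qed.

Lemma mikusinski_summable D f l x : measurable D -> mikusinski D f l x ->
  cvgn (series (fun n => (\int[mu]_(t in D) `|l n t|) * `|x n|)).
Proof.
move=> mD [ml il sl _].
apply: nneseries_cvgn => [n|]; first by rewrite mulr_ge0// Rintegral_ge0.
apply: le_lt_trans sl; apply: lee_nneseries => n _.
  by rewrite lee_fin mulr_ge0// Rintegral_ge0.
by rewrite integrable_norm_fin.
Qed.

Import HBSimple.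

Lemma fibered_sfun (s : {sfun measurableTypeR R >-> R}) : fibered (s : R -> R).
Proof.
split; first exact: (@fimfunP _ _ s).
by move=> y; exact: measurable_sfunP (measurable_set1 y).
Qed.

Lemma fibered_approx D (h : R -> R) (e : R) : measurable D -> mu.-integrable D (EFin \o h) ->
  0 < e -> exists s : R -> R, [/\ fibered s, mu.-integrable D (EFin \o s) &
    (\int[mu]_(t in D) (`|h t - s t|)%:E <= e%:E)%E].
Proof.
move=> mD ih e0; have [g [ig _ g0]] := @approximation_sfun_integrable _ _ _ mu D mD _ ih.
have [n hn] := filter_ex (ecvg0_near e0 g0).
by exists (g n); split => //; exact: fibered_sfun.
Qed.

(** Each [l n] is replaced by a simple function so close to it that the simple sums follow the
    partial sums of the series both in L^1 and almost everywhere. *)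
Lemma mikusinski_bochner D f l x : measurable D -> (mu D < +oo)%E -> mikusinski D f l x ->
  cvgn (series (fun n => (\int[mu]_(t in D) l n t) *: x n)) /\
  is_bochner_integral D f (limn (series (fun n => (\int[mu]_(t in D) l n t) *: x n))).
Proof.
move=> mD Doo Hf; have [ml il sl lf] := Hf.
set c := fun n => _; set v := limn _.
pose a n := (\int[mu]_(t in D) `|l n t|) * `|x n|.
have ca : cvgn (series a) by exact: mikusinski_summable Hf.
have cc : cvgn (series c).
  apply: normed_cvg; apply: series_le_cvg ca => [n|n|n] //=.
    by rewrite /a mulr_ge0// Rintegral_ge0.
  by rewrite /c /a normrZ ler_wpM2r// le_normr_Rintegral.
split=> //.
(* Dividing by [m.+1] shares an error 2^-m among the m terms of the m-th sum; [|x n| + 1] absorbs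
   the coefficient without vanishing. *)
pose d n m : R := 2 ^- m / m.+1%:R / (`|x n| + 1).
have d0 n m : 0 < d n m by rewrite /d !divr_gt0// ltr_wpDl.
have dx n m : `|x n| * d n m <= 2 ^- m / m.+1%:R.
  rewrite /d mulrCA ger_pMr ?divr_gt0// ler_pdivrMr ?ltr_wpDl// mul1r lerDl//.
have /choice[sg hsg] (p : nat * nat) : exists s : R -> R,
    [/\ fibered s, mu.-integrable D (EFin \o s) &
    (\int[mu]_(t in D) (`|l p.1 t - s t|)%:E <= (d p.1 p.2)%:E)%E].
  exact: fibered_approx.
pose S m t := \sum_(n < m) sg (val n, m) t *: x n.
have fS m : simple (S m).
  by apply: fibered_sum => n; apply: (fibered_comp (fun y => y *: x n)); case: (hsg (val n, m)).
pose Z m t := \sum_(n < m) `|l n t - sg (val n, m) t| * `|x n|.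
have msg p : measurable_fun setT (sg p) by apply: fibered_measurable; case: (hsg p).
have mZ m : measurable_fun setT (Z m).
  apply: measurable_sum => n; have := ml n; have := msg (val n, m) => h h'; mf.
have ZS m t : `|series (fun n => l n t *: x n) m - S m t| <= Z m t.
  rewrite /series /= big_mkord -sumrB.
  apply: le_trans (ler_norm_sum _ _ _) _; apply: ler_sum => n _.
  by rewrite -scalerBl normrZ.
have Z0 m t : 0 <= Z m t by apply: sumr_ge0 => n _; rewrite mulr_ge0.
have IZ m : (\int[mu]_(t in D) (Z m t)%:E <= (2 ^- m)%:E)%E.
  rewrite /Z; under eq_integral do rewrite -sumEFin.
  rewrite ge0_integral_sum//; last first.
    by move=> n; apply: measurable_funTS; have := ml n; have := msg (val n, m) => h h'; mf.
  apply: (@le_trans _ _ (\sum_(n < m) (2 ^- m / m.+1%:R)%:E)%E).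
    apply: lee_sum => n _; under eq_integral do rewrite EFinM.
    rewrite ge0_integralZr//; last first.
      by apply: measurable_funTS; have := ml n; have := msg (val n, m) => h h'; mf.
    have [_ _ h] := hsg (val n, m).
    apply: (@le_trans _ _ ((d n m)%:E * (`|x n|)%:E)%E).
      by apply: lee_wpmul2r h; rewrite lee_fin.
    by rewrite -EFinM lee_fin mulrC dx.
  rewrite sumEFin lee_fin sumr_const card_ord -[leLHS]mulr_natr -mulrA ger_pMr//.
  by rewrite mulrC ler_pdivrMr// mul1r ler_nat.
have ae1 := ae_normal_convergence mD ml sl.
(* The integrals of [Z m] are summable in m, so [Z m] tends to 0 almost everywhere, and the simple
   sums [S m] converge to [f]. *)
have ae2 : {ae mu, forall t, D t -> Z ^~ t @ \oo --> 0}.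
  have sZ : (\sum_(0 <= n <oo) (\int[mu]_(t in D) (`|Z n t|)%:E * (`|1 : R|)%:E) < +oo)%E.
    apply: (@le_lt_trans _ _ (\sum_(0 <= n <oo) (2 ^- n)%:E)%E).
      apply: lee_nneseries => n _.
        by rewrite mule_ge0 ?integral_ge0// lee_fin.
      rewrite normr1 mule1; under eq_integral do rewrite ger0_norm//.
      exact: IZ.
    apply: nneseries_EFin_lty; rewrite (_ : (fun n => _) = geometric 1 2^-1); last first.
      by apply/funext => n; rewrite /geometric/= mul1r exprVn.
    by apply: is_cvg_geometric_series; rewrite ger0_norm ?invr_ge0// invf_lt1// ltr1n.
  have := @ae_normal_convergence R R^o D Z (fun _ => 1 : R) mD mZ sZ.
  move=> /ae_impl; apply => t h Dt.
  have {}h : (\sum_(0 <= n <oo) (Z n t)%:E < +oo)%E.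
    by move: (h Dt); under eq_eseriesr do rewrite normr1 mulr1 ger0_norm//.
  by apply: cvg_series_cvg_0; apply: nneseries_cvgn.
have bnd : {ae mu, forall t, D t -> forall m,
    ((`|f t - S m t|)%:E <= \sum_(m <= n <oo) (`|l n t| * `|x n|)%:E + (Z m t)%:E)%E}.
  apply: (ae_impl lf) => t h Dt m.
  have := le_norm_series_tail m (h Dt).
  under eq_eseriesr do rewrite normrZ.
  move=> h1; apply: (le_trans _ (leeD2r _ h1)); rewrite -EFinD lee_fin.
  apply: le_trans (ler_distD (series (fun n => l n t *: x n) m) _ _) _.
  exact: lerD (lexx _) (ZS _ _).
have sf : strongly_measurable D f.
  exists S => //.
  apply: (ae_impl3 lf ae2 bnd) => t h1 h2 _ Dt.
  have c0 : (fun m => series (fun n => l n t *: x n) m - S m t) @ \oo --> 0.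
    apply/cvgr0Pnorm_le => e' e'0; move/cvgr0Pnorm_le : (h2 Dt) => /(_ _ e'0).
    by apply: filterS => m; rewrite (ger0_norm (Z0 _ _)); exact: le_trans.
  rewrite -[f t]subr0 (_ : (fun n => S n t) =
    (fun m => series (fun n => l n t *: x n) m - (series (fun n => l n t *: x n) m - S m t))).
    exact: (cvgB (h1 Dt) c0).
  by apply/funext => m; rewrite opprB addrC subrK.
apply/is_bochner_integralP => //; split=> // e e0.
have e20 : 0 < e / 2 by rewrite divr_gt0.
have tail : (fun N => \sum_(N <= n <oo) (\int[mu]_(t in D) (`|l n t|)%:E * (`|x n|)%:E)%E)%E
    @ \oo --> 0%E.
  by apply: nneseries_tail_cvg => // n _; rewrite mule_ge0// integral_ge0.
have t1 := ecvg0_near e20 tail.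
have t2 : \forall m \near \oo, `|v - series c m| <= e / 2.
  by move/cvgrPdist_le : cc => /(_ _ e20).
have t3 : \forall m \near \oo, 2 ^- m <= e / 2.
  have : (fun m : nat => 2^-1 ^+ m : R) @ \oo --> (0 : R).
    by apply: cvg_expr; rewrite ger0_norm ?invr_ge0// invf_lt1// ltr1n.
  move=> /cvgrPdist_le/(_ _ e20); apply: filterS => m.
  by rewrite sub0r normrN ger0_norm ?exprn_ge0 ?invr_ge0// exprVn.
have [m [[h1 h2] h3]] := filter_ex (filterI (filterI t1 t2) t3).
exists (S m); split => //.
- rewrite /S simple_integral_sum//; last first.
    by move=> n; apply: (fibered_comp (fun y => y *: x n)); case: (hsg (val n, m)).
  rewrite -(subrK (series c m) v) -addrA (splitr e) (le_trans (ler_normD _ _))// lerD//.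
  apply: le_trans h3; rewrite -lee_fin; apply: le_trans (IZ m).
  have : (`|series c m - \sum_(n < m) simple_integral D (fun t => sg (val n, m) t *: x n)|%:E <=
     \sum_(n < m) (\int[mu]_(t in D) (`|l n t - sg (val n, m) t| * `|x n|)%:E))%E.
    rewrite /series/= big_mkord -sumrB.
    apply: (@le_trans _ _ (\sum_(n < m) (`|c n - simple_integral D (fun t => sg (val n, m) t *: x n)|)%:E)%E).
      by rewrite sumEFin lee_fin ler_norm_sum.
    apply: lee_sum => n _; have [fs sI hs] := hsg (val n, m).
    rewrite simple_integral_scalar// /c -scalerBl normrZ -RintegralB//.
    have id : mu.-integrable D (EFin \o (fun t => l n t - sg (val n, m) t)).
      exact: (@integrableB _ _ _ mu D mD _ _ (il n) sI).
    under eq_integral do rewrite EFinM.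
    rewrite ge0_integralZr//; last first.
      by apply: measurable_funTS; have := ml n; have := msg (val n, m) => h h'; mf.
    rewrite EFinM; apply: lee_wpmul2r; first by rewrite lee_fin.
    rewrite integrable_norm_fin// lee_fin; exact: le_normr_Rintegral.
  move=> /le_trans; apply; rewrite -ge0_integral_sum//; last first.
    by move=> n; apply: measurable_funTS; have := ml n; have := msg (val n, m) => h h'; mf.
  by under eq_integral do rewrite sumEFin.
- pose T t := (\sum_(0 <= n <oo) (`|l (n + m)%N t| * `|x (n + m)%N|)%:E)%E.
  have T0 t : (0 <= T t)%E by apply: nneseries_ge0 => n _ _; rewrite lee_fin mulr_ge0.
  have mF n : measurable_fun D (fun t => (`|l (n + m)%N t| * `|x (n + m)%N|)%:E).
    by apply: measurable_funTS; have := ml (n + m)%N => h; mf.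
  apply: (@le_trans _ _ (\int[mu]_(t in D) (T t + (Z m t)%:E))%E).
    apply: ge0_ae_le_integral => //.
      by move=> t _; rewrite adde_ge0 ?lee_fin.
    apply: (ae_impl bnd) => t h Dt; rewrite /T (@nneseries_addn _ (fun n => (`|l n t| * `|x n|)%:E)); first exact: h.
    by move=> n; rewrite lee_fin mulr_ge0.
  have mT : measurable_fun D T.
    apply: ge0_emeasurable_sum => [n t _ _|n _]; first by rewrite lee_fin mulr_ge0.
    exact: mF.
  rewrite ge0_integralD//; last 2 first.
  + by move=> t _; rewrite lee_fin.
  + by apply: measurable_funTS; have := mZ m => h; mf.
  rewrite (splitr e) EFinD; apply: leeD; last by apply: le_trans (IZ m) _; rewrite lee_fin.
  apply: le_trans h1; rewrite /T integral_nneseries//.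
  rewrite -[leRHS](@nneseries_addn _ (fun n => (\int[mu]_(t in D) (`|l n t|)%:E * (`|x n|)%:E)%E)); last first.
    by move=> n; rewrite mule_ge0// integral_ge0.
  apply: lee_nneseries => n _.
    by move=> _; apply: integral_ge0 => t _; rewrite lee_fin mulr_ge0.
  under eq_integral do rewrite EFinM.
  rewrite ge0_integralZr//.
  by apply: measurable_funTS; have := ml (n + m)%N => h; mf.
Qed.

End mikusinski.

Section mikusinski_representation.
Context {R : realType} {X : completeNormedModType R}.
Local Notation mu := (@lebesgue_measure R).
Variable D : set R.
Hypotheses (mD : measurable D) (Doo : (mu D < +oo)%E).
Implicit Types (f g : R -> X).

(** The simple functions are cut to 0 where they exceed twice the norm of [f]. The limit is
    unchanged, and three times the norm becomes a dominating function. *)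
Lemma simple_L1_approx f (e : R) : strongly_measurable D f ->
  (\int[mu]_(t in D) (`|f t|)%:E < +oo)%E -> 0 < e ->
  exists s, simple s /\ (\int[mu]_(t in D) (`|f t - s t|)%:E <= e%:E)%E.
Proof.
move=> sf If e0; have [s fs sl] := sf; have [N [mN N0 fN]] := strongly_measurable_norm sf.
pose r n t := if `|s n t| <= 2 * N t then s n t else 0.
have fr n : simple (r n).
  have fb : fibered (fun t => `|s n t| <= 2 * N t).
    split; first exact: finite_finset.
    have ms : measurable_fun setT (fun t => `|s n t|).
      by apply: fibered_measurable; exact: (fibered_comp Num.norm (fs n)).
    have mb : measurable_fun setT (fun t => `|s n t| <= 2 * N t).
      by apply: measurable_fun_ler => //; mf.
    by move=> b; rewrite -[X in measurable X]setTI; exact: mb.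
  exact: (fibered_comp2 (fun (b : bool) x => if b then x else 0) fb (fs n)).
have rN n t : `|r n t| <= 2 * N t.
  by rewrite /r; case: ifP => // _; rewrite normr0 mulr_ge0.
have rf : {ae mu, forall t, D t -> r ^~ t @ \oo --> f t}.
  apply: (ae_impl2 sl fN) => t st ft Dt; have {}st := st Dt; have {}ft := ft Dt.
  have [Nt0|Nt0] := eqVneq (N t) 0.
    have -> : f t = 0 by apply/eqP; rewrite -normr_le0 ft Nt0.
    rewrite (_ : r ^~ t = cst 0); first exact: cvg_cst.
    by apply/funext => n; apply/eqP; rewrite -normr_le0 (le_trans (rN n t))// Nt0 mulr0.
  have {}Nt0 : 0 < N t by rewrite lt_neqAle eq_sym Nt0 N0.
  have sN : (fun n => `|s n t|) @ \oo --> `|f t| by exact: cvg_norm.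
  apply: cvg_trans st; apply: near_eq_cvg.
  have Nt2 : N t < 2 * N t by rewrite ltr_pMl// ltr1n.
  by move: sN; rewrite ft => /cvgr_le/(_ _ Nt2); apply: filterS => n; rewrite /r => ->.
have /choice[G hG] n : exists G : R -> R, [/\ measurable_fun setT G, forall t, 0 <= G t &
    {ae mu, forall t, D t -> `|f t - r n t| = G t}].
  by apply: strongly_measurable_norm; apply: strongly_measurableB => //;
    exact: simple_strongly_measurable.
have aG : {ae mu, forall t n, D t -> `|f t - r n t| = G n t}.
  by apply: ae_foralln => n; case: (hG n).
have mG n : measurable_fun setT (G n) by case: (hG n).
have IN : (\int[mu]_(t in D) (N t)%:E < +oo)%E.
  rewrite -(@ge0_ae_eq_integral_lower _ _ _ mu D (fun t => (`|f t|)%:E))//.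
    by move=> t _; rewrite lee_fin.
  by apply: (ae_impl fN) => t h /h ->.
have iN : mu.-integrable D (fun t => (3 * N t)%:E).
  apply/integrableP; split; first by apply: measurable_funTS; mf.
  under eq_integral do rewrite gee0_abs ?lee_fin ?mulr_ge0// EFinM.
  rewrite ge0_integralZl//; first by rewrite lte_mul_pinfty// lee_fin.
  - by apply: measurable_funTS; mf.
  - by move=> t _; rewrite lee_fin.
have m1 n : measurable_fun D (fun t => (G n t)%:E).
  by apply: measurable_funTS; have := mG n => h; mf.
have c1 : {ae mu, forall t, D t -> (fun n => (G n t)%:E) @ \oo --> 0%E}.
  apply: (ae_impl2 rf aG) => t h1 h2 Dt.
  apply: cvg_EFin; first exact: nearW.
  rewrite (_ : fine \o _ = (fun n => `|f t - r n t|)); last first.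
    by apply/funext => n /=; rewrite h2.
  rewrite -(normr0 X) -(subrr (f t)); apply: cvg_norm; apply: cvgB; first exact: cvg_cst.
  exact: h1.
have d1 : {ae mu, forall t n, D t -> (`|(G n t)%:E| <= (3 * N t)%:E)%E}.
  apply: (ae_impl2 fN aG) => t h1 h2 n Dt.
  rewrite -h2// lee_fin normr_id (le_trans (ler_normB _ _))// h1//.
  by have := rN n t; lra.
have [_ h _] := @dominated_convergence _ _ _ mu D mD _ _ _ m1 (measurable_cst _) c1 iN d1.
have [n hn] := filter_ex (ecvg0_near e0 h).
exists (r n); split => //; apply: le_trans hn.
apply: ge0_ae_le_integral => //.
by apply: (ae_impl aG) => t h1 Dt; rewrite h1// sube0 abse_EFin lee_fin ler_norm.
Qed.

(** As no block is empty, position n lies within the first n.+1 blocks, and later blocks do not move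
    it. This allows a series of finite sums to be listed as one series. *)
Lemma nth_flatten_mkseq (A : Type) (d : A) (B : nat -> seq A) k n :
  (forall i, 0 < size (B i))%N -> (n < size (flatten (mkseq B k)))%N ->
  nth d (flatten (mkseq B n.+1)) n = nth d (flatten (mkseq B k)) n.
Proof.
move=> B0.
have ext i j : (i <= j)%N -> exists u, flatten (mkseq B j) = flatten (mkseq B i) ++ u.
  move=> ij; exists (flatten (map B (iota i (j - i)))).
  by rewrite -flatten_cat /mkseq -{1}(subnKC ij) iotaD map_cat.
have sz i : (i <= size (flatten (mkseq B i)))%N.
  elim: i => // i ih; rewrite mkseqS -cats1 flatten_cat size_cat /= cats0.
  by rewrite -addn1 leq_add// B0.
move=> nk; have [nk'|kn] := leqP n.+1 k.
  by have [u ->] := ext _ _ nk'; rewrite nth_cat sz.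
by have [u ->] := ext _ _ (ltnW kn); rewrite nth_cat nk.
Qed.

Lemma sum_flatten_mkseq (A : Type) (d : A) (B : nat -> seq A) (V : nmodType) (F : A -> V) k :
  (forall i, 0 < size (B i))%N ->
  \sum_(0 <= n < size (flatten (mkseq B k))) F (nth d (flatten (mkseq B n.+1)) n) =
  \sum_(0 <= i < k) \sum_(b <- B i) F b.
Proof.
move=> B0; rewrite (eq_big_nat _ _ (F2 := fun n => F (nth d (flatten (mkseq B k)) n))); last first.
  by move=> n /andP[_ nk]; rewrite (@nth_flatten_mkseq A d B k n).
by rewrite -(big_nth d xpredT F) big_flatten/= big_map /index_iota subn0.
Qed.

(** Simple functions within 2^-k of [f] in L^1 give a telescoping series. Each difference splits
    into indicators of its fibres times its values, and all these pairs are listed in one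
    sequence. *)
Lemma mikusinski_exists f : strongly_measurable D f ->
  (\int[mu]_(t in D) (`|f t|)%:E < +oo)%E -> exists l x, mikusinski D f l x.
Proof.
move=> sf If.
have /choice[r hr] (k : nat) : exists s, simple s /\
    (\int[mu]_(t in D) (`|f t - s t|)%:E <= (2 ^- k)%:E)%E.
  by apply: simple_L1_approx => //; rewrite invr_gt0 exprn_gt0.
have fr k : simple (r k) by case: (hr k).
pose d k t := if k is k'.+1 then r k'.+1 t - r k' t else r 0%N t.
have fd k : simple (d k).
  by case: k => [|k]; [exact: fr|exact: (fibered_comp2 (fun x y => x - y) (fr k.+1) (fr k))].
have sd t k : \sum_(0 <= i < k.+1) d i t = r k t.
  elim: k => [|k ih]; first by rewrite big_nat1.
  by rewrite big_nat_recr//= ih addrC subrK.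
have Ir0 : (\int[mu]_(t in D) (`|r 0%N t|)%:E < +oo)%E.
  by rewrite integral_norm_simple// ltry.
(* The 3 comes from 2^-(k+1) + 2^-k = 3 * 2^-(k+1); the integral accounts for the first block. *)
pose A := fine (\int[mu]_(t in D) (`|r 0%N t|)%:E) + 3.
have Id k : (\int[mu]_(t in D) (`|d k t|)%:E <= (A * 2^-1 ^+ k)%:E)%E.
  case: k => [|k].
    rewrite expr0 mulr1 /A EFinD fineK; first by rewrite leeDl// lee_fin.
    by rewrite ge0_fin_numE// integral_ge0.
  apply: (@le_trans _ _ (\int[mu]_(t in D) (`|r k.+1 t - f t|)%:E +
      \int[mu]_(t in D) (`|f t - r k t|)%:E)%E).
    by apply: integral_normB_le => //; exact: simple_strongly_measurable.
  under eq_integral do rewrite distrC.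
  apply: (le_trans (leeD (hr k.+1).2 (hr k).2)); rewrite -EFinD lee_fin.
  have q0 : 0 <= 2^-1 ^+ k.+1 :> R by rewrite exprn_ge0.
  have -> : 2 ^- k.+1 + 2 ^- k = 3 * 2^-1 ^+ k.+1 :> R by rewrite -!exprVn exprS; lra.
  by rewrite ler_wpM2r// /A lerDr fine_ge0// integral_ge0.
pose B k := [seq (k, y) | y <- finmap.enum_fset (fset_set (range (d k)))].
have B0 k : (0 < size (B k))%N.
  rewrite size_map lt0n size_eq0; apply/eqP => e0.
  have : d k 0 \in finmap.enum_fset (fset_set (range (d k))).
    by rewrite in_fset_set; [apply/mem_set; exists 0|case: (fd k)].
  by rewrite e0.
pose F n := nth (0%N, 0) (flatten (mkseq B n.+1)) n.
pose lam (b : nat * X) : R -> R := \1_(d b.1 @^-1` [set b.2]).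
pose l n := lam (F n); pose x n := (F n).2.
have mlam b : measurable_fun setT (lam b) by apply: measurable_indic; case: (fd b.1).
have sumB k t : \sum_(b <- B k) lam b t *: b.2 = d k t.
  rewrite big_map (bigD1_seq (d k t))/=; last 2 first.
  - by rewrite in_fset_set; [apply/mem_set; exists t|case: (fd k)].
  - exact: finmap.fset_uniq.
  rewrite /lam/= indicE mem_set// scale1r big1 ?addr0// => y yd.
  by rewrite indicE memNset ?scale0r//= => dy; rewrite -dy eqxx in yd.
have lam01 b t : 0 <= lam b t <= 1 by rewrite /lam indicE; case: (_ \in _); rewrite ?lexx ?ler01.
have ilam b : mu.-integrable D (EFin \o lam b).
  apply/integrableP; split; first by apply/measurable_EFinP/measurable_funTS; exact: mlam.
  apply: le_lt_trans Doo; rewrite -[leRHS]mul1e -integral_cst//.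
  apply: ge0_ae_le_integral => //; apply: aeW => t _ /=.
  by rewrite lee_fin ger0_norm; case/andP: (lam01 b t).
have IB k : \sum_(b <- B k) (\int[mu]_(t in D) (`|lam b t|)%:E * (`|b.2|)%:E)%E =
    (\int[mu]_(t in D) (`|d k t|)%:E)%E.
  rewrite integral_norm_simple// -sumEFin big_map; apply: eq_bigr => y _ /=.
  have my : measurable (d k @^-1` [set y]) by case: (fd k).
  under eq_integral do rewrite /lam/= ger0_norm//.
  rewrite integral_indic// setIC EFinM; congr (_ * _)%E; rewrite fineK//.
  exact: measure_subset_fin.
have szB k : (k <= size (flatten (mkseq B k)))%N.
  elim: k => // k ih; rewrite mkseqS -cats1 flatten_cat size_cat /= cats0.
  by rewrite -addn1 leq_add// B0.
have cA : cvgn (series (fun k => A * 2^-1 ^+ k)).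
  rewrite (_ : (fun k => _) = geometric A 2^-1)//.
  by apply: is_cvg_geometric_series; rewrite ger0_norm ?invr_ge0// invf_lt1// ltr1n.
have sl : (\sum_(0 <= n <oo) (\int[mu]_(t in D) (`|l n t|)%:E * (`|x n|)%:E) < +oo)%E.
  have a0 n : (0 <= \int[mu]_(t in D) (`|l n t|)%:E * (`|x n|)%:E)%E.
    by rewrite mule_ge0 ?integral_ge0.
  apply: le_lt_trans (nneseries_EFin_lty cA); apply: lime_le.
    exact: is_cvg_nneseries.
  apply: nearW => N.
  apply: (@le_trans _ _ (\sum_(0 <= n < size (flatten (mkseq B N)))
      (\int[mu]_(t in D) (`|l n t|)%:E * (`|x n|)%:E))%E).
    by rewrite (big_cat_nat _ (szB N))//= leeDl// sume_ge0.
  rewrite (@sum_flatten_mkseq _ (0%N, 0) B _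
    (fun b => \int[mu]_(t in D) (`|lam b t|)%:E * (`|b.2|)%:E)%E)//.
  apply: (@le_trans _ _ (\sum_(0 <= i < N) (A * 2^-1 ^+ i)%:E)%E).
    by apply: lee_sum => i _; rewrite IB.
  by apply: nneseries_lim_ge => i _ _; rewrite lee_fin mulr_ge0 ?exprn_ge0// /A addr_ge0// fine_ge0// integral_ge0.
exists l, x; split.
- by move=> n; exact: mlam.
- by move=> n; exact: ilam.
- exact: sl.
(* Almost everywhere the whole series converges absolutely, so its limit can be read off at the ends
   of blocks, where the partial sums are the functions [r k]. *)
have ae1 := ae_normal_convergence mD (fun n => mlam (F n)) sl.
have /choice[G hG] k : exists G : R -> R, [/\ measurable_fun setT G, forall t, 0 <= G t &
    {ae mu, forall t, D t -> `|f t - r k t| = G t}].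
  by apply: strongly_measurable_norm; apply: strongly_measurableB => //;
    exact: simple_strongly_measurable.
have aG : {ae mu, forall t n, D t -> `|f t - r n t| = G n t}.
  by apply: ae_foralln => n; case: (hG n).
have mG k : measurable_fun setT (G k) by case: (hG k).
have G0 k t : 0 <= G k t by case: (hG k).
have ae2 : {ae mu, forall t, D t -> (\sum_(0 <= n <oo) (`|G n t| * `|1 : R^o|)%:E < +oo)%E}.
  apply: (@ae_normal_convergence R R^o D G (fun _ => 1) mD mG).
  have c2 : cvgn (series (fun k => 1 * 2^-1 ^+ k : R)).
    rewrite (_ : (fun k => _) = geometric 1 2^-1)//.
    by apply: is_cvg_geometric_series; rewrite ger0_norm ?invr_ge0// invf_lt1// ltr1n.
  apply: le_lt_trans (nneseries_EFin_lty c2); apply: lee_nneseries => k _.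
    by rewrite mule_ge0 ?integral_ge0// lee_fin.
  rewrite normr1 mule1 mul1r exprVn; apply: le_trans (hr k).2.
  by apply: ge0_ae_le_integral => //; apply: (ae_impl aG) => t h Dt; rewrite h// ger0_norm.
apply: (ae_impl3 ae1 ae2 aG) => t h1 h2 h3 Dt.
have cS : cvgn (series (fun n => l n t *: x n)).
  apply: normed_cvg; apply: (@series_le_cvg _ _ (fun n => `|l n t| * `|x n|)) => [n|n|n|] //=.
  - by rewrite normrZ.
  - by apply: nneseries_cvgn (h1 Dt) => n; rewrite mulr_ge0.
have cG : (fun n => G n t) @ \oo --> 0.
  apply: cvg_series_cvg_0; apply: nneseries_cvgn => //.
  by move: (h2 Dt); under eq_eseriesr do rewrite normr1 mulr1 ger0_norm//.
have cr : (fun n => r n t) @ \oo --> f t.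
  apply/cvgrPdist_le => e e0; move/cvgrPdist_le : cG => /(_ _ e0); apply: filterS => n.
  by rewrite sub0r normrN ger0_norm// h3.
have cP : (fun k => series (fun n => l n t *: x n) (size (flatten (mkseq B k.+1)))) @ \oo -->
    limn (series (fun n => l n t *: x n)).
  apply: (@cvg_comp _ _ _ (fun k => size (flatten (mkseq B k.+1))) (series (fun n => l n t *: x n))
    \oo \oo) => //.
  apply/cvgnyPge => N; exists N => // k /= Nk.
  by rewrite (leq_trans _ (szB k.+1))// (leq_trans Nk).
suff <- : limn (series (fun n => l n t *: x n)) = f t by [].
apply: (@cvg_unique _ (@norm_hausdorff _ X) _ _ _ _ cP).
rewrite (_ : (fun k => _) = (fun n => r n t))//; apply/funext => k.
apply: etrans (@sum_flatten_mkseq _ (0%N, 0) B _ (fun b => lam b t *: b.2) k.+1 B0) _.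
by under eq_bigr do rewrite sumB; exact: sd.
Qed.

Lemma ae_sub_domain (P : R -> Prop) (E : set R) : E `<=` D ->
  {ae mu, forall t, D t -> P t} -> {ae mu, forall t, E t -> P t}.
Proof. by move=> ED /ae_impl; apply => t h /ED. Qed.

Definition bochner_integrable f :=
  strongly_measurable D f /\ (\int[mu]_(t in D) (`|f t|)%:E < +oo)%E.

Lemma bochnerP f : bochner_integrable f -> is_bochner_integral D f (bochner D f).
Proof.
move=> [sf If]; have [l [x lx]] := mikusinski_exists sf If.
have [_ h] := mikusinski_bochner mD Doo lx.
by rewrite (bochnerE mD Doo h).
Qed.

Lemma bochner_integrable_ae f g : {ae mu, forall t, D t -> f t = g t} ->
  bochner_integrable f -> bochner_integrable g.
Proof.
move=> fg [sf If]; split; first exact: strongly_measurable_ae fg.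
apply: le_lt_trans If; apply: ge0_ae_le_integral => //.
by apply: (ae_impl fg) => t h Dt; rewrite h.
Qed.

Lemma bochner_ae f g : {ae mu, forall t, D t -> f t = g t} ->
  bochner D f = bochner D g.
Proof.
move=> fg; suff e : [set v | is_bochner_integral D f v] = [set v | is_bochner_integral D g v].
  by rewrite /bochner e.
apply/seteqP.
have sub f1 g1 v : {ae mu, forall t, D t -> f1 t = g1 t} ->
    is_bochner_integral D f1 v -> is_bochner_integral D g1 v.
  move=> fg1 /is_bochner_integralP[sf hf].
  apply/is_bochner_integralP; split; first exact: strongly_measurable_ae fg1.
  move=> e /hf[s [fs vs Is]]; exists s; split => //; apply: le_trans Is.
  by apply: ge0_ae_le_integral => //; apply: (ae_impl fg1) => t h Dt; rewrite h.
split=> v; first exact: sub.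
by apply: sub; apply: (ae_impl fg) => t h /h.
Qed.

Lemma le_norm_bochner f : bochner_integrable f ->
  ((`|bochner D f|)%:E <= \int[mu]_(t in D) (`|f t|)%:E)%E.
Proof.
move=> If; have /is_bochner_integralP[sf h] := bochnerP If.
exact: bochner_approx_norm sf h.
Qed.

Lemma strongly_measurableZ f (c : R) : strongly_measurable D f ->
  strongly_measurable D (fun t => c *: f t).
Proof.
move=> [s fs sl]; exists (fun n t => c *: s n t).
  by move=> n; exact: (fibered_comp ( *:%R c) (fs n)).
by apply: (ae_impl sl) => t h Dt; apply: cvgZr; exact: h.
Qed.

Lemma strongly_measurableD f g : strongly_measurable D f -> strongly_measurable D g ->
  strongly_measurable D (fun t => f t + g t).
Proof.
move=> sf /(strongly_measurableZ (-1)) sg.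
apply: (strongly_measurable_ae (strongly_measurableB sf sg)).
by apply: aeW => t _; rewrite scaleN1r opprK.
Qed.

Lemma bochner_integrableD f g : bochner_integrable f -> bochner_integrable g ->
  bochner_integrable (fun t => f t + g t).
Proof.
move=> [sf If] [sg Ig]; split; first exact: strongly_measurableD.
apply: le_lt_trans (lte_add_pinfty If Ig); rewrite -ge0_integral_normD//.
by apply: ge0_ae_le_integral => //; apply: aeW => t _; rewrite lee_fin ler_normD.
Qed.

Lemma bochner_integrableZ f (c : R) : bochner_integrable f ->
  bochner_integrable (fun t => c *: f t).
Proof.
move=> [sf If]; split; first exact: strongly_measurableZ.
under eq_integral do rewrite normrZ.
by rewrite ge0_integral_normZ// lte_mul_pinfty// lee_fin.
Qed.

Lemma bochnerD f g : bochner_integrable f -> bochner_integrable g ->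
  bochner D (fun t => f t + g t) = bochner D f + bochner D g.
Proof.
move=> If Ig; apply: bochnerE => //.
have /is_bochner_integralP[sf hf] := bochnerP If.
have /is_bochner_integralP[sg hg] := bochnerP Ig.
apply/is_bochner_integralP; split; first exact: strongly_measurableD.
exact: bochner_approxD.
Qed.

Lemma bochnerZ f (c : R) : bochner_integrable f ->
  bochner D (fun t => c *: f t) = c *: bochner D f.
Proof.
move=> If; apply: bochnerE => //.
have /is_bochner_integralP[sf hf] := bochnerP If.
apply/is_bochner_integralP; split; first exact: strongly_measurableZ.
exact: bochner_approxZ.
Qed.

Lemma bochner_mikusinski f l x : mikusinski D f l x ->
  series (fun n => (\int[mu]_(t in D) l n t) *: x n) @ \oo --> bochner D f.
Proof.
move=> /(mikusinski_bochner mD Doo)[c h]; rewrite (bochnerE mD Doo h); exact: c.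
Qed.

Lemma mikusinski_norm_le f l x : mikusinski D f l x ->
  (\int[mu]_(t in D) (`|f t|)%:E <=
   \sum_(0 <= n <oo) (\int[mu]_(t in D) (`|l n t|)%:E * (`|x n|)%:E))%E.
Proof.
move=> [ml il sl lf].
apply: (@le_trans _ _ (\int[mu]_(t in D) \sum_(0 <= n <oo) (`|l n t| * `|x n|)%:E)%E).
  apply: ge0_ae_le_integral => //.
    by move=> t _; apply: nneseries_ge0 => n _ _; rewrite lee_fin mulr_ge0.
  apply: (ae_impl lf) => t h Dt.
  have := le_norm_series_tail 0 (h Dt); rewrite /series/= big_geq// subr0.
  by move=> /le_trans; apply; apply: lee_nneseries => n _ //; rewrite normrZ.
rewrite integral_nneseries//; last first.
  by move=> n; apply: measurable_funTS; have := ml n => h; mf.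
apply: lee_nneseries => n _.
  by move=> _; apply: integral_ge0 => t _; rewrite lee_fin mulr_ge0.
under eq_integral do rewrite EFinM.
by rewrite ge0_integralZr//; apply: measurable_funTS; have := ml n => h; mf.
Qed.

Lemma mikusinski_integrable f l x : mikusinski D f l x -> bochner_integrable f.
Proof.
move=> lx; have [_ [sf _]] := mikusinski_bochner mD Doo lx.
by split => //; apply: le_lt_trans (mikusinski_norm_le lx) _; case: lx.
Qed.

End mikusinski_representation.

Section integration_extra.
Context {R : realType}.
Local Notation mu := (@lebesgue_measure R).

Lemma ge0_integral_lty_ae (D : set R) (g : R -> \bar R) : measurable D ->
  measurable_fun setT g -> (forall t, 0 <= g t)%E -> (\int[mu]_(t in D) g t < +oo)%E ->
  {ae mu, forall t, D t -> (g t < +oo)%E}.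
Proof.
move=> mD mg g0 Ig.
have ig : mu.-integrable D g.
  apply/integrableP; split; first exact: measurable_funTS.
  by under eq_integral do rewrite gee0_abs//.
have := @integrable_ae _ _ _ mu D mD _ ig.
by move=> /ae_impl; apply => t h Dt; rewrite -ge0_fin_numE ?h.
Qed.

Lemma jmeasurable_comp d (S : measurableType d) (k : R -> R -> R) (u v : S -> R) : jmeasurable k ->
  measurable_fun setT u -> measurable_fun setT v -> measurable_fun setT (fun x => k (u x) (v x)).
Proof.
move=> mk mu' mv.
exact: (measurableT_comp mk (measurable_fun_pair mu' mv)).
Qed.

(** The positive or the negative part has an infinite integral, so the extended integral is infinite
    and [fine] sends it to 0. This lets [Rintegral_scalel] move scalars out without an integrability
    check. *)
Lemma Rintegral_nonintegrable (D : set R) (f : R -> R) : measurable D ->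
  measurable_fun D f -> ~ mu.-integrable D (EFin \o f) -> \int[mu]_(t in D) f t = 0.
Proof.
move=> mD mf ni; rewrite /Rintegral.
have mEf : measurable_fun D (EFin \o f) by exact/measurable_EFinP.
have : (\int[mu]_(t in D) `|(EFin \o f) t| = +oo)%E.
  apply/eqP; rewrite -leye_eq leNgt; apply/negP => lt; apply: ni.
  by apply/integrableP.
rewrite (_ : (fun t => `|(EFin \o f) t|)%E =
  (fun t => ((EFin \o f)^\+ t + (EFin \o f)^\- t)%E)); last first.
  by rewrite -fune_abse.
rewrite ge0_integralD//; last 2 first.
- exact: measurable_funepos.
- exact: measurable_funeneg.
rewrite [X in fine X]integralE.
have : (0 <= \int[mu]_(t in D) (EFin \o f)^\+ t)%E by apply: integral_ge0 => t _; exact: funepos_ge0.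
have : (0 <= \int[mu]_(t in D) (EFin \o f)^\- t)%E by apply: integral_ge0 => t _; exact: funeneg_ge0.
set p := (\int[_]_(_ in _) _^\+ _)%E; set q := (\int[_]_(_ in _) _^\- _)%E.
by case: p => [p| |]; case: q => [q| |].
Qed.

Lemma Rintegral_scalel (D : set R) (f : R -> R) (c : R) : measurable D ->
  measurable_fun D f -> \int[mu]_(t in D) (c * f t) = c * \int[mu]_(t in D) f t.
Proof.
move=> mD mf; have [->|c0] := eqVneq c 0.
  by rewrite mul0r; under eq_Rintegral do rewrite mul0r; rewrite Rintegral_cst// mul0r.
have [i|ni] := pselect (mu.-integrable D (EFin \o f)); first by rewrite RintegralZl.
rewrite (Rintegral_nonintegrable mD mf ni) mulr0 Rintegral_nonintegrable//.
  exact: measurable_funM.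
move=> i; apply: ni; 
rewrite (_ : EFin \o f = (fun t => (c^-1)%:E * (EFin \o (fun t => c * f t)%R) t)%E).
  exact: (@integrableZl _ _ _ mu D mD c^-1 _ i).
by apply/funext => t /=; rewrite -EFinM mulrA mulVf// mul1r.
Qed.

End integration_extra.

(** * Volterra kernels and operators *)

Section kernels.
Context {R : realType}.
Local Notation mu := (@lebesgue_measure R).
Implicit Types (T b C : R) (k l : R -> R -> R) (u v : R -> R).

(** The order [b = 1] is the case of a kernel bounded by [C], since the power is then 1. *)
Definition weakly_singular T b C k := [/\ 0 <= C, jmeasurable k &
  forall s t, 0 <= s -> s < t -> t <= T -> `|k t s| <= C * (t - s) `^ (b - 1)].

Definition kcomp l k (t s : R) := \int[mu]_(r in `]s, t[) (l t r * k r s).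

Definition svolterra k u (t : R) := \int[mu]_(s in `]0, t[) (k t s * u s).

Lemma jmeasurable_kcomp l k : jmeasurable l -> jmeasurable k -> jmeasurable (kcomp l k).
Proof.
move=> ml mk; rewrite /jmeasurable /kcomp.
apply: (@measurable_Rintegral_between _ _ _ (fun q : R * R => q.2) (fun q => q.1) _ _
  (fun p : (R * R) * R => l p.1.1 p.2 * k p.2 p.1.2)); [exact: measurable_snd|exact: measurable_fst|].
apply: measurable_funM; apply: jmeasurable_comp => //.
- by apply: measurableT_comp.
- by apply: measurableT_comp.
Qed.

Lemma measurable_svolterra k u : jmeasurable k -> measurable_fun setT u -> measurable_fun setT (svolterra k u).
Proof.
move=> mk m; rewrite /svolterra.
apply: (@measurable_Rintegral_between _ _ _ (cst 0) id _ _ (fun p : R * R => k p.1 p.2 * u p.2)) => //.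
by apply: measurable_funM => //; exact: measurableT_comp.
Qed.

(** A majorant of [svolterra] in the extended reals, to which Tonelli's theorem applies before
    convergence is known. *)
Definition evolterra k u (t : R) : \bar R := (\int[mu]_(s in `]0%R, t[) (`|k t s * u s|)%:E)%E.

Lemma measurable_evolterra k u : jmeasurable k -> measurable_fun setT u -> measurable_fun setT (evolterra k u).
Proof.
move=> mk m; rewrite /evolterra.
apply: (@measurable_integral_between _ _ _ (cst 0) id _ _ (fun p : R * R => (`|k p.1 p.2 * u p.2|)%:E)) => //.
apply: measurable_fun_EFin; apply: measurable_fun_normr.
by apply: measurable_funM => //; exact: measurableT_comp.
Qed.

Lemma evolterra_ge0 k u t : (0 <= evolterra k u t)%E.
Proof. exact: integral_ge0. Qed.

Lemma svolterra_le_evolterra k u t : jmeasurable k -> measurable_fun setT u -> (evolterra k u t < +oo)%E ->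
  ((`|svolterra k u t|)%:E <= evolterra k u t)%E.
Proof.
move=> mk mu' h.
have m : measurable_fun `]0, t[ (fun s => k t s * u s).
  by apply: measurable_funTS; apply: measurable_funM => //; exact: jmeasurable_comp.
have i : mu.-integrable `]0, t[ (EFin \o (fun s => k t s * u s)).
  by apply/integrableP; split; first exact/measurable_EFinP.
rewrite /evolterra integrable_norm_fin// lee_fin; exact: le_normr_Rintegral.
Qed.

Lemma abs_svolterra_le_evolterra k u t : jmeasurable k -> measurable_fun setT u ->
  ((`|svolterra k u t|)%:E <= evolterra k u t)%E.
Proof.
move=> mk m; have [h|h] := ltP (evolterra k u t) +oo%E; first exact: svolterra_le_evolterra.
by apply: le_trans h; rewrite leey.
Qed.

Lemma integral_weakly_singular_col T b C k s : weakly_singular T b C k -> 0 < b <= 1 -> 0 <= s < T ->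
  (\int[mu]_(t in `]s, T[) (`|k t s|)%:E <= (C * T `^ b / b)%:E)%E.
Proof.
move=> [C0 mk kC] b01 /andP[s0 sT]; have b0 : 0 < b by case/andP: b01.
apply: (@le_trans _ _ (\int[mu]_(t in `]s, T[) (C * (t - s) `^ (b - 1))%:E)%E).
  apply: ge0_ae_le_integral => //.
    by move=> t _; rewrite lee_fin mulr_ge0// powR_ge0.
  apply: aeW => t /=; rewrite in_itv/= => /andP[st tT].
  by rewrite lee_fin kC// ltW.
under eq_integral do rewrite EFinM.
rewrite ge0_integralZl//; last 2 first.
- by apply: measurable_funTS; mf.
- by move=> t _; rewrite lee_fin powR_ge0.
rewrite integral_pow_left// -EFinM lee_fin mulrA ler_wpM2r ?invr_ge0 ?(ltW b0)//.
by rewrite ler_wpM2l// ge0_ler_powR ?nnegrE ?subr_ge0 ?(ltW b0) ?(ltW sT)//; lra.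
Qed.

Definition conv_cst (bl bk : R) := Gamma bk * Gamma bl / Gamma (bk + bl).

Lemma conv_cst_ge0 bl bk : 0 < bl <= 1 -> 0 < bk <= 1 -> 0 <= conv_cst bl bk.
Proof.
by move=> h1 h2; rewrite /conv_cst divr_ge0 ?mulr_ge0// ltW// Gamma_gt0; lra.
Qed.

Lemma comp_cst_ge0 T bl bk Cl Ck : 0 <= Cl -> 0 <= Ck -> 0 < bl <= 1 -> 0 < bk <= 1 ->
  0 <= Cl * Ck * conv_cst bl bk * T `^ (bk + bl - 1).
Proof. by move=> *; rewrite mulr_ge0 ?powR_ge0// mulr_ge0 ?conv_cst_ge0// mulr_ge0. Qed.

(** By the Beta integral the singularities combine to the power bk + bl - 1 of t - s, which is
    nonnegative here; the composed kernel is therefore bounded. *)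
Lemma integral_weakly_singular_comp T bl bk Cl Ck l k s t : weakly_singular T bl Cl l -> weakly_singular T bk Ck k ->
  0 < bl <= 1 -> 0 < bk <= 1 -> 1 <= bl + bk -> 0 <= s -> s < t -> t <= T ->
  (\int[mu]_(r in `]s, t[) (`|l t r * k r s|)%:E <=
    (Cl * Ck * conv_cst bl bk * T `^ (bk + bl - 1))%:E)%E.
Proof.
move=> [Cl0 ml lC] [Ck0 mk kC] bl1 bk1 b1 s0 st tT.
apply: (@le_trans _ _ (\int[mu]_(r in `]s, t[)
    (Cl * Ck * ((t - r) `^ (bl - 1) * (r - s) `^ (bk - 1)))%:E)%E).
  apply: ge0_ae_le_integral => //.
    by move=> r _; rewrite lee_fin mulr_ge0 ?mulr_ge0 ?powR_ge0.
  apply: aeW => r /=; rewrite in_itv/= => /andP[sr rt].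
  rewrite lee_fin normrM mulrACA; apply: ler_pM => //; [apply: lC => //|apply: kC => //]; lra.
under eq_integral do rewrite EFinM.
rewrite ge0_integralZl//; last 3 first.
- by apply: measurable_funTS; mf.
- by move=> r _; rewrite lee_fin mulr_ge0 ?powR_ge0.
- by rewrite lee_fin mulr_ge0.
rewrite integral_pow_conv// -EFinM lee_fin -[leRHS]mulrA ler_wpM2l ?mulr_ge0// -/(conv_cst bl bk).
rewrite ler_wpM2l ?conv_cst_ge0// ge0_ler_powR ?nnegrE; lra.
Qed.

Lemma weakly_singular_kcomp T bl bk Cl Ck l k : weakly_singular T bl Cl l -> weakly_singular T bk Ck k ->
  0 < bl <= 1 -> 0 < bk <= 1 -> 1 <= bl + bk ->
  weakly_singular T 1 (Cl * Ck * conv_cst bl bk * T `^ (bk + bl - 1)) (kcomp l k).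
Proof.
move=> hl hk bl1 bk1 b1; have [Cl0 ml _] := hl; have [Ck0 mk _] := hk.
split; first exact: comp_cst_ge0.
  exact: jmeasurable_kcomp.
move=> s t s0 st tT; rewrite subrr powRr0 mulr1 -lee_fin.
have h := integral_weakly_singular_comp hl hk bl1 bk1 b1 s0 st tT.
apply: le_trans h.
have m : measurable_fun `]s, t[ (fun r => l t r * k r s).
  by apply: measurable_funTS; apply: measurable_funM; exact: jmeasurable_comp.
have i : mu.-integrable `]s, t[ (EFin \o (fun r => l t r * k r s)).
  apply/integrableP; split; first exact/measurable_EFinP.
  exact: le_lt_trans (integral_weakly_singular_comp hl hk bl1 bk1 b1 s0 st tT) (ltry _).
rewrite integrable_norm_fin// lee_fin; exact: le_normr_Rintegral.
Qed.

(** After swapping the integrals only the integral of the kernel in t for fixed s matters, and it is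
    bounded by [integral_weakly_singular_col]. *)
Lemma integral_evolterra_le T b C k u : weakly_singular T b C k -> 0 < b <= 1 -> measurable_fun setT u ->
  (\int[mu]_(t in `]0%R, T[) evolterra k u t <=
   (C * T `^ b / b)%:E * \int[mu]_(s in `]0%R, T[) (`|u s|)%:E)%E.
Proof.
move=> hk b01 m; have [C0 mk kC] := hk; have b0 : 0 < b by case/andP: b01.
rewrite /evolterra (@tonelli_triangle _ (fun q : R * R => (`|k q.1 q.2 * u q.2|)%:E) 0 (BLeft T))//=; last first.
  apply: measurable_fun_EFin; apply: measurable_fun_normr.
  by apply: measurable_funM => //; exact: measurableT_comp.
rewrite -ge0_integralZl//; last 2 first.
- by apply: measurable_funTS; mf.
- by rewrite lee_fin divr_ge0 ?(ltW b0)// mulr_ge0// powR_ge0.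
apply: ge0_ae_le_integral => //.
- by move=> s _; exact: integral_ge0.
- by move=> s _; rewrite mule_ge0// lee_fin divr_ge0 ?(ltW b0)// mulr_ge0// powR_ge0.
apply: aeW => s; rewrite /= in_itv/= => /andP[s0 sT].
under eq_integral do rewrite normrM EFinM.
rewrite ge0_integralZr//; last first.
  by apply: measurable_funTS; apply: measurable_fun_EFin; apply: measurable_fun_normr; exact: jmeasurable_comp.
apply: lee_wpmul2r; first by rewrite lee_fin.
by apply: (integral_weakly_singular_col hk b01); rewrite (ltW s0).
Qed.

Lemma integral_triangle_le T bl bk Cl Ck l k u c t : 0 <= c -> weakly_singular T bl Cl l -> weakly_singular T bk Ck k ->
  0 < bl <= 1 -> 0 < bk <= 1 -> 1 <= bl + bk -> t <= T -> measurable_fun setT u ->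
  (\int[mu]_(r in `]c, t[) \int[mu]_(s in `]c, r[) (`|l t r * k r s * u s|)%:E <=
   (Cl * Ck * conv_cst bl bk * T `^ (bk + bl - 1))%:E * \int[mu]_(s in `]c, t[) (`|u s|)%:E)%E.
Proof.
move=> c0 hl hk bl1 bk1 b1 tT m; have [Cl0 ml _] := hl; have [Ck0 mk _] := hk.
rewrite (@tonelli_triangle _ (fun q : R * R => (`|l t q.1 * k q.1 q.2 * u q.2|)%:E) c (BLeft t))//=; last first.
  apply: measurable_fun_EFin; apply: measurable_fun_normr.
  apply: measurable_funM; last exact: measurableT_comp.
  by apply: measurable_funM => //; exact: jmeasurable_comp.
have K0 : 0 <= Cl * Ck * conv_cst bl bk * T `^ (bk + bl - 1).
  exact: comp_cst_ge0.
rewrite -ge0_integralZl//; last first.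
  by apply: measurable_funTS; mf.
apply: ge0_ae_le_integral => //.
- by move=> s _; exact: integral_ge0.
- by move=> s _; rewrite mule_ge0.
apply: aeW => s; rewrite /= in_itv/= => /andP[cs st].
under eq_integral do rewrite normrM EFinM.
rewrite ge0_integralZr//; last first.
  apply: measurable_funTS; apply: measurable_fun_EFin; apply: measurable_fun_normr.
  by apply: measurable_funM; exact: jmeasurable_comp.
apply: lee_wpmul2r; first by rewrite lee_fin.
exact: (integral_weakly_singular_comp hl hk bl1 bk1 b1 (le_trans c0 (ltW cs)) st tT).
Qed.

(** The lower limit is free: [c = 0] gives the composition of two operators, and [c = s] the
    associativity of kernel composition. *)
Lemma triangle_comp T bl bk Cl Ck l k u c t : 0 <= c -> weakly_singular T bl Cl l -> weakly_singular T bk Ck k ->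
  0 < bl <= 1 -> 0 < bk <= 1 -> 1 <= bl + bk -> t <= T -> measurable_fun setT u ->
  (\int[mu]_(s in `]c, t[) (`|u s|)%:E < +oo)%E ->
  \int[mu]_(r in `]c, t[) (l t r * \int[mu]_(s in `]c, r[) (k r s * u s)) =
  \int[mu]_(s in `]c, t[) (kcomp l k t s * u s).
Proof.
move=> c0 hl hk bl1 bk1 b1 tT m Iu; have [Cl0 ml _] := hl; have [Ck0 mk _] := hk.
have h := integral_triangle_le c0 hl hk bl1 bk1 b1 tT m.
transitivity (\int[mu]_(r in `]c, t[) \int[mu]_(s in `]c, r[) (l t r * k r s * u s)).
  apply: eq_Rintegral => r _; rewrite -Rintegral_scalel//.
    by apply: eq_Rintegral => s _; rewrite mulrA.
  by apply: measurable_funTS; apply: measurable_funM => //; exact: jmeasurable_comp.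
rewrite (@fubini_triangle _ (fun q : R * R => l t q.1 * k q.1 q.2 * u q.2) c (BLeft t))//=.
- apply: eq_Rintegral => s _; rewrite mulrC -Rintegral_scalel//.
    by apply: eq_Rintegral => r _; rewrite mulrC.
  by apply: measurable_funTS; apply: measurable_funM => //; exact: jmeasurable_comp.
- apply: measurable_funM; last exact: measurableT_comp.
  by apply: measurable_funM => //; exact: jmeasurable_comp.
- apply: le_lt_trans h _; rewrite lte_mul_pinfty// lee_fin.
  exact: comp_cst_ge0.
Qed.

Lemma svolterra_comp T bl bk Cl Ck l k u t : weakly_singular T bl Cl l -> weakly_singular T bk Ck k ->
  0 < bl <= 1 -> 0 < bk <= 1 -> 1 <= bl + bk -> t <= T -> measurable_fun setT u ->
  (\int[mu]_(s in `]0%R, t[) (`|u s|)%:E < +oo)%E ->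
  svolterra l (svolterra k u) t = svolterra (kcomp l k) u t.
Proof. exact: triangle_comp. Qed.

Lemma kcomp_assoc T bl bk bm Cl Ck Cm l k m s t : weakly_singular T bl Cl l -> weakly_singular T bk Ck k -> weakly_singular T bm Cm m ->
  0 < bl <= 1 -> 0 < bk <= 1 -> 0 < bm <= 1 -> 1 <= bl + bk -> 0 <= s -> s < t -> t <= T ->
  kcomp l (kcomp k m) t s = kcomp (kcomp l k) m t s.
Proof.
move=> hl hk [Cm0 mm mC] bl1 bk1 bm1 b1 s0 st tT.
apply: (triangle_comp s0 hl hk bl1 bk1 b1 tT (u := fun r => m r s)).
  exact: jmeasurable_comp.
apply: (@le_lt_trans _ _ (\int[mu]_(r in `]s, t[) (Cm * (r - s) `^ (bm - 1))%:E)%E).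
  apply: ge0_ae_le_integral => //; first by move=> r _; rewrite lee_fin mulr_ge0// powR_ge0.
  apply: aeW => r /=; rewrite in_itv/= => /andP[sr rt].
  by rewrite lee_fin mC// ltW// (lt_le_trans rt).
under eq_integral do rewrite EFinM.
rewrite ge0_integralZl//; last 2 first.
- by apply: measurable_funTS; mf.
- by move=> r _; rewrite lee_fin powR_ge0.
by rewrite integral_pow_left// -?EFinM ?ltry//; case/andP: bm1.
Qed.

End kernels.

Section kernel_operators.
Context {R : realType} {X : completeNormedModType R}.
Local Notation mu := (@lebesgue_measure R).
Implicit Types (T b C : R) (k l : R -> R -> R) (f g : R -> X) (u : nat -> R -> R) (x : nat -> X).

Definition volterra k f (t : R) : X := bochner `]0, t[ (fun s => k t s *: f s).

Lemma measure_oo_lty (a b : R) : (mu `]a, b[ < +oo)%E.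
Proof. by rewrite lebesgue_measure_itv/=; case: ifP => // _; rewrite -EFinB ltry. Qed.

Lemma mikusinski_kernel T k f u x t : mikusinski `]0, T[ f u x -> t <= T -> jmeasurable k ->
  (forall n, evolterra k (u n) t < +oo)%E ->
  (\sum_(0 <= n <oo) (evolterra k (u n) t * (`|x n|)%:E) < +oo)%E ->
  mikusinski `]0, t[ (fun s => k t s *: f s) (fun n s => k t s * u n s) x.
Proof.
move=> [ml il sl lf] tT mk Iku sk.
have mku n : measurable_fun setT (fun s => k t s * u n s).
  by apply: measurable_funM => //; exact: jmeasurable_comp.
split=> //.
- move=> n; apply/integrableP; split; last exact: Iku.
  by apply/measurable_EFinP; exact: measurable_funTS (mku n).
- apply: (ae_impl lf) => s h; rewrite /= in_itv/= => /andP[s0 st].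
  have {}h := h _; rewrite /= in_itv/= s0 (lt_le_trans st tT) in h.
  have {}h := h isT.
  rewrite (_ : series _ = (fun n => k t s *: series (fun n => u n s *: x n) n)).
    exact: cvgZr.
  apply/funext => n; rewrite /series/= scaler_sumr; apply: eq_bigr => i _.
  by rewrite scalerA.
Qed.

(** The sum of all the majorants has a finite integral in t, so the expansion of a function can be
    carried under a singular kernel for almost every t. *)
Lemma ae_kernel T b C k u x : weakly_singular T b C k -> 0 < b <= 1 ->
  (forall n, measurable_fun setT (u n)) ->
  (forall n, mu.-integrable `]0, T[ (EFin \o u n)) ->
  (\sum_(0 <= n <oo) (\int[mu]_(t in `]0%R, T[) (`|u n t|)%:E * (`|x n|)%:E) < +oo)%E ->
  {ae mu, forall t, `]0, T[%classic t -> (forall n, evolterra k (u n) t < +oo)%E /\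
    (\sum_(0 <= n <oo) (evolterra k (u n) t * (`|x n|)%:E) < +oo)%E}.
Proof.
move=> hk b01 ml il sl; have [C0 mk kC] := hk; have b0 : 0 < b by case/andP: b01.
have K0 : 0 <= C * T `^ b / b by rewrite divr_ge0 ?(ltW b0)// mulr_ge0// powR_ge0.
have mso n : measurable_fun setT (evolterra k (u n)) by exact: measurable_evolterra.
have Is n : (\int[mu]_(t in `]0%R, T[) evolterra k (u n) t <=
   (C * T `^ b / b)%:E * \int[mu]_(s in `]0%R, T[) (`|u n s|)%:E)%E.
  exact: integral_evolterra_le.
have a1 : {ae mu, forall t n, `]0, T[%classic t -> (evolterra k (u n) t < +oo)%E}.
  apply: ae_foralln => n; apply: ge0_integral_lty_ae => //.
    by move=> t; exact: evolterra_ge0.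
  apply: le_lt_trans (Is n) _; rewrite lte_mul_pinfty// ?lee_fin//.
  by have /integrableP[] := il n.
have a2 : {ae mu, forall t, `]0, T[%classic t ->
    (\sum_(0 <= n <oo) (evolterra k (u n) t * (`|x n|)%:E) < +oo)%E}.
  have ms n : measurable_fun setT (fun t => evolterra k (u n) t * (`|x n|)%:E)%E.
    by apply: emeasurable_funM => //; exact: measurable_cst.
  have s0 n t : (0 <= evolterra k (u n) t * (`|x n|)%:E)%E by rewrite mule_ge0 ?evolterra_ge0.
  apply: ge0_integral_lty_ae => //.
  - by apply: ge0_emeasurable_sum => n //.
  - by move=> t; apply: nneseries_ge0.
  - have msD n : measurable_fun (`]0, T[ : set R) (fun t => evolterra k (u n) t * (`|x n|)%:E)%E.
      exact: measurable_funTS (ms n).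
    rewrite integral_nneseries//.
    apply: (@le_lt_trans _ _ (\sum_(0 <= n <oo) ((C * T `^ b / b)%:E *
        (\int[mu]_(t in `]0%R, T[) (`|u n t|)%:E * (`|x n|)%:E)))%E).
      apply: lee_nneseries => n _; first by move=> _; exact: integral_ge0.
      rewrite ge0_integralZr//; last 2 first.
      + exact: measurable_funTS (mso n).
      + by move=> t _; exact: evolterra_ge0.
      by rewrite muleA; apply: lee_wpmul2r.
    rewrite nneseriesZl; last by move=> n _; rewrite mule_ge0// integral_ge0.
    by rewrite lte_mul_pinfty// lee_fin.
by apply: (ae_impl2 a1 a2) => t h1 h2 tT; split => [n|]; [exact: h1|exact: h2].
Qed.

Lemma mikusinski_volterra T b C k f u x : weakly_singular T b C k -> 0 < b <= 1 -> mikusinski `]0, T[ f u x ->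
  mikusinski `]0, T[ (volterra k f) (fun n => svolterra k (u n)) x.
Proof.
move=> hk b01 fu; have [ml il sl lf] := fu; have [C0 mk kC] := hk.
have b0 : 0 < b by case/andP: b01.
have K0 : 0 <= C * T `^ b / b by rewrite divr_ge0 ?(ltW b0)// mulr_ge0// powR_ge0.
have Is n : (\int[mu]_(t in `]0%R, T[) (`|svolterra k (u n) t|)%:E <=
   (C * T `^ b / b)%:E * \int[mu]_(s in `]0%R, T[) (`|u n s|)%:E)%E.
  apply: le_trans (integral_evolterra_le hk b01 (ml n)).
  apply: ge0_ae_le_integral => //; first by move=> t _; exact: evolterra_ge0.
  by apply: aeW => t _; exact: abs_svolterra_le_evolterra.
have mso n : measurable_fun setT (svolterra k (u n)) by exact: measurable_svolterra.
split; first exact: mso.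
- move=> n; apply/integrableP; split; first by apply/measurable_EFinP; exact: measurable_funTS (mso n).
  apply: le_lt_trans (Is n) _; rewrite lte_mul_pinfty// ?lee_fin//.
  by have /integrableP[] := il n.
- apply: (@le_lt_trans _ _ (\sum_(0 <= n <oo) ((C * T `^ b / b)%:E *
        (\int[mu]_(t in `]0%R, T[) (`|u n t|)%:E * (`|x n|)%:E)))%E).
    apply: lee_nneseries => n _; first by rewrite mule_ge0// integral_ge0.
    by rewrite muleA; apply: lee_wpmul2r.
  rewrite nneseriesZl; last by move=> n _; rewrite mule_ge0// integral_ge0.
  by rewrite lte_mul_pinfty// lee_fin.
apply: (ae_impl (ae_kernel hk b01 ml il sl)) => t h tT; have [h1 h2] := h tT.
have tT' : t <= T by move: tT; rewrite /= in_itv/= => /andP[_ /ltW].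
have := mikusinski_kernel fu tT' mk h1 h2.
by move=> /(bochner_mikusinski (measurable_itv _) (measure_oo_lty 0 t)).
Qed.

(** The scalar identity is applied term by term. Because [1 <= bl + bk], the composed kernel is
    bounded, which controls both expansions at each fixed t; the identity therefore holds at every
    t. *)
Lemma volterra_comp T bl bk Cl Ck l k f t : weakly_singular T bl Cl l -> weakly_singular T bk Ck k ->
  0 < bl <= 1 -> 0 < bk <= 1 -> 1 <= bl + bk -> t <= T ->
  bochner_integrable `]0, T[ f -> volterra l (volterra k f) t = volterra (kcomp l k) f t.
Proof.
move=> hl hk bl1 bk1 b1 tT [sf If].
have [u [x fu]] := mikusinski_exists (measurable_itv _) (measure_oo_lty 0 T) sf If.
have [mu_ iu su uf] := fu; have [Cl0 ml _] := hl; have [Ck0 mk _] := hk.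
have ku := mikusinski_volterra hk bk1 fu.
set K := Cl * Ck * conv_cst bl bk * T `^ (bk + bl - 1).
have K0 : 0 <= K by exact: comp_cst_ge0.
have It n : (\int[mu]_(s in `]0%R, t[) (`|u n s|)%:E <= \int[mu]_(s in `]0%R, T[) (`|u n s|)%:E)%E.
  apply: ge0_subset_integral => //.
  - by apply: measurable_funTS; have := mu_ n => h; mf.
  - by move=> s /=; rewrite !in_itv/= => /andP[-> st]; exact: lt_le_trans st tT.
have Iu n : (\int[mu]_(s in `]0%R, T[) (`|u n s|)%:E < +oo)%E by have /integrableP[] := iu n.
have fin (m : R -> R -> R) (v : nat -> R -> R) :
    (forall n, evolterra m (v n) t <= K%:E * \int[mu]_(s in `]0%R, T[) (`|u n s|)%:E)%E ->
    (forall n, evolterra m (v n) t < +oo)%E /\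
    (\sum_(0 <= n <oo) (evolterra m (v n) t * (`|x n|)%:E) < +oo)%E.
  move=> h; split=> [n|].
    by apply: le_lt_trans (h n) _; rewrite lte_mul_pinfty// lee_fin.
  apply: (@le_lt_trans _ _ (\sum_(0 <= n <oo) (K%:E *
        (\int[mu]_(t in `]0%R, T[) (`|u n t|)%:E * (`|x n|)%:E)))%E).
    apply: lee_nneseries => n _; first by rewrite mule_ge0// evolterra_ge0.
    by rewrite muleA; apply: lee_wpmul2r.
  rewrite nneseriesZl; last by move=> n _; rewrite mule_ge0// integral_ge0.
  by rewrite lte_mul_pinfty// lee_fin.
have [l1 l2] : (forall n, evolterra l (svolterra k (u n)) t < +oo)%E /\
    (\sum_(0 <= n <oo) (evolterra l (svolterra k (u n)) t * (`|x n|)%:E) < +oo)%E.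
  apply: (fin l (fun n => svolterra k (u n))) => n.
  apply: (le_trans _ (lee_wpmul2l _ (It n))); last by rewrite lee_fin.
  apply: (le_trans _ (integral_triangle_le (lexx 0) hl hk bl1 bk1 b1 tT (mu_ n))).
  apply: ge0_ae_le_integral => //; first by move=> r _; exact: integral_ge0.
  apply: aeW => r _.
  rewrite normrM EFinM.
  apply: (@le_trans _ _ ((`|l t r|)%:E * evolterra k (u n) r)%E).
    by apply: lee_wpmul2l => //; exact: abs_svolterra_le_evolterra.
  rewrite /evolterra -ge0_integralZl//.
    apply: ge0_ae_le_integral => //.
    by apply: aeW => s _; rewrite -EFinM lee_fin -normrM mulrA.
  apply: measurable_funTS; apply: measurable_fun_EFin; apply: measurable_fun_normr.
  by apply: measurable_funM; [exact: jmeasurable_comp|exact: mu_].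
have mc : jmeasurable (kcomp l k) by exact: jmeasurable_kcomp.
have [c1 c2] : (forall n, evolterra (kcomp l k) (u n) t < +oo)%E /\
    (\sum_(0 <= n <oo) (evolterra (kcomp l k) (u n) t * (`|x n|)%:E) < +oo)%E.
  apply: (fin (kcomp l k) u) => n.
  apply: (le_trans _ (lee_wpmul2l _ (It n))); last by rewrite lee_fin.
  rewrite /evolterra -ge0_integralZl//; last by apply: measurable_funTS; have := mu_ n => h; mf.
  apply: ge0_ae_le_integral => //; first by move=> s _; rewrite mule_ge0.
  apply: aeW => s /=; rewrite in_itv/= => /andP[s0 st].
  rewrite normrM lee_fin ler_wpM2r//.
  have [_ _ h] := weakly_singular_kcomp hl hk bl1 bk1 b1.
  by have := h _ _ (ltW s0) st tT; rewrite subrr powRr0 mulr1.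
have e1 := bochner_mikusinski (measurable_itv _) (measure_oo_lty 0 t)
  (mikusinski_kernel ku tT ml l1 l2).
have e2 := bochner_mikusinski (measurable_itv _) (measure_oo_lty 0 t)
  (mikusinski_kernel fu tT mc c1 c2).
apply: (@cvg_unique _ (@norm_hausdorff _ X) _ _ _ _ e1).
rewrite (_ : (fun n => _) = (fun n => (\int[mu]_(s in `]0, t[) (kcomp l k t s * u n s)) *: x n))//.
apply/funext => n; congr (_ *: _).
apply: (svolterra_comp hl hk bl1 bk1 b1 tT (mu_ n)).
exact: le_lt_trans (It n) (Iu n).
Qed.

Lemma bochner_integrable_volterra T b C k f : weakly_singular T b C k -> 0 < b <= 1 ->
  bochner_integrable `]0, T[ f -> bochner_integrable `]0, T[ (volterra k f).
Proof.
move=> hk b01 [sf If].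
have [u [x fu]] := mikusinski_exists (measurable_itv _) (measure_oo_lty 0 T) sf If.
exact: mikusinski_integrable (measurable_itv _) (measure_oo_lty 0 T) _ _ _ (mikusinski_volterra hk b01 fu).
Qed.

Lemma ae_integrable_kernel T b C k f : weakly_singular T b C k -> 0 < b <= 1 ->
  bochner_integrable `]0, T[ f ->
  {ae mu, forall t, `]0, T[%classic t -> bochner_integrable `]0, t[ (fun s => k t s *: f s)}.
Proof.
move=> hk b01 [sf If]; have [_ mk _] := hk.
have [u [x fu]] := mikusinski_exists (measurable_itv _) (measure_oo_lty 0 T) sf If.
have [mu_ iu su uf] := fu.
apply: (ae_impl (ae_kernel hk b01 mu_ iu su)) => t h tT; have [h1 h2] := h tT.
have tT' : t <= T by move: tT; rewrite /= in_itv/= => /andP[_ /ltW].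
exact: mikusinski_integrable (measurable_itv _) (measure_oo_lty 0 t) _ _ _
  (mikusinski_kernel fu tT' mk h1 h2).
Qed.

Lemma integrable_bounded_kernel T C k f t : weakly_singular T 1 C k -> t <= T ->
  bochner_integrable `]0, T[ f -> bochner_integrable `]0, t[ (fun s => k t s *: f s).
Proof.
move=> hk tT [sf If]; have [C0 mk kC] := hk.
have [u [x fu]] := mikusinski_exists (measurable_itv _) (measure_oo_lty 0 T) sf If.
have [mu_ iu su uf] := fu.
have Iu n : (\int[mu]_(s in `]0%R, T[) (`|u n s|)%:E < +oo)%E by have /integrableP[] := iu n.
have It n : (evolterra k (u n) t <= C%:E * \int[mu]_(s in `]0%R, T[) (`|u n s|)%:E)%E.
  apply: (@le_trans _ _ (C%:E * \int[mu]_(s in `]0%R, t[) (`|u n s|)%:E)%E).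
    rewrite /evolterra -ge0_integralZl//; last by apply: measurable_funTS; have := mu_ n => h; mf.
    apply: ge0_ae_le_integral => //; first by move=> s _; rewrite mule_ge0.
    apply: aeW => s /=; rewrite in_itv/= => /andP[s0 st].
    rewrite normrM lee_fin ler_wpM2r//.
    by have := kC _ _ (ltW s0) st tT; rewrite subrr powRr0 mulr1.
  apply: lee_wpmul2l; first by rewrite lee_fin.
  apply: ge0_subset_integral => //.
  - by apply: measurable_funTS; have := mu_ n => h; mf.
  - by move=> s /=; rewrite !in_itv/= => /andP[-> st]; exact: lt_le_trans st tT.
apply: mikusinski_integrable (measurable_itv _) (measure_oo_lty 0 t) _ _ _
  (mikusinski_kernel fu tT mk _ _) => [n|].
  by apply: le_lt_trans (It n) _; rewrite lte_mul_pinfty// lee_fin.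
apply: (@le_lt_trans _ _ (\sum_(0 <= n <oo) (C%:E *
      (\int[mu]_(t in `]0%R, T[) (`|u n t|)%:E * (`|x n|)%:E)))%E).
  apply: lee_nneseries => n _; first by rewrite mule_ge0// evolterra_ge0.
  by rewrite muleA; apply: lee_wpmul2r.
rewrite nneseriesZl; last by move=> n _; rewrite mule_ge0// integral_ge0.
by rewrite lte_mul_pinfty// lee_fin.
Qed.

End kernel_operators.

(** * Primitives of Bochner integrable functions *)

Section derivative.
Context {R : realType} {V : normedModType R}.

(** A form without division, which adds up over adjacent intervals and includes the case s = t. *)
Lemma derive1_epsP (F : R -> V) (t : R) (v : V) :
  (forall e : R, 0 < e -> exists2 d : R, 0 < d &
     forall s, `|s - t| < d -> `|F s - F t - (s - t) *: v| <= e * `|s - t|) <->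
  derivable F t 1 /\ derive1 F t = v.
Proof.
split=> [h|[dF <-] e e0].
  have c : h^-1 *: (F (h + t) - F t) @[h --> (0 : R)^'] --> v.
    apply/cvgrPdist_le => e /h[d d0 hd]; near=> x.
    have x0 : x != 0 by near: x; exact: nbhs_dnbhs_neq.
    have xd : `|x| < d by near: x; exact: dnbhs0_lt.
    have := hd (x + t); rewrite addrK => /(_ xd) hx.
    rewrite -[v in v - _](scale1r) -(mulVf x0) -scalerA -scalerBr normrZ normfV.
    by rewrite ler_pdivrMl ?normr_gt0// distrC mulrC.
  split; last exact: cvg_lim.
  apply/cvg_ex; exists v; move: c; apply: cvg_trans; apply: near_eq_cvg.
  by apply: nearW => x /=; rewrite [in LHS](_ : x = x%:A)// /GRing.scale/= mulr1.
have c : h^-1 *: (F (h + t) - F t) @[h --> (0 : R)^'] --> derive1 F t.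
  have := dF; rewrite /derivable => c; rewrite derive1E.
  move: c; rewrite -/(cvg _) => c.
  apply: cvg_trans c; apply: near_eq_cvg.
  by apply: nearW => x /=; rewrite [in RHS](_ : x = x%:A)// /GRing.scale/= mulr1.
move/cvgrPdist_le : c => /(_ _ e0) /nbhs_ballP[d /= d0 hd].
exists d => // s sd; have [->|st] := eqVneq s t.
  by rewrite !(subrr, scale0r, normr0, mulr0).
have st0 : s - t != 0 by rewrite subr_eq0.
have /hd/(_ st0) : ball 0 d (s - t) by rewrite /ball /= sub0r normrN.
rewrite subrK => hs.
have -> : F s - F t - (s - t) *: derive1 F t = - ((s - t) *: (derive1 F t - (s - t)^-1 *: (F s - F t))).
  by rewrite scalerBr scalerA mulfV// scale1r opprB.
by rewrite normrN normrZ mulrC ler_wpM2r.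
Unshelve. all: by end_near. Qed.

End derivative.

Lemma subrACA (V : zmodType) (x y z w : V) : x - y - (z - w) = x - z - (y - w).
Proof. by rewrite !opprB addrACA [RHS]addrACA [- z - _]addrC. Qed.

Section absolute_continuity.
Context {R : realType} {V : normedModType R}.
Local Notation mu := (@lebesgue_measure R).
Implicit Types (F G : R -> V) (a b : R).

Lemma absolutely_continuousB a b F G : absolutely_continuous a b F ->
  absolutely_continuous a b G -> absolutely_continuous a b (fun t => F t - G t).
Proof.
move=> aF aG e e0; have e20 : 0 < e / 2 by rewrite divr_gt0.
have [d d0 hF] := aF _ e20; have [d' d'0 hG] := aG _ e20.
exists (Num.min d d'); first by rewrite lt_min d0.
move=> n l r lr tI; rewrite lt_min => /andP[sd sd'].
rewrite (splitr e); apply: le_lt_trans (ltrD (hF _ _ _ lr tI sd) (hG _ _ _ lr tI sd')).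
rewrite -big_split/=; apply: ler_sum => i _.
by rewrite subrACA ler_normB.
Qed.

(* Each point of [a, b] has a neighbourhood which either lies in a small open set containing the
   exceptional points, or on which F varies by at most e per unit of length; a supremum argument
   chains such neighbourhoods from a to x. *)
Lemma ac_derive0_const a b F : absolutely_continuous a b F ->
  {ae mu, forall t, t \in `]a, b[ -> derivable F t 1 /\ derive1 F t = 0} ->
  forall x, a <= x <= b -> F x = F a.
Proof.
move=> aF [N [mN N0 PN]] x0 /andP[ax0 x0b].
apply/eqP; rewrite -subr_eq0 -normr_le0; apply/ler_addgt0Pr => e' e'0; rewrite add0r.
(* The regular part will cost e (x0 - a) and the exceptional part e, together e'. *)
pose e := e' / (x0 - a + 1).
have xa1 : 0 < x0 - a + 1 by rewrite ltr_wpDl// subr_ge0.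
have e0 : 0 < e by rewrite divr_gt0.
have [d d0 hd] := aF _ e0.
(* The end points join the exceptional set, since the derivative is controlled in the open interval
   only. *)
pose N' := N `|` [set a] `|` [set b].
have mN' : measurable N' by do 2 apply: measurableU => //.
have N'0 : (mu N' = 0)%E.
  have h1 : (mu (N `|` [set a]) = 0)%E.
    by apply: etrans (measureU0 _ _ _) N0 => //; exact: lebesgue_measure_set1.
  by apply: etrans (measureU0 _ _ _) h1 => //; [exact: measurableU|exact: lebesgue_measure_set1].
have [U [oU N'U Ud]] := lebesgue_regularity_outer mN' (eq_ind_r (fun z => (z < +oo)%E) (ltry 0) N'0) d0.
have mU : measurable U by exact: open_measurable.
have muU : (mu U < d%:E)%E.
  apply: le_lt_trans Ud.
  apply: (@le_trans _ _ (mu (U `\` N') + mu N')%E); last by rewrite [X in (_ + X)%E]N'0 adde0.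
  have mUN : measurable (U `\` N') by exact: measurableD.
  apply: (le_trans _ (measureU2 mu mUN mN')).
  apply: le_measure; rewrite ?inE//; first exact: measurableU.
  by move=> t Ut; have [|] := pselect (N' t); [right|left].
(* The list collects disjoint intervals, of total length at most that of U below x, which carry all
   the variation of F not covered by e (x - a). Absolute continuity is applied to this list at the
   end. *)
pose reach x := exists s : seq (R * R),
  [/\ all (fun p => [&& a <= p.1, p.1 <= p.2 & p.2 <= x]) s,
      pairwise (fun p q => q.2 <= p.1) s,
      ((\sum_(p <- s) (p.2 - p.1))%:E <= mu (U `&` `]a, x[))%E &
      `|F x - F a| <= e * (x - a) + \sum_(p <- s) `|F p.2 - F p.1|].
have muI (u v : R) : a <= u -> u <= v -> (mu (U `&` `]a, u[) <= mu (U `&` `]a, v[))%E.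
  move=> au uv; apply: le_measure; rewrite ?inE; [exact: measurableI|exact: measurableI|].
  by apply: setIS => t /=; rewrite !in_itv/= => /andP[-> tu]; exact: lt_le_trans tu uv.
have reach_good (u v : R) : a <= u -> u <= v -> `|F v - F u| <= e * (v - u) -> reach u -> reach v.
  move=> au uv Fuv [s [s1 s2 s3 s4]]; exists s; split => //.
  - apply: sub_all s1 => p /and3P[-> -> pu] /=; exact: le_trans pu uv.
  - exact: le_trans s3 (muI _ _ au uv).
  - rewrite -(subrK (F u) (F v)) -addrA (le_trans (ler_normD _ _))//.
    apply: le_trans (lerD Fuv s4) _; rewrite addrA -mulrDr addrA subrK//.
have reach_bad (u v : R) : a <= u -> u <= v -> `]u, v[%classic `<=` U -> reach u -> reach v.
  move=> au uv UU [s [s1 s2 s3 s4]]; exists ((u, v) :: s); split => /=.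
  - rewrite au uv lexx/=.
    apply: sub_all s1 => p /and3P[-> -> pu] /=; exact: le_trans pu uv.
  - by rewrite s2 andbT; apply: sub_all s1 => p /and3P[].
  - rewrite big_cons EFinD/=.
    apply: (@le_trans _ _ (mu (`]u, v[%classic `|` (U `&` `]a, u[)))%E); last first.
      apply: le_measure; rewrite ?inE.
      + by apply: measurableU => //; exact: measurableI.
      + exact: measurableI.
      + move=> t [|[Ut]]/=; rewrite !in_itv/= => /andP[t1 t2].
          by split; [apply: UU; rewrite /= in_itv/= t1|rewrite (le_lt_trans au t1)].
        by split => //; rewrite t1 (lt_le_trans t2).
    rewrite measureU//=; last 2 first.
    + exact: measurableI.
    + apply/seteqP; split => // t [/= + [_ +]].
      by rewrite /= !in_itv/= => /andP[ut _] /andP[_ tu]; move: (lt_trans ut tu); rewrite ltxx.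
    apply: leeD s3; rewrite lebesgue_measure_itv/= lte_fin; case: ltP => // vu.
    by rewrite lee_fin subr_le0.
  - rewrite big_cons/= -(subrK (F u) (F v)) -addrA (le_trans (ler_normD _ _))//.
    have e1 : e * (u - a) <= e * (v - a) by rewrite ler_pM2l// lerB.
    rewrite subrK addrCA lerD2l; apply: le_trans s4 _; exact: lerD.
have gauge c : a <= c <= b -> exists2 r : R, 0 < r & forall u v, a <= u -> u <= c -> c <= v ->
    v <= b -> c - u < r -> v - c < r -> reach u -> reach v.
  move=> /andP[ac cb].
  have [N'c|nN'c] := pselect (N' c).
    have /nbhs_ballP[r /= r0 hr] : nbhs c U by apply: open_nbhs_nbhs; split => //; exact: N'U.
    exists r => // u v au uc cv vb cur vcr; apply: reach_bad => //; first exact: le_trans uc cv.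
    move=> t /=; rewrite in_itv/= => /andP[ut tv]; apply: hr; rewrite /ball/=.
    by rewrite ltr_distlC; apply/andP; split; lra.
  have [nNc ca cb'] : [/\ ~ N c, c != a & c != b].
    by split; [move=> Nc; apply: nN'c; left; left|apply/eqP => ca; apply: nN'c; left; right|
      apply/eqP => ca; apply: nN'c; right].
  have cin : c \in `]a, b[ by rewrite in_itv/= !lt_neqAle eq_sym ca cb' ac.
  have {}hc : derivable F c 1 /\ derive1 F c = 0.
    by apply: contra_notP nNc => h; apply: PN => /(_ cin).
  move/derive1_epsP : hc => /(_ _ e0)[r r0 hr].
  exists r => // u v au uc cv vb cur vcr.
  apply: reach_good => //; first exact: le_trans uc cv.
  have h1 := hr u; have h2 := hr v.
  rewrite -(subrK (F c) (F v)) -addrA (le_trans (ler_normD _ _))//.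
  have -> : e * (v - u) = e * `|v - c| + e * `|u - c|.
    by rewrite -mulrDr (ger0_norm (_ : 0 <= v - c)) ?subr_ge0// ler0_norm ?subr_le0// opprB; congr (_ * _); lra.
  apply: lerD.
    move: h2; rewrite scaler0 subr0; apply; rewrite ger0_norm ?subr_ge0//.
  rewrite distrC; move: h1; rewrite scaler0 subr0; apply.
  by rewrite ler0_norm ?subr_le0// opprB.
have reach_a : reach a.
  exists [::]; split => //=; first by rewrite big_nil.
  by rewrite !subrr normr0 mulr0 big_nil addr0.
have reach_x0 : reach x0.
  pose S := [set y | a <= y <= x0 /\ reach y].
  have Sa : S a by split => //; rewrite lexx.
  have hS : has_sup S by split; [exists a|exists x0 => y [/andP[]]].
  pose c := sup S.
  have ac : a <= c by exact: ub_le_sup hS.2 _ Sa.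
  have cx : c <= x0 by apply: ge_sup; [exists a|move=> y [/andP[]]].
  have acb : a <= c <= b by rewrite ac (le_trans cx).
  have [r r0 hr] := gauge c acb.
  have [y Sy yc] := sup_adherent r0 hS.
  have [/andP[ay yx0] ry] := Sy.
  have yc' : y <= c by exact: ub_le_sup hS.2 _ Sy.
  (* A point beyond the supremum would still be reachable, so the supremum is [x0]; the minimum
     keeps the point inside the interval. *)
  pose z := Num.min (c + r / 2) x0.
  have cz : c <= z by rewrite le_min cx andbT lerDl divr_ge0// ltW.
  have zx : z <= x0 by rewrite ge_min lexx orbT.
  have rz : reach z.
    apply: (hr y) => //; first exact: le_trans zx x0b.
      by rewrite -/c in yc; lra.
    have : z <= c + r / 2 by rewrite ge_min lexx.
    by lra.
  have : z <= c by apply: ub_le_sup hS.2 _ _; split => //; rewrite (le_trans ac cz).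
  move=> zc; suff <- : z = x0 by [].
  apply/eqP; rewrite eq_le zx/=; move: zc; rewrite /z; case: (leP (c + r / 2) x0) => //.
  by move=> _ h; exfalso; move: r0; lra.
have [s [s1 s2 s3 s4]] := reach_x0.
apply: (le_trans s4).
have -> : e' = e * (x0 - a) + e by rewrite -{2}(mulr1 e) -mulrDr /e divfK// gt_eqF.
rewrite lerD2l; apply: ltW.
pose p0 : R * R := (0, 0).
rewrite (big_nth p0) big_mkord.
apply: (hd _ (fun i : 'I_(size s) => (nth p0 s i).1) (fun i => (nth p0 s i).2)).
- move=> i; have := all_nthP p0 s1 i (ltn_ord i) => /and3P[h1 h2 h3]; split => //.
  exact: le_trans h3 x0b.
- have key (i j : 'I_(size s)) : (i < j)%N -> (nth p0 s j).2 <= (nth p0 s i).1.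
    by move=> ij; have /(pairwiseP p0) := s2; apply; rewrite ?inE.
  apply/trivIsetP => i j _ _ ij; apply/seteqP; split => // t [/=].
  rewrite !in_itv/= => /andP[h1 h2] /andP[h3 h4].
  have [/key h|/key h|/val_inj h] := ltngtP i j.
  + by have := lt_trans h1 (lt_le_trans h4 h); rewrite ltxx.
  + by have := lt_trans h3 (lt_le_trans h2 h); rewrite ltxx.
  + by rewrite h eqxx in ij.
- have := s3; rewrite (big_nth p0) big_mkord -lte_fin => /le_lt_trans; apply.
  apply: le_lt_trans muU; apply: le_measure; rewrite ?inE//; first exact: measurableI.
Qed.

End absolute_continuity.

Section scalar_primitive.
Context {R : realType}.
Local Notation mu := (@lebesgue_measure R).
Implicit Types (a b s t : R) (f : R -> R).

Lemma Rintegral_split a s t f : a <= s -> s <= t -> mu.-integrable `]a, t[ (EFin \o f) ->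
  \int[mu]_(x in `]a, t[) f x = \int[mu]_(x in `]a, s[) f x + \int[mu]_(x in `]s, t[) f x.
Proof.
move=> as_ st fi; move: st; rewrite le_eqVlt => /predU1P[->|st].
  by rewrite [X in _ = _ + X](_ : _ = 0) ?addr0// set_itv_ge ?Rintegral_set0// bnd_simp ltxx.
have := @Rintegral_itvB _ f (BRight a) (BLeft t) s fi; rewrite !bnd_simp => /(_ as_ st) <-.
rewrite -Rintegral_itv_bndo_bndc ?subrKC//.
apply: integrableS fi => //; apply: subset_itvl; rewrite bnd_simp; exact: ltW.
Qed.

(** The differentiability of the scalar primitive is put in the division-free form, for intervals
    with t as an end point, that [ae_derive_bochner] combines with norm estimates. *)
Lemma ae_derive_primitive a b f : measurable_fun setT f -> mu.-integrable `]a, b[ (EFin \o f) ->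
  {ae mu, forall t, t \in `]a, b[ -> forall e : R, 0 < e -> exists2 d : R, 0 < d &
    forall s u, s <= u -> s \in `]a, b[ -> u \in `]a, b[ -> (s = t \/ u = t) -> u - s < d ->
    `|\int[mu]_(x in `]s, u[) f x - (u - s) * f t| <= e * (u - s)}.
Proof.
move=> mf fi; pose g := f \_ (`]a, b[ : set R).
have gi : mu.-integrable setT (EFin \o g).
  by have := (@integrable_mkcond _ _ _ mu `]a, b[ (EFin \o f) (measurable_itv _)).1 fi; rewrite restrict_EFin.
have lg : locally_integrable setT g.
  split; [by have /integrableP[/measurable_EFinP] := gi|exact: openT|].
  move=> K _ cK; have /integrableP[mg] := gi; apply: le_lt_trans.
  apply: ge0_subset_integral => //; first exact: compact_measurable.
  by have /measurable_EFinP mg' := mg; mf.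
have gS (A : set R) : measurable A -> mu.-integrable A (EFin \o g).
  by move=> mA; apply: integrableS gi.
have := @FTC1 _ g (BRight a) (fun y => gS _ (measurable_itv _)) lg => /=.
move=> /ae_impl; apply => t h tab e e0.
have /derive1_epsP/(_ _ e0)[d d0 hd] : derivable (fun x => \int[mu]_(t in `]a, x]) g t : R^o) t 1 /\
    derive1 (fun x => \int[mu]_(t in `]a, x]) g t : R^o) t = g t.
  by apply: h; rewrite lte_fin; move: tab; rewrite in_itv/= => /andP[].
have gt : g t = f t by rewrite /g patchE mem_set.
exists d => // s u su sab uab sut us.
have E : \int[mu]_(x in `]s, u[) f x =
    \int[mu]_(x in `]a, u]) g x - \int[mu]_(x in `]a, s]) g x.
  rewrite Rintegral_itvB ?bnd_simp//; last 2 first.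
  - exact: gS.
  - by move: sab; rewrite in_itv/= => /andP[/ltW].
  rewrite -Rintegral_itv_bndo_bndc; last exact: gS.
  apply: eq_Rintegral => x; rewrite inE/= in_itv/= => /andP[sx xu].
  rewrite /g patchE mem_set//= in_itv/=.
  move: sab uab; rewrite !in_itv/= => /andP[sa _] /andP[_ ub].
  by rewrite (lt_trans sa sx) (lt_trans xu ub).
rewrite E -gt; case: sut => [st|ut].
  have := hd u; rewrite -st ger0_norm ?subr_ge0// => /(_ us).
  by [].
have := hd s; rewrite -ut ler0_norm ?subr_le0// opprB => /(_ us).
by rewrite -normrN !opprB [X in `|X|](_ : _ = \int[mu]_(x in `]a, u]) g x - \int[mu]_(x in `]a, s]) g x - (u - s) * g u)//
  /GRing.scale/=; ring.
Qed.

(** Absolute continuity of the integral, phrased by the excess over a level: it splits [N] into a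
    bounded part and a part with small integral. The excess tends to 0 by dominated convergence. *)
Lemma integral_abs_cont (D : set R) (N : R -> R) (e : R) : measurable D ->
  measurable_fun setT N -> (forall t, 0 <= N t) -> (\int[mu]_(t in D) (N t)%:E < +oo)%E -> 0 < e ->
  exists m : R, 0 <= m /\ (\int[mu]_(t in D) (Num.max (N t - m) 0)%:E <= e%:E)%E.
Proof.
move=> mD mN N0 IN e0.
have m1 n : measurable_fun D (fun t => (Num.max (N t - n%:R) 0)%:E).
  apply: measurable_funTS; apply: measurable_fun_EFin.
  by apply: measurable_maxr => //; mf.
have iN : mu.-integrable D (fun t => (N t)%:E).
  apply/integrableP; split; first by apply: measurable_funTS; mf.
  by under eq_integral do rewrite gee0_abs ?lee_fin//.
have c1 : {ae mu, forall t, D t -> (fun n => (Num.max (N t - n%:R) 0)%:E) @ \oo --> 0%E}.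
  apply: aeW => t Dt; apply: cvg_EFin; first exact: nearW.
  apply: cvg_near_cst; have := nbhs_infty_ge (Num.trunc (N t)).+1.
  apply: filterS => n nN; apply/max_idPr; rewrite subr_le0.
  by have := truncnS_gt (N t); move=> /ltW/le_trans; apply; rewrite ler_nat.
have d1 : {ae mu, forall t n, D t -> (`|(Num.max (N t - n%:R) 0)%:E| <= (N t)%:E)%E}.
  apply: aeW => t n Dt; rewrite gee0_abs ?lee_fin ?le_max ?lexx ?orbT//.
  by rewrite ge_max N0 andbT gerBl.
have [_ h _] := @dominated_convergence _ _ _ mu D mD _ _ _ m1 (measurable_cst _) c1 iN d1.
have [n hn] := filter_ex (ecvg0_near e0 h).
exists n%:R; split => //; apply: le_trans hn.
by apply: ge0_ae_le_integral => //; [move=> t _; rewrite lee_fin le_max lexx orbT|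
  apply: aeW => t _; rewrite sube0 abse_EFin lee_fin ler_norm].
Qed.

End scalar_primitive.

Section primitive.
Context {R : realType} {X : completeNormedModType R}.
Local Notation mu := (@lebesgue_measure R).
Implicit Types (a b s t : R) (f g : R -> X) (x : X).

Lemma strongly_measurable_sub (D E : set R) f : E `<=` D -> strongly_measurable D f ->
  strongly_measurable E f.
Proof. by move=> ED [s fs sf]; exists s => //; exact: ae_sub_domain ED sf. Qed.

Lemma integral_norm_sub (D E : set R) f : measurable D -> measurable E -> E `<=` D ->
  strongly_measurable D f ->
  (\int[mu]_(t in E) (`|f t|)%:E <= \int[mu]_(t in D) (`|f t|)%:E)%E.
Proof.
move=> mD mE ED /strongly_measurable_norm[N [mN N0 fN]].
rewrite (@ge0_ae_eq_integral_lower _ _ _ mu E (fun t => (`|f t|)%:E) (fun t => (N t)%:E))//;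
  [|by move=> t _; rewrite lee_fin|by apply: (ae_impl (ae_sub_domain ED fN)) => t h /h ->].
rewrite (@ge0_ae_eq_integral_lower _ _ _ mu D (fun t => (`|f t|)%:E) (fun t => (N t)%:E))//;
  [|by move=> t _; rewrite lee_fin|by apply: (ae_impl fN) => t h /h ->].
apply: ge0_subset_integral => //.
- by apply: measurable_funTS; mf.
- by move=> t _; rewrite lee_fin.
Qed.

Lemma bochner_integrable_sub (D E : set R) f : measurable D -> measurable E -> E `<=` D ->
  bochner_integrable D f -> bochner_integrable E f.
Proof.
move=> mD mE ED [sf If]; split; first exact: strongly_measurable_sub ED sf.
exact: le_lt_trans (integral_norm_sub mD mE ED sf) If.
Qed.

Lemma mikusinski_sub (D E : set R) f l (x : nat -> X) : measurable D -> measurable E -> E `<=` D ->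
  mikusinski D f l x -> mikusinski E f l x.
Proof.
move=> mD mE ED [ml il sl lf]; split => //.
- by move=> n; apply: integrableS (il n).
- apply: le_lt_trans sl; apply: lee_nneseries => n _.
    by rewrite mule_ge0 ?integral_ge0.
  apply: lee_wpmul2r => //; apply: ge0_subset_integral => //.
  by apply: measurable_funTS; have := ml n => h; mf.
- exact: ae_sub_domain ED lf.
Qed.

Lemma subset_oo a b s t : a <= s -> t <= b -> `]s, t[%classic `<=` `]a, b[%classic.
Proof. by move=> as_ tb; apply: subset_itv; rewrite bnd_simp. Qed.

Lemma bochner_oo0 t f : bochner `]t, t[ f = 0.
Proof.
have e : (`]t, t[%classic : set R) = set0 by rewrite set_itv_ge// bnd_simp ltxx.
rewrite e; have m0 : (mu set0 < +oo)%E by rewrite measure0.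
apply/eqP; rewrite -normr_le0 -lee_fin.
have If : bochner_integrable set0 f.
  split; last by rewrite integral_set0.
  by exists (fun _ _ => 0) => [n|]; [exact: fibered_cst|exact: aeW].
by apply: le_trans (le_norm_bochner measurable0 m0 If) _; rewrite integral_set0.
Qed.

Lemma bochner_split a s t f : a <= s -> s <= t -> bochner_integrable `]a, t[ f ->
  bochner `]a, t[ f = bochner `]a, s[ f + bochner `]s, t[ f.
Proof.
move=> as_ st [sf If].
have [l [x lx]] := mikusinski_exists (measurable_itv _) (measure_oo_lty a t) sf If.
have [_ il _ _] := lx.
have mi (u v : R) : measurable (`]u, v[ : set R) by [].
have h0 := bochner_mikusinski (mi _ _) (measure_oo_lty a t) lx.
have h1 := bochner_mikusinski (mi _ _) (measure_oo_lty a s)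
  (mikusinski_sub (mi a t) (mi a s) (subset_oo (lexx a) st) lx).
have h2 := bochner_mikusinski (mi _ _) (measure_oo_lty s t)
  (mikusinski_sub (mi a t) (mi s t) (subset_oo as_ (lexx t)) lx).
apply: (@cvg_unique _ (@norm_hausdorff _ X) _ _ _ _ h0).
rewrite (_ : series (fun n => (\int[mu]_(t in `]a, t[) l n t) *: x n) =
  series (fun n => (\int[mu]_(t in `]a, s[) l n t) *: x n) +
  series (fun n => (\int[mu]_(t in `]s, t[) l n t) *: x n)); first exact: cvgD h1 h2.
apply/funext => n; rewrite /series /= -[RHS]big_split/=; apply: eq_bigr => i _.
by rewrite -scalerDl; congr (_ *: _); apply: Rintegral_split as_ st (il i).
Qed.

Lemma bochner_integrable_cst s t x : bochner_integrable `]s, t[ (fun=> x).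
Proof.
split; first exact: simple_strongly_measurable (fibered_cst x).
have mi (u v : R) : measurable (`]u, v[ : set R) by [].
by rewrite integral_cst// lte_mul_pinfty//; exact: measure_oo_lty.
Qed.

Lemma lebesgue_measure_oo s t : s <= t -> mu `]s, t[ = (t - s)%:E.
Proof.
rewrite lebesgue_measure_itv/= lte_fin le_eqVlt => /predU1P[->|->] //.
by rewrite ltxx subrr.
Qed.

Lemma bochner_cst s t x : s <= t -> bochner `]s, t[ (fun=> x) = (t - s) *: x.
Proof.
move=> st; have mi : measurable (`]s, t[ : set R) by [].
apply: (bochnerE mi (measure_oo_lty s t)).
apply/is_bochner_integralP; split; first exact: simple_strongly_measurable (fibered_cst x).
move=> e e0; exists (fun=> x); split; first exact: (fibered_cst x).
- have -> : simple_integral `]s, t[ (fun=> x) = (t - s) *: x.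
    have := @simple_integral_scalar R X `]s, t[ mi (measure_oo_lty s t) (fun=> 1) x (fibered_cst 1).
    rewrite Rintegral_cst// mul1r (_ : (fun=> 1 *: x) = (fun=> x)); last first.
      by apply/funext => ?; rewrite scale1r.
    move=> ->; congr (_ *: _).
    exact: (congr1 fine (lebesgue_measure_oo st)).
  by rewrite subrr normr0 ltW.
- under eq_integral do rewrite subrr normr0.
  by rewrite integral0 lee_fin ltW.
Qed.

Lemma le_norm_primitive a s t b f x : a <= s -> s <= t -> t <= b -> bochner_integrable `]a, b[ f ->
  ((`|bochner `]a, t[ f - bochner `]a, s[ f - (t - s) *: x|)%:E <=
   \int[mu]_(r in `]s, t[) (`|f r - x|)%:E)%E.
Proof.
move=> as_ st tb If.
have mi (u v : R) : measurable (`]u, v[ : set R) by [].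
have It := bochner_integrable_sub (mi a b) (mi a t) (subset_oo (lexx a) tb) If.
have Ist := bochner_integrable_sub (mi a b) (mi s t) (subset_oo as_ tb) If.
rewrite (bochner_split as_ st It) [_ + bochner `]s, t[ f]addrC addrK -(bochner_cst x st).
rewrite -scaleN1r -bochnerZ//; [|exact: measure_oo_lty|exact: bochner_integrable_cst].
rewrite -bochnerD//; [|exact: measure_oo_lty|]; last first.
  apply: bochner_integrableZ => //; exact: bochner_integrable_cst.
have -> : (fun r => f r + -1 *: x) = (fun r => f r - x) by apply/funext => r; rewrite scaleN1r.
apply: le_norm_bochner => //; first exact: measure_oo_lty.
have := bochner_integrableD (mi s t) Ist (bochner_integrable_cst s t (- x)); exact.
Qed.

(** The finitely many values of each simple function are enumerated through [pickle]; an index that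
    codes no value gets 0. *)
Lemma ae_dense_values (D : set R) f : strongly_measurable D f -> exists xs : nat -> X,
  {ae mu, forall t, D t -> forall e : R, 0 < e -> exists n, `|f t - xs n| <= e}.
Proof.
move=> [s fs sf].
exists (fun m => if unpickle m is Some p then
  nth 0 (finmap.enum_fset (fset_set (range (s (p : nat * nat).1)))) p.2 else 0).
apply: (ae_impl sf) => t h Dt e e0; have {}h := h Dt.
move/cvgrPdist_le : h => /(_ _ e0) h.
have [n hn] := filter_ex h.
exists (pickle (n, index (s n t) (finmap.enum_fset (fset_set (range (s n)))))).
rewrite pickleK/= nth_index// in_fset_set; last by case: (fs n).
by apply/mem_set; exists t.
Qed.

(* The primitives of the countably many scalar functions |f - x_n|, with x_n dense in the
   essential range of f, have the right derivative almost everywhere. *)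
Lemma ae_derive_bochner a b f : bochner_integrable `]a, b[ f ->
  {ae mu, forall t, t \in `]a, b[ -> derivable (fun t => bochner `]a, t[ f) t 1 /\
    derive1 (fun t => bochner `]a, t[ f) t = f t}.
Proof.
move=> If; have [sf _] := If.
have mi (u v : R) : measurable (`]u, v[ : set R) by [].
have [xs hxs] := ae_dense_values sf.
have Ifx n : bochner_integrable `]a, b[ (fun t => f t - xs n).
  exact: (bochner_integrableD (mi a b) If (bochner_integrable_cst a b (- xs n))).
have /choice[N hN] n := strongly_measurable_norm (Ifx n).1.
have mN n : measurable_fun setT (N n) by case: (hN n).
have aN : {ae mu, forall t n, `]a, b[%classic t -> `|f t - xs n| = N n t}.
  by apply: ae_foralln => n; case: (hN n).
have iN n : mu.-integrable `]a, b[ (EFin \o N n).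
  apply/integrableP; split; first by apply/measurable_EFinP; exact: measurable_funTS (mN n).
  apply: le_lt_trans (Ifx n).2; apply: ge0_ae_le_integral => //.
  by apply: (ae_impl aN) => t h tab; rewrite /= h// ger0_norm//; case: (hN n).
have dN : {ae mu, forall t n, t \in `]a, b[ -> forall e : R, 0 < e -> exists2 d : R, 0 < d &
    forall s u, s <= u -> s \in `]a, b[ -> u \in `]a, b[ -> (s = t \/ u = t) -> u - s < d ->
    `|\int[mu]_(x in `]s, u[) N n x - (u - s) * N n t| <= e * (u - s)}.
  by apply: ae_foralln => n; exact: ae_derive_primitive.
apply: (ae_impl3 hxs aN dN) => t h1 h2 h3 tab; apply/derive1_epsP => e e0.
(* One quarter pays for differentiating the primitive of |f - x_n|, two for the distance of x_n from
   f(t), which enters once through that derivative and once directly. *)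
have e40 : 0 < e / 4 by rewrite divr_gt0.
have [n hn] := h1 tab _ e40.
have [d d0 hd] := h3 n tab _ e40.
move: (tab); rewrite in_itv/= => /andP[ta tb].
have key s u : s <= u -> s \in `]a, b[ -> u \in `]a, b[ -> (s = t \/ u = t) -> u - s < d ->
    `|bochner `]a, u[ f - bochner `]a, s[ f - (u - s) *: f t| <= e * (u - s).
  move=> su sab uab sut us.
  have us0 : 0 <= u - s by rewrite subr_ge0.
  have /andP[as_ sb] : a < s < b by move: sab; rewrite in_itv.
  have /andP[au ub] : a < u < b by move: uab; rewrite in_itv.
  have := @le_norm_primitive a s u b f (xs n) (ltW as_) su (ltW ub) If.
  rewrite (@ge0_ae_eq_integral_lower _ _ _ mu `]s, u[ (fun r => (`|f r - xs n|)%:E)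
      (fun r => (`|N n r|)%:E))//; last first.
    apply: (ae_impl aN) => r h rsu; rewrite h ?ger0_norm//; first by case: (hN n).
    exact: subset_oo (ltW as_) (ltW ub) _ rsu.
  rewrite integrable_norm_fin//; last first.
    by apply: integrableS (iN n) => //; exact: subset_oo (ltW as_) (ltW ub).
  rewrite lee_fin => hle.
  have N0 r : 0 <= N n r by case: (hN n).
  have EN : \int[mu]_(r in `]s, u[) `|N n r| = \int[mu]_(r in `]s, u[) N n r.
    by apply: eq_Rintegral => r _; rewrite ger0_norm.
  have := hd s u su sab uab sut us; move/ler_normlP => [_ hI].
  have Nt : N n t <= e / 4 by rewrite -h2.
  rewrite (_ : _ - (u - s) *: f t = (bochner `]a, u[ f - bochner `]a, s[ f - (u - s) *: xs n)
    - (u - s) *: (f t - xs n)); last by rewrite scalerBr opprB addrA subrK.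
  apply: le_trans (ler_normB _ _) _.
  rewrite normrZ (ger0_norm us0).
  have p1 : (u - s) * N n t <= (u - s) * (e / 4) by rewrite ler_wpM2l.
  have p2 : (u - s) * `|f t - xs n| <= (u - s) * (e / 4) by rewrite ler_wpM2l.
  move: hle; rewrite EN => hle.
  have e3 : 0 <= e * (u - s) by rewrite mulr_ge0// ltW.
  by lra.
exists (Num.min d (Num.min (t - a) (b - t))); first by rewrite !lt_min d0 !subr_gt0 ta tb.
move=> s; rewrite !lt_min => /and3P[sd sta sbt].
have sab : s \in `]a, b[.
  by move: sta sbt; rewrite in_itv/= !ltr_norml => /andP[? ?] /andP[? ?]; apply/andP; split; lra.
have [ts|st] := leP t s.
  rewrite (ger0_norm (_ : 0 <= s - t)) ?subr_ge0//; apply: key => //; first by left.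
  by move: sd; rewrite ger0_norm ?subr_ge0.
rewrite (_ : _ - (s - t) *: f t = - (bochner `]a, t[ f - bochner `]a, s[ f - (t - s) *: f t)).
  have st0 : s - t <= 0 by rewrite subr_le0 ltW.
  rewrite normrN (ler0_norm st0) opprB; apply: key => //; [exact: ltW|by right|].
  by move: sd; rewrite ler0_norm// opprB.
by rewrite !opprB -[in LHS](opprB t s) scaleNr opprK addrC.
Qed.

Lemma absolutely_continuous_bochner a b f : bochner_integrable `]a, b[ f ->
  absolutely_continuous a b (fun t => bochner `]a, t[ f).
Proof.
move=> If; have [sf Iff] := If.
have mi (u v : R) : measurable (`]u, v[ : set R) by [].
have [N [mN N0 fN]] := strongly_measurable_norm sf.
have IN : (\int[mu]_(t in `]a, b[) (N t)%:E < +oo)%E.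
  rewrite -(@ge0_ae_eq_integral_lower _ _ _ mu _ (fun t => (`|f t|)%:E))//.
    by move=> t _; rewrite lee_fin.
  by apply: (ae_impl fN) => t h /h ->.
move=> e e0; have e40 : 0 < e / 4 by rewrite divr_gt0.
have [m [m0 hm]] := integral_abs_cont (mi a b) mN N0 IN e40.
pose Q t := Num.max (N t - m) 0.
have Q0 t : 0 <= Q t by rewrite /Q le_max lexx orbT.
have mQ : measurable_fun setT (fun t => (Q t)%:E).
  by apply: measurable_fun_EFin; apply: measurable_maxr => //; mf.
(* On intervals of this total length the part of the norm below level m contributes at most e/4, and
   so does the excess; [m + 1] avoids division by 0. *)
exists (e / 4 / (m + 1)); first by rewrite divr_gt0// ltr_wpDl.
move=> n l r lr tI sd.
have lrab i : `]l i, r i[%classic `<=` `]a, b[%classic.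
  by have [h1 h2 h3] := lr i; exact: subset_oo.
have step i : ((`|bochner `]a, r i[ f - bochner `]a, l i[ f|)%:E <=
    \int[mu]_(t in `]l i, r i[) (Q t)%:E + (m * (r i - l i))%:E)%E.
  have [h1 h2 h3] := lr i.
  have := @le_norm_primitive a (l i) (r i) b f 0 h1 h2 h3 If.
  rewrite scaler0 subr0 => /le_trans; apply.
  apply: (@le_trans _ _ (\int[mu]_(t in `]l i, r i[) ((Q t)%:E + m%:E))%E).
    apply: ge0_ae_le_integral => //.
      by move=> t _; rewrite -EFinD lee_fin addr_ge0.
    apply: (ae_impl fN) => t h tlr; rewrite subr0 h ?lee_fin; last exact: lrab tlr.
    by rewrite -lerBlDr le_max lexx.
  rewrite ge0_integralD//; last 2 first.
  - by move=> t _; rewrite lee_fin.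
  - exact: measurable_funTS.
  apply: leeD => //; rewrite integral_cst//.
  rewrite EFinM; apply: lee_wpmul2l; first by rewrite lee_fin.
  by rewrite le_eqVlt; apply/orP; left; apply/eqP; exact: lebesgue_measure_oo.
have sumQ : (\sum_(i < n) \int[mu]_(t in `]l i, r i[) (Q t)%:E <= (e / 4)%:E)%E.
  apply: le_trans hm.
  have := @ge0_integral_bigsetU _ _ _ mu 'I_n (fun i => `]l i, r i[%classic) (fun t => (Q t)%:E)
    (index_enum 'I_n) (fun i => mi _ _) (index_enum_uniq _).
  rewrite /= => <-; last 3 first.
  - by apply: sub_trivIset tI => i.
  - exact: measurable_funTS.
  - by move=> t _; rewrite lee_fin.
  apply: ge0_subset_integral => //.
  - by apply: bigsetU_measurable.
  - exact: measurable_funTS.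
  - by move=> t _; rewrite lee_fin.
  - by rewrite -bigcup_seq => t [i _ /lrab].
rewrite -lte_fin -sumEFin.
apply: (@le_lt_trans _ _ (\sum_(i < n) (\int[mu]_(t in `]l i, r i[) (Q t)%:E + (m * (r i - l i))%:E))%E).
  by apply: lee_sum => i _.
rewrite big_split/= sumEFin -mulr_sumr.
apply: (@le_lt_trans _ _ ((e / 4)%:E + (e / 4)%:E)%E); last by rewrite -EFinD lte_fin; lra.
apply: leeD => //; rewrite lee_fin.
apply: (@le_trans _ _ (m * (e / 4 / (m + 1)))); first by rewrite ler_wpM2l// ltW.
rewrite mulrCA ger_pMr// ler_pdivrMr ?ltr_wpDl//; lra.
Qed.

Lemma ac_derivable_bochner a b f : bochner_integrable `]a, b[ f ->
  ac_derivable a b (fun t => bochner `]a, t[ f).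
Proof.
move=> If; split; first exact: absolutely_continuous_bochner.
by apply: (ae_impl (ae_derive_bochner If)) => t h tab; have [] := h tab.
Qed.

(** [F] minus the primitive of [g] is absolutely continuous with derivative 0 almost everywhere,
    hence constant by [ac_derive0_const]. *)
Lemma ac_derivable_FTC a b (F g : R -> X) : ac_derivable a b F -> bochner_integrable `]a, b[ g ->
  {ae mu, forall t, t \in `]a, b[ -> derive1 F t = g t} ->
  forall t, a <= t <= b -> F t = F a + bochner `]a, t[ g.
Proof.
move=> [aF dF] Ig Fg t tab; have aG := absolutely_continuous_bochner Ig.
suff D0 : {ae mu, forall t, t \in `]a, b[ -> derivable (fun t => F t - bochner `]a, t[ g) t 1 /\
    derive1 (fun t => F t - bochner `]a, t[ g) t = 0}.
  have := ac_derive0_const (absolutely_continuousB aF aG) D0 tab.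
  by rewrite bochner_oo0 subr0 => <-; rewrite subrK.
apply: (ae_impl3 dF Fg (ae_derive_bochner Ig)) => s h1 h2 h3 sab.
have /derive1_epsP hF : derivable F s 1 /\ derive1 F s = g s by split; [exact: h1|exact: h2].
have /derive1_epsP hG := h3 sab.
apply/derive1_epsP => e e0; have e20 : 0 < e / 2 by rewrite divr_gt0.
have [d d0 hd] := hF _ e20; have [d' d'0 hd'] := hG _ e20.
exists (Num.min d d'); first by rewrite lt_min d0.
move=> r; rewrite lt_min => /andP[rd rd'].
pose u := bochner `]a, r[ g - bochner `]a, s[ g - (r - s) *: g s.
pose v := F r - F s - (r - s) *: g s.
have hv : `|v| <= e / 2 * `|r - s| := hd _ rd.
have hu : `|u| <= e / 2 * `|r - s| := hd' _ rd'.
rewrite (_ : _ - (r - s) *: 0 = v - u).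
  by rewrite (splitr e) mulrDl (le_trans (ler_normB _ _))// lerD.
by rewrite /u /v scaler0 subr0 [RHS]subrACA subrr subr0 subrACA.
Qed.

Lemma bochner_eq0_ae a b g : bochner_integrable `]a, b[ g ->
  (forall t, t \in `]a, b[ -> bochner `]a, t[ g = 0) -> {ae mu, forall t, `]a, b[%classic t -> g t = 0}.
Proof.
move=> Ig g0; apply: (ae_impl (ae_derive_bochner Ig)) => t h tab.
have [_ <-] := h tab.
suff [] : derivable (fun t => bochner `]a, t[ g) t 1 /\ derive1 (fun t => bochner `]a, t[ g) t = 0 by [].
apply/derive1_epsP => e e0.
move: (tab); rewrite /= in_itv/= => /andP[ta tb].
exists (Num.min (t - a) (b - t)); first by rewrite lt_min !subr_gt0 ta.
move=> s; rewrite !lt_min => /andP[sta sbt].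
rewrite !g0//; first by rewrite scaler0 !subr0 normr0 mulr_ge0// ltW.
by move: sta sbt; rewrite in_itv/= !ltr_norml => /andP[? ?] /andP[? ?]; apply/andP; split; lra.
Qed.

End primitive.

Ltac nonneg := repeat match goal with
  | |- is_true (Order.le _ (EFin _)) => rewrite lee_fin
  | |- is_true (Order.le _ (mule _ _)) => apply: mule_ge0
  | |- is_true (Order.le _ (adde _ _)) => apply: adde_ge0
  | |- is_true (Order.le _ (integral _ _ _)) => apply: integral_ge0 => * /=
  | |- is_true (Order.le _ (GRing.mul _ _)) => apply: mulr_ge0
  | |- is_true (Order.le _ (GRing.add _ _)) => apply: addr_ge0
  | |- is_true (Order.le _ (GRing.inv _)) => rewrite invr_ge0
  | |- is_true (Order.le _ (expR _)) => exact: expR_ge0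
  | |- is_true (Order.le _ (powR _ _)) => exact: powR_ge0
  | |- is_true (Order.le _ (Num.norm _)) => exact: normr_ge0
  end; try done; try (apply: ltW; done).

Ltac side := first
  [ done
  | by apply: measurable_funTS; mf
  | by mf
  | by intros; nonneg ].

Section scalar_bochner.
Context {R : realType} {X : completeNormedModType R}.
Local Notation mu := (@lebesgue_measure R).

(** Such a function is a Mikusinski series with a single nonzero term. *)
Lemma bochner_scalar (D : set R) (h : R -> R) (x : X) : measurable D -> (mu D < +oo)%E ->
  measurable_fun setT h -> mu.-integrable D (EFin \o h) ->
  bochner_integrable D (fun t => h t *: x) /\
  bochner D (fun t => h t *: x) = (\int[mu]_(t in D) h t) *: x.
Proof.
move=> mD Doo mh ih.
pose l n : R -> R := if n is 0%N then h else fun=> 0.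
have i0 : mu.-integrable D (EFin \o (fun=> 0)) by exact: integrable0.
have hx : mikusinski D (fun t => h t *: x) l (fun=> x).
  split.
  - by case=> [|n]; [exact: mh|exact: measurable_cst].
  - by case=> [|n]; [exact: ih|exact: i0].
  - apply: (@le_lt_trans _ _ (\int[mu]_(t in D) (`|h t|)%:E * (`|x|)%:E)%E); last first.
      rewrite integrable_norm_fin// -EFinM; exact: ltry.
    apply: lime_le.
      by apply: is_cvg_nneseries => n _ _; rewrite mule_ge0 ?integral_ge0.
    apply: nearW => -[|n]; first by rewrite big_nil mule_ge0 ?integral_ge0.
    rewrite big_nat_recl//= big1 ?adde0// => i _.
    by under eq_integral do rewrite normr0; rewrite integral0 mul0e.
  - apply: aeW => t _; apply: cvg_near_cst; exists 1%N => // -[|n] //= _.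
    by rewrite /series/= big_nat_recl//= big1 ?addr0// => i _; rewrite scale0r.
split; first exact: mikusinski_integrable hx.
have h1 := bochner_mikusinski mD Doo hx.
apply: (@cvg_unique _ (@norm_hausdorff _ X) _ _ _ _ h1).
apply: cvg_near_cst; exists 1%N => // -[|n] //= _.
rewrite /series/= big_nat_recl//= big1 ?addr0// => i _.
by rewrite Rintegral_cst// mul0r scale0r.
Qed.

End scalar_bochner.

(** * Volterra equations with bounded kernel *)

Section volterra.
Context {R : realType}.
Local Notation mu := (@lebesgue_measure R).
Implicit Types (T N c : R) (u v : R -> R) (k : R -> R -> R).

Lemma integral_expR_tail_le c s T : 0 < c ->
  (\int[mu]_(t in `]s, T[) (expR (- (c * t)))%:E <= (expR (- (c * s)) / c)%:E)%E.
Proof.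
move=> c0; apply: (@le_trans _ _ (\int[mu]_(t in `]s, +oo[) (expR (- (c * t)))%:E)%E).
  apply: ge0_subset_integral => //.
  - by apply: measurable_funTS; mf.
  - exact: subset_itvl.
rewrite ge0_integral_shift_oy; [|side..].
rewrite (_ : (fun x => _) = (fun x => (expR (- (c * s)))%:E * (expR (- (c * x)))%:E)%E); last first.
  by apply/funext => x; rewrite -EFinM -expRD mulrDr opprD addrC.
rewrite ge0_integralZl; [|side..].
by rewrite integral_expRM// -EFinM.
Qed.

(** In L^1 with weight exp(-c t) integration has norm at most 1/c. With c = 2 N, a kernel bounded by
    N becomes a contraction of factor 1/2 on any interval. *)
Lemma weighted_volterra_le c T v : 0 < c -> measurable_fun setT v -> (forall t, 0 <= v t) ->
  (\int[mu]_(t in `]0%R, T[) ((expR (- (c * t)))%:E * \int[mu]_(s in `]0%R, t[) (v s)%:E) <=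
   (c^-1)%:E * \int[mu]_(s in `]0%R, T[) (expR (- (c * s)) * v s)%:E)%E.
Proof.
move=> c0 mv v0.
have mF : measurable_fun setT (fun q : R * R => (expR (- (c * q.1)) * v q.2)%:E).
  by apply: measurable_fun_EFin; apply: measurable_funM; [mf|exact: measurableT_comp].
apply: (@le_trans _ _ (\int[mu]_(t in `]0%R, T[) \int[mu]_(s in `]0%R, t[) (expR (- (c * t)) * v s)%:E)%E).
  rewrite le_eqVlt; apply/orP; left; apply/eqP; apply: eq_integral => t _.
  by rewrite -ge0_integralZl; [|side..].
rewrite (@tonelli_triangle _ (fun q : R * R => (expR (- (c * q.1)) * v q.2)%:E) 0 (BLeft T))/=; [|side..].
rewrite -ge0_integralZl; [|side..].
apply: ge0_ae_le_integral => //.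
- by move=> s _; apply: integral_ge0 => t _; rewrite lee_fin mulr_ge0 ?expR_ge0.
- by move=> s _; rewrite lee_fin mulr_ge0 ?invr_ge0 ?(ltW c0)// mulr_ge0 ?expR_ge0.
apply: aeW => s _.
under eq_integral do rewrite EFinM.
rewrite ge0_integralZr; [|side..].
apply: (le_trans (lee_wpmul2r _ (integral_expR_tail_le s T c0))); first by rewrite lee_fin.
by rewrite -!EFinM lee_fin mulrA [c^-1 * _]mulrC.
Qed.

Lemma le_weighted c T v : 0 < c -> measurable_fun setT v -> (forall t, 0 <= v t) ->
  (\int[mu]_(t in `]0%R, T[) (v t)%:E <=
   (expR (c * T))%:E * \int[mu]_(t in `]0%R, T[) (expR (- (c * t)) * v t)%:E)%E /\
  (\int[mu]_(t in `]0%R, T[) (expR (- (c * t)) * v t)%:E <=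
   \int[mu]_(t in `]0%R, T[) (v t)%:E)%E.
Proof.
move=> c0 mv v0; split.
  rewrite -ge0_integralZl; [|side..].
  apply: ge0_ae_le_integral => //.
  - by move=> t _; rewrite lee_fin.
  - by move=> t _; rewrite lee_fin !mulr_ge0 ?expR_ge0.
  apply: aeW => t; rewrite /= in_itv/= => /andP[t0 tT].
  rewrite -EFinM lee_fin mulrA -expRD ler_peMl// -expR0 ler_expR -mulrBr mulr_ge0 ?(ltW c0)//.
  by rewrite subr_ge0 ltW.
apply: ge0_ae_le_integral => //.
- by move=> t _; rewrite lee_fin mulr_ge0 ?expR_ge0.
- by move=> t _; rewrite lee_fin.
apply: aeW => t; rewrite /= in_itv/= => /andP[t0 tT].
rewrite lee_fin ler_piMl// -expR0 ler_expR oppr_le0 mulr_ge0 ?(ltW c0) ?(ltW t0)//.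
Qed.

(** With the weight exp(-2 N t), half of the norm of Y is absorbed into the left side, whence the 2;
    removing the weight costs exp(2 N T). *)
Lemma gronwall_L1 T N (Y b : R -> R) : 0 < N ->
  measurable_fun setT Y -> measurable_fun setT b -> (forall t, 0 <= Y t) -> (forall t, 0 <= b t) ->
  (\int[mu]_(t in `]0%R, T[) (Y t)%:E < +oo)%E ->
  {ae mu, forall t, `]0, T[%classic t ->
    ((Y t)%:E <= (b t)%:E + N%:E * \int[mu]_(s in `]0%R, t[) (Y s)%:E)%E} ->
  (\int[mu]_(t in `]0%R, T[) (Y t)%:E <=
   (2 * expR (2 * N * T))%:E * \int[mu]_(t in `]0%R, T[) (b t)%:E)%E.
Proof.
move=> N0 mY mb Y0 b0 IY hY; have c0 : 0 < 2 * N by rewrite mulr_gt0.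
set c := 2 * N in c0 *.
pose W v := (\int[mu]_(t in `]0%R, T[) (expR (- (c * t)) * v t)%:E)%E.
have [y1 y2] := le_weighted T c0 mY Y0; have [b1 b2] := le_weighted T c0 mb b0.
have W0 v : (forall t, 0 <= v t) -> (0 <= W v)%E.
  by move=> v0; apply: integral_ge0 => t _; rewrite lee_fin mulr_ge0 ?expR_ge0.
have WY : (W Y <= W b + (2^-1)%:E * W Y)%E.
  have mI : measurable_fun setT (fun t : R => \int[mu]_(s in `]0%R, t[) (Y s)%:E)%E.
    apply: (@measurable_integral_between _ _ _ (cst 0) id _ _ (fun p : R * R => (Y p.2)%:E)) => //.
      by apply: measurable_fun_EFin; exact: measurableT_comp.
    by move=> q; rewrite lee_fin.
  have I0 t : (0 <= \int[mu]_(s in `]0%R, t[) (Y s)%:E)%E by apply: integral_ge0 => s _; rewrite lee_fin.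
  apply: (@le_trans _ _ (\int[mu]_(t in `]0%R, T[) ((expR (- (c * t)) * b t)%:E +
     N%:E * ((expR (- (c * t)))%:E * \int[mu]_(s in `]0%R, t[) (Y s)%:E)))%E).
    apply: ge0_ae_le_integral => //.
    - by move=> t _; rewrite lee_fin mulr_ge0 ?expR_ge0.
    - move=> t _; rewrite adde_ge0 ?lee_fin ?mulr_ge0 ?expR_ge0//.
      by rewrite !mule_ge0 ?lee_fin ?expR_ge0 ?(ltW N0).
    apply: (ae_impl hY) => t h tT; have {}h := h tT.
    rewrite EFinM; apply: (le_trans (lee_wpmul2l _ h)); first by rewrite lee_fin expR_ge0.
    rewrite ge0_muleDr ?lee_fin//; last by rewrite mule_ge0 ?lee_fin ?(ltW N0).
    by rewrite -EFinM muleCA.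
  rewrite ge0_integralD//; last 4 first.
  - by move=> t _; rewrite lee_fin mulr_ge0 ?expR_ge0.
  - by apply: measurable_funTS; mf.
  - by move=> t _; rewrite !mule_ge0 ?lee_fin ?expR_ge0 ?(ltW N0).
  - apply: measurable_funTS; apply: emeasurable_funM; first exact: measurable_cst.
    by apply: emeasurable_funM => //; mf.
  apply: leeD2l; rewrite ge0_integralZl//; last 3 first.
  - apply: measurable_funTS; apply: emeasurable_funM => //; mf.
  - by move=> t _; rewrite mule_ge0 ?lee_fin ?expR_ge0.
  - by rewrite lee_fin ltW.
  apply: (le_trans (lee_wpmul2l _ (weighted_volterra_le T c0 mY Y0))); first by rewrite lee_fin ltW.
  rewrite muleA -EFinM (_ : N * c^-1 = 2^-1)// /c.
  by rewrite invfM mulrCA mulfV ?mulr1// gt_eqF.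
(* Absorbing half of [W Y] is legitimate because it is finite. *)
have WYfin : (W Y < +oo)%E by apply: le_lt_trans IY.
have W2 : (W Y <= 2%:E * W b)%E.
  move: WY WYfin; have := W0 _ Y0; have := W0 _ b0.
  case: (W Y) => [y| |] //; case: (W b) => [z| |] //=.
    by rewrite -!EFinM -EFinD !lee_fin => z0 y0' h _; lra.
  by move=> _ _ _ _; rewrite gt0_muley ?leey// lte_fin.
apply: le_trans y1 _.
apply: (@le_trans _ _ ((expR (c * T))%:E * (2%:E * W b))%E).
  by apply: lee_wpmul2l W2; rewrite lee_fin expR_ge0.
rewrite muleA -EFinM [expR _ * 2]mulrC.
by apply: lee_wpmul2l => //; rewrite lee_fin mulr_ge0 ?expR_ge0.
Qed.

Lemma evolterra_bounded_le T N k u t : weakly_singular T 1 N k -> t <= T -> measurable_fun setT u ->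
  (evolterra k u t <= N%:E * \int[mu]_(s in `]0%R, t[) (`|u s|)%:E)%E.
Proof.
move=> [N0 mk kN] tT m.
rewrite /evolterra -ge0_integralZl; [|side..].
apply: ge0_ae_le_integral => //; first by move=> s _; rewrite mule_ge0.
apply: aeW => s /=; rewrite in_itv/= => /andP[s0 st].
rewrite normrM lee_fin ler_wpM2r//.
by have := kN _ _ (ltW s0) st tT; rewrite subrr powRr0 mulr1.
Qed.

(** Each term of the Neumann series has at most half the weighted norm of the one before. The sum is
    defined by an upper limit, which makes it Borel everywhere. *)
Lemma scalar_volterra T N k u : 0 < N -> weakly_singular T 1 N k -> measurable_fun setT u ->
  mu.-integrable `]0, T[ (EFin \o u) ->
  exists w : R -> R, [/\ measurable_fun setT w, mu.-integrable `]0, T[ (EFin \o w),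
    (\int[mu]_(t in `]0%R, T[) (`|w t|)%:E <=
      (2 * expR (2 * N * T))%:E * \int[mu]_(t in `]0%R, T[) (`|u t|)%:E)%E &
    {ae mu, forall t, `]0, T[%classic t -> w t = u t + svolterra k w t}].
Proof.
move=> N0 hk m_u iu; have [_ mk kN] := hk.
have c0 : 0 < 2 * N by rewrite mulr_gt0.
set c := 2 * N in c0 *.
pose W v := (\int[mu]_(t in `]0%R, T[) (expR (- (c * t)) * `|v t|)%:E)%E.
pose d n := iter n (svolterra k) u.
have md n : measurable_fun setT (d n).
  by elim: n => //= n ih; exact: measurable_svolterra.
have Wd n : (W (d n.+1) <= (2^-1)%:E * W (d n))%E.
  apply: (@le_trans _ _ (N%:E * \int[mu]_(t in `]0%R, T[) ((expR (- (c * t)))%:E *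
     \int[mu]_(s in `]0%R, t[) (`|d n s|)%:E))%E).
    rewrite -ge0_integralZl//; last 3 first.
    - apply: measurable_funTS; apply: emeasurable_funM; first by mf.
      apply: (@measurable_integral_between _ _ _ (cst 0) id _ _ (fun p : R * R => (`|d n p.2|)%:E)) => //.
      by apply: measurable_fun_EFin; apply: measurable_fun_normr; exact: measurableT_comp.
    - by move=> t _; rewrite mule_ge0 ?lee_fin ?expR_ge0// integral_ge0.
    - by rewrite lee_fin ltW.
    apply: ge0_ae_le_integral => //.
    - by move=> t _; nonneg.
    apply: aeW => t; rewrite /= in_itv/= => /andP[t0 tT].
    rewrite EFinM muleCA; apply: lee_wpmul2l; first by rewrite lee_fin expR_ge0.
    apply: le_trans (abs_svolterra_le_evolterra _ mk (md n)) _.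
    exact: evolterra_bounded_le (ltW tT) (md n).
  have mn : measurable_fun setT (fun t => `|d n t|) by have := md n => h; mf.
  apply: (le_trans (lee_wpmul2l _ (weighted_volterra_le T c0 mn _))).
  - by rewrite lee_fin ltW.
  - by [].
  rewrite muleA -EFinM (_ : N * c^-1 = 2^-1)// /c.
  by rewrite invfM mulrCA mulfV ?mulr1// gt_eqF.
have mau : measurable_fun setT (fun t => `|u t|) by mf.
have Wu : (W u <= \int[mu]_(t in `]0%R, T[) (`|u t|)%:E)%E.
  by have [_] := le_weighted T c0 mau (fun t => normr_ge0 _).
pose I := \int[mu]_(t in `]0, T[) `|u t|.
have EI : (\int[mu]_(t in `]0%R, T[) (`|u t|)%:E = I%:E)%E by exact: integrable_norm_fin.
have I0 : 0 <= I by exact: Rintegral_ge0.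
have Wn n : (W (d n) <= (I * 2^-1 ^+ n)%:E)%E.
  elim: n => [|n ih]; first by rewrite expr0 mulr1 -EI.
  apply: le_trans (Wd n) _; apply: (le_trans (lee_wpmul2l _ ih)); first by rewrite lee_fin.
  by rewrite -EFinM lee_fin exprS mulrCA.
have In n : (\int[mu]_(t in `]0%R, T[) (`|d n t|)%:E <= (expR (c * T) * I * 2^-1 ^+ n)%:E)%E.
  have mn : measurable_fun setT (fun t => `|d n t|) by have := md n => h; mf.
  have [h _] := le_weighted T c0 mn (fun t => normr_ge0 _).
  apply: (le_trans h); apply: (le_trans (lee_wpmul2l _ (Wn n))); first by rewrite lee_fin expR_ge0.
  by rewrite -EFinM lee_fin mulrA.
pose A := expR (c * T) * I.
have A0 : 0 <= A by rewrite mulr_ge0 ?expR_ge0.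
have cA : series (fun n => A * 2^-1 ^+ n) @ \oo --> A * 2.
  have := @cvg_geometric_series _ A (2^-1 : R); rewrite (_ : (1 - 2^-1)^-1 = 2); last by field.
  by apply; rewrite ger0_norm ?invr_ge0// invf_lt1// ltr1n.
have SI : (\sum_(0 <= n <oo) (\int[mu]_(t in `]0%R, T[) (`|d n t|)%:E * (`|1 : R^o|)%:E) <= (A * 2)%:E)%E.
  apply: (@le_trans _ _ (\sum_(0 <= n <oo) (A * 2^-1 ^+ n)%:E)%E).
    apply: lee_nneseries => n _; first by rewrite mule_ge0 ?integral_ge0// lee_fin.
    by rewrite normr1 mule1; exact: In.
  rewrite (_ : (fun M => \sum_(0 <= n < M) (A * 2^-1 ^+ n)%:E)%E = EFin \o series (fun n => A * 2^-1 ^+ n)).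
    rewrite EFin_lim; last by apply/cvg_ex; exists (A * 2).
    by rewrite lee_fin (cvg_lim _ cA).
  by apply/funext => M; rewrite /= sumEFin.
have id n : mu.-integrable `]0, T[ (EFin \o d n).
  apply/integrableP; split; first by apply/measurable_EFinP; exact: measurable_funTS (md n).
  exact: le_lt_trans (In n) (ltry _).
pose w t := fine (limn_esup (fun n => (series (fun n => d n t) n)%:E)).
have mw : measurable_fun setT w.
  apply: (@measurableT_comp _ _ _ _ _ _ fine) => //.
  apply: measurable_fun_limn_esup => n; apply: measurable_fun_EFin.
  by rewrite /series/=; apply: measurable_sum => i.
(* With all coefficients equal to 1 in [R^o], the scalar series is an instance of the vector
   expansion, so [mikusinski_volterra] carries the kernel through it. *)
have hw : mikusinski `]0, T[ (w : R -> R^o) d (fun=> 1).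
  split => //; first by apply: le_lt_trans SI _; exact: ltry.
  have := ae_normal_convergence (measurable_itv `]0%R, T[) md (le_lt_trans SI (ltry _)).
  move=> /ae_impl; apply => t h tT.
  have cs : cvgn (series (fun n => d n t)).
    apply: normed_cvg; apply: nneseries_cvgn => [n|]; first exact: normr_ge0.
    by have := h tT; under eq_eseriesr do rewrite normr1 mulr1; exact.
  rewrite (_ : (fun n => d n t *: (1 : R^o)) = (fun n => d n t)); last first.
    by apply/funext => n; rewrite /GRing.scale/= mulr1.
  suff -> : w t = limn (series (fun n => d n t)) by exact: cs.
  have cE : (fun n => (series (fun n => d n t) n)%:E) @ \oo --> (limn (series (fun n => d n t)))%:E.
    by apply: cvg_EFin; [exact: nearW|exact: cs].
  by rewrite /w (cvg_limn_einf_sup cE).2.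
have mi : measurable (`]0, T[ : set R) by [].
have iw : mu.-integrable `]0, T[ (EFin \o w).
  apply/integrableP; split; first by apply/measurable_EFinP; exact: measurable_funTS mw.
  by have [_] := mikusinski_integrable mi (measure_oo_lty 0 T) hw.
exists w; split => //.
  apply: (le_trans (mikusinski_norm_le mi hw)); apply: le_trans SI _.
  by rewrite EI -EFinM lee_fin /A mulrC -!mulrA [2 * _]mulrA.
have b01 : 0 < (1 : R) <= 1 by rewrite ltr01 lexx.
have [_ _ _ kw] := mikusinski_volterra hk b01 hw; have [_ _ _ ww] := hw.
apply: (ae_impl2 kw ww) => t h1 h2 tT; have {}h1 := h1 tT; have {}h2 := h2 tT.
have tT' : t <= T by move: tT; rewrite /= in_itv/= => /andP[_ /ltW].
have E : volterra k (w : R -> R^o) t = svolterra k w t.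
  have mkw : measurable_fun setT (fun s => k t s * w s).
    by apply: measurable_funM => //; exact: jmeasurable_comp.
  have ikw : mu.-integrable `]0, t[ (EFin \o (fun s => k t s * w s)).
    apply/integrableP; split; first by apply/measurable_EFinP; exact: measurable_funTS mkw.
    apply: le_lt_trans (evolterra_bounded_le hk tT' mw) _.
    rewrite lte_mul_pinfty// ?lee_fin ?(ltW N0)//.
    have /integrableP[_] := iw; apply: le_lt_trans.
    apply: ge0_subset_integral => //.
    + by apply: measurable_funTS; mf.
    + by move=> s /=; rewrite !in_itv/= => /andP[-> st]; exact: lt_le_trans st tT'.
  have [_ ] := @bochner_scalar R R^o `]0, t[ (fun s => k t s * w s) 1 (measurable_itv _)
    (measure_oo_lty 0 t) mkw ikw.
  rewrite /volterra /svolterra => e; transitivity (bochner `]0, t[ (fun s => (k t s * w s) *: (1 : R^o))).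
    by congr bochner; apply/funext => s; rewrite /GRing.scale/= mulr1.
  by rewrite e /GRing.scale/= mulr1.
rewrite E in h1.
have c1 : series (fun n => d n t) @ \oo --> w t.
  by rewrite (_ : (fun n => d n t) = (fun n => d n t *: (1 : R^o)))//; apply/funext => n; rewrite /GRing.scale/= mulr1.
have c2 : series (fun n => d n.+1 t) @ \oo --> svolterra k w t.
  by rewrite (_ : (fun n => d n.+1 t) = (fun n => d n.+1 t *: (1 : R^o)))//; apply/funext => n; rewrite /GRing.scale/= mulr1.
have c3 : (fun n => series (fun n => d n t) n.+1) @ \oo --> w t by rewrite cvg_shiftS.
apply: (@cvg_unique _ (@Rhausdorff R) _ _ _ _ c3).
rewrite (_ : (fun n => _) = (fun n => u t + series (fun n => d n.+1 t) n)).
  by apply: cvgD => //; exact: cvg_cst.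
by apply/funext => n; rewrite /series/= big_nat_recl.
Qed.

End volterra.

Section vector_volterra.
Context {R : realType} {X : completeNormedModType R}.
Local Notation mu := (@lebesgue_measure R).

(** The equation is solved for each scalar coefficient of the expansion of [g]; the constant in
    [scalar_volterra] is the same for all terms, so the solutions sum up to an expansion of [u]. *)
Lemma vector_volterra (T N : R) k (g : R -> X) : 0 < N -> weakly_singular T 1 N k ->
  bochner_integrable `]0, T[ g -> exists u : R -> X, bochner_integrable `]0, T[ u /\
    {ae mu, forall t, `]0, T[%classic t -> u t = g t + volterra k u t}.
Proof.
move=> N0 hk [sg Ig]; have mi : measurable (`]0, T[ : set R) by [].
have [l [x lx]] := mikusinski_exists mi (measure_oo_lty 0 T) sg Ig.
have [ml il sl lg] := lx.
have /choice[w hw] n := scalar_volterra N0 hk (ml n) (il n).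
have mw n : measurable_fun setT (w n) by case: (hw n).
have iw n : mu.-integrable `]0, T[ (EFin \o w n) by case: (hw n).
have ew : {ae mu, forall t n, `]0, T[%classic t -> w n t = l n t + svolterra k (w n) t}.
  by apply: ae_foralln => n; case: (hw n).
have sw : (\sum_(0 <= n <oo) (\int[mu]_(t in `]0%R, T[) (`|w n t|)%:E * (`|x n|)%:E) < +oo)%E.
  apply: (@le_lt_trans _ _ (\sum_(0 <= n <oo) ((2 * expR (2 * N * T))%:E *
        (\int[mu]_(t in `]0%R, T[) (`|l n t|)%:E * (`|x n|)%:E)))%E).
    apply: lee_nneseries => n _; first by rewrite mule_ge0// integral_ge0.
    by rewrite muleA; apply: lee_wpmul2r => //; case: (hw n).
  rewrite nneseriesZl; last by move=> n _; rewrite mule_ge0// integral_ge0.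
  by rewrite lte_mul_pinfty// lee_fin mulr_ge0// expR_ge0.
pose u t : X := limn (series (fun n => w n t *: x n)).
have hu : mikusinski `]0, T[ u w x.
  split => //; have := ae_normal_convergence mi mw sw.
  move=> /ae_impl; apply => t h tT; rewrite /u.
  have : cvgn (series (fun n => w n t *: x n)); last exact.
  apply: normed_cvg; apply: (@series_le_cvg _ _ (fun n => `|w n t| * `|x n|)) => [n|n|n|] //=.
  - by rewrite normrZ.
  - by apply: nneseries_cvgn (h tT) => n; rewrite mulr_ge0.
exists u; split; first exact: (mikusinski_integrable mi (measure_oo_lty 0 T) hu).
have b01 : 0 < (1 : R) <= 1 by rewrite ltr01 lexx.
have [_ _ _ ku] := mikusinski_volterra hk b01 hu; have [_ _ _ uu] := hu.
have lgku : {ae mu, forall t, `]0, T[%classic t ->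
    series (fun n => l n t *: x n) + series (fun n => svolterra k (w n) t *: x n) @ \oo --> g t + volterra k u t}.
  by apply: (ae_impl2 lg ku) => t h1 h2 tT; exact: cvgD (h1 tT) (h2 tT).
apply: (ae_impl3 lgku uu ew) => t h1 h2 h3 tT.
apply: (@cvg_unique _ (@norm_hausdorff _ X) _ _ _ _ (h2 tT)).
rewrite (_ : series (fun n => w n t *: x n) =
  series (fun n => l n t *: x n) + series (fun n => svolterra k (w n) t *: x n)); first exact: h1.
apply/funext => n; rewrite /series/= -[RHS]big_split/=; apply: eq_bigr => i _.
by rewrite h3// scalerDl.
Qed.

End vector_volterra.

(** * L^p estimates *)

Section jensen.
Context d (S : measurableType d) (R : realType) (m : {measure set S -> \bar R}).
Local Open Scope ereal_scope.

Lemma lee_poweR (r : R) (x y : \bar R) : (0 <= r)%R -> 0 <= x -> x <= y -> x `^ r <= y `^ r.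
Proof.
move=> r0 x0 xy; apply: (gt0_ler_poweR r0) => //; rewrite in_itv/= leey andbT//.
exact: le_trans xy.
Qed.

(* Hoelder's inequality for k f = k^(1 - 1/r) * (k^(1/r) f). *)
Lemma integral_jensen (D : set S) (k f : S -> R) (r : R) : measurable D -> (1 <= r)%R ->
  measurable_fun setT k -> measurable_fun setT f -> (forall x, 0 <= k x)%R -> (forall x, 0 <= f x)%R ->
  (\int[m]_(x in D) (k x * f x)%:E) `^ r <=
  (\int[m]_(x in D) (k x)%:E) `^ (r - 1) * \int[m]_(x in D) (k x * f x `^ r)%:E.
Proof.
move=> mD r1 mk m_f k0 f0.
have I0 : 0 <= \int[m]_(x in D) (k x * f x)%:E.
  by apply: integral_ge0 => x _; rewrite lee_fin mulr_ge0.
have [rE|rn1] := eqVneq r 1%R.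
  rewrite rE subrr poweRe0 mul1e poweRe1//.
  by under [in leRHS]eq_integral do rewrite powRr1//.
have {rn1}r1 : (1 < r)%R by rewrite lt_neqAle eq_sym rn1.
have r0 : (0 < r)%R by exact: lt_trans r1.
pose q := (r / (r - 1))%R.
have q0 : (0 < q)%R by rewrite divr_gt0// subr_gt0.
have qr : (q^-1 + r^-1 = 1)%R by rewrite /q; field; rewrite ?gt_eqF// subr_gt0.
have rn0 : r != 0%R by rewrite gt_eqF.
have qn0 : q != 0%R by rewrite gt_eqF.
pose u x := (k x `^ q^-1 * \1_D x)%R.
pose v x := (k x `^ r^-1 * f x * \1_D x)%R.
have mu' : measurable_fun setT u.
  by apply: measurable_funM; [mf|exact: measurable_indic].
have mv : measurable_fun setT v.
  by apply: measurable_funM; [mf|exact: measurable_indic].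
have E1 : \int[m]_x `|(EFin \o (u \* v)%R) x| = \int[m]_(x in D) (k x * f x)%:E.
  rewrite [RHS]integral_mkcond; apply: eq_integral => x _.
  rewrite patchE /u /v /=; case: ifPn => xD.
    rewrite indicE xD !mulr1 mulrA -powRD; last by rewrite qr oner_eq0.
    by rewrite qr powRr1// ger0_norm ?mulr_ge0.
  by rewrite indicE (negbTE xD) mulr0 mul0r normr0.
have E2 : 'N[m]_q%:E[EFin \o u] `^ q = \int[m]_(x in D) (k x)%:E.
  rewrite poweR_Lnorm// [RHS]integral_mkcond; apply: eq_integral => x _.
  rewrite patchE /u /=; case: ifPn => xD.
    by rewrite indicE xD mulr1 ger0_norm ?powR_ge0// -powRrM mulVf// powRr1.
  by rewrite indicE (negbTE xD) mulr0 normr0 powR0.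
have E3 : 'N[m]_r%:E[EFin \o v] `^ r = \int[m]_(x in D) (k x * f x `^ r)%:E.
  rewrite poweR_Lnorm// [RHS]integral_mkcond; apply: eq_integral => x _.
  rewrite patchE /v /=; case: ifPn => xD.
    rewrite indicE xD mulr1 ger0_norm ?mulr_ge0 ?powR_ge0// powRM ?powR_ge0//.
    by rewrite -powRrM mulVf// powRr1.
  by rewrite indicE (negbTE xD) mulr0 normr0 powR0.
have := hoelder m mu' mv q0 r0 qr; rewrite Lnorm1 E1.
move=> /(lee_poweR (ltW r0) I0) /le_trans; apply.
rewrite poweRM ?Lnorm_ge0// E3 -E2 -poweRrM.
by rewrite (_ : q * (r - 1) = r)%R // /q divfK// gt_eqF// subr_gt0.
Qed.

End jensen.

Section Lp_norm.
Context {R : realType}.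
Local Notation mu := (@lebesgue_measure R).
Implicit Types (T : R) (p : \bar R).

Lemma ae_closed_of_open T (P : R -> Prop) : {ae mu, forall t, `]0, T[%classic t -> P t} ->
  {ae mu, forall t, t \in `[0, T] -> P t}.
Proof.
move=> h.
have h0 (c : R) : {ae mu, forall t, t <> c}.
  exists [set c]; split; [exact: measurable_set1|exact: lebesgue_measure_set1|].
  by move=> t /= /contrapT.
apply: (ae_impl3 h (h0 0) (h0 T)) => t h1 h2 h3; rewrite in_itv/= => /andP[t0 tT].
apply: h1; rewrite /= in_itv/= !lt_neqAle t0 tT !andbT.
by apply/andP; split; apply/eqP => // e; apply: h2.
Qed.

Lemma LpNE (X : normedModType R) T (r : R) (u : R -> X) : 0 < r ->
  LpN T r%:E u = ((\int[mu]_(t in `[0%R, T]) ((`|u t|) `^ r)%:E) `^ r^-1)%E.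
Proof.
move=> r0; rewrite /LpN unlock [in RHS]integral_mkcond; congr (_ `^ _)%E.
apply: eq_integral => t _; rewrite !patchE; case: ifP => _ /=; first by rewrite normr_id.
by rewrite normr0 powR0// gt_eqF.
Qed.

Lemma LpNE_oo (X : normedModType R) T (r : R) (u : R -> X) : 0 < r ->
  LpN T r%:E u = ((\int[mu]_(t in `]0%R, T[) ((`|u t|) `^ r)%:E) `^ r^-1)%E.
Proof.
move=> r0; rewrite LpNE//; congr (_ `^ _)%E.
apply/eqP; rewrite eq_le; apply/andP; split; rewrite integral_mkcond [leRHS]integral_mkcond.
  apply: ge0_ae_le_integral => //; [by move=> t _; rewrite patchE; case: ifP => // _; rewrite lee_fin powR_ge0..|].
  have h0 (c : R) : {ae mu, forall t, t <> c}.
    exists [set c]; split; [exact: measurable_set1|exact: lebesgue_measure_set1|].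
    by move=> t /= /contrapT.
  apply: (ae_impl2 (h0 0) (h0 T)) => t t0 tT _; rewrite !patchE.
  case: ifPn => [|_]; last by case: ifP => // _; rewrite lee_fin powR_ge0.
  rewrite inE/= in_itv/= => /andP[t1 t2]; rewrite mem_set//= in_itv/= !lt_neqAle t1 t2 !andbT.
  by apply/andP; split; apply/eqP => // e; apply: t0.
apply: ge0_ae_le_integral => //; [by move=> t _; rewrite patchE; case: ifP => // _; rewrite lee_fin powR_ge0..|].
apply: aeW => t _; rewrite !patchE; case: ifPn => [|_]; last by case: ifP => // _; rewrite lee_fin powR_ge0.
by rewrite inE/= in_itv/= => /andP[t1 t2]; rewrite mem_set//= in_itv/= !ltW.
Qed.

Lemma lebesgue_measureT_gt0 : (0 < mu setT)%E.
Proof.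
apply: (@lt_le_trans _ _ (mu `]0, 1[)); first by rewrite lebesgue_measure_itv/= lte_fin ltr01 sube0.
by apply: le_measure; rewrite ?inE.
Qed.

Lemma LpNy_leP (X : normedModType R) T (u : R -> X) (B : \bar R) : (0 <= B)%E ->
  (LpN T +oo%E u <= B)%E <-> {ae mu, forall t, `]0, T[%classic t -> ((`|u t|)%:E <= B)%E}.
Proof.
move=> B0; rewrite /LpN unlock lebesgue_measureT_gt0; split.
  move=> /ess_supP /ae_impl; apply => t + tT; rewrite /= patchE mem_set/=; first by rewrite normr_id.
  by move: tT; rewrite /= !in_itv/= => /andP[/ltW-> /ltW].
move=> /ae_closed_of_open h; apply/ess_supP.
apply: (ae_impl h) => t ht; rewrite /= patchE; case: ifPn => tT /=; last by rewrite normr0.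
by rewrite normr_id; apply: ht; move: tT; rewrite inE.
Qed.

Lemma LpN_le_ae (X Y : normedModType R) T p (u : R -> X) (v : R -> Y) : (1 <= p)%E ->
  {ae mu, forall t, `]0, T[%classic t -> `|u t| <= `|v t|} -> (LpN T p u <= LpN T p v)%E.
Proof.
move=> p1 uv; case: p p1 => [r|_|//].
  rewrite lee_fin => r1; have r0 : 0 < r by exact: lt_le_trans r1.
  rewrite !LpNE_oo//; apply: lee_poweR; first by rewrite invr_ge0 ltW.
    by apply: integral_ge0 => t _; rewrite lee_fin powR_ge0.
  apply: ge0_ae_le_integral => //; [by move=> t _; rewrite lee_fin powR_ge0..|].
  apply: (ae_impl uv) => t h tT; rewrite lee_fin ge0_ler_powR ?nnegrE ?(ltW r0)//.
  exact: h.
apply/LpNy_leP; first exact: Lnorm_ge0.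
have /LpNy_leP h : (LpN T +oo%E v <= LpN T +oo%E v)%E by [].
have {}h := h (Lnorm_ge0 _ _ _).
by apply: (ae_impl2 h uv) => t h1 h2 tT; apply: le_trans (h1 tT); rewrite lee_fin h2.
Qed.

(** Minkowski's inequality for Borel versions of the norms; only norms are compared, so the three
    functions may take values in different spaces. *)
Lemma LpN_add_le (X Y Z : normedModType R) T p (u : R -> X) (v : R -> Y) (w : R -> Z) : (1 <= p)%E ->
  strongly_measurable `]0, T[ u -> strongly_measurable `]0, T[ v ->
  {ae mu, forall t, `]0, T[%classic t -> `|w t| <= `|u t| + `|v t|} ->
  (LpN T p w <= LpN T p u + LpN T p v)%E.
Proof.
move=> p1 /strongly_measurable_norm[N [mN N0 uN]] /strongly_measurable_norm[N' [mN' N'0 vN]] wuv.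
pose g : R -> R := N \_ `[0%R, T]; pose g' : R -> R := N' \_ `[0%R, T].
have mg : measurable_fun setT g by apply/(measurable_restrictT _ _).1 => //; exact: measurable_funTS.
have mg' : measurable_fun setT g' by apply/(measurable_restrictT _ _).1 => //; exact: measurable_funTS.
have h := eminkowski mu mg mg' p1.
have eN (X' : normedModType R) (u' : R -> X') (M : R -> R) : (forall t, 0 <= M t) ->
    {ae mu, forall t, `]0, T[%classic t -> `|u' t| = M t} ->
    ('N[mu]_p[EFin \o (M \_ (`[0%R, T] : set R))%R] <= LpN T p u')%E.
  move=> M0 uM; have := @LpN_le_ae R^o X' T p (M : R -> R^o) u' p1.
  rewrite /LpN (_ : (fun t : R => (`|(M : R -> R^o) t|)%:E) \_ `[0, T] = EFin \o (M \_ (`[0%R, T] : set R))).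
    by apply; apply: (ae_impl uM) => t ht tT; rewrite ht// ger0_norm.
  by apply/funext => t; rewrite /= !patchE; case: ifP => _ //; rewrite ger0_norm.
apply: (@le_trans _ _ ('N[mu]_p[EFin \o g] + 'N[mu]_p[EFin \o g'])%E); last first.
  by apply: leeD; exact: eN.
apply: le_trans h.
have -> : ('N[mu]_p[EFin \o (g \+ g')%R] = @LpN R R^o T p (fun t : R => (N t + N' t)%R))%E.
  rewrite /LpN; congr Lnorm; apply/funext => t; rewrite /= /g /g' !patchE; case: ifP => _.
    by rewrite ger0_norm// addr_ge0.
  by rewrite addr0.
apply: LpN_le_ae => //; apply: (ae_impl3 uN vN wuv) => t h1 h2 h3 tT.
by rewrite -h1// -h2// ger0_norm ?addr_ge0//; exact: h3.
Qed.

Lemma LpN_scale (X : normedModType R) T p (c : R) (u : R -> X) : (1 <= p)%E -> 0 <= c ->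
  strongly_measurable `]0, T[ u ->
  (LpN T p (fun t => c *: u t) <= c%:E * LpN T p u)%E.
Proof.
move=> p1 c0 /strongly_measurable_norm[N [mN N0 uN]]; case: p p1 => [r|_|//].
  rewrite lee_fin => r1; have r0 : 0 < r by exact: lt_le_trans r1.
  rewrite !LpNE_oo//.
  rewrite (@ge0_ae_eq_integral_lower _ _ _ mu `]0, T[ (fun t => (`|c *: u t| `^ r)%:E)
    (fun t => (c `^ r)%:E * (N t `^ r)%:E)%E); [|side|side|side|]; last first.
    by apply: (ae_impl uN) => t h tT; rewrite normrZ (ger0_norm c0) h// powRM// EFinM.
  rewrite (@ge0_ae_eq_integral_lower _ _ _ mu `]0, T[ (fun t => (`|u t| `^ r)%:E)
    (fun t => (N t `^ r)%:E)); [|side|side|side|]; last first.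
    by apply: (ae_impl uN) => t h tT; rewrite h.
  rewrite ge0_integralZl; [|side..].
  rewrite poweRM; [|by nonneg..].
  by rewrite poweR_EFin -powRrM mulfV ?gt_eqF// powRr1.
apply/LpNy_leP; first by rewrite mule_ge0// Lnorm_ge0.
have /LpNy_leP h : (LpN T +oo%E u <= LpN T +oo%E u)%E by [].
have {}h := h (Lnorm_ge0 _ _ _).
apply: (ae_impl h) => t h1 tT.
rewrite normrZ (ger0_norm c0) EFinM; apply: lee_wpmul2l; first by rewrite lee_fin.
exact: h1.
Qed.

Lemma LpN_integrable (X : completeNormedModType R) T p (u : R -> X) : (1 <= p)%E ->
  in_Lp T p u -> bochner_integrable `]0, T[ u.
Proof.
move=> p1 [su Lu]; have su' := strongly_measurable_sub (@subset_itv_oo_cc _ _ 0 T) su.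
split => //; have [N [mN N0 uN]] := strongly_measurable_norm su'.
have iN : (\int[mu]_(t in `]0%R, T[) (N t)%:E < +oo)%E -> (\int[mu]_(t in `]0%R, T[) (`|u t|)%:E < +oo)%E.
  apply: le_lt_trans; apply: ge0_ae_le_integral => //; first by move=> t _; rewrite lee_fin.
  by apply: (ae_impl uN) => t h tT; rewrite h.
apply: iN; case: p p1 Lu => [r|_|//].
  rewrite lee_fin => r1; have r0 : 0 < r by exact: lt_le_trans r1.
  rewrite LpNE_oo// => /lty_poweRy; rewrite invr_eq0 gt_eqF// => /(_ isT).
  rewrite (@ge0_ae_eq_integral_lower _ _ _ mu `]0, T[ (fun t => (`|u t| `^ r)%:E)
    (fun t => (N t `^ r)%:E)); [|side|side|side|]; last first.
    by apply: (ae_impl uN) => t h tT; rewrite h.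
  move=> INr; apply: (@le_lt_trans _ _ (\int[mu]_(t in `]0%R, T[) (1%:E + (N t `^ r)%:E))%E).
    apply: ge0_ae_le_integral; [side|side|side|].
    apply: aeW => t _; rewrite -EFinD lee_fin.
    have [N1|N1] := leP (N t) 1; first by rewrite (le_trans N1)// lerDl powR_ge0.
    by rewrite (le_trans (le1r_powR (ltW N1) r1))// lerDr.
  rewrite ge0_integralD; [|side..].
  rewrite lte_add_pinfty// integral_cst// mul1e; exact: measure_oo_lty.
move=> Lu.
have B0 : (0 <= LpN T +oo%E u)%E by exact: Lnorm_ge0.
have /LpNy_leP h : (LpN T +oo%E u <= LpN T +oo%E u)%E by [].
have {}h := h B0; move: h B0 Lu; case: (LpN T +oo%E u) => [B| |]// h B0 _.
apply: (@le_lt_trans _ _ (\int[mu]_(t in `]0%R, T[) B%:E)%E).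
  apply: ge0_ae_le_integral => //; first by move=> t _; rewrite lee_fin.
  by apply: (ae_impl2 h uN) => t h1 h2 tT; rewrite -h2//; exact: h1.
by rewrite integral_cst// lte_mul_pinfty//; exact: measure_oo_lty.
Qed.

Import HBSimple.

Lemma measurable_strongly_measurable (D : set R) (f : R -> R) : measurable_fun setT f ->
  @strongly_measurable R R^o D f.
Proof.
move=> mf; have [g hg] := @approximation_sfun _ (measurableTypeR R) R (EFin \o f) setT measurableT
  ((measurable_EFinP _ _).2 mf).
exists (fun n => g n : R -> R^o); first by move=> n; exact: fibered_sfun.
apply: aeW => t _; have := hg t I.
by move=> /fine_cvgP[_].
Qed.

(** Schur's test with one bound for rows and columns. For finite exponent r, Jensen's inequality in
    s gives A^(r-1) from the rows, and Tonelli's theorem one more A from the columns; for exponent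
    +oo the rows suffice. *)
Lemma LpN_schur T p (A : R) (k : R -> R -> R) (f F : R -> R) : (1 <= p)%E -> 0 < A ->
  jmeasurable k -> (forall t s, 0 <= k t s) -> measurable_fun setT f -> (forall t, 0 <= f t) ->
  (forall t, `]0, T[%classic t -> (\int[mu]_(s in `]0%R, T[) (k t s)%:E <= A%:E)%E) ->
  (forall s, `]0, T[%classic s -> (\int[mu]_(t in `]0%R, T[) (k t s)%:E <= A%:E)%E) ->
  {ae mu, forall t, `]0, T[%classic t ->
     ((`|F t|)%:E <= \int[mu]_(s in `]0%R, T[) (k t s * f s)%:E)%E} ->
  (LpN T p (F : R -> R^o) <= A%:E * LpN T p (f : R -> R^o))%E.
Proof.
move=> p1 A0 mk k0 m_f f0 kt ks hF; case: p p1 => [r|_|//].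
  rewrite lee_fin => r1; have r0 : 0 < r by exact: lt_le_trans r1.
  have rn0 : r != 0 by rewrite gt_eqF.
  have mkt t : measurable_fun setT (k t) by exact: jmeasurable_comp.
  rewrite !LpNE_oo//.
  have -> : A%:E = ((A `^ r)%:E `^ r^-1)%E by rewrite poweR_EFin -powRrM mulfV// powRr1// ltW.
  rewrite -poweRM; [|by nonneg|by nonneg].
  apply: lee_poweR; [by rewrite invr_ge0 ltW|by nonneg|].
  apply: (@le_trans _ _ (\int[mu]_(t in `]0%R, T[) ((A `^ (r - 1))%:E *
      \int[mu]_(s in `]0%R, T[) (k t s * f s `^ r)%:E))%E).
    apply: ge0_ae_le_integral; [side|side|side|].
    apply: (ae_impl hF) => t h tT; rewrite -poweR_EFin.
    apply: (le_trans (lee_poweR (ltW r0) _ (h tT))); first by rewrite lee_fin.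
    apply: (le_trans (@integral_jensen _ _ _ mu `]0, T[ (k t) f r _ r1 (mkt t) m_f (k0 t) f0)) => //.
    apply: lee_wpmul2r; first by nonneg.
    rewrite -poweR_EFin; apply: lee_poweR; [by rewrite subr_ge0|by nonneg|exact: kt].
  have mkf : measurable_fun setT (fun q : R * R => (k q.1 q.2 * f q.2 `^ r)%:E).
    apply: measurable_fun_EFin; apply: measurable_funM => //.
    by apply: measurable_fun_powR; exact: measurableT_comp.
  have mI : measurable_fun setT (fun t : R => \int[mu]_(s in `]0%R, T[) (k t s * f s `^ r)%:E)%E.
    apply: (@measurable_integral_between _ _ _ (cst 0) (cst T) _ _
      (fun q : R * R => (k q.1 q.2 * f q.2 `^ r)%:E)) => //.
    by move=> q; nonneg.
  rewrite ge0_integralZl//; last 3 first.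
  - exact: measurable_funTS.
  - by move=> t _; nonneg.
  - by nonneg.
  have -> : (\int[mu]_(t in `]0%R, T[) \int[mu]_(s in `]0%R, T[) (k t s * f s `^ r)%:E =
      \int[mu]_(s in `]0%R, T[) \int[mu]_(t in `]0%R, T[) (k t s * f s `^ r)%:E)%E.
    pose G q := ((fun q : R * R => (k q.1 q.2 * f q.2 `^ r)%:E) \_ (`]0, T[ `*` `]0, T[)) q : \bar R.
    have mG : measurable_fun setT G.
      by apply/(measurable_restrictT _ _).1; [exact: measurableX|exact: measurable_funTS].
    have G0 q : (0 <= G q)%E by rewrite /G patchE; case: ifP => // _; nonneg.
    have e1 : (\int[mu]_x \int[mu]_y G (x, y) =
        \int[mu]_(t in `]0%R, T[) \int[mu]_(s in `]0%R, T[) (k t s * f s `^ r)%:E)%E.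
      rewrite [RHS]integral_mkcond; apply: eq_integral => t _; rewrite patchE; case: ifPn => tT.
        rewrite [RHS]integral_mkcond; apply: eq_integral => s _; rewrite /G !patchE.
        by rewrite in_setX/= tT.
      by rewrite integral0_eq// => s _; rewrite /G patchE in_setX/= (negbTE tT).
    have e2 : (\int[mu]_y \int[mu]_x G (x, y) =
        \int[mu]_(s in `]0%R, T[) \int[mu]_(t in `]0%R, T[) (k t s * f s `^ r)%:E)%E.
      rewrite [RHS]integral_mkcond; apply: eq_integral => s _; rewrite patchE; case: ifPn => sT.
        rewrite [RHS]integral_mkcond; apply: eq_integral => t _; rewrite /G !patchE.
        by rewrite in_setX/= sT andbT.
      by rewrite integral0_eq// => t _; rewrite /G patchE in_setX/= (negbTE sT) andbF.
    exact: etrans (esym e1) (etrans (@fubini_tonelli _ _ _ _ _ mu mu G mG G0) e2).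
  apply: (@le_trans _ _ ((A `^ (r - 1))%:E * \int[mu]_(s in `]0%R, T[) (A%:E * (`|f s| `^ r)%:E))%E).
    apply: lee_wpmul2l; first by nonneg.
    apply: ge0_ae_le_integral; [side|side|side|].
    apply: aeW => s sT; under eq_integral do rewrite EFinM.
    rewrite ge0_integralZr//; last 3 first.
    - by apply: measurable_funTS; apply: measurable_fun_EFin; exact: jmeasurable_comp.
    - by move=> t _; rewrite lee_fin.
    - by nonneg.
    rewrite (ger0_norm (f0 s)); apply: lee_wpmul2r; first by nonneg.
    exact: ks.
  rewrite ge0_integralZl; [|side..].
  rewrite muleA -EFinM -[X in (_ * X)%:E](powRr1 (ltW A0)) -powRD ?subrK ?(negbTE rn0)//.
apply/LpNy_leP; first by rewrite mule_ge0 ?lee_fin ?(ltW A0)// Lnorm_ge0.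
have B0 : (0 <= LpN T +oo%E (f : R -> R^o))%E by exact: Lnorm_ge0.
have /LpNy_leP h : (LpN T +oo%E (f : R -> R^o) <= LpN T +oo%E (f : R -> R^o))%E by [].
have {}h := h B0; move: h B0; case: (LpN T +oo%E (f : R -> R^o)) => [B| |]// h B0; last first.
  by apply: aeW => t _; rewrite gt0_muley ?leey// lte_fin.
apply: (ae_impl hF) => t ht tT; apply: (le_trans (ht tT)).
rewrite lee_fin in B0.
apply: (@le_trans _ _ (\int[mu]_(s in `]0%R, T[) (k t s * B)%:E)%E).
  apply: ge0_ae_le_integral; [side|side|side|].
  apply: (ae_impl h) => s hs sT; rewrite lee_fin ler_wpM2l//.
  by have := hs sT; rewrite lee_fin ger0_norm.
under eq_integral do rewrite EFinM.
rewrite ge0_integralZr//; last 2 first.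
- by apply: measurable_funTS; apply: measurable_fun_EFin; exact: jmeasurable_comp.
- by move=> s _; rewrite lee_fin.
by apply: lee_wpmul2r; [rewrite lee_fin|exact: kt].
Qed.

(** Gronwall's inequality in L^1 bounds the integral of |y| by K times that of b, so |y| <= b + N K
    times a number. The number is the action of the constant kernel N K on b, which Schur's test
    bounds by N K T for every p. *)
Lemma apriori_bound (X : completeNormedModType R) T p (N : R) (y : R -> X) (b : R -> R) :
  0 < T -> (1 <= p)%E -> 0 < N -> bochner_integrable `]0, T[ y ->
  measurable_fun setT b -> (forall t, 0 <= b t) ->
  {ae mu, forall t, `]0, T[%classic t ->
    ((`|y t|)%:E <= (b t)%:E + N%:E * \int[mu]_(s in `]0%R, t[) (`|y s|)%:E)%E} ->
  (LpN T p y <= (1 + 2 * (N * T) * expR (2 * (N * T)))%:E * LpN T p (b : R -> R^o))%E.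
Proof.
move=> T0 p1 N0 [sy Iy] mb b0 hy.
set K := 2 * expR (2 * (N * T)).
have K0 : 0 < K by rewrite mulr_gt0 ?expR_gt0.
have -> : 1 + 2 * (N * T) * expR (2 * (N * T)) = 1 + N * K * T by rewrite /K; ring.
have cst0 : 0 < 1 + N * K * T by rewrite ltr_wpDr// !mulr_ge0// ltW.
(* An infinite right side is disposed of first, so that [b] is integrable in what follows. *)
have [Lb|Lb] := ltP (LpN T p (b : R -> R^o)) +oo%E; last first.
  have -> : LpN T p (b : R -> R^o) = +oo%E by apply/eqP; rewrite -leye_eq.
  by rewrite gt0_muley ?leey// lte_fin.
have sb (D : set R) := @measurable_strongly_measurable D b mb.
have [_ Ib] := @LpN_integrable R^o T p b p1 (conj (sb _) Lb).
have EI : (\int[mu]_(t in `]0%R, T[) (`|(b : R -> R^o) t|)%:E = \int[mu]_(t in `]0%R, T[) (b t)%:E)%E.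
  by apply: eq_integral => t _; rewrite ger0_norm.
rewrite EI in Ib.
have [Y [mY Y0 yY]] := strongly_measurable_norm sy.
have IY : (\int[mu]_(t in `]0%R, T[) (Y t)%:E < +oo)%E.
  apply: le_lt_trans Iy; apply: ge0_ae_le_integral; [side|side|side|].
  by apply: (ae_impl yY) => t h tT; rewrite h.
have eY t : t <= T -> (\int[mu]_(s in `]0%R, t[) (`|y s|)%:E = \int[mu]_(s in `]0%R, t[) (Y s)%:E)%E.
  move=> tT; apply: ge0_ae_eq_integral_lower; [side|side|side|].
  apply: (ae_impl yY) => s h st; rewrite h//.
  exact: subset_oo (lexx 0) tT _ st.
have hY : {ae mu, forall t, `]0, T[%classic t ->
    ((Y t)%:E <= (b t)%:E + N%:E * \int[mu]_(s in `]0%R, t[) (Y s)%:E)%E}.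
  apply: (ae_impl2 hy yY) => t h1 h2 tT; rewrite -h2// -eY; first exact: h1.
  by move: tT; rewrite /= in_itv/= => /andP[_ /ltW].
have := gronwall_L1 N0 mY mb Y0 b0 IY hY; rewrite -[2 * N * T]mulrA -/K => YK.
pose J := fine (\int[mu]_(t in `]0%R, T[) (b t)%:E).
have EJ : (\int[mu]_(t in `]0%R, T[) (b t)%:E = J%:E)%E.
  by rewrite fineK// ge0_fin_numE// integral_ge0// => t _; rewrite lee_fin.
have J0 : 0 <= J by rewrite fine_ge0// integral_ge0// => t _; rewrite lee_fin.
apply: (@le_trans _ _ (LpN T p (b : R -> R^o) + LpN T p (cst (N * K * J)%R : R -> R^o))%E).
  apply: LpN_add_le => //; first exact: measurable_strongly_measurable.
  apply: (ae_impl2 hy yY) => t h1 h2 tT; have {}h1 := h1 tT.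
  rewrite -lee_fin (le_trans h1)// EFinD (ger0_norm (b0 t)) ger0_norm; last first.
    by rewrite !mulr_ge0// ltW.
  apply: leeD2l; rewrite -mulrA EFinM; apply: lee_wpmul2l; first by rewrite lee_fin ltW.
  have tT' : t <= T by move: tT; rewrite /= in_itv/= => /andP[_ /ltW].
  rewrite eY// EFinM -EJ; apply: le_trans YK.
  apply: ge0_subset_integral => //; [by apply: measurable_funTS; mf|by move=> s _; rewrite lee_fin|].
  exact: subset_oo.
rewrite EFinD ge0_muleDl ?lee_fin ?mulr_ge0 ?(ltW N0) ?(ltW K0) ?(ltW T0)// mul1e.
apply: leeD2l.
have Ic : (\int[mu]_(s in `]0%R, T[) (N * K)%:E <= (N * K * T)%:E)%E.
  rewrite integral_cst// [leRHS]EFinM; apply: lee_wpmul2l.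
    by rewrite lee_fin mulr_ge0 ?(ltW N0) ?(ltW K0).
  by rewrite -[T in leRHS]subr0 le_eqVlt; apply/orP; left; apply/eqP;
    exact: lebesgue_measure_oo (ltW T0).
apply: (@LpN_schur T p (N * K * T) (fun _ _ => N * K) b) => //.
- by rewrite mulr_gt0// mulr_gt0.
- exact: measurable_cst.
- by move=> _ _; rewrite mulr_ge0 ?(ltW N0) ?(ltW K0).
- apply: aeW => t tT; rewrite ger0_norm ?mulr_ge0 ?(ltW N0) ?(ltW K0)//.
  under eq_integral do rewrite EFinM.
  rewrite ge0_integralZl; [|side|side|side|by rewrite lee_fin mulr_ge0 ?(ltW N0) ?(ltW K0)].
  by rewrite EFinM EJ.
Qed.

End Lp_norm.

(** If [f] has no Bochner integral, neither has its nonzero multiple, and both sides are the default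
    value 0. The constants in front of the operators can thus be moved at every t. *)
Lemma bochner_scale {R : realType} {X : completeNormedModType R} (D : set R) (f : R -> X) (c : R) : measurable D -> (lebesgue_measure D < +oo)%E -> c != 0 ->
  bochner D (fun t => c *: f t) = c *: bochner D f.
Proof.
move=> mD Doo c0.
have sc (f1 : R -> X) (d : R) (v1 : X) : is_bochner_integral D f1 v1 -> is_bochner_integral D (fun t => d *: f1 t) (d *: v1).
  move=> /is_bochner_integralP[sf hf]; apply/is_bochner_integralP; split.
    exact: strongly_measurableZ.
  exact: bochner_approxZ.
have [[v hv]|nv] := pselect (exists v, is_bochner_integral D f v).
  by rewrite (bochnerE mD Doo hv); apply: bochnerE => //; exact: sc.
have no (f1 : R -> X) : ~ (exists v, is_bochner_integral D f1 v) -> bochner D f1 = 0.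
  by move=> nf; rewrite /bochner; apply: xgetPN => v hv; apply: nf; exists v.
have nv' : ~ (exists v, is_bochner_integral D (fun t => c *: f t) v).
  move=> [v hv]; apply: nv; exists (c^-1 *: v).
  have e : (fun t => c^-1 *: (c *: f t)) = f.
    by apply/funext => t; rewrite scalerA mulVf// scale1r.
  by rewrite -e; exact: (sc (fun t => c *: f t) c^-1 v hv).
by rewrite (no f nv) (no _ nv') scaler0.
Qed.

Local Opaque bochner Gamma.

(** * Fractional integrals *)

Section power_segment.
Context {R : realType}.
Local Notation mu := (@lebesgue_measure R).

Lemma integral_powR_segment (b x y : R) : b != 0 -> 0 < x -> x < y ->
  (\int[mu]_(r in `[x, y]) (r `^ (b - 1))%:E = (y `^ b / b - x `^ b / b)%:E)%E.
Proof.
move=> b0 x0 xy; rewrite (@continuous_FTC2 _ _ (fun r => r `^ b / b))//.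
- apply: continuous_in_subspaceT => r; rewrite inE/= in_itv/= => /andP[nx _].
  by apply: continuous_powR_gt0; apply: lt_le_trans nx.
- split.
  + move=> r; rewrite in_itv/= => /andP[nx _].
    have [d _] := is_derive1_powR b (lt_trans x0 nx).
    by apply: derivableM; [exact: d|exact: derivable_cst].
  + by apply: cvg_at_right_filter; apply: cvgMl; exact: continuous_powR_gt0.
  + by apply: cvg_at_left_filter; apply: cvgMl; apply: continuous_powR_gt0; exact: lt_trans xy.
- move=> r; rewrite in_itv/= => /andP[nx _].
  have [d e] := is_derive1_powR b (lt_trans x0 nx).
  rewrite derive1E deriveMr//; last first.
  by rewrite e /GRing.scale/=; field.
Qed.

(** Away from the singularity negative [b] is allowed; [psik_primitive] takes [b = a - 1]. *)
Lemma integral_powR_shift (b s x y : R) : b != 0 -> s < x -> x < y ->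
  (\int[mu]_(r in `]x, y[) ((r - s) `^ (b - 1))%:E =
   ((y - s) `^ b / b - (x - s) `^ b / b)%:E)%E.
Proof.
move=> b0 sx xy.
have sx0 : 0 < x - s by rewrite subr_gt0.
have xys : x - s < y - s by rewrite ltrD2r.
rewrite -(integral_powR_segment b0 sx0 xys).
rewrite -integral_itv_bndo_bndc; last by apply: measurable_funTS; mf.
rewrite -integral_itv_obnd_cbnd; last by apply: measurable_funTS; mf.
rewrite (@ge0_integral_affine_set _ _ _ 1 s)//; last 2 first.
- by mf.
- by move=> r; rewrite lee_fin powR_ge0.
rewrite mul1e; under eq_integral do rewrite mul1r addrK.
congr (integral _ _ _); apply/seteqP; split => r /=; rewrite !in_itv/= mul1r; lra.
Qed.

End power_segment.

Section fractional_kernels.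
Context {R : realType}.
Local Notation mu := (@lebesgue_measure R).
Implicit Types (a b s t T : R).

Definition rl_kernel b (t s : R) := (Gamma b)^-1 * (t - s) `^ (b - 1).

Lemma rl_kernel1 t s : rl_kernel 1 t s = 1.
Proof. by rewrite /rl_kernel Gamma1 subrr powRr0 invr1 mulr1. Qed.

Lemma itv01_le2 a : 0 < a <= 1 -> 0 < a <= 2.
Proof. by move=> /andP[-> a1]; rewrite (le_trans a1)// ler1n. Qed.

Lemma invGamma_ge0 b : 0 < b <= 2 -> 0 <= (Gamma b)^-1.
Proof. by move=> b1; rewrite invr_ge0 ltW// Gamma_gt0. Qed.

Lemma weakly_singular_rl_kernel T b : 0 < b <= 1 -> weakly_singular T b (Gamma b)^-1 (rl_kernel b).
Proof.
move=> b1; split; first by rewrite invGamma_ge0// itv01_le2.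
  by rewrite /jmeasurable /rl_kernel; mf.
by move=> s t s0 st tT; rewrite /rl_kernel ger0_norm// mulr_ge0 ?powR_ge0// invGamma_ge0// itv01_le2.
Qed.

Lemma weakly_singular_mono T b C D k : weakly_singular T b C k -> C <= D -> weakly_singular T b D k.
Proof.
move=> [C0 mk kC] CD; split=> //; first exact: le_trans CD.
move=> s t s0 st tT; apply: le_trans (kC s t s0 st tT) _.
by rewrite ler_wpM2r// powR_ge0.
Qed.

Lemma kcomp_rl_kernel a b s t : 0 < a <= 1 -> 0 < b <= 1 -> s < t ->
  kcomp (rl_kernel a) (rl_kernel b) t s = (t - s) `^ (a + b - 1) / Gamma (a + b).
Proof.
move=> a1 b1 st; rewrite /kcomp /rl_kernel.
transitivity (\int[mu]_(r in `]s, t[) ((Gamma a)^-1 * (Gamma b)^-1 * ((t - r) `^ (a - 1) * (r - s) `^ (b - 1)))).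
  by apply: eq_Rintegral => r _; rewrite mulrACA.
rewrite Rintegral_scalel//; last by apply: measurable_funTS; mf.
rewrite /Rintegral integral_pow_conv//= [b + a]addrC.
have ga : Gamma a != 0 by rewrite gt_eqF// Gamma_gt0// itv01_le2.
have gb : Gamma b != 0 by rewrite gt_eqF// Gamma_gt0// itv01_le2.
have gab : Gamma (a + b) != 0 by rewrite gt_eqF// Gamma_gt0//; lra.
move: (Gamma a) (Gamma b) (Gamma (a + b)) ((t - s) `^ (a + b - 1)) ga gb gab => x y z p x0 y0 z0.
by field; rewrite x0 y0 z0.
Qed.

Lemma kcomp_congr (l l' k k' : R -> R -> R) s t :
  (forall r, s < r < t -> l t r = l' t r) -> (forall r, s < r < t -> k r s = k' r s) ->
  kcomp l k t s = kcomp l' k' t s.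
Proof.
move=> hl hk; apply: eq_Rintegral => r; rewrite inE/= in_itv/= => srt.
by rewrite hl// hk.
Qed.

End fractional_kernels.

Section fractional_operators.
Context {R : realType} {X : completeNormedModType R}.
Local Notation mu := (@lebesgue_measure R).
Implicit Types (a b s t T : R) (f g v w : R -> X).

Lemma RL_integralE b f t : 0 < b <= 1 -> RL_integral b f t = volterra (rl_kernel b) f t.
Proof.
move=> b1; rewrite /RL_integral /volterra.
have mt : measurable (`]0, t[ : set R) by [].
have g0 : (Gamma b)^-1 != 0 by rewrite invr_eq0 gt_eqF// Gamma_gt0// itv01_le2.
apply: etrans (esym (bochner_scale _ mt (measure_oo_lty 0 t) g0)) _.
by apply: (bochner_ae mt); apply: aeW => s _; exact: scalerA.
Qed.

Lemma volterra_ae T k k' f g t : t <= T -> {ae mu, forall s, `]0, T[%classic s -> s < t -> k t s = k' t s} ->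
  {ae mu, forall s, `]0, T[%classic s -> f s = g s} -> volterra k f t = volterra k' g t.
Proof.
move=> tT kk fg; apply: (bochner_ae (measurable_itv _)); apply: (ae_impl2 kk fg) => s h1 h2 st.
have sT : `]0, T[%classic s by exact: subset_oo (lexx 0) tT _ st.
by rewrite h1// ?h2//; move: st; rewrite /= in_itv/= => /andP[].
Qed.

Lemma volterra_rl_kernel1 f t : volterra (rl_kernel 1) f t = bochner `]0, t[ f.
Proof. by apply: (bochner_ae (measurable_itv _)); apply: aeW => s _; rewrite rl_kernel1 scale1r. Qed.

Lemma bochner_empty a t f : t <= a -> bochner `]a, t[ f = 0.
Proof.
move=> ta; have -> : `]a, t[%classic = `]a, a[%classic :> set R.
  by rewrite !set_itv_ge// bnd_simp ?ltxx// -leNgt.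
exact: bochner_oo0.
Qed.

Lemma bochner_oo_zero a t : bochner `]a, t[ (fun=> 0 : X) = 0.
Proof.
have [at_|/ltW ta] := leP a t; last exact: bochner_empty.
by rewrite bochner_cst// scaler0.
Qed.

Lemma volterra_nonpos k f t : t <= 0 -> volterra k f t = 0.
Proof.
exact: bochner_empty.
Qed.

Lemma volterra_zero k t : volterra k (fun=> 0 : X) t = 0.
Proof.
have mt : measurable (`]0, t[ : set R) by [].
apply: etrans (bochner_oo_zero 0 t).
by apply: (bochner_ae mt); apply: aeW => s _; rewrite scaler0.
Qed.

Lemma bochner_integrableB (D : set R) f g : measurable D -> bochner_integrable D f ->
  bochner_integrable D g -> bochner_integrable D (fun t => f t - g t).
Proof.
move=> mD If Ig; have := bochner_integrableD mD If (bochner_integrableZ mD (-1) Ig).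
by congr bochner_integrable; apply/funext => t; rewrite scaleN1r.
Qed.

Lemma bochnerB (D : set R) f g : measurable D -> (mu D < +oo)%E -> bochner_integrable D f ->
  bochner_integrable D g -> bochner D (fun t => f t - g t) = bochner D f - bochner D g.
Proof.
move=> mD Doo If Ig; have Ig' := bochner_integrableZ mD (-1) Ig.
rewrite -[in RHS]scaleN1r -(bochnerZ mD Doo _ Ig) -(bochnerD mD Doo If Ig').
by apply: (bochner_ae mD); apply: aeW => t _; rewrite scaleN1r.
Qed.

Lemma volterraB_bounded T C k f g t : weakly_singular T 1 C k -> t <= T ->
  bochner_integrable `]0, T[ f -> bochner_integrable `]0, T[ g ->
  volterra k (fun t => f t - g t) t = volterra k f t - volterra k g t.
Proof.
move=> hk tT If Ig; have mt : measurable (`]0, t[ : set R) by [].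
rewrite /volterra -(bochnerB mt (measure_oo_lty 0 t) (integrable_bounded_kernel hk tT If)
  (integrable_bounded_kernel hk tT Ig)).
by apply: (bochner_ae mt); apply: aeW => s _; rewrite scalerBr.
Qed.

Lemma ae_volterraB T b C k f g : weakly_singular T b C k -> 0 < b <= 1 ->
  bochner_integrable `]0, T[ f -> bochner_integrable `]0, T[ g ->
  {ae mu, forall t, `]0, T[%classic t -> volterra k (fun t => f t - g t) t = volterra k f t - volterra k g t}.
Proof.
move=> hk b1 If Ig.
apply: (ae_impl2 (ae_integrable_kernel hk b1 If) (ae_integrable_kernel hk b1 Ig)) => t h1 h2 tT.
have mt : measurable (`]0, t[ : set R) by [].
rewrite /volterra -(bochnerB mt (measure_oo_lty 0 t) (h1 tT) (h2 tT)).
by apply: (bochner_ae mt); apply: aeW => s _; rewrite scalerBr.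
Qed.

Lemma volterra_rl_kernel_rl_kernel1 T b f t : 0 < b < 1 -> t <= T -> bochner_integrable `]0, T[ f ->
  volterra (rl_kernel b) (volterra (rl_kernel (1 - b)) f) t = bochner `]0, t[ f.
Proof.
move=> b1 tT If; rewrite -volterra_rl_kernel1.
have h1 : 0 < b <= 1 by lra.
have h2 : 0 < 1 - b <= 1 by lra.
have h12 : 1 <= b + (1 - b) by lra.
rewrite (volterra_comp (weakly_singular_rl_kernel T h1) (weakly_singular_rl_kernel T h2) h1 h2 h12 tT If).
apply: (@volterra_ae T) tT _ (aeW _ (fun _ _ => erefl)).
apply: aeW => s _ st; rewrite (kcomp_rl_kernel h1 h2 st).
by rewrite subrKC subrr powRr0 Gamma1 rl_kernel1 divr1.
Qed.

(** Applying J^(1-b) shows that the primitive of the difference vanishes at every t, and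
    differentiating it gives 0 almost everywhere. *)
Lemma fractional_injective T b f g : 0 < b < 1 -> bochner_integrable `]0, T[ f ->
  bochner_integrable `]0, T[ g ->
  {ae mu, forall t, `]0, T[%classic t -> volterra (rl_kernel b) f t = volterra (rl_kernel b) g t} ->
  {ae mu, forall t, `]0, T[%classic t -> f t = g t}.
Proof.
move=> b1 If Ig fg.
have Iw := bochner_integrableB (measurable_itv _) If Ig.
have b1' : 0 < 1 - b < 1 by lra.
have jw : {ae mu, forall t, `]0, T[%classic t -> volterra (rl_kernel b) (fun t => f t - g t) t = 0}.
  have b1'' : 0 < b <= 1 by lra.
  apply: (ae_impl2 fg (ae_volterraB (weakly_singular_rl_kernel T b1'') b1'' If Ig)) => t h1 h2 tT.
  by rewrite (h2 tT) (h1 tT) subrr.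
suff : {ae mu, forall t, `]0, T[%classic t -> f t - g t = 0}.
  by move=> /ae_impl; apply => t h tT; apply/eqP; rewrite -subr_eq0 h.
apply: (bochner_eq0_ae Iw) => t; rewrite in_itv/= => /andP[t0 /ltW tT].
have := @volterra_rl_kernel_rl_kernel1 T (1 - b) _ t b1' tT Iw; rewrite subKr => <-.
apply: etrans (volterra_zero (rl_kernel (1 - b)) t); apply: (@volterra_ae T) tT (aeW _ (fun _ _ _ => erefl)) jw.
Qed.

End fractional_operators.

Lemma ae_eq_integral_lower {d} {T : measurableType d} {R : realType}
    (m : {measure set T -> \bar R}) (D : set T) (f g : T -> \bar R) : measurable D ->
  {ae m, forall x, D x -> f x = g x} -> (\int[m]_(x in D) f x = \int[m]_(x in D) g x)%E.
Proof.
move=> mD fg; rewrite integralE [RHS]integralE.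
congr (_ - _)%E; apply: ge0_ae_eq_integral_lower => //; apply: filterS fg => x h Dx.
  by rewrite !funeposE (h Dx).
by rewrite !funenegE (h Dx).
Qed.

Lemma ae_eq_Rintegral {R : realType} (D : set R) (f g : R -> R) : measurable D ->
  {ae @lebesgue_measure R, forall x, D x -> f x = g x} ->
  \int[@lebesgue_measure R]_(x in D) f x = \int[@lebesgue_measure R]_(x in D) g x.
Proof.
move=> mD fg; rewrite /Rintegral.
rewrite (@ae_eq_integral_lower _ _ _ (@lebesgue_measure R) D (EFin \o f) (EFin \o g) mD)//.
by apply: (ae_impl fg) => x h Dx; rewrite /= (h Dx).
Qed.

Lemma derive1_subcst {R : realType} (f : R -> R) (c t : R) :
  derive1 (fun t => f t - c) t = derive1 f t.
Proof.
rewrite /derive1; set F := (X in X @ _); set G := (X in _ = lim (X @ _)).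
suff -> : F = G by [].
by apply/funext => x; rewrite /F /G; congr (_ *: _); lra.
Qed.

Lemma powR_subr2 {R : realType} (x a : R) : 0 < x -> x `^ (a - 2) = x `^ (a - 1) * x^-1.
Proof.
move=> x0; rewrite -[x^-1]powR_inv1 ?ltW// -powRD; last by rewrite (gt_eqF x0) implybT.
by congr (_ `^ _); lra.
Qed.

Lemma kcomp_rl_kernelC {R : realType} (a b s t : R) : 0 < a <= 1 -> 0 < b <= 1 -> s < t ->
  kcomp (rl_kernel a) (rl_kernel b) t s = kcomp (rl_kernel b) (rl_kernel a) t s.
Proof.
by move=> a1 b1 st; rewrite (kcomp_rl_kernel a1 b1 st) [RHS](kcomp_rl_kernel b1 a1 st) (addrC b a).
Qed.

Fact abel_kernel_algebra {R : comRingType} (x y u w p : R) :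
  y * u * (x * w * (1 + p)) = y * u * (x * w) + x * (y * u * (w * p)).
Proof. ring. Qed.

(** * The Abel operator *)

Section abel_kernels.
Context {R : realType}.
Local Notation mu := (@lebesgue_measure R).
Implicit Types (a b s t T M : R) (h kap : R -> R -> R).

(** What the equation needs to know of K_0 at a fixed parameter. The bound on [h] holds everywhere,
    the relation to [kap] for almost every s only, because the L^oo bound on the derivative
    determines it up to null sets. *)
Definition regular_kernel T M kap h := [/\ 0 <= M, jmeasurable h, forall t s, `|h t s| <= M &
  {ae mu, forall s, `]0, T[%classic s ->
    (forall t, s <= t <= T -> kap t s = 1 + \int[mu]_(r in `]s, t[) h r s) /\
    {ae mu, forall t, `]s, T[%classic t -> derive1 (fun t => kap t s) t = h t s}}].

Definition kprimitive h t s := \int[mu]_(r in `]s, t[) h r s.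

(* If h is the t-derivative of K_0 then 1 + kprimitive h = K_0, abel_kernel is
   the kernel of the Abel operator, dpsik is the t-derivative of psik, and
   abel_Lh is abel_L written in terms of h alone. *)
Definition psik a h t s := (t - s) `^ (a - 1) * kprimitive h t s.

Definition dpsik a h t s :=
  (a - 1) * (t - s) `^ (a - 2) * kprimitive h t s + (t - s) `^ (a - 1) * h t s.

Definition abel_kernel a h t s := rl_kernel a t s * (1 + kprimitive h t s).

Definition abel_Lh a h t s := - (Gamma a)^-1 * kcomp (rl_kernel (1 - a)) (dpsik a h) t s.

Lemma kprimitiveE h t s : kprimitive h t s = kcomp (rl_kernel 1) h t s.
Proof. by apply: eq_Rintegral => r _; rewrite rl_kernel1 mul1r. Qed.

Lemma jmeasurable_kprimitive h : jmeasurable h -> jmeasurable (kprimitive h).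
Proof.
move=> mh; rewrite (_ : kprimitive h = kcomp (rl_kernel 1) h).
  by apply: jmeasurable_kcomp => //; rewrite /jmeasurable /rl_kernel; mf.
by apply/funext => t; apply/funext => s; exact: kprimitiveE.
Qed.

Lemma integrable_bounded_oo (f : R -> R) M s t : measurable_fun setT f ->
  (forall r, `|f r| <= M) -> mu.-integrable `]s, t[ (EFin \o f).
Proof.
move=> m fM; apply/integrableP; split; first by apply/measurable_EFinP; exact: measurable_funTS.
apply: (@le_lt_trans _ _ (\int[mu]_(r in `]s, t[) M%:E)%E).
  have M0 : 0 <= M by exact: le_trans (fM 0).
  apply: ge0_ae_le_integral; [side|side|side|]; apply: aeW => r _.
  by rewrite /= lee_fin.
have M0 : 0 <= M by exact: le_trans (fM 0).
by rewrite integral_cst// lte_mul_pinfty// ?lee_fin//; exact: measure_oo_lty.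
Qed.

Lemma le_norm_Rintegral_oo (f : R -> R) M s t : measurable_fun setT f ->
  (forall r, `|f r| <= M) -> s <= t -> `|\int[mu]_(r in `]s, t[) f r| <= M * (t - s).
Proof.
move=> m fM st; have fi := integrable_bounded_oo s t m fM.
rewrite -lee_fin; apply: (@le_trans _ _ (\int[mu]_(r in `]s, t[) (`|f r|)%:E)%E).
  by rewrite integrable_norm_fin// lee_fin; exact: le_normr_Rintegral.
apply: (@le_trans _ _ (\int[mu]_(r in `]s, t[) M%:E)%E).
  have M0 : 0 <= M by exact: le_trans (fM 0).
  apply: ge0_ae_le_integral; [side|side|side|]; apply: aeW => r _.
  by rewrite /= lee_fin.
have M0 : 0 <= M by exact: le_trans (fM 0).
rewrite integral_cst// EFinM; apply: lee_wpmul2l; first by rewrite lee_fin.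
by rewrite le_eqVlt; apply/orP; left; apply/eqP; exact: lebesgue_measure_oo.
Qed.

Variables (T M a : R) (h : R -> R -> R).
Hypotheses (a01 : 0 < a < 1) (mh : jmeasurable h) (hM : forall t s, `|h t s| <= M).

Let M0 : 0 <= M.
Proof. exact: le_trans (hM 0 0). Qed.

Let mhs s : measurable_fun setT (h^~ s).
Proof. by apply: jmeasurable_comp. Qed.

Lemma kprimitive_le s t : s <= t -> `|kprimitive h t s| <= M * (t - s).
Proof. by move=> st; apply: le_norm_Rintegral_oo. Qed.

Let a1 : 0 < a <= 1. Proof. by case/andP: a01 => -> /ltW. Qed.
Let a1' : 0 < 1 - a <= 1. Proof. by case/andP: a01 => ? ?; apply/andP; split; lra. Qed.

Lemma weakly_singular_abel_kernel : weakly_singular T a ((Gamma a)^-1 * (1 + M * `|T|)) (abel_kernel a h).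
Proof.
have [g0 mj jC] := weakly_singular_rl_kernel T a1.
split; first by rewrite mulr_ge0// addr_ge0// mulr_ge0.
  rewrite /jmeasurable /abel_kernel; apply: measurable_funM; first exact: mj.
  by apply: measurable_funD => //; exact: jmeasurable_kprimitive.
move=> s t s0 st tT; rewrite normrM [leRHS]mulrAC; apply: ler_pM => //; first exact: jC.
apply: le_trans (ler_normD _ _) _; rewrite normr1 lerD2l.
apply: le_trans (kprimitive_le (ltW st)) _; rewrite ler_wpM2l//.
by rewrite (le_trans _ (ler_norm T))//; lra.
Qed.

Lemma jmeasurable_dpsik : jmeasurable (dpsik a h).
Proof.
rewrite /jmeasurable /dpsik; apply: measurable_funD; apply: measurable_funM.
- by mf.
- exact: jmeasurable_kprimitive.
- by mf.
- exact: mh.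
Qed.

(** [kprimitive h] is at most M (t - s), which lowers the singularity (t - s)^(a-2) by one power. *)
Lemma weakly_singular_dpsik : weakly_singular T a (2 * M) (dpsik a h).
Proof.
split; [by rewrite mulr_ge0|exact: jmeasurable_dpsik|].
move=> s t s0 st tT; have ts0 : 0 < t - s by rewrite subr_gt0.
have -> : 2 * M * (t - s) `^ (a - 1) = M * (t - s) `^ (a - 1) + M * (t - s) `^ (a - 1) by ring.
apply: le_trans (ler_normD _ _) _; apply: lerD.
  rewrite !normrM (ger0_norm (powR_ge0 _ _)).
  have -> : M * (t - s) `^ (a - 1) = 1 * (t - s) `^ (a - 2) * (M * (t - s)).
    rewrite (powR_subr2 _ ts0) mul1r -mulrA mulrC; congr (_ * _).
    by rewrite mulrCA mulVf ?mulr1 ?gt_eqF.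
  apply: ler_pM => //; last exact: kprimitive_le (ltW st).
    by rewrite mulr_ge0 ?powR_ge0.
  by rewrite ler_wpM2r ?powR_ge0// ler0_norm; case/andP: a01 => ? ?; lra.
by rewrite normrM (ger0_norm (powR_ge0 _ _)) mulrC ler_wpM2r ?powR_ge0.
Qed.

(** Integration by parts through Fubini: (t - s)^(a-2) alone is not integrable at s, but writing
    [kprimitive] as an integral and swapping leaves powers integrated away from s. *)
Lemma psik_primitive s t : s < t -> kcomp (rl_kernel 1) (dpsik a h) t s = psik a h t s.
Proof.
move=> st; have an0 : a - 1 != 0 by rewrite subr_eq0; case/andP: a01 => _ /lt_eqF ->.
have ts0 : 0 < t - s by rewrite subr_gt0.
have m1 : measurable_fun setT (fun q : R * R => (a - 1) * (q.1 - s) `^ (a - 2) * h q.2 s).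
  apply: measurable_funM; first by mf.
  exact: jmeasurable_comp.
(* The value at r of the integrated power is integrable in r near s, which justifies Fubini
   below. *)
have inner r : s < r -> r < t -> (\int[mu]_(x in `]r, t[) (`|a - 1| * (x - s) `^ (a - 2))%:E <=
    ((r - s) `^ (a - 1))%:E)%E.
  move=> sr rt; under eq_integral do rewrite EFinM.
  rewrite ge0_integralZl; [|side..].
  have -> : a - 2 = (a - 1) - 1 by lra.
  rewrite integral_powR_shift// -EFinM lee_fin ler0_norm ?subr_le0; last by case/andP: a01 => _ /ltW.
  apply: (@le_trans _ _ ((r - s) `^ (a - 1) - (t - s) `^ (a - 1))); last by rewrite gerBl powR_ge0.
  by rewrite le_eqVlt; apply/orP; left; apply/eqP; field.
have Ifin : (\int[mu]_(x in `]s, t[) \int[mu]_(y in `]s, x[)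
    (`|(a - 1) * (x - s) `^ (a - 2) * h y s|)%:E < +oo)%E.
  rewrite (@tonelli_triangle _ (fun q : R * R => (`|(a - 1) * (q.1 - s) `^ (a - 2) * h q.2 s|)%:E) s (BLeft t))/=; [|by mf|by side].
  apply: (@le_lt_trans _ _ (\int[mu]_(r in `]s, t[) (M%:E * ((r - s) `^ (a - 1))%:E))%E).
    apply: ge0_ae_le_integral; [side|side|side|].
    apply: aeW => r; rewrite /= in_itv/= => /andP[sr rt].
    apply: le_trans (lee_wpmul2l _ (inner r sr rt)); last by rewrite lee_fin.
    rewrite -ge0_integralZl; [|side..].
    apply: ge0_ae_le_integral; [side|side|side|]; apply: aeW => x _.
    rewrite -EFinM lee_fin !normrM (ger0_norm (powR_ge0 _ _)) mulrC ler_wpM2r//.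
    by rewrite mulr_ge0 ?powR_ge0.
  rewrite ge0_integralZl; [|side..].
  by rewrite integral_pow_left// -?EFinM ?ltry//; case/andP: a01.
rewrite /psik /kprimitive; transitivity (\int[mu]_(r in `]s, t[)
   ((a - 1) * (r - s) `^ (a - 2) * kprimitive h r s + (r - s) `^ (a - 1) * h r s)).
  by apply: eq_Rintegral => r _; rewrite rl_kernel1 mul1r.
have i1 : mu.-integrable `]s, t[ (EFin \o (fun r => (a - 1) * (r - s) `^ (a - 2) * kprimitive h r s)).
  apply/integrableP; split.
    apply/measurable_EFinP; apply: measurable_funTS; apply: measurable_funM; first by mf.
    by apply: jmeasurable_comp => //; exact: jmeasurable_kprimitive.
  apply: le_lt_trans Ifin; apply: ge0_ae_le_integral; [side|side|side|].
  apply: aeW => r; rewrite /= in_itv/= => /andP[sr rt].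
  rewrite normrM EFinM; under eq_integral do rewrite normrM EFinM.
  rewrite ge0_integralZl; [|side|by apply: measurable_funTS; have := mhs s => mhs'; mf|side..].
  apply: lee_wpmul2l; first by rewrite lee_fin.
  have ih := integrable_bounded_oo s r (mhs s) (hM^~ s).
  by rewrite integrable_norm_fin// lee_fin; exact: le_normr_Rintegral.
have i2 : mu.-integrable `]s, t[ (EFin \o (fun r => (r - s) `^ (a - 1) * h r s)).
  apply/integrableP; split.
    by apply/measurable_EFinP; apply: measurable_funTS; apply: measurable_funM; [mf|exact: mhs].
  apply: (@le_lt_trans _ _ (\int[mu]_(r in `]s, t[) (M%:E * ((r - s) `^ (a - 1))%:E))%E).
    apply: ge0_ae_le_integral; [side|side|side|].
    apply: aeW => r _; rewrite /= -EFinM lee_fin normrM (ger0_norm (powR_ge0 _ _)) mulrC.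
    by rewrite ler_wpM2r ?powR_ge0.
  rewrite ge0_integralZl; [|side..].
  by rewrite integral_pow_left// -?EFinM ?ltry//; case/andP: a01.
rewrite RintegralD//.
have -> : \int[mu]_(r in `]s, t[) ((a - 1) * (r - s) `^ (a - 2) * kprimitive h r s) =
    \int[mu]_(r in `]s, t[) (((t - s) `^ (a - 1) - (r - s) `^ (a - 1)) * h r s).
  transitivity (\int[mu]_(x in `]s, t[) \int[mu]_(y in `]s, x[) ((a - 1) * (x - s) `^ (a - 2) * h y s)).
    by apply: eq_Rintegral => r _; rewrite -Rintegral_scalel//; exact: measurable_funTS.
  rewrite (@fubini_triangle _ (fun q : R * R => (a - 1) * (q.1 - s) `^ (a - 2) * h q.2 s) s (BLeft t))//=.
  apply: eq_Rintegral => r; rewrite inE/= in_itv/= => /andP[sr rt].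
  transitivity (h r s * \int[mu]_(x in `]r, t[) ((a - 1) * (x - s) `^ (a - 2))).
    rewrite -Rintegral_scalel//; last by apply: measurable_funTS; mf.
    by apply: eq_Rintegral => x _; rewrite mulrC.
  rewrite mulrC; congr (_ * _).
  rewrite Rintegral_scalel//; last by apply: measurable_funTS; mf.
  rewrite /Rintegral (_ : a - 2 = (a - 1) - 1); last by lra.
  by rewrite integral_powR_shift//=; field.
transitivity (\int[mu]_(r in `]s, t[) ((t - s) `^ (a - 1) * h r s - (r - s) `^ (a - 1) * h r s) +
   \int[mu]_(r in `]s, t[) ((r - s) `^ (a - 1) * h r s)).
  by congr (_ + _); apply: eq_Rintegral => r _; rewrite mulrBl.
have i3 : mu.-integrable `]s, t[ (EFin \o (fun r => (t - s) `^ (a - 1) * h r s)).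
  apply: (@integrable_bounded_oo _ ((t - s) `^ (a - 1) * M)).
    by apply: measurable_funM => //; exact: mhs.
  by move=> r; rewrite normrM (ger0_norm (powR_ge0 _ _)) ler_wpM2l ?powR_ge0.
by rewrite RintegralB// subrK Rintegral_scalel//; exact: measurable_funTS.
Qed.

(** The Beta integral produces Gamma(a) Gamma(1 - a), which cancels the two normalising factors;
    hence a bound free of a. *)
Lemma weakly_singular_abel_Lh : weakly_singular T 1 (2 * M) (abel_Lh a h).
Proof.
have b1 : 1 <= 1 - a + a by rewrite subrK.
have [C0 mk kC] := weakly_singular_kcomp (weakly_singular_rl_kernel T a1') weakly_singular_dpsik a1' a1 b1.
have g0 : 0 <= (Gamma a)^-1 by rewrite invGamma_ge0// itv01_le2.
split; first by rewrite mulr_ge0.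
  by rewrite /jmeasurable /abel_Lh; apply: measurable_funM => //; exact: mk.
move=> s t s0 st tT; rewrite /abel_Lh normrM normrN (ger0_norm g0).
apply: (le_trans (ler_wpM2l g0 (kC s t s0 st tT))).
rewrite /conv_cst [a + (1 - a)]subrKC Gamma1 divr1 subrr powRr0 !mulr1 powRr0 mulr1.
have ga : Gamma a != 0 by rewrite gt_eqF// Gamma_gt0// itv01_le2.
have gb : Gamma (1 - a) != 0 by rewrite gt_eqF// Gamma_gt0// itv01_le2.
move: (Gamma a) (Gamma (1 - a)) ga gb => x y x0 y0.
by rewrite le_eqVlt; apply/orP; left; apply/eqP; field; rewrite x0 y0.
Qed.

(* The kernel of J^(1-a) A_a is that of J^1 (1 - B_a). *)
Lemma abel_kernel_identity s t : 0 <= s -> s < t -> t <= T ->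
  kcomp (rl_kernel (1 - a)) (abel_kernel a h) t s = 1 - kcomp (rl_kernel 1) (abel_Lh a h) t s.
Proof.
move=> s0 st tT; have one1 : 0 < (1 : R) <= 1 by rewrite ltr01 lexx.
have /andP[a0 a1lt] := a01.
have b1a : 1 <= 1 + a by lra.
have b11 : 1 <= 1 - a + 1 by lra.
have b11' : 1 <= 1 + (1 - a) by lra.
have mL : measurable_fun setT (fun r => (abel_Lh a h) r s).
  by have [_ mk _] := weakly_singular_abel_Lh; exact: jmeasurable_comp.
(* By associativity both sides are reduced to [dpsik] under a composition of the kernels of J^1 and
   J^(1-a), in opposite orders; these commute. *)
have E1 : kcomp (rl_kernel 1) (abel_Lh a h) t s =
    - (Gamma a)^-1 * kcomp (kcomp (rl_kernel 1) (rl_kernel (1 - a))) (dpsik a h) t s.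
  rewrite -(kcomp_assoc (weakly_singular_rl_kernel T one1) (weakly_singular_rl_kernel T a1') weakly_singular_dpsik one1 a1' a1 b11' s0 st tT).
  have mk : measurable_fun setT (fun r => kcomp (rl_kernel (1 - a)) (dpsik a h) r s).
    have [_ m1 _] := weakly_singular_rl_kernel T a1'; have [_ m2 _] := weakly_singular_dpsik.
    by apply: jmeasurable_comp => //; exact: jmeasurable_kcomp.
  rewrite /kcomp -Rintegral_scalel//; last first.
    apply: measurable_funTS; apply: measurable_funM; last exact: mk.
    by rewrite /rl_kernel; mf.
  by apply: eq_Rintegral => r _; rewrite mulrCA.
have E2 : kcomp (rl_kernel (1 - a)) (abel_kernel a h) t s =
   kcomp (rl_kernel (1 - a)) (rl_kernel a) t s +
   (Gamma a)^-1 * kcomp (kcomp (rl_kernel (1 - a)) (rl_kernel 1)) (dpsik a h) t s.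
  rewrite -(kcomp_assoc (weakly_singular_rl_kernel T a1') (weakly_singular_rl_kernel T one1) weakly_singular_dpsik a1' one1 a1 b11 s0 st tT).
  have [_ mj _] := weakly_singular_rl_kernel T a1'; have [_ mj1 _] := weakly_singular_rl_kernel T one1; have [_ md _] := weakly_singular_dpsik.
  have [_ mja _] := weakly_singular_rl_kernel T a1.
  have mk : measurable_fun setT (fun r => rl_kernel (1 - a) t r * kcomp (rl_kernel 1) (dpsik a h) r s).
    apply: measurable_funM; first by rewrite /rl_kernel; mf.
    by apply: jmeasurable_comp => //; exact: jmeasurable_kcomp.
  rewrite [X in _ + _ * X]/kcomp -Rintegral_scalel//; last exact: measurable_funTS.
  have b1 : 1 <= 1 - a + a by rewrite subrK.
  have ij : mu.-integrable `]s, t[ (EFin \o (fun r => rl_kernel (1 - a) t r * rl_kernel a r s)).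
    apply/integrableP; split.
      apply/measurable_EFinP; apply: measurable_funTS; apply: measurable_funM.
        by rewrite /rl_kernel; mf.
      by rewrite /rl_kernel; mf.
    exact: le_lt_trans (integral_weakly_singular_comp (weakly_singular_rl_kernel T a1') (weakly_singular_rl_kernel T a1) a1' a1 b1 s0 st tT) (ltry _).
  have [C0 mc cC] := weakly_singular_kcomp (weakly_singular_rl_kernel T one1) weakly_singular_dpsik one1 a1 b1a.
  have ip : mu.-integrable `]s, t[ (EFin \o (fun r => (Gamma a)^-1 *
      (rl_kernel (1 - a) t r * kcomp (rl_kernel 1) (dpsik a h) r s))).
    apply: (@integrableZl _ _ _ mu _ (measurable_itv _) (Gamma a)^-1
      (EFin \o (fun r => rl_kernel (1 - a) t r * kcomp (rl_kernel 1) (dpsik a h) r s))).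
    apply/integrableP; split; first by apply/measurable_EFinP; exact: measurable_funTS.
    exact: le_lt_trans (integral_weakly_singular_comp (weakly_singular_rl_kernel T a1') (weakly_singular_kcomp (weakly_singular_rl_kernel T one1) weakly_singular_dpsik one1 a1 b1a)
      a1' one1 b11 s0 st tT) (ltry _).
  rewrite /kcomp.
  transitivity (\int[mu]_(r in `]s, t[) (rl_kernel (1 - a) t r * rl_kernel a r s + (Gamma a)^-1 *
      (rl_kernel (1 - a) t r * kcomp (rl_kernel 1) (dpsik a h) r s))); last by rewrite (RintegralD _ ij ip).
  apply: eq_Rintegral => r; rewrite inE/= in_itv/= => /andP[sr rt].
  rewrite (psik_primitive sr) /abel_kernel /psik /rl_kernel.
  exact: abel_kernel_algebra.
rewrite E1 E2 (kcomp_rl_kernel a1' a1 st) subrK subrr powRr0 Gamma1 divr1 mulNr opprK.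
apply: (congr1 (fun x => 1 + (Gamma a)^-1 * x)).
apply: kcomp_congr => [r /andP[sr rt]|r _]; last by [].
exact: kcomp_rl_kernelC.
Qed.

End abel_kernels.

Section abel_operators.
Context {R : realType} {X : completeNormedModType R}.
Local Notation mu := (@lebesgue_measure R).
Variables (T M a : R) (kap h : R -> R -> R).
Hypotheses (a01 : 0 < a < 1) (rk : regular_kernel T M kap h).
Implicit Types (v : R -> X) (s t : R).

Let a1 : 0 < a <= 1. Proof. by case/andP: a01 => -> /ltW. Qed.
Let a1' : 0 < 1 - a <= 1. Proof. by case/andP: a01 => ? ?; apply/andP; split; lra. Qed.
Let mh : jmeasurable h. Proof. by have [] := rk. Qed.
Let hM : forall t s, `|h t s| <= M. Proof. by have [] := rk. Qed.

Lemma abel_opE v t : t <= T -> abel_op a kap v t = volterra (abel_kernel a h) v t.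
Proof.
move=> tT; have [_ _ _ hs] := rk; rewrite /abel_op.
have mt : measurable (`]0, t[ : set R) by [].
have g0 : (Gamma a)^-1 != 0 by rewrite invr_eq0 gt_eqF// Gamma_gt0// itv01_le2.
apply: etrans (esym (bochner_scale _ mt (measure_oo_lty 0 t) g0)) _.
apply: (bochner_ae mt); apply: (ae_impl hs) => s h1 st.
have [h2 _] := h1 (subset_oo (lexx 0) tT st).
have st' : s < t by move: st; rewrite /= in_itv/= => /andP[].
rewrite scalerA h2 ?(ltW st')// /abel_kernel /kprimitive /rl_kernel -powRN opprB mulrA mulrAC.
by rewrite -[LHS]/(_ *: _); congr (_ *: _); rewrite mulrAC.
Qed.

(** The reflection formula turns sin(pi a) / pi into 1 / (Gamma(a) Gamma(1 - a)), whose second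
    factor belongs to the kernel of J^(1-a). *)
Lemma abel_LE : {ae mu, forall s, `]0, T[%classic s ->
  forall t, s < t <= T -> abel_L a kap t s = abel_Lh a h t s}.
Proof.
have [_ _ _ hs] := rk; apply: (ae_impl hs) => s h1 sT t /andP[st tT].
have [h2 h3] := h1 sT.
have ss : kap s s = 1.
  have [s0 sT'] : 0 < s /\ s < T by move: sT; rewrite /= in_itv/= => /andP.
  by rewrite h2 ?lexx ?ltW// set_itvoo0 Rintegral_set0 addr0.
have g0 : Gamma a != 0 by rewrite gt_eqF// Gamma_gt0// itv01_le2.
have g0' : Gamma (1 - a) != 0 by rewrite gt_eqF// Gamma_gt0// itv01_le2.
have sinE : sin (pi * a) / pi = (Gamma a)^-1 * (Gamma (1 - a))^-1.
  by rewrite -invfM Gamma_reflection// invf_div.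
rewrite /abel_L sinE /abel_Lh mulNr [in RHS]mulNr -mulrA; congr (- (_ * _)).
have [_ mj _] := weakly_singular_rl_kernel T a1'; have [_ md _] := weakly_singular_dpsik T a01 mh hM.
have mk : measurable_fun setT (fun r : R => (t - r) `^ (- a) * dpsik a h r s).
  by apply: measurable_funM; [mf|exact: jmeasurable_comp].
transitivity ((Gamma (1 - a))^-1 * \int[mu]_(r in `]s, t[) ((t - r) `^ (- a) * dpsik a h r s)); last first.
  rewrite -Rintegral_scalel//; last exact: measurable_funTS.
  apply: eq_Rintegral => r _; rewrite /rl_kernel mulrA; congr (_ * _ `^ _ * _).
  by rewrite addrAC subrr add0r.
congr (_ * _); apply: (ae_eq_Rintegral (measurable_itv _)).
apply: (ae_impl h3) => r h4 rst.
have [sr rt] : s < r /\ r < t by move: rst; rewrite /= in_itv/= => /andP.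
have rs0 : 0 < r - s by rewrite subr_gt0.
have rT : `]s, T[%classic r by rewrite /= in_itv/= sr (lt_le_trans rt tT).
rewrite -mulrA; congr (_ * _).
have dE : derive1 (fun t' => abel_H kap t' s) r = h r s.
  by rewrite -(h4 rT); exact: derive1_subcst.
have sT2 : s <= r <= T by rewrite (ltW sr) ltW// (lt_le_trans rt tT).
have HE : abel_H kap r s = kprimitive h r s by rewrite /abel_H ss (h2 r sT2) addrC addKr.
rewrite dE HE /dpsik mulrDr; congr (_ + _).
rewrite (powR_subr2 _ rs0) !mulrA; congr (_ / _ * _); exact: mulrC.
Qed.

Lemma abel_BE v t : t <= T -> abel_B a kap v t = volterra (abel_Lh a h) v t.
Proof.
move=> tT; apply: (bochner_ae (measurable_itv _)); apply: (ae_impl abel_LE) => s h1 st.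
have st' : s < t by move: st; rewrite /= in_itv/= => /andP[].
by rewrite (h1 (subset_oo (lexx 0) tT st))// st' tT.
Qed.

Lemma RL_abel_kernel v t : bochner_integrable `]0, T[ v -> t <= T ->
  volterra (rl_kernel (1 - a)) (volterra (abel_kernel a h) v) t =
  bochner `]0, t[ v - bochner `]0, t[ (volterra (abel_Lh a h) v).
Proof.
move=> Iv tT; have one1 : 0 < (1 : R) <= 1 by rewrite ltr01 lexx.
have b1 : 1 <= 1 - a + a by rewrite subrK.
have b11 : (1 : R) <= 1 + 1 by rewrite lerDl.
have wL := weakly_singular_abel_Lh T a01 mh hM; have wj1 := weakly_singular_rl_kernel T one1.
have mt : measurable (`]0, t[ : set R) by [].
rewrite (volterra_comp (weakly_singular_rl_kernel T a1') (weakly_singular_abel_kernel T a01 mh hM) a1' a1 b1 tT Iv).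
rewrite -(volterra_rl_kernel1 (volterra (abel_Lh a h) v)) (volterra_comp wj1 wL one1 one1 b11 tT Iv).
have wc := weakly_singular_kcomp wj1 wL one1 one1 b11.
rewrite -(bochnerB mt (measure_oo_lty 0 t) (bochner_integrable_sub (measurable_itv _) mt (subset_oo (lexx 0) tT) Iv) (integrable_bounded_kernel wc tT Iv)).
apply: (bochner_ae mt); apply: aeW => s; rewrite /= in_itv/= => /andP[s0 st].
by rewrite (abel_kernel_identity a01 mh hM (ltW s0) st tT) scalerBl scale1r.
Qed.

End abel_operators.

(** * Regularity of the kernel K_0 *)

Section ae_product.
Context {R : realType}.
Local Notation mu := (@lebesgue_measure R).
Local Open Scope ereal_scope.

(** The sections with the second variable fixed are taken, as the regularity of the kernel concerns
    t for fixed s. *)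
Lemma ae_product_swap (Q : R * R -> Prop) :
  {ae (mu \x mu), forall q, Q q} -> {ae mu, forall s, {ae mu, forall t, Q (t, s)}}.
Proof.
move=> [N [mN N0 QN]].
have h0 : \int[mu]_s (mu (ysection N s)) = 0.
  have := @indic_fubini_tonelli _ _ _ _ R mu mu N mN.
  rewrite indic_fubini_tonelli_FE// indic_fubini_tonelli_GE// => <-.
  by rewrite -N0.
have mG : measurable_fun setT (fun s => mu (ysection N s)).
  exact: measurable_fun_ysection.
have : ae_eq mu setT (fun s => mu (ysection N s)) (cst 0).
  apply/ae_eq_integral_abs => //; rewrite -[RHS]h0; apply: eq_integral => s _.
  by rewrite gee0_abs.
move=> h; apply: (ae_impl h) => s /(_ I) /= hs.
exists (ysection N s); split => //; first exact: measurable_ysection.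
by move=> t /= nQ; apply/ysectionP; exact: QN.
Qed.

End ae_product.

Lemma within_continuous_cvg {T U : topologicalType} (A : set T) (f : T -> U) (u : nat -> T) (x : T) :
  {within A, continuous f} -> A x -> (forall n, A (u n)) -> u @ \oo --> x ->
  (fun n => f (u n)) @ \oo --> f x.
Proof.
move=> /subspace_continuousP/(_ x) cf Ax Au ux V /(cf Ax) /= /ux.
move=> h; have h' : \forall n \near \oo, A (u n) -> V (f (u n)) := h.
suff : \forall n \near \oo, V (f (u n)) by [].
by apply: filterS h' => n; apply.
Qed.

Section measurable_grid.
Context {R : realType}.

Lemma measurable_truncn_fiber (n i : nat) :
  measurable [set x : R | 0 <= x /\ Num.truncn (n.+1%:R * x) = i].
Proof.
rewrite (_ : [set _ | _] = `[i%:R / n.+1%:R, i.+1%:R / n.+1%:R[%classic); first by [].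
apply/seteqP; split => x /=; rewrite in_itv/= ler_pdivrMr// ltr_pdivlMr// [x * _]mulrC.
  by move=> [x0 <-]; apply: truncn_itv; rewrite mulr_ge0.
move=> /andP[h1 h2]; split; last by apply: truncn_def; rewrite h1 h2.
by have : 0 <= n.+1%:R * x := le_trans (ler0n _ i) h1; rewrite pmulr_rge0.
Qed.

(** Rounding down, with the same grid in both variables, preserves s <= t <= T, so grid points of
    the triangle stay where the kernel is continuous. *)
Definition grid n (x : R) : R := (Num.truncn (n.+1%:R * x))%:R / n.+1%:R.

Lemma grid_ge0 n x : 0 <= grid n x.
Proof. by rewrite divr_ge0. Qed.

Lemma grid_le n x : 0 <= x -> grid n x <= x.
Proof.
move=> x0; rewrite ler_pdivrMr// [x * _]mulrC.
by have /truncn_itv/andP[] : 0 <= n.+1%:R * x by rewrite mulr_ge0.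
Qed.

Lemma grid_mono n x y : x <= y -> grid n x <= grid n y.
Proof.
by move=> xy; rewrite ler_pM2r ?invr_gt0// ler_nat le_truncn// ler_wpM2l.
Qed.

Lemma grid_cvg x : 0 <= x -> (grid^~ x) @ \oo --> x.
Proof.
move=> x0; apply: (@squeeze_cvgr _ _ _ _ (fun n => x - n.+1%:R^-1) (fun=> x)).
- apply: nearW => n; rewrite grid_le// andbT lerBlDr ltW//.
  rewrite /grid -[X in _ + X]mul1r -mulrDl ltr_pdivlMr// natr1 mulrC.
  by have /truncn_itv/andP[] : 0 <= n.+1%:R * x by rewrite mulr_ge0.
- rewrite -[X in _ --> X]subr0; apply: cvgB; first exact: cvg_cst.
  exact: cvg_harmonic.
- exact: cvg_cst.
Qed.

Definition closed_triangle (T : R) := [set q : R * R | [/\ 0 <= q.2, q.2 <= q.1 & q.1 <= T]].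

Lemma measurable_closed_triangle T : measurable (closed_triangle T).
Proof.
have h (f g : R * R -> R) : measurable_fun setT f -> measurable_fun setT g ->
    measurable [set q | f q <= g q].
  move=> mf mg; rewrite -[X in measurable X]setTI.
  by apply: (measurable_fun_ler mf mg measurableT (Y := [set true])).
rewrite (_ : closed_triangle T = [set q : R * R| 0 <= q.2] `&` [set q | q.2 <= q.1] `&` [set q | q.1 <= T]).
  by apply: measurableI; [apply: measurableI|]; apply: h.
by apply/seteqP; split => q /= => [[]|[[]]].
Qed.

Lemma grid_closed_triangle n T t s : closed_triangle T (t, s) -> closed_triangle T (grid n t, grid n s).
Proof.
move=> [/= s0 st tT]; split => /=; first exact: grid_ge0; first exact: grid_mono.
by rewrite (le_trans (grid_le _ _))// (le_trans s0).
Qed.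

(** Composition with the grid is constant on countably many measurable cells and converges pointwise
    by continuity on the triangle. *)
Lemma jmeasurable_within_continuous T (F : R -> R -> R) :
  {within closed_triangle T, continuous (fun q => F q.1 q.2)} ->
  jmeasurable (fun t s => if (t, s) \in closed_triangle T then F t s else 0).
Proof.
move=> cF; have mD := measurable_closed_triangle T.
pose f n (q : R * R) : R := F (grid n q.1) (grid n q.2).
have mf n : measurable_fun (closed_triangle T) (f n).
  move=> _ Y mY; rewrite (_ : _ `&` _ = \bigcup_(i in setT) \bigcup_(j in [set j : nat | Y (F (i%:R / n.+1%:R) (j%:R / n.+1%:R))])
     (closed_triangle T `&` ([set x : R | 0 <= x /\ Num.truncn (n.+1%:R * x) = i] `*` [set x : R | 0 <= x /\ Num.truncn (n.+1%:R * x) = j]))).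
    apply: bigcup_measurable => i _; apply: bigcup_measurable => j _.
    by apply: measurableI => //; apply: measurableX; exact: measurable_truncn_fiber.
  apply/seteqP; split => [[t s] [[/= s0 st tT] Yf]|[t s] [i _ [j /= Yij [Dts [[_ ei] [_ ej]]]]]].
    exists (Num.truncn (n.+1%:R * t)) => //; exists (Num.truncn (n.+1%:R * s)) => //=.
    by do 2! split => //; split => //; exact: le_trans st.
  by split => //; rewrite /f /grid /= ei ej.
pose g (q : R * R) : R := F q.1 q.2.
have mg : measurable_fun (closed_triangle T) g.
  apply: (measurable_fun_cvg mf) => -[t s] Dts; have [/= s0 st tT] := Dts.
  apply: (within_continuous_cvg (u := fun n => (grid n t, grid n s)) cF Dts).
    by move=> n; exact: grid_closed_triangle.
  by apply: (@cvg_pair _ _ _ _ (nbhs t) (nbhs s)); apply: grid_cvg => //; exact: le_trans st.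
rewrite /jmeasurable; have /(measurable_restrictT _ mD) := mg.
by apply: eq_measurable_fun => -[t s] _; rewrite patchE.
Qed.

End measurable_grid.

Section derivative_kernel.
Context {R : realType}.
Local Notation mu := (@lebesgue_measure R).
Implicit Types (T M : R) (kap h : R -> R -> R).

Definition clip M x : R := Num.max (- M) (Num.min M x).

Lemma clip_le M x : 0 <= M -> `|clip M x| <= M.
Proof.
move=> M0; rewrite ler_norml /clip le_max lexx/= ge_max ge_min lexx/= andbT.
by rewrite (le_trans _ M0)// oppr_le0.
Qed.

Lemma clip_id M x : `|x| <= M -> clip M x = x.
Proof. by rewrite ler_norml => /andP[h1 h2]; rewrite /clip min_r// max_r. Qed.

Lemma measurable_clip d (S : measurableType d) M (f : S -> R) :
  measurable_fun setT f -> measurable_fun setT (fun x => clip M (f x)).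
Proof.
by move=> mf; apply: measurable_maxr => //; apply: measurable_minr.
Qed.

Lemma cvg_clip M (u : R^nat) l : u @ \oo --> l -> (fun n => clip M (u n)) @ \oo --> clip M l.
Proof.
move=> ul; apply: continuous_cvg => //.
apply: continuous_max; first exact: cst_continuous.
by apply: continuous_min; [exact: cst_continuous|].
Qed.

(** Forward difference quotients with step 1/(n+1). Extending the kernel by 0 off the triangle makes
    them Borel on the plane and changes nothing for t < T and large n. *)
Definition dquot T kap (n : nat) t s :=
  let Kb t s := if (t, s) \in closed_triangle T then kap t s else 0 in
  n.+1%:R * (Kb (t + n.+1%:R^-1) s - Kb t s).

(* A jointly Borel function bounded by M, equal to the t-derivative of kap
   wherever the latter exists and is bounded by M. *)
Definition dker T M kap t s := clip M (limn_sup (fun n => clip M (dquot T kap n t s))).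

Lemma jmeasurable_dker T M kap : 0 <= M ->
  {within closed_triangle T, continuous (fun q => kap q.1 q.2)} -> jmeasurable (dker T M kap).
Proof.
move=> M0 /jmeasurable_within_continuous; set Kb := (X in jmeasurable X) => mK.
apply: measurable_clip; apply: measurable_fun_limn_sup.
- move=> q _; exists M => _ [n _ <-].
  by have := clip_le (dquot T kap n q.1 q.2) M0; rewrite ler_norml => /andP[].
- move=> q _; exists (- M) => _ [n _ <-].
  by have := clip_le (dquot T kap n q.1 q.2) M0; rewrite ler_norml => /andP[].
- move=> n; apply: measurable_clip; apply: measurable_funM => //; apply: measurable_funB.
    by apply: (jmeasurable_comp mK) => //; exact: measurable_funD.
  exact: jmeasurable_comp mK _ _.
Qed.

Lemma dkerE T M kap t s : 0 <= s -> s <= t -> t < T -> derivable (kap^~ s) t 1 ->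
  `|derive1 (kap^~ s) t| <= M -> dker T M kap t s = derive1 (kap^~ s) t.
Proof.
move=> s0 st tT dk dM; set v := derive1 _ _.
have /derive1_epsP est : derivable (kap^~ s) t 1 /\ derive1 (kap^~ s) t = v by [].
rewrite /dker; set u := (X in limn_sup X).
suff uv : u @ \oo --> v by rewrite cvg_limn_supE ?(cvg_lim _ uv)//; exact: clip_id.
rewrite -[v](clip_id dM) -/v; apply: cvg_clip.
have i0 : (fun n => n.+1%:R^-1 : R) @ \oo --> (0 : R) by exact: cvg_harmonic.
apply/cvgrPdist_le => e e0; have [d d0 hd] := est e e0.
have ts0 : 0 < T - t by rewrite subr_gt0.
have m0 : 0 < Num.min d (T - t) by rewrite lt_min d0 ts0.
have nm : \forall n \near \oo, n.+1%:R^-1 < Num.min d (T - t) by exact: cvgr_lt i0 _ m0.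
apply: filterS nm => n; rewrite lt_min => /andP[nd nT].
have n0 : 0 < n.+1%:R^-1 :> R by rewrite invr_gt0.
have in1 : (t + n.+1%:R^-1, s) \in closed_triangle T.
  by rewrite inE; split => //=; [rewrite (le_trans st)// lerDl ltW|rewrite -lerBrDl ltW].
have in2 : (t, s) \in closed_triangle T by rewrite inE; split => //=; exact: ltW.
rewrite /dquot in1 in2.
have := hd (t + n.+1%:R^-1); rewrite addrAC subrr add0r gtr0_norm// => /(_ nd).
rewrite -ler_pdivrMr// invrK => h; apply: le_trans h.
rewrite -[X in _ <= _ * X](@gtr0_norm _ n.+1%:R)// -normrM mulrBl mulrC distrC.
suff -> : n.+1%:R^-1 *: v * n.+1%:R = v by rewrite mulrC.
by rewrite [_ *: _]mulrC mulrVK// unitfE.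
Qed.

End derivative_kernel.

Section regular.
Context {R : realType}.
Local Notation mu := (@lebesgue_measure R).

Lemma triangle_norm_ae (T : R) (g : R -> R -> R) (d : R) : (triangle_norm T g <= d%:E)%E ->
  {ae mu, forall s, `]0, T[%classic s -> {ae mu, forall t, `]s, T[%classic t -> `|g t s| <= d}}.
Proof.
move=> /ess_supP /ae_product_swap h; apply: (ae_impl h) => s hs sT.
apply: (ae_impl hs) => t + tT; rewrite patchE mem_set/= ?lee_fin//.
move: sT tT; rewrite /= !in_itv/= => /andP[s0 _] /andP[st tT].
by split => /=; exact: ltW.
Qed.

Lemma regular_kernel_diff (T M d : R) (kap kap' h h' : R -> R -> R) :
  regular_kernel T M kap h -> regular_kernel T M kap' h' ->
  (triangle_norm T (fun t s => derive1 (kap'^~ s) t - derive1 (kap^~ s) t)%R <= d%:E)%E ->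
  {ae mu, forall s, `]0, T[%classic s -> {ae mu, forall t, `]s, T[%classic t -> `|h' t s - h t s| <= d}}.
Proof.
move=> [_ _ _ hh] [_ _ _ hh'] /triangle_norm_ae hd.
apply: (ae_impl3 hh hh' hd) => s h1 h2 h3 sT.
have [_ e1] := h1 sT; have [_ e2] := h2 sT.
by apply: (ae_impl3 e1 e2 (h3 sT)) => t f1 f2 f3 tT; rewrite -f1// -f2//; exact: f3.
Qed.

(** For s off a null set the derivative is bounded by M for almost every t and there equals [dker];
    the fundamental theorem rebuilds the kernel from its value 1 on the diagonal. *)
Lemma regular_kernel_dker (T M : R) (kap : R -> R -> R) : 0 <= M ->
  {within closed_triangle T, continuous (fun q => kap q.1 q.2)} ->
  (forall t, 0 <= t <= T -> kap t t = 1) ->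
  (forall s, 0 <= s <= T -> ac_derivable s T (fun t => kap t s : R^o)) ->
  (triangle_norm T (fun t s => derive1 (kap^~ s) t) <= M%:E)%E ->
  regular_kernel T M kap (dker T M kap).
Proof.
move=> M0 ck k1 ack /triangle_norm_ae hM; have mh := jmeasurable_dker M0 ck.
split => //; first by move=> t s; exact: clip_le.
apply: (ae_impl hM) => s hs sT.
have [s0 sT'] : 0 < s /\ s < T by move: sT; rewrite /= in_itv/= => /andP.
have sT2 : 0 <= s <= T by rewrite !ltW.
have [_ dk] := ack s sT2.
have dE : {ae mu, forall t, `]s, T[%classic t -> derive1 (fun t => kap t s) t = dker T M kap t s}.
  apply: (ae_impl2 (hs sT) dk) => t h1 h2 st; have [st' tT] : s < t /\ t < T.
    by move: st; rewrite /= in_itv/= => /andP.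
  have h2' : derivable (kap^~ s) t 1 by apply: h2; rewrite in_itv/= st' tT.
  by rewrite (dkerE (ltW s0) (ltW st') tT h2' (h1 st)).
split => // t tT.
have mhs : measurable_fun setT (dker T M kap ^~ s) by exact: jmeasurable_comp.
have ih t' := integrable_bounded_oo s t' mhs (fun t => clip_le _ M0).
have sc t' := @bochner_scalar R R^o `]s, t'[%classic (dker T M kap ^~ s) 1 (measurable_itv _)
  (measure_oo_lty s t') mhs (ih t').
have e1 : (fun t => dker T M kap t s *: (1 : R^o)) = (fun t => dker T M kap t s).
  by apply/funext => x; exact: mulr1.
have [i1 _] := sc T; rewrite e1 in i1.
have dE' : {ae mu, forall t, t \in `]s, T[ -> derive1 (fun t => kap t s : R^o) t = dker T M kap t s}.
  by apply: (ae_impl dE) => x hx xT; exact: hx.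
have := ac_derivable_FTC (ack s sT2) i1 dE' tT => ->.
by have [_] := sc t; rewrite e1 => ->; rewrite k1//; congr (_ + _); exact: mulr1.
Qed.

(** Using [|M|] as the bound spares a derivation of the sign of [M]. *)
Lemma admissible_regular (k : nat) (T a0 a1 : R) (P : set 'rV[R]_k) (nu : R) (m : 'I_k -> R)
    (kappa1 M a : R) (K : R -> R -> R -> 'rV[R]_k -> R) z :
  admissible_kernel T a0 a1 P nu m kappa1 M K -> parameters a0 a1 P (a, z) ->
  exists h, regular_kernel T `|M| (fun t s => K t s a z) h.
Proof.
move=> [cK K1 acK KM _] az; exists (dker T `|M| (fun t s => K t s a z)).
apply: regular_kernel_dker => //.
- apply/subspace_continuousP => -[t s] Dts.
  have Dq : Delta T a0 a1 P (t, s, a, z) by have [] := Dts.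
  have /subspace_continuousP/(_ _ Dq) h := cK => V /h /= hV.
  have emb : (fun q : R * R => (q.1, q.2, a, z)) @ nbhs (t, s) --> nbhs (t, s, a, z).
    apply: (@cvg_pair _ _ _ _ (nbhs (t, s, a)) (nbhs z)); last exact: cvg_cst.
    apply: (@cvg_pair _ _ _ _ (nbhs (t, s)) (nbhs a)); last exact: cvg_cst.
    apply: (@cvg_pair _ _ _ _ (nbhs t) (nbhs s)); [exact: cvg_fst|exact: cvg_snd].
  have := emb _ hV => h2.
  have h2' : \forall q \near (t, s), Delta T a0 a1 P (q.1, q.2, a, z) -> V (K q.1 q.2 a z) := h2.
  by apply: filterS h2' => -[t' s'] /= hq Dts'; apply: hq; have [] := Dts'.
- by move=> t tT; exact: K1.
- by move=> s sT; exact: acK.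
- apply: le_trans (le_trans (_ : _ <= Delta_norm T a0 a1 P (dt K))%E KM) _.
    by apply: ereal_sup_ubound; exists (a, z).
  by rewrite lee_fin ler_norm.
Qed.

End regular.

(** * Solution of the Abel equation *)

Section bounded_volterra.
Context {R : realType} {X : completeNormedModType R}.
Local Notation mu := (@lebesgue_measure R).
Implicit Types (u v g : R -> X) (k : R -> R -> R).

Lemma strongly_measurable_closed T u : strongly_measurable `]0, T[ u -> strongly_measurable `[0, T] u.
Proof.
by move=> [s fs sf]; exists s => //; exact: ae_closed_of_open sf.
Qed.

Lemma in_Lp_oo T p u : strongly_measurable `]0, T[ u -> (LpN T p u < +oo)%E -> in_Lp T p u.
Proof. by move=> su Lu; split => //; exact: strongly_measurable_closed. Qed.

Lemma norm_volterra_le T N k u t : weakly_singular T 1 N k -> bochner_integrable `]0, T[ u -> t <= T ->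
  ((`|volterra k u t|)%:E <= N%:E * \int[mu]_(s in `]0%R, t[) (`|u s|)%:E)%E.
Proof.
move=> hk Iu tT; have [N0 mk kN] := hk.
have mt : measurable (`]0, t[ : set R) by [].
have st := subset_oo (lexx 0) tT.
have [su _] := bochner_integrable_sub (measurable_itv _) mt st Iu.
have [n [mn n0 un]] := strongly_measurable_norm su.
apply: (le_trans (le_norm_bochner mt (measure_oo_lty 0 t) (integrable_bounded_kernel hk tT Iu))).
have e1 : (\int[mu]_(s in `]0%R, t[) (`|u s|)%:E = \int[mu]_(s in `]0%R, t[) (n s)%:E)%E.
  rewrite (@ae_eq_integral_lower _ _ _ mu _ _ (fun s => (n s)%:E) mt)//.
  by apply: (ae_impl un) => s hs sT; rewrite (hs sT).
rewrite e1 -ge0_integralZl; [|side..].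
apply: ge0_ae_le_integral; [side|side|side|].
apply: (ae_impl un) => s hs sT; rewrite -EFinM lee_fin normrZ (hs sT) ler_wpM2r//.
have [s0 st'] : 0 < s /\ s < t by move: sT; rewrite /= in_itv/= => /andP.
by have := kN s t (ltW s0) st' tT; rewrite subrr powRr0 mulr1.
Qed.

Variables (T N : R) (p : \bar R) (k : R -> R -> R).
Hypotheses (T0 : 0 < T) (p1 : (1 <= p)%E) (N0 : 0 < N) (hk : weakly_singular T 1 N k).

(** Stated for a residual bounded by [b], because the difference of two solutions is to be estimated
    from the norm of its residual. *)
Lemma volterra_perturbed u (b : R -> R) : bochner_integrable `]0, T[ u ->
  measurable_fun setT b -> (forall t, 0 <= b t) ->
  {ae mu, forall t, `]0, T[%classic t -> `|u t - volterra k u t| <= b t} ->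
  (LpN T p u <= (1 + 2 * (N * T) * expR (2 * (N * T)))%:E * LpN T p (b : R -> R^o))%E.
Proof.
move=> Iu mb b0 ub; apply: apriori_bound => //; apply: (ae_impl ub) => t ht tT.
have tT' : t <= T by move: tT; rewrite /= in_itv/= => /andP[_ /ltW].
apply: le_trans (leeD2l _ (norm_volterra_le hk Iu tT')).
rewrite -EFinD lee_fin; apply: le_trans (lerD (ht tT) (lexx _)).
by apply: le_trans (ler_normD _ _); rewrite subrK.
Qed.

Lemma volterra_bound u g : bochner_integrable `]0, T[ u -> strongly_measurable `]0, T[ g ->
  {ae mu, forall t, `]0, T[%classic t -> u t = g t + volterra k u t} ->
  (LpN T p u <= (1 + 2 * (N * T) * expR (2 * (N * T)))%:E * LpN T p g)%E.
Proof.
move=> Iu /strongly_measurable_norm[b [mb b0 gb]] ug.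
apply: (@le_trans _ _ ((1 + 2 * (N * T) * expR (2 * (N * T)))%:E * LpN T p (b : R -> R^o))%E).
  apply: volterra_perturbed => //; apply: (ae_impl2 ug gb) => t h1 h2 tT.
  by rewrite {1}(h1 tT) addrK (h2 tT).
apply: lee_wpmul2l; first by rewrite lee_fin addr_ge0// !mulr_ge0 ?expR_ge0 ?ltW.
apply: LpN_le_ae => //; apply: (ae_impl gb) => t h tT.
by rewrite (h tT) ger0_norm.
Qed.

(** The difference solves the homogeneous equation, to which the a priori bound applies with
    exponent +oo and [b = 0]. *)
Lemma volterra_unique u v g : bochner_integrable `]0, T[ u -> bochner_integrable `]0, T[ v ->
  {ae mu, forall t, `]0, T[%classic t -> u t = g t + volterra k u t} ->
  {ae mu, forall t, `]0, T[%classic t -> v t = g t + volterra k v t} ->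
  {ae mu, forall t, `]0, T[%classic t -> u t = v t}.
Proof.
move=> Iu Iv ug vg; have Iw := bochner_integrableB (measurable_itv _) Iu Iv.
have C0 : 0 <= 1 + 2 * (N * T) * expR (2 * (N * T)).
  by rewrite addr_ge0// !mulr_ge0 ?expR_ge0 ?ltW.
have B : (LpN T +oo%E (fun t => u t - v t)%R <=
    (1 + 2 * (N * T) * expR (2 * (N * T)))%:E * LpN T +oo%E (fun=> 0%R : R^o))%E.
  apply: apriori_bound => //; first by rewrite leey.
  apply: (ae_impl2 ug vg) => t h1 h2 tT; rewrite add0e.
  have tT' : t <= T by move: tT; rewrite /= in_itv/= => /andP[_ /ltW].
  have -> : u t - v t = volterra k (fun t => u t - v t) t.
    rewrite (volterraB_bounded hk tT' Iu Iv) {1}(h1 tT) {1}(h2 tT) opprD addrACA subrr add0r.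
    by [].
  exact: norm_volterra_le hk Iw tT'.
have : (LpN T +oo%E (fun t => u t - v t)%R <= 0)%E.
  apply: le_trans B _; rewrite -[leRHS](mule0 (1 + 2 * (N * T) * expR (2 * (N * T)))%:E).
  apply: lee_wpmul2l; first by rewrite lee_fin.
  apply/LpNy_leP => //; apply: aeW => t _; by rewrite normr0.
move=> /(LpNy_leP _ _ (lexx 0%E)) h; apply: (ae_impl h) => t ht tT.
by have := ht tT; rewrite lee_fin normr_le0 subr_eq0 => /eqP.
Qed.

End bounded_volterra.

Section abel_equation.
Context {R : realType} {X : completeNormedModType R}.
Local Notation mu := (@lebesgue_measure R).
Variables (T M a : R) (kap h : R -> R -> R).
Hypotheses (T0 : 0 < T) (a01 : 0 < a < 1) (rk : regular_kernel T M kap h).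
Implicit Types (v f g : R -> X).

Let mh : jmeasurable h. Proof. by have [] := rk. Qed.
Let hM : forall t s, `|h t s| <= M. Proof. by have [] := rk. Qed.
Let M0 : 0 <= M. Proof. by have [] := rk. Qed.
Let a1 : 0 < a <= 1. Proof. by case/andP: a01 => -> /ltW. Qed.
Let b01 : 0 < 1 - a < 1. Proof. by case/andP: a01 => ? ?; apply/andP; split; lra. Qed.
Let b1 : 0 < 1 - a <= 1. Proof. by case/andP: b01 => -> /ltW. Qed.

Let wL : weakly_singular T 1 (2 * M) (abel_Lh a h). Proof. exact: weakly_singular_abel_Lh. Qed.

(* The term 1/T makes the constant positive when M = 0. *)
Definition volterra_cst := 2 * M + T^-1.

Lemma volterra_cst_gt0 : 0 < volterra_cst.
Proof. by rewrite ltr_wpDl ?mulr_ge0 ?invr_gt0. Qed.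

Lemma weakly_singular_abel_Lh_cst : weakly_singular T 1 volterra_cst (abel_Lh a h).
Proof. by apply: (weakly_singular_mono wL); rewrite lerDl invr_ge0 ltW. Qed.

Lemma abel_integrable v : bochner_integrable `]0, T[ v ->
  bochner_integrable `]0, T[ (volterra (abel_kernel a h) v).
Proof. exact: bochner_integrable_volterra (weakly_singular_abel_kernel T a01 mh hM) a1. Qed.

(** Applying J^(1-a) and [RL_abel_kernel] gives the identity at every t; the way back is the
    injectivity of J^(1-a). *)
Lemma RL_integral_abel f v : bochner_integrable `]0, T[ f -> bochner_integrable `]0, T[ v ->
  {ae mu, forall t, `]0, T[%classic t -> abel_op a kap v t = f t} <->
  (forall t, 0 <= t <= T -> RL_integral (1 - a) f t =
     bochner `]0, t[ v - bochner `]0, t[ (volterra (abel_Lh a h) v)).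
Proof.
move=> If Iv; split => [vf t /andP[t0 tT]|vf].
  rewrite (RL_integralE _ _ b1) -(RL_abel_kernel a01 rk Iv tT).
  apply: (volterra_ae tT); first by apply: aeW => s _ _.
  apply: (ae_impl vf) => s hs sT; rewrite -(hs sT); apply: (abel_opE a01 rk).
  by move: sT; rewrite /= in_itv/= => /andP[_ /ltW].
have Ia := abel_integrable Iv.
have e : {ae mu, forall t, `]0, T[%classic t ->
    volterra (rl_kernel (1 - a)) (volterra (abel_kernel a h) v) t = volterra (rl_kernel (1 - a)) f t}.
  apply: aeW => t; rewrite /= in_itv/= => /andP[t0 tT].
  have tT2 : 0 <= t <= T by rewrite !ltW.
  by rewrite (RL_abel_kernel a01 rk Iv (ltW tT)) -(vf t tT2) (RL_integralE _ _ b1).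
apply: (ae_impl (fractional_injective b01 Ia If e)) => t ht tT.
rewrite -(ht tT); apply: (abel_opE a01 rk).
by move: tT; rewrite /= in_itv/= => /andP[_ /ltW].
Qed.

(** [g] need agree with D^a f almost everywhere only: under the assumption on [a2] it will be
    J^(a2-a) applied to D^(a2) f. Both directions compare primitives at every t. *)
Lemma abel_equation_volterra f g v :
  ac_derivable 0 T (RL_integral (1 - a) f) ->
  {ae mu, forall t, t \in `]0, T[ -> RL_derivative a f t = g t} ->
  bochner_integrable `]0, T[ f -> bochner_integrable `]0, T[ g -> bochner_integrable `]0, T[ v ->
  {ae mu, forall t, `]0, T[%classic t -> abel_op a kap v t = f t} <->
  {ae mu, forall t, `]0, T[%classic t -> v t = g t + volterra (abel_Lh a h) v t}.
Proof.
move=> acF Fg If Ig Iv.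
have F0 : RL_integral (1 - a) f 0 = 0 by rewrite (RL_integralE _ _ b1); exact: volterra_nonpos.
have FE t : 0 <= t <= T -> RL_integral (1 - a) f t = bochner `]0, t[ g.
  by move=> tT; rewrite (ac_derivable_FTC acF Ig Fg tT) F0 add0r.
have one1 : 0 < (1 : R) <= 1 by rewrite ltr01 lexx.
have IL := bochner_integrable_volterra wL one1 Iv.
have mT : measurable (`]0, T[ : set R) by [].
have sub (w : R -> X) t (tT : t <= T) (Iw : bochner_integrable `]0, T[ w) : bochner_integrable `]0, t[ w.
  exact: bochner_integrable_sub mT (measurable_itv _) (subset_oo (lexx 0) tT) Iw.
split=> [/(RL_integral_abel If Iv) vf|vg].
  have Iw := bochner_integrableB mT (bochner_integrableB mT Iv IL) Ig.
  have w0 t : t \in `]0, T[ -> bochner `]0, t[ (fun t => v t - volterra (abel_Lh a h) v t - g t) = 0.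
    rewrite in_itv/= => /andP[t0 tT]; have tT2 : 0 <= t <= T by rewrite !ltW.
    have mt : measurable (`]0, t[ : set R) by [].
    have o := measure_oo_lty 0 t; have tT' := ltW tT.
    rewrite (bochnerB mt o (bochner_integrableB mt (sub _ _ tT' Iv) (sub _ _ tT' IL)) (sub _ _ tT' Ig)).
    by rewrite (bochnerB mt o (sub _ _ tT' Iv) (sub _ _ tT' IL)) -(vf t tT2) (FE t tT2) subrr.
  apply: (ae_impl (bochner_eq0_ae Iw w0)) => t ht tT.
  by have /eqP := ht tT; rewrite subr_eq0 subr_eq => /eqP.
apply/(RL_integral_abel If Iv) => t /andP[t0 tT]; rewrite FE ?t0//.
have mt : measurable (`]0, t[ : set R) by [].
rewrite -(bochnerB mt (measure_oo_lty 0 t) (sub _ _ tT Iv) (sub _ _ tT IL)).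
apply: (bochner_ae mt); apply: (ae_impl vg) => s hs st.
by rewrite {1}(hs (subset_oo (lexx 0) tT st)) addrK.
Qed.

End abel_equation.

Section part_a.
Context {R : realType} {X : completeNormedModType R}.
Local Notation mu := (@lebesgue_measure R).

(** The a priori constant for the kernel bound N = 2 |M| + 1/T: then N T = 2 |M T| + 1, so it
    depends on the product M T alone. *)
Definition stability_cst (x : R) := 1 + 2 * (2 * `|x| + 1) * expR (2 * (2 * `|x| + 1)).

Lemma eq_on_oo T (u v : R -> X) : {ae mu, forall t, `]0, T[%classic t -> u t = v t} -> eq_on T u v.
Proof. exact: ae_closed_of_open. Qed.

Lemma eq_on_sub T (u v : R -> X) : eq_on T u v -> {ae mu, forall t, `]0, T[%classic t -> u t = v t}.
Proof.
move=> h; apply: (ae_impl h) => t ht tT; apply: ht.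
by move: tT; rewrite /= !in_itv/= => /andP[/ltW -> /ltW].
Qed.

Lemma abel_solution_exists (T M a : R) p (kap h : R -> R -> R) (f : R -> X) :
  0 < T -> (1 <= p)%E -> 0 < a < 1 -> regular_kernel T `|M| kap h ->
  in_Lp T 1%E f -> RL_derivative_in_Lp T p a f ->
  exists u : R -> X,
  [/\ abel_solution T p a kap f u,
      forall v : R -> X, abel_solution T p a kap f v -> eq_on T v u,
      eq_on T u (fun t => RL_derivative a f t + abel_B a kap u t) &
      (LpN T p u <= (stability_cst (M * T))%:E * LpN T p (RL_derivative a f))%E].
Proof.
move=> T0 p1 a01 rk /(LpN_integrable (lexx _)) If [acF gLp].
set g := RL_derivative a f in gLp *.
have Ig := LpN_integrable p1 gLp.
have Fg : {ae mu, forall t, t \in `]0, T[ -> RL_derivative a f t = g t} by apply: aeW.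
have N0 := volterra_cst_gt0 T0 rk; have wk := weakly_singular_abel_Lh_cst T0 a01 rk.
have [u [Iu ug]] := vector_volterra N0 wk Ig.
have [sg _] := Ig.
have ub := volterra_bound T0 p1 N0 wk Iu sg ug.
have CE : 1 + 2 * (volterra_cst T `|M| * T) * expR (2 * (volterra_cst T `|M| * T)) = stability_cst (M * T).
  have -> : volterra_cst T `|M| * T = 2 * `|M * T| + 1.
    by rewrite normrM (gtr0_norm T0) /volterra_cst mulrDl mulVf ?gt_eqF// mulrA.
  by [].
rewrite CE in ub.
have uLp : in_Lp T p u.
  apply: in_Lp_oo; first by case: Iu.
  apply: le_lt_trans ub _; rewrite lte_mul_pinfty// ?lee_fin; last by case: gLp.
  by rewrite /stability_cst addr_ge0// !mulr_ge0 ?expR_ge0// ?addr_ge0// mulr_ge0.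
exists u; split => //.
- split => //; apply: eq_on_oo.
  by have [_ H] := abel_equation_volterra a01 rk acF Fg If Ig Iu; exact: H ug.
- move=> v [vLp /eq_on_sub vf]; apply: eq_on_oo.
  have Iv := LpN_integrable p1 vLp.
  have [H _] := abel_equation_volterra a01 rk acF Fg If Ig Iv.
  exact: (volterra_unique T0 N0 wk Iv Iu (H vf) ug).
- apply: eq_on_oo; apply: (ae_impl ug) => t ht tT.
  have tT' : t <= T by move: tT; rewrite /= in_itv/= => /andP[_ /ltW].
  have e := abel_BE a01 rk u tT'.
  rewrite e.
  exact: ht tT.
Qed.

End part_a.

(** * Dependence on the parameters *)

Section gamma_lipschitz.
Context {R : realType}.
Local Notation mu := (@lebesgue_measure R).
Implicit Types (b c p q x : R).

(** The bound of [powR_lipschitz_exponent] with loss c/2, integrated against exp(-x): the two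
    exponents c/2 - 1 and c/2 yield the two Gamma values. *)
Definition gamma_lip c := 2 / c * (Gamma (c / 2) + Gamma (1 + c / 2)).

Lemma gamma_lip_ge0 c : 0 < c <= 1 -> 0 <= gamma_lip c.
Proof.
move=> /andP[c0 c1]; rewrite mulr_ge0 ?divr_ge0 ?(ltW c0)// addr_ge0// ltW// Gamma_gt0//; lra.
Qed.

Lemma Gamma_integrable p : 0 < p <= 1 ->
  mu.-integrable `]0, +oo[ (EFin \o (fun x => x `^ (p - 1) * expR (- x))).
Proof.
move=> p1; apply/integrableP; split; first by apply/measurable_EFinP; apply: measurable_funTS; mf.
have /andP[_] := gammae_bounds (itv01_le2 p1); apply: le_lt_trans.
apply: ge0_ae_le_integral; [side|side|side|]; apply: aeW => x _.
by rewrite /= ger0_norm ?mulr_ge0 ?powR_ge0 ?expR_ge0.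
Qed.

Lemma Gamma_lipschitz c p q : 0 < c <= 1 -> c <= p <= 1 -> c <= q <= 1 ->
  `|Gamma p - Gamma q| <= `|p - q| * gamma_lip c.
Proof.
move=> /andP[c0 c1] /andP[cp p1] /andP[cq q1].
have p01 : 0 < p <= 1 by rewrite (lt_le_trans c0 cp) p1.
have q01 : 0 < q <= 1 by rewrite (lt_le_trans c0 cq) q1.
have ip := Gamma_integrable p01; have iq := Gamma_integrable q01.
have c2 : 0 < c / 2 by rewrite divr_gt0.
have gE r : Gamma r = \int[mu]_(x in `]0, +oo[) (x `^ (r - 1) * expR (- x)) := erefl.
have -> : Gamma p - Gamma q =
    \int[mu]_(x in `]0, +oo[) (x `^ (p - 1) * expR (- x) - x `^ (q - 1) * expR (- x)).
  by rewrite (RintegralB _ ip iq) // -!gE.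
rewrite -lee_fin; apply: (@le_trans _ _ (\int[mu]_(x in `]0%R, +oo[)
    (`|x `^ (p - 1) * expR (- x) - x `^ (q - 1) * expR (- x)|)%:E)%E).
  have ipq' : mu.-integrable `]0, +oo[ (EFin \o (fun x => x `^ (p - 1) * expR (- x) - x `^ (q - 1) * expR (- x))).
    exact: (integrableB _ ip iq).
  by rewrite integrable_norm_fin// lee_fin; exact: le_normr_Rintegral.
apply: (@le_trans _ _ (\int[mu]_(x in `]0%R, +oo[)
    ((`|p - q| / (c / 2))%:E * ((x `^ (c / 2 - 1) * expR (- x))%:E + (x `^ (1 + c / 2 - 1) * expR (- x))%:E)))%E).
  have cc : 0 <= `|p - q| / (c / 2) by rewrite divr_ge0 ?(ltW c2).
  apply: ge0_ae_le_integral; [side|side|side|].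
  apply: aeW => x; rewrite /= in_itv/= andbT => x0; rewrite -EFinD -EFinM lee_fin -mulrBl normrM.
  rewrite [`|expR _|]ger0_norm ?expR_ge0// -mulrDl mulrA ler_wpM2r ?expR_ge0//.
  have h1 : c - 1 <= p - 1 <= 0 by apply/andP; split; lra.
  have h2 : c - 1 <= q - 1 <= 0 by apply/andP; split; lra.
  have := powR_lipschitz_exponent c2 x0 h1 h2.
  rewrite opprB addrA subrK add0r.
  have -> : c - 1 - c / 2 = c / 2 - 1 by lra.
  by rewrite [1 + _ - 1]addrAC subrr add0r.
have cc : 0 <= `|p - q| / (c / 2) by rewrite divr_ge0 ?(ltW c2).
rewrite ge0_integralZl; [|side|by apply: measurable_funTS; apply: emeasurable_funD; mf|side|side].
rewrite ge0_integralD; [|side|side|side|side|side].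
have b1 : 0 < c / 2 <= 2 by lra.
have b2 : 0 < 1 + c / 2 <= 2 by lra.
rewrite -/(gammae (c / 2)) -/(gammae (1 + c / 2)) (GammaE b1) (GammaE b2) -EFinD -EFinM lee_fin.
by rewrite /gamma_lip invf_div [leRHS]mulrA lexx.
Qed.

Lemma invGamma_le p : 0 < p <= 1 -> (Gamma p)^-1 <= expR 1.
Proof.
move=> p1; have := Gamma_ge p1; rewrite expRN => h.
by rewrite -[leRHS]invrK lef_pV2// posrE ?Gamma_gt0 ?itv01_le2// invr_gt0 expR_gt0.
Qed.

Definition invgamma_lip c := gamma_lip c * (expR 1 * expR 1).

Lemma invgamma_lip_ge0 c : 0 < c <= 1 -> 0 <= invgamma_lip c.
Proof. by move=> c1; rewrite mulr_ge0 ?gamma_lip_ge0 ?mulr_ge0 ?expR_ge0. Qed.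

Lemma invGamma_lipschitz c p q : 0 < c <= 1 -> c <= p <= 1 -> c <= q <= 1 ->
  `|(Gamma p)^-1 - (Gamma q)^-1| <= `|p - q| * invgamma_lip c.
Proof.
move=> c1 cp cq; have [c0 _] := andP c1.
have p01 : 0 < p <= 1 by case/andP: cp => /(lt_le_trans c0) ->.
have q01 : 0 < q <= 1 by case/andP: cq => /(lt_le_trans c0) ->.
have gp : 0 < Gamma p by rewrite Gamma_gt0// itv01_le2.
have gq : 0 < Gamma q by rewrite Gamma_gt0// itv01_le2.
have -> : (Gamma p)^-1 - (Gamma q)^-1 = (Gamma q - Gamma p) * ((Gamma p)^-1 * (Gamma q)^-1).
  move: (Gamma p) (Gamma q) gp gq => x y x0 y0.
  by field; rewrite !gt_eqF.
rewrite normrM distrC mulrA; apply: ler_pM => //; first exact: Gamma_lipschitz.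
rewrite ger0_norm; last by rewrite mulr_ge0// invr_ge0 ltW.
by apply: ler_pM; rewrite ?invr_ge0 ?(ltW gp) ?(ltW gq)//; exact: invGamma_le.
Qed.

Lemma powR_le1D x q T : 0 < x <= T -> 0 <= q <= 1 -> x `^ q <= 1 + T.
Proof.
move=> /andP[x0 xT] /andP[q0 q1]; have [x1|x1] := leP x 1.
  apply: (@le_trans _ _ 1); first by have := @ge0_ler_powR _ q q0 x 1; rewrite !nnegrE ler01 (ltW x0) powR1; exact.
  by rewrite lerDl (le_trans (ltW x0)).
apply: (@le_trans _ _ x); last by rewrite (le_trans xT)// lerDr.
by have := ler_powR (ltW x1) q1; rewrite powRr1// ltW.
Qed.

Definition rl_kernel_lip T c := (expR 1 * (2 / c) + invgamma_lip c) * (1 + T).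

Lemma rl_kernel_lip_ge0 T c : 0 < T -> 0 < c <= 1 -> 0 <= rl_kernel_lip T c.
Proof.
move=> T0 c1; have /andP[c0 _] := c1; rewrite mulr_ge0 ?addr_ge0 ?(ltW T0)//; last exact: invgamma_lip_ge0.
by rewrite mulr_ge0 ?expR_ge0 ?divr_ge0 ?ltW.
Qed.

(** Half of the margin c is spent on the logarithm, leaving a kernel of order c/2 > 0; the factor 1
    + T brings all higher powers down to (t - s)^(c/2 - 1). *)
Lemma weakly_singular_rl_kernel_lipschitz T c b b' : 0 < T -> 0 < c <= 1 -> c <= b <= 1 -> c <= b' <= 1 ->
  weakly_singular T (c / 2) (`|b' - b| * rl_kernel_lip T c) (fun t s => rl_kernel b' t s - rl_kernel b t s).
Proof.
move=> T0 c1 cb cb'; have /andP[c0 c1'] := c1.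
have b01 : 0 < b <= 1 by case/andP: cb => /(lt_le_trans c0) ->.
have b01' : 0 < b' <= 1 by case/andP: cb' => /(lt_le_trans c0) ->.
split; first by rewrite mulr_ge0// rl_kernel_lip_ge0.
  by rewrite /jmeasurable /rl_kernel; mf.
move=> s t s0 st tT; rewrite /rl_kernel; set x := t - s.
have x0 : 0 < x by rewrite subr_gt0.
have xT : 0 < x <= T by rewrite x0 lerBlDr (le_trans tT)// lerDl.
have c2 : 0 < c / 2 by rewrite divr_gt0.
have -> : (Gamma b')^-1 * x `^ (b' - 1) - (Gamma b)^-1 * x `^ (b - 1) =
    (Gamma b')^-1 * (x `^ (b' - 1) - x `^ (b - 1)) + ((Gamma b')^-1 - (Gamma b)^-1) * x `^ (b - 1) by ring.
apply: le_trans (ler_normD _ _) _.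
have -> : `|b' - b| * rl_kernel_lip T c * x `^ (c / 2 - 1) =
    expR 1 * (`|b' - b| * (2 / c) * (x `^ (c / 2 - 1) * (1 + T))) +
    `|b' - b| * invgamma_lip c * (x `^ (c / 2 - 1) * (1 + T)) by rewrite /rl_kernel_lip; ring.
apply: lerD.
  rewrite normrM (ger0_norm (invGamma_ge0 (itv01_le2 b01'))).
  apply: ler_pM => //; [exact: invGamma_ge0 (itv01_le2 b01')|exact: invGamma_le|].
  have h1 : c - 1 <= b' - 1 <= 0 by case/andP: cb' => ? ?; apply/andP; split; lra.
  have h2 : c - 1 <= b - 1 <= 0 by case/andP: cb => ? ?; apply/andP; split; lra.
  have := powR_lipschitz_exponent c2 x0 h1 h2.
  rewrite opprB addrA subrK add0r -mulrA invf_div => /le_trans; apply; rewrite mulrA.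
  rewrite ler_wpM2l ?mulr_ge0 ?divr_ge0 ?invr_ge0 ?(ltW c0)//.
  have -> : c - 1 - c / 2 = c / 2 - 1 by lra.
  rewrite mulrDr mulr1 lerD2l -(powRB1 (c / 2) x0) mulrC ler_wpM2l ?powR_ge0//.
  by case/andP: xT.
rewrite normrM (ger0_norm (powR_ge0 _ _)); apply: ler_pM => //; first exact: powR_ge0.
  exact: invGamma_lipschitz.
have -> : b - 1 = (c / 2 - 1) + (b - c / 2) by lra.
rewrite powRD1// ler_wpM2l ?powR_ge0//; apply: powR_le1D => //.
by case/andP: cb => ? ?; apply/andP; split; lra.
Qed.

End gamma_lipschitz.

Section kernel_Lp.
Context {R : realType} {X : completeNormedModType R}.
Local Notation mu := (@lebesgue_measure R).

(** Schur's test for C (t - s)^(b-1): its integrals over s < t and over t > s are both at most C T^b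
    / b. *)
Lemma LpN_volterra T p b C k (f : R -> X) : 0 < T -> (1 <= p)%E -> 0 < b <= 1 -> weakly_singular T b C k ->
  bochner_integrable `]0, T[ f ->
  (LpN T p (volterra k f) <= (C * (T `^ b / b))%:E * LpN T p f)%E.
Proof.
move=> T0 p1 b1 hk If; have [C0 mk kC] := hk; have /andP[b0 _] := b1.
have [sf _] := If; have [n [mn n0 fn]] := strongly_measurable_norm sf.
have mt t : measurable (`]0, t[ : set R) by [].
have OF : {ae mu, forall t, `]0, T[%classic t -> ((`|volterra k f t|)%:E <=
    \int[mu]_(s in `]0%R, t[) (C * (t - s) `^ (b - 1) * n s)%:E)%E}.
  apply: (ae_impl (ae_integrable_kernel hk b1 If)) => t It tT; have Ik := It tT.
  have tT' : t <= T by move: tT; rewrite /= in_itv/= => /andP[_ /ltW].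
  apply: (le_trans (le_norm_bochner (mt t) (measure_oo_lty 0 t) Ik)).
  apply: ge0_ae_le_integral; [side|side|by move=> s _; rewrite lee_fin !mulr_ge0 ?powR_ge0|].
  apply: (ae_impl fn) => s hs st; have sT := subset_oo (lexx 0) tT' st.
  rewrite lee_fin normrZ (hs sT) ler_wpM2r//.
  have [s0 st'] : 0 < s /\ s < t by move: st; rewrite /= in_itv/= => /andP.
  exact: kC (ltW s0) st' tT'.
(* Schur's test is stated for a positive bound, so a vanishing kernel is treated apart. *)
have [C00|Cp] := eqVneq C 0.
  rewrite C00 !mul0r; apply: le_trans (LpN_scale p1 (lexx 0) sf).
  apply: LpN_le_ae => //; apply: (ae_impl OF) => t h tT; have := h tT.
  rewrite integral0_eq => [|s _]; last by rewrite C00 !mul0r.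
  by rewrite scale0r normr0 lee_fin.
pose K t s : R := if s < t then C * (t - s) `^ (b - 1) else 0.
have mK : jmeasurable K.
  rewrite /jmeasurable /K; apply: measurable_fun_ifT => //.
    by apply: measurable_fun_ltr.
  by mf.
have K0 t s : 0 <= K t s by rewrite /K; case: ifP => // _; rewrite mulr_ge0 ?powR_ge0.
have A0 : 0 < C * (T `^ b / b) by rewrite mulr_gt0 ?divr_gt0 ?powR_gt0// lt_neqAle eq_sym Cp.
have le_A x : 0 < x -> x <= T -> C * (x `^ b / b) <= C * (T `^ b / b).
  move=> x0 xT; rewrite ler_wpM2l// ler_wpM2r ?invr_ge0 ?(ltW b0)//.
  by rewrite ge0_ler_powR ?nnegrE ?(ltW b0) ?(ltW x0) ?(ltW T0).
have Kf t : `]0, T[%classic t -> (\int[mu]_(s in `]0%R, T[) (K t s * n s)%:E =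
    \int[mu]_(s in `]0%R, t[) (C * (t - s) `^ (b - 1) * n s)%:E)%E.
  rewrite /= in_itv/= => /andP[t0 tT]; rewrite integral_mkcond [RHS]integral_mkcond.
  apply: eq_integral => s _; rewrite !patchE /K.
  have [st|st] := ltP s t.
    rewrite !mem_setE !in_itv/= st (lt_trans st tT) !andbT; by [].
  by rewrite mul0r !mem_setE !in_itv/= [s < t]ltNge st andbF; case: ifP.
have B : (LpN T p ((fun t => `|volterra k f t|%R) : R -> R^o) <= (C * (T `^ b / b))%:E * LpN T p (n : R -> R^o))%E.
  apply: (LpN_schur p1 A0 mK K0 mn n0).
  - move=> t tT; have := tT; rewrite /= in_itv/= => /andP[t0 /ltW tT'].
    apply: (@le_trans _ _ (\int[mu]_(s in `]0%R, t[) (C%:E * ((t - s) `^ (b - 1))%:E))%E).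
      rewrite integral_mkcond [leRHS]integral_mkcond; apply: ge0_ae_le_integral => //.
      + by move=> s _; rewrite patchE; case: ifP => // _; rewrite lee_fin.
      + by move=> s _; rewrite patchE; case: ifP => // _; rewrite -EFinM lee_fin mulr_ge0 ?powR_ge0.
      apply: aeW => s _; rewrite !patchE !mem_setE !in_itv/= /K; case: (ltP s t) => st.
        by case: (0 < s) => //=; case: ifP => // _; rewrite -EFinM lee_fin mulr_ge0 ?powR_ge0.
      by rewrite andbF; case: ifP.
    rewrite ge0_integralZl; [|side..].
    by rewrite integral_pow_right// -EFinM subr0 lee_fin le_A.
  - move=> s sT; have := sT; rewrite /= in_itv/= => /andP[s0 sT'].
    apply: (@le_trans _ _ (\int[mu]_(t in `]s, T[) (C%:E * ((t - s) `^ (b - 1))%:E))%E).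
      rewrite integral_mkcond [leRHS]integral_mkcond; apply: ge0_ae_le_integral => //.
      + by move=> t _; rewrite patchE; case: ifP => // _; rewrite lee_fin.
      + by move=> t _; rewrite patchE; case: ifP => // _; rewrite -EFinM lee_fin mulr_ge0 ?powR_ge0.
      apply: aeW => t _; rewrite !patchE !mem_setE !in_itv/= /K; case: (ltP s t) => st.
        by rewrite (lt_trans s0 st)/=; case: ifP.
      by case: ifP.
    rewrite ge0_integralZl; [|side..].
    by rewrite integral_pow_left// -EFinM lee_fin le_A ?subr_gt0// gerBl ltW.
  - apply: (ae_impl OF) => t h tT; rewrite normr_id Kf//; exact: h.
apply: (@le_trans _ _ (LpN T p ((fun t => `|volterra k f t|%R) : R -> R^o))).
  by apply: LpN_le_ae => //; apply: aeW => t _; rewrite normr_id.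
apply: le_trans B _; apply: lee_wpmul2l; first by rewrite lee_fin ltW.
by apply: LpN_le_ae => //; apply: (ae_impl fn) => t h tT; rewrite (h tT) ger0_norm.
Qed.

End kernel_Lp.

(** * Lipschitz dependence of the Volterra kernel on the order and on h *)

Section kernel_lipschitz.
Context {R : realType}.
Local Notation mu := (@lebesgue_measure R).
Implicit Types (a b s t x y : R).

(** Clipping the increment keeps the value between x and x + y. *)
Lemma clip_between (M d x y : R) : 0 <= d -> `|x| <= M -> `|x + y| <= M -> `|x + clip d y| <= M.
Proof.
move=> d0; rewrite !ler_norml /clip !maxEle !minEle => /andP[h1 h2] /andP[h3 h4].
have [dy|dy] := leP d y; first by case: ifP => [_|/negbT]; rewrite -?ltNge => *; lra.
by have [dy'|dy'] := leP (- d) y; lra.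
Qed.

(** The hypothesis bounds the difference almost everywhere. Clipping the increment from [h] makes
    the bound hold everywhere, changes [h'] on null sets only, and preserves the bound M. *)
Lemma regular_kernel_close (T M d : R) (kap kap' h h' : R -> R -> R) : 0 <= d ->
  regular_kernel T M kap h -> regular_kernel T M kap' h' ->
  (triangle_norm T (fun t s => derive1 (kap'^~ s) t - derive1 (kap^~ s) t)%R <= d%:E)%E ->
  exists2 h2, regular_kernel T M kap' h2 & forall t s, `|h2 t s - h t s| <= d.
Proof.
move=> d0 rk rk' hd; have hh := regular_kernel_diff rk rk' hd.
have [M0 mh hM _] := rk; have [_ mh' hM' hk] := rk'.
exists (fun t s => h t s + clip d (h' t s - h t s)); last first.
  by move=> t s; rewrite addrAC subrr add0r; exact: clip_le.
split => //.
- apply: measurable_funD; first exact: mh.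
  by apply: measurable_clip; apply: measurable_funB.
- by move=> t s; apply: clip_between => //; rewrite subrKC.
apply: (ae_impl2 hh hk) => s e1 e2 sT.
have [h1 h2] := e2 sT; have e3 := e1 sT; split=> [t /andP[st tT]|].
  rewrite h1 ?st//; congr (_ + _); apply: ae_eq_Rintegral => //.
  apply: (ae_impl e3) => r h3 rst; rewrite clip_id ?subrKC//.
  exact: h3 (subset_oo (lexx s) tT rst).
by apply: (ae_impl2 e3 h2) => t h3 h4 tT; rewrite clip_id ?subrKC; [exact: h4|exact: h3].
Qed.

(** The Beta weight of orders b and 1 - b. As the orders sum to 1, its integral over []s, t[] does
    not depend on t - s. *)
Definition betaw b (t s r : R) := (t - r) `^ (1 - b - 1) * (r - s) `^ (b - 1).

Lemma betaw_ge0 b t s r : 0 <= betaw b t s r.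
Proof. by rewrite mulr_ge0 ?powR_ge0. Qed.

(** Here b is the exponent of a single ratio, so [powR_lipschitz_exponent] applies to the weight as
    a whole. *)
Lemma betawE b t s r : s < r -> r < t -> betaw b t s r = (r - s)^-1 * ((r - s) / (t - r)) `^ b.
Proof.
move=> sr rt; have x0 : 0 < t - r by rewrite subr_gt0.
have y0 : 0 < r - s by rewrite subr_gt0.
rewrite /betaw powRM ?invr_ge0 ?(ltW x0) ?(ltW y0)//.
rewrite -(powR_inv1 (ltW x0)) -powRrM mulN1r [1 - b - 1]addrAC subrr add0r.
by rewrite powRD1// (powR_inv1 (ltW y0)); ring.
Qed.

Lemma integral_betaw b t s : s < t -> 0 < b < 1 ->
  (\int[mu]_(r in `]s, t[) (betaw b t s r)%:E = (Gamma b * Gamma (1 - b))%:E)%E.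
Proof.
move=> st /andP[b0 b1]; have h1 : 0 < b <= 1 by rewrite b0 ltW.
have h2 : 0 < 1 - b <= 1 by apply/andP; split; lra.
rewrite (integral_pow_conv st h1 h2) subrKC Gamma1 divr1.
by rewrite subrr powRr0 mulr1.
Qed.

(** A power with exponent between a0 and a1 is dominated by one of the two extreme powers, according
    to whether the base exceeds 1. *)
Lemma betaw_le (a0 a1 a t s r : R) : s < r -> r < t -> a0 <= a <= a1 ->
  betaw a t s r <= betaw a0 t s r + betaw a1 t s r.
Proof.
move=> sr rt /andP[h0 h1]; have x0 : 0 < t - r by rewrite subr_gt0.
have y0 : 0 < r - s by rewrite subr_gt0.
rewrite !betawE// -mulrDr ler_wpM2l ?invr_ge0 ?(ltW y0)//.
set x := _ / _; have xp : 0 < x by rewrite divr_gt0.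
have [x1|x1] := leP 1 x.
  by rewrite (le_trans (ler_powR x1 h1))// lerDr powR_ge0.
apply: (@le_trans _ _ (x `^ a0)); last by rewrite lerDl powR_ge0.
by rewrite /powR gt_eqF// ler_expR ler_wnM2r// ln_le0// ltW.
Qed.

Lemma betaw_lipschitz (e a0 a1 a a' t s r : R) : 0 < e -> s < r -> r < t ->
  a0 <= a <= a1 -> a0 <= a' <= a1 ->
  `|betaw a' t s r - betaw a t s r| <= `|a' - a| / e * (betaw (a0 - e) t s r + betaw (a1 + e) t s r).
Proof.
move=> e0 sr rt ha ha'; have x0 : 0 < t - r by rewrite subr_gt0.
have y0 : 0 < r - s by rewrite subr_gt0.
rewrite !betawE// -mulrBr -mulrDr normrM (@gtr0_norm _ (r - s)^-1) ?invr_gt0//.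
rewrite [leRHS]mulrCA ler_wpM2l ?invr_ge0 ?(ltW y0)//.
by apply: powR_lipschitz_exponent => //; rewrite divr_gt0.
Qed.

(** What remains of the integrand of [abel_Lh] after the Gamma factors and the Beta weight: a
    combination of the mean of h(., s) over (s, r) and of h(r, s), hence bounded. *)
Definition kquot a (h : R -> R -> R) r s := (a - 1) * (kprimitive h r s / (r - s)) + h r s.

Lemma abel_Lh_integrandE a h t s r : s < r ->
  (Gamma a)^-1 * (rl_kernel (1 - a) t r * dpsik a h r s) =
  (Gamma a)^-1 * (Gamma (1 - a))^-1 * betaw a t s r * kquot a h r s.
Proof.
move=> sr; have y0 : 0 < r - s by rewrite subr_gt0.
rewrite /rl_kernel /dpsik (powR_subr2 _ y0) /betaw /kquot.
move: (Gamma a)^-1 (Gamma (1 - a))^-1 ((t - r) `^ _) ((r - s) `^ _) (kprimitive h r s) (r - s)^-1 (h r s).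
by move=> *; ring.
Qed.

Lemma triple_diff (g g' w w' q q' E Q : R) : 0 <= g <= E -> 0 <= w -> 0 <= w' -> `|q'| <= Q ->
  `|g' * w' * q' - g * w * q| <= `|g' - g| * w' * Q + E * `|w' - w| * Q + E * w * `|q' - q|.
Proof.
move=> /andP[g0 gE] w0 w0' qQ.
have -> : g' * w' * q' - g * w * q = (g' - g) * w' * q' + g * (w' - w) * q' + g * w * (q' - q) by ring.
apply: le_trans (ler_normD _ _) _; apply: lerD.
  apply: le_trans (ler_normD _ _) _; apply: lerD; rewrite !normrM.
    by rewrite (ger0_norm w0') ler_wpM2l// mulr_ge0.
  by rewrite (ger0_norm g0) ler_pM ?mulr_ge0// ler_wpM2r.
by rewrite !normrM (ger0_norm g0) (ger0_norm w0) ler_wpM2r// ler_wpM2r.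
Qed.

Lemma itv_mid (a0 a1 b : R) : 0 < a0 -> a1 < 1 -> a0 <= b <= a1 -> 0 < b < 1.
Proof. by move=> ? ? /andP[? ?]; apply/andP; split; lra. Qed.

Lemma itv_compl b : 0 < b < 1 -> 0 < 1 - b <= 1.
Proof. by move=> /andP[? ?]; apply/andP; split; lra. Qed.

Lemma itv_norm_le1 b : 0 < b < 1 -> `|b - 1| <= 1.
Proof. by move=> /andP[? ?]; rewrite ler_norml; apply/andP; split; lra. Qed.

Lemma prod_lipschitz (x y z w v E G : R) : 0 <= y -> y <= E -> 0 <= z -> z <= E ->
  `|x - y| <= v * G -> `|z - w| <= v * G -> `|x * z - y * w| <= v * (E * G *+ 2).
Proof.
move=> y0 yE z0 zE l1 l2; have -> : x * z - y * w = (x - y) * z + y * (z - w) by ring.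
apply: le_trans (ler_normD _ _) _; rewrite !normrM (ger0_norm y0) (ger0_norm z0) mulr2n mulrDr.
apply: lerD; last by rewrite [leRHS]mulrCA; apply: ler_pM.
by rewrite [leRHS]mulrCA [leRHS]mulrC; apply: ler_pM.
Qed.

Definition lkE : R := expR 1 * expR 1.
Definition lkG c : R := expR 1 * invgamma_lip c *+ 2.

Lemma lkE_ge0 : 0 <= lkE. Proof. by rewrite mulr_ge0 ?expR_ge0. Qed.

Lemma lkG_ge0 c : 0 < c <= 1 -> 0 <= lkG c.
Proof. by move=> c1; rewrite mulrn_wge0// mulr_ge0 ?expR_ge0 ?invgamma_lip_ge0. Qed.

(** The numerical part of the estimate: the Gamma factors, the weight and the quotient vary in turn,
    and everything is collected into v + d, where v stands for |a' - a|. *)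
Lemma integrand_bound (M d e E G v W1 W2 gd w' w k k' : R) :
  0 < e -> 0 <= M -> 0 <= d -> 0 <= E -> 0 <= G -> 0 <= v -> 0 <= W2 -> 0 <= gd -> 0 <= w -> 0 <= w' ->
  gd <= v * G -> w <= W1 -> w' <= W1 -> `|w' - w| <= v / e * W2 -> `|k' - k| <= v * M + 2 * d ->
  gd * w' * (2 * M) + E * `|w' - w| * (2 * M) + E * w * `|k' - k| <=
  (v + d) * (2 * G * M + E * M + 2 * E) * W1 + (v + d) * (E * e^-1 * (2 * M)) * W2.
Proof.
move=> e0 M0 d0 E0 G0 v0 W20 gd0 w0 w0' gL w1 w1' wL k2.
have dl0 : 0 <= v + d by rewrite addr_ge0.
have vd : v <= v + d by rewrite lerDl.
have s1 : gd * w' * (2 * M) <= (v + d) * G * W1 * (2 * M).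
  rewrite ler_wpM2r ?mulr_ge0//; apply: ler_pM => //.
  by apply: le_trans gL _; rewrite ler_wpM2r.
have s2 : E * `|w' - w| * (2 * M) <= E * ((v + d) * e^-1 * W2) * (2 * M).
  rewrite ler_wpM2r ?mulr_ge0// ler_wpM2l//; apply: le_trans wL _.
  by rewrite ler_wpM2r// ler_wpM2r ?invr_ge0 ?(ltW e0).
have s3 : E * w * `|k' - k| <= E * W1 * ((v + d) * M + 2 * (v + d)).
  apply: ler_pM => //; rewrite ?mulr_ge0//; first by rewrite ler_wpM2l.
  apply: le_trans k2 _; apply: lerD; first by rewrite ler_wpM2r.
  by rewrite ler_wpM2l// lerDr.
apply: le_trans (lerD (lerD s1 s2) s3) _; rewrite le_eqVlt; apply/orP; left; apply/eqP.
by ring.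
Qed.

Definition refl_gam b : R := (Gamma b)^-1 * (Gamma (1 - b))^-1.

Lemma refl_gam_bounds b : 0 < b < 1 -> 0 <= refl_gam b <= lkE.
Proof.
move=> hb; have b1 : 0 < b <= 1 by case/andP: hb => -> /ltW.
have b1' := itv_compl hb.
have g0 := invGamma_ge0 (itv01_le2 b1); have g0' := invGamma_ge0 (itv01_le2 b1').
by rewrite mulr_ge0//=; apply: ler_pM g0 g0' (invGamma_le b1) (invGamma_le b1').
Qed.

Lemma refl_gam_lipschitz c a a' : 0 < c <= 1 -> c <= a <= 1 -> c <= a' <= 1 ->
  c <= 1 - a <= 1 -> c <= 1 - a' <= 1 ->
  `|refl_gam a' - refl_gam a| <= `|a' - a| * lkG c.
Proof.
move=> c1 h1 h2 h3 h4; have [c0 _] := andP c1.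
have b1 : 0 < a <= 1 by case/andP: h1 => /(lt_le_trans c0) ->.
have b1' : 0 < 1 - a' <= 1 by case/andP: h4 => /(lt_le_trans c0) ->.
have g0 := invGamma_ge0 (itv01_le2 b1); have g0' := invGamma_ge0 (itv01_le2 b1').
have l1 := invGamma_lipschitz c1 h2 h1; have l2 := invGamma_lipschitz c1 h4 h3.
have e1 := invGamma_le b1; have e1' := invGamma_le b1'.
have d1 : 1 - a' - (1 - a) = - (a' - a) by ring.
rewrite d1 normrN in l2; exact: prod_lipschitz g0 e1 g0' e1' l1 l2.
Qed.

Lemma kprimitive_quot_le (M : R) h r s : jmeasurable h -> (forall t s, `|h t s| <= M) -> s < r ->
  `|kprimitive h r s / (r - s)| <= M.
Proof.
move=> mk kM sr; have y0 : 0 < r - s by rewrite subr_gt0.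
by rewrite normrM (@gtr0_norm _ (r - s)^-1) ?invr_gt0// ler_pdivrMr//; exact: (kprimitive_le mk kM (ltW sr)).
Qed.

Lemma kquot_le (M : R) a h r s : 0 < a < 1 -> jmeasurable h -> (forall t s, `|h t s| <= M) -> s < r ->
  `|kquot a h r s| <= 2 * M.
Proof.
move=> ha mh hM sr; apply: le_trans (ler_normD _ _) _; rewrite mulr_natl mulr2n; apply: lerD => //.
rewrite normrM -[leRHS]mul1r; apply: ler_pM => //; last exact: kprimitive_quot_le.
exact: itv_norm_le1.
Qed.

(** One d comes from h itself and one from its mean; the coefficient a - 1 contributes |a' - a|
    M. *)
Lemma kquot_diff (M d : R) a a' h h' r s : 0 < a < 1 -> jmeasurable h -> jmeasurable h' ->
  (forall t s, `|h t s| <= M) -> (forall t s, `|h' t s| <= M) ->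
  (forall t s, `|h' t s - h t s| <= d) -> s < r ->
  `|kquot a' h' r s - kquot a h r s| <= `|a' - a| * M + 2 * d.
Proof.
move=> ha mh mh' hM hM' hd sr; have y0 : 0 < r - s by rewrite subr_gt0.
have mu1 : measurable_fun setT (h'^~ s) by exact: jmeasurable_comp.
have mu2 : measurable_fun setT (h^~ s) by exact: jmeasurable_comp.
have p1 := kprimitive_quot_le mh' hM' sr.
have p2 : `|(kprimitive h' r s - kprimitive h r s) / (r - s)| <= d.
  rewrite normrM (@gtr0_norm _ (r - s)^-1) ?invr_gt0// ler_pdivrMr//.
  have -> : kprimitive h' r s - kprimitive h r s = \int[mu]_(x in `]s, r[) (h' x s - h x s).
    by rewrite (RintegralB _ (integrable_bounded_oo s r mu1 (hM'^~ s)) (integrable_bounded_oo s r mu2 (hM^~ s))).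
  by apply: le_norm_Rintegral_oo => //; [exact: measurable_funB|exact: ltW].
have p3 := hd r s; have p4 := itv_norm_le1 ha; rewrite /kquot.
move: (kprimitive h' r s) (kprimitive h r s) (r - s)^-1 (h' r s) (h r s) p1 p2 p3 => x y z u w p1 p2 p3.
have -> : (a' - 1) * (x * z) + u - ((a - 1) * (y * z) + w) =
  (a' - a) * (x * z) + ((a - 1) * ((x - y) * z) + (u - w)) by ring.
apply: le_trans (ler_normD _ _) _; apply: lerD; first by rewrite normrM ler_wpM2l.
apply: le_trans (ler_normD _ _) _; rewrite mulr_natl mulr2n; apply: lerD => //.
by rewrite normrM -[leRHS]mul1r; apply: ler_pM.
Qed.

Definition abel_Lh_integrand a t h s r := (Gamma a)^-1 * (rl_kernel (1 - a) t r * dpsik a h r s).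

Lemma measurable_abel_Lh_integrand a t h s : jmeasurable h -> measurable_fun setT (abel_Lh_integrand a t h s).
Proof.
move=> mh; apply: measurable_funM => //; apply: measurable_funM; first by rewrite /rl_kernel; mf.
by apply: jmeasurable_comp => //; exact: jmeasurable_dpsik.
Qed.

Lemma abel_Lh_Rintegral a h t s : jmeasurable h -> abel_Lh a h t s = - \int[mu]_(r in `]s, t[) abel_Lh_integrand a t h s r.
Proof.
move=> mk; rewrite /abel_Lh mulNr; congr (- _); rewrite -Rintegral_scalel//.
apply: measurable_funTS; apply: measurable_funM; first by rewrite /rl_kernel; mf.
by apply: jmeasurable_comp => //; exact: jmeasurable_dpsik.
Qed.

Lemma integrable_abel_Lh_integrand (T M : R) a h t s : 0 < a < 1 -> jmeasurable h ->
  (forall t s, `|h t s| <= M) -> 0 <= s -> s < t -> t <= T ->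
  mu.-integrable `]s, t[ (EFin \o abel_Lh_integrand a t h s).
Proof.
move=> ha mh hM s0 st tT; have b1 : 0 < a <= 1 by case/andP: ha => -> /ltW.
have b1' := itv_compl ha; have b2 : 1 <= 1 - a + a by rewrite subrK.
apply: (@integrableZl _ _ _ mu _ (measurable_itv _) (Gamma a)^-1
  (EFin \o (fun r => rl_kernel (1 - a) t r * dpsik a h r s))).
apply/integrableP; split.
  apply/measurable_EFinP; apply: measurable_funTS; apply: measurable_funM; first by rewrite /rl_kernel; mf.
  by apply: jmeasurable_comp => //; exact: jmeasurable_dpsik.
exact: le_lt_trans (integral_weakly_singular_comp (weakly_singular_rl_kernel T b1') (weakly_singular_dpsik T ha mh hM) b1' b1 b2 s0 st tT) (ltry _).
Qed.

Lemma abel_Lh_integrand_lipschitz (M d c e a0 a1 : R) a a' h h' t s r :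
  0 < c <= 1 -> 0 < e -> c <= a0 -> c <= 1 - a1 -> a0 <= a <= a1 -> a0 <= a' <= a1 ->
  jmeasurable h -> jmeasurable h' -> 0 <= M ->
  (forall t s, `|h t s| <= M) -> (forall t s, `|h' t s| <= M) -> 0 <= d ->
  (forall t s, `|h' t s - h t s| <= d) -> s < r -> r < t ->
  `|abel_Lh_integrand a' t h' s r - abel_Lh_integrand a t h s r| <=
   (`|a' - a| + d) * (2 * lkG c * M + lkE * M + 2 * lkE) * (betaw a0 t s r + betaw a1 t s r) +
   (`|a' - a| + d) * (lkE * e^-1 * (2 * M)) * (betaw (a0 - e) t s r + betaw (a1 + e) t s r).
Proof.
move=> c1 e0 ca0 ca1 ha ha' mh mh' M0 hM hM' d0 hd sr rt.
have [c0 _] := andP c1.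
have p0 : 0 < a0 := lt_le_trans c0 ca0.
have p1 : a1 < 1 by rewrite -subr_gt0 (lt_le_trans c0).
have q1 := itv_mid p0 p1 ha; have q1' := itv_mid p0 p1 ha'.
have inc b : a0 <= b <= a1 -> c <= b <= 1.
  by move=> hb; have /andP[_ /ltW ->] := itv_mid p0 p1 hb; case/andP: hb => /(le_trans ca0) ->.
have inc' b : a0 <= b <= a1 -> c <= 1 - b <= 1.
  move=> hb; have /andP[_ ->] := itv_compl (itv_mid p0 p1 hb); rewrite andbT.
  by apply: le_trans ca1 _; rewrite lerB//; case/andP: hb.
have gL := refl_gam_lipschitz c1 (inc a ha) (inc a' ha') (inc' a ha) (inc' a' ha').
have gb := refl_gam_bounds q1.
have w0 := betaw_ge0 a t s r; have w0' := betaw_ge0 a' t s r.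
have w1 := betaw_le sr rt ha; have w1' := betaw_le sr rt ha'.
have wL := betaw_lipschitz e0 sr rt ha ha'.
have k1 := kquot_le q1' mh' hM' sr.
have k2 := kquot_diff a' q1 mh mh' hM hM' hd sr.
have W2 : 0 <= betaw (a0 - e) t s r + betaw (a1 + e) t s r by rewrite addr_ge0 ?betaw_ge0.
rewrite /abel_Lh_integrand !abel_Lh_integrandE// -/(refl_gam a) -/(refl_gam a').
apply: le_trans (triple_diff _ _ gb w0 w0' k1) _.
exact: (integrand_bound e0 M0 d0 lkE_ge0 (lkG_ge0 c1) (normr_ge0 _) W2 (normr_ge0 _) w0 w0' gL w1 w1' wL k2).
Qed.

(** The integrand is Lipschitz with Beta weights as factors, and these integrate to constants; the
    bound is therefore uniform in s and t, with no singularity left. *)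
Lemma abel_Lh_lipschitz (T M a0 a1 : R) : 0 < a0 -> a0 <= a1 -> a1 < 1 -> 0 <= M ->
  exists2 D, 0 <= D & forall a a' h h' (d : R), a0 <= a <= a1 -> a0 <= a' <= a1 ->
    jmeasurable h -> jmeasurable h' -> (forall t s, `|h t s| <= M) -> (forall t s, `|h' t s| <= M) -> 0 <= d ->
    (forall t s, `|h' t s - h t s| <= d) ->
    weakly_singular T 1 (D * (`|a' - a| + d)) (fun t s => abel_Lh a' h' t s - abel_Lh a h t s).
Proof.
move=> p0 p01 p1 M0; have in01 b := @itv_mid a0 a1 b p0 p1.
(* The distance of the orders from 0 and 1. Half of it is given up in the exponents, so that a0 - e
   and a1 + e still lie in (0, 1) and the weights remain integrable. *)
pose c := Num.min a0 (1 - a1).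
have c0 : 0 < c by rewrite lt_min p0 subr_gt0.
have ca0 : c <= a0 by rewrite ge_min lexx.
have ca1 : c <= 1 - a1 by rewrite ge_min lexx orbT.
have c1 : 0 < c <= 1 by rewrite c0; apply/andP; split => //; lra.
pose e := c / 2; have e0 : 0 < e by rewrite divr_gt0.
have ec : e < c by rewrite /e; lra.
pose B b : R := Gamma b * Gamma (1 - b).
have B0 b : 0 < b < 1 -> 0 <= B b.
  by move=> /andP[b0 b1]; rewrite mulr_ge0// ltW// Gamma_gt0//; lra.
have hb0 : 0 < a0 < 1 by apply/andP; split; lra.
have hb1 : 0 < a1 < 1 by apply/andP; split; lra.
have hb2 : 0 < a0 - e < 1 by apply/andP; split; lra.
have hb3 : 0 < a1 + e < 1 by apply/andP; split; lra.
have E0 := lkE_ge0; have G0 := lkG_ge0 c1.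
pose D1 := 2 * lkG c * M + lkE * M + 2 * lkE.
pose D2 := lkE * e^-1 * (2 * M).
have D10 : 0 <= D1 by rewrite /D1 !addr_ge0 ?mulr_ge0.
have D20 : 0 <= D2 by rewrite /D2 !mulr_ge0 ?invr_ge0 ?(ltW e0).
pose D := D1 * (B a0 + B a1) + D2 * (B (a0 - e) + B (a1 + e)).
have D0 : 0 <= D.
  by rewrite /D; apply: addr_ge0; apply: mulr_ge0 => //; apply: addr_ge0; exact: B0.
exists D => // a a' h h' d ha ha' mh mh' hM hM' d0 hd.
pose dl := `|a' - a| + d; have dl0 : 0 <= dl by rewrite addr_ge0.
have [_ mL _] := weakly_singular_abel_Lh T (in01 a ha) mh hM.
have [_ mL' _] := weakly_singular_abel_Lh T (in01 a' ha') mh' hM'.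
split; first by rewrite mulr_ge0.
  by rewrite /jmeasurable; apply: measurable_funB; [exact: mL'|exact: mL].
move=> s t s0 st tT; rewrite subrr powRr0 mulr1 !abel_Lh_Rintegral// opprK addrC.
have i1 := integrable_abel_Lh_integrand (in01 a' ha') mh' hM' s0 st tT.
have i2 := integrable_abel_Lh_integrand (in01 a ha) mh hM s0 st tT.
have m1 := measurable_abel_Lh_integrand a' t s mh'; have m2 := measurable_abel_Lh_integrand a t s mh.
have -> : \int[mu]_(r in `]s, t[) abel_Lh_integrand a t h s r - \int[mu]_(r in `]s, t[) abel_Lh_integrand a' t h' s r =
    - \int[mu]_(r in `]s, t[) (abel_Lh_integrand a' t h' s r - abel_Lh_integrand a t h s r).
  by rewrite (RintegralB _ i1 i2)// opprB.
rewrite normrN -lee_fin.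
apply: (@le_trans _ _ (\int[mu]_(r in `]s, t[) (`|abel_Lh_integrand a' t h' s r - abel_Lh_integrand a t h s r|)%:E)%E).
  have i12 : mu.-integrable `]s, t[ (EFin \o (fun r => abel_Lh_integrand a' t h' s r - abel_Lh_integrand a t h s r)).
    exact: (integrableB _ i1 i2).
  by rewrite integrable_norm_fin// lee_fin; exact: le_normr_Rintegral.
have mw b : measurable_fun setT (betaw b t s) by rewrite /betaw; mf.
have mw2 b b' : measurable_fun setT (fun r => (betaw b t s r + betaw b' t s r)%:E).
  by apply: measurable_fun_EFin; apply: measurable_funD.
have w20 b b' r : (0 <= (betaw b t s r + betaw b' t s r)%:E)%E by rewrite lee_fin addr_ge0 ?betaw_ge0.
have c10 : 0 <= dl * D1 by rewrite mulr_ge0.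
have c20 : 0 <= dl * D2 by rewrite mulr_ge0.
apply: (@le_trans _ _ (\int[mu]_(r in `]s, t[) ((dl * D1)%:E * (betaw a0 t s r + betaw a1 t s r)%:E +
    (dl * D2)%:E * (betaw (a0 - e) t s r + betaw (a1 + e) t s r)%:E))%E).
  apply: ge0_ae_le_integral; [side|side| |].
    by move=> r _; rewrite adde_ge0// mule_ge0.
  apply: aeW => r; rewrite /= in_itv/= => /andP[sr rt]; rewrite -!EFinM -EFinD lee_fin.
  exact: (abel_Lh_integrand_lipschitz c1 e0 ca0 ca1 ha ha' mh mh' M0 hM hM' d0 hd sr rt).
rewrite ge0_integralD; [|side|by move=> r _; rewrite mule_ge0| |by move=> r _; rewrite mule_ge0|].
- rewrite ge0_integralZl; [|side|by apply: measurable_funTS; exact: mw2|by move=> r _|side].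
  rewrite ge0_integralZl; [|side|by apply: measurable_funTS; exact: mw2|by move=> r _|side].
  have IW b b' : 0 < b < 1 -> 0 < b' < 1 ->
      (\int[mu]_(r in `]s, t[) (betaw b t s r + betaw b' t s r)%:E = (B b + B b')%:E)%E.
    move=> hb hb'; under eq_integral do rewrite EFinD.
    rewrite ge0_integralD; [|side| | | |].
    - by rewrite !integral_betaw.
    - by move=> r _; rewrite lee_fin betaw_ge0.
    - by apply: measurable_funTS; apply: measurable_fun_EFin; exact: mw.
    - by move=> r _; rewrite lee_fin betaw_ge0.
    - by apply: measurable_funTS; apply: measurable_fun_EFin; exact: mw.
  rewrite !IW// -!EFinM -EFinD lee_fin -/dl /D.
  by rewrite [leRHS]mulrC [leRHS]mulrDr !mulrA lexx.
- by apply: measurable_funTS; apply: measurable_funeM; exact: mw2.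
- by apply: measurable_funTS; apply: measurable_funeM; exact: mw2.
Qed.

End kernel_lipschitz.

(** * Fractional derivatives of lower order *)

Section riemann_liouville.
Context {R : realType} {X : completeNormedModType R}.
Local Notation mu := (@lebesgue_measure R).
Implicit Types (F G f g : R -> X).

Lemma derive1_eq_on a b F G t : (forall t, a <= t <= b -> F t = G t) -> t \in `]a, b[ ->
  derivable F t 1 -> derivable G t 1 /\ derive1 G t = derive1 F t.
Proof.
move=> FG; rewrite in_itv/= => /andP[at_ tb] dF.
have /derive1_epsP est : derivable F t 1 /\ derive1 F t = derive1 F t by [].
apply/derive1_epsP => e e0; have [d d0 hd] := est e e0.
exists (Num.min d (Num.min (t - a) (b - t))); first by rewrite !lt_min d0 !subr_gt0 at_.
move=> s; rewrite !lt_min => /and3P[sd sa sb].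
have h1 : a <= s <= b.
  move: sa sb; rewrite !ltr_norml => /andP[sa _] /andP[_ sb].
  by apply/andP; split; lra.
by rewrite -!FG ?(ltW at_) ?(ltW tb)//; exact: hd.
Qed.

Lemma ac_derivable_eq_on a b F G : (forall t, a <= t <= b -> F t = G t) ->
  ac_derivable a b F -> ac_derivable a b G.
Proof.
move=> FG [acF dF]; split.
  move=> e e0; have [d d0 hd] := acF e e0; exists d => // n l r lr tr sd.
  suff -> : \sum_(i < n) `|G (r i) - G (l i)| = \sum_(i < n) `|F (r i) - F (l i)| by exact: hd.
  apply: eq_bigr => i _; have [h1 h2 h3] := lr i.
  by rewrite -!FG// ?h1 ?h3 ?(le_trans h1) ?(le_trans h2).
apply: (ae_impl dF) => t h tab.
by have [] := derive1_eq_on FG tab (h tab).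
Qed.

Variables (T a a2 : R) (f : R -> X).
Hypotheses (T0 : 0 < T) (a0 : 0 < a) (aa2 : a < a2) (a21 : a2 < 1).
Hypotheses (If : bochner_integrable `]0, T[ f)
  (acf : ac_derivable 0 T (RL_integral (1 - a2) f))
  (Ig : bochner_integrable `]0, T[ (RL_derivative a2 f)).

Let g2 := RL_derivative a2 f.
Let b2 : 0 < 1 - a2 < 1. Proof. by move: a0 aa2 a21 => ? ? ?; apply/andP; split; lra. Qed.
Let b2' : 0 < 1 - a2 <= 1. Proof. by move: a0 aa2 a21 => ? ? ?; apply/andP; split; lra. Qed.
Let a2' : 0 < a2 <= 1. Proof. by move: a0 aa2 a21 => ? ? ?; apply/andP; split; lra. Qed.
Let d1 : 0 < a2 - a <= 1. Proof. by move: a0 aa2 a21 => ? ? ?; apply/andP; split; lra. Qed.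
Let a1 : 0 < 1 - a <= 1. Proof. by move: a0 aa2 a21 => ? ? ?; apply/andP; split; lra. Qed.

Lemma RL_integral_eq_bochner t : 0 <= t <= T -> RL_integral (1 - a2) f t = bochner `]0, t[ g2.
Proof.
move=> tT; have gE : {ae mu, forall t, t \in `]0, T[ -> derive1 (RL_integral (1 - a2) f) t = g2 t}.
  by apply: aeW.
rewrite (ac_derivable_FTC acf Ig gE tT) (RL_integralE _ _ b2').
by have -> : volterra (rl_kernel (1 - a2)) f 0 = 0 by [exact: volterra_nonpos]; rewrite add0r.
Qed.

(** J^(1-a2) takes both sides to the primitive of [g2], at every t, and is injective. *)
Lemma eq_fractional_derivative : {ae mu, forall t, `]0, T[%classic t -> f t = volterra (rl_kernel a2) g2 t}.
Proof.
have Ij := bochner_integrable_volterra (weakly_singular_rl_kernel T a2') a2' Ig.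
apply: (fractional_injective b2 If Ij); apply: aeW => t; rewrite /= in_itv/= => /andP[t0 tT].
have tT2 : 0 <= t <= T by rewrite !ltW.
have -> : volterra (rl_kernel (1 - a2)) f t = bochner `]0, t[ g2.
  by rewrite -(RL_integralE _ _ b2') RL_integral_eq_bochner.
have E := volterra_rl_kernel_rl_kernel1 b2 (ltW tT) Ig; rewrite subKr in E.
exact: esym E.
Qed.

(** The order 1 - a + a2 exceeds 1, beyond the orders of [weakly_singular] kernels; J^(1-a) J^(a2)
    and J^1 J^(a2-a) are therefore compared through their composed kernels. *)
Lemma RL_integral_lower t : t <= T ->
  RL_integral (1 - a) f t = bochner `]0, t[ (volterra (rl_kernel (a2 - a)) g2).
Proof.
move=> tT; rewrite (RL_integralE _ _ a1).
have one1 : 0 < (1 : R) <= 1 by rewrite ltr01 lexx.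
have c1 : 1 <= 1 - a + a2 by move: aa2 => ?; lra.
have c2 : 1 <= 1 + (a2 - a) by move: aa2 => ?; lra.
have -> : volterra (rl_kernel (1 - a)) f t = volterra (rl_kernel (1 - a)) (volterra (rl_kernel a2) g2) t.
  by apply: (volterra_ae tT); [apply: aeW => s _ _|exact: eq_fractional_derivative].
rewrite (volterra_comp (weakly_singular_rl_kernel T a1) (weakly_singular_rl_kernel T a2') a1 a2' c1 tT Ig) -volterra_rl_kernel1.
rewrite (volterra_comp (weakly_singular_rl_kernel T one1) (weakly_singular_rl_kernel T d1) one1 d1 c2 tT Ig).
apply: (volterra_ae tT); last by apply: aeW => s _.
apply: aeW => s _ st; rewrite (kcomp_rl_kernel a1 a2' st) (kcomp_rl_kernel one1 d1 st).
by have -> : 1 - a + a2 = 1 + (a2 - a) by ring.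
Qed.

Lemma RL_derivative_lower : ac_derivable 0 T (RL_integral (1 - a) f) /\
  {ae mu, forall t, t \in `]0, T[ -> RL_derivative a f t = volterra (rl_kernel (a2 - a)) g2 t}.
Proof.
have Ij := bochner_integrable_volterra (weakly_singular_rl_kernel T d1) d1 Ig.
have FG t : 0 <= t <= T -> bochner `]0, t[ (volterra (rl_kernel (a2 - a)) g2) = RL_integral (1 - a) f t.
  by move=> /andP[_ tT]; rewrite RL_integral_lower.
split; first exact: ac_derivable_eq_on FG (ac_derivable_bochner Ij).
apply: (ae_impl (ae_derive_bochner Ij)) => t h tT; have [h1 h2] := h tT.
by have [_ E] := derive1_eq_on FG tT h1; rewrite /RL_derivative E h2.
Qed.

End riemann_liouville.

Section expectation_power.
Context d (Omega : measurableType d) (R : realType) (Pr : probability Omega R).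

(** Jensen's inequality with exponent lambda / nu >= 1 and constant density 1, on a space of total
    mass 1. *)
Lemma expectation_power_le (Y : Omega -> R) (nu lambda : R) : measurable_fun setT Y ->
  (forall w, 0 <= Y w) -> 0 < nu -> nu <= lambda ->
  (\int[Pr]_w (Y w `^ nu)%:E <= (\int[Pr]_w (Y w `^ lambda)%:E) `^ (nu / lambda))%E.
Proof.
move=> mY Y0 nu0 nl; have l0 : 0 < lambda by exact: lt_le_trans nl.
pose r := lambda / nu; have r1 : 1 <= r by rewrite ler_pdivlMr// mul1r.
have r0 : 0 < r by exact: lt_le_trans r1.
have mYn : measurable_fun setT (fun w => Y w `^ nu) by exact: measurable_fun_powR.
have h := @integral_jensen _ _ _ Pr setT (fun=> 1) (fun w => Y w `^ nu) r measurableT r1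
  (measurable_cst _) mYn (fun=> ler01) (fun w => powR_ge0 _ _).
have e1 : (\int[Pr]_w (1%R * Y w `^ nu)%:E = \int[Pr]_w (Y w `^ nu)%:E)%E.
  by apply: eq_integral => w _; rewrite mul1r.
have e2 : (\int[Pr]_w (1%R * (Y w `^ nu) `^ r)%:E = \int[Pr]_w (Y w `^ lambda)%:E)%E.
  by apply: eq_integral => w _; rewrite mul1r -powRrM /r mulrCA mulfV ?gt_eqF// mulr1.
have e3 : (\int[Pr]_w (1%:E : \bar R) = 1)%E.
  by rewrite integral_cst// mul1e; exact: probability_setT.
rewrite e1 e2 e3 poweR1r mul1e in h.
have -> : nu / lambda = r^-1 by rewrite /r invf_div.
have I0 : (0 <= \int[Pr]_w (Y w `^ nu)%:E)%E by apply: integral_ge0 => w _; rewrite lee_fin powR_ge0.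
rewrite -[leLHS](poweRe1 I0) -(mulfV (lt0r_neq0 r0)) poweRrM.
by apply: lee_poweR => //; [rewrite invr_ge0 ltW|exact: poweR_ge0].
Qed.

End expectation_power.

(** * Stability of the solution in the parameters *)

Section part_b.
Context {R : realType} {X : completeNormedModType R}.
Local Notation mu := (@lebesgue_measure R).

Lemma ae_volterra_sub_kernel T b b' C C' k k' (f : R -> X) : weakly_singular T b C k -> weakly_singular T b' C' k' ->
  0 < b <= 1 -> 0 < b' <= 1 -> bochner_integrable `]0, T[ f ->
  {ae mu, forall t, `]0, T[%classic t -> volterra k' f t - volterra k f t = volterra (fun t s => k' t s - k t s) f t}.
Proof.
move=> hk hk' b1 b1' If.
apply: (ae_impl2 (ae_integrable_kernel hk b1 If) (ae_integrable_kernel hk' b1' If)) => t h1 h2 tT.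
have mt : measurable (`]0, t[ : set R) by [].
apply: etrans (esym (bochnerB mt (measure_oo_lty 0 t) (h2 tT) (h1 tT))) _.
by apply: (bochner_ae mt); apply: aeW => s _; rewrite scalerBl.
Qed.

Variables (T : R) (p : \bar R) (a0 a1 a2 : R) (f : R -> X).
Hypotheses (T0 : 0 < T) (p1 : (1 <= p)%E) (a00 : 0 < a0) (a01 : a0 <= a1) (a12 : a1 < a2) (a21 : a2 < 1).
Hypotheses (fL : in_Lp T 1%E f) (gL : RL_derivative_in_Lp T p a2 f).

Let g2 := RL_derivative a2 f.
Let Ig2 : bochner_integrable `]0, T[ g2. Proof. by apply: (LpN_integrable p1); case: gL. Qed.
Let If : bochner_integrable `]0, T[ f. Proof. exact: LpN_integrable (lexx _) fL. Qed.
Let c := a2 - a1.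
Let c1 : 0 < c <= 1.
Proof. by rewrite /c; move: a00 a01 a12 a21 => ? ? ? ?; apply/andP; split; lra. Qed.
Let c0 : 0 < c. Proof. by case/andP: c1. Qed.
Let cb a : a0 <= a <= a1 -> c <= a2 - a <= 1.
Proof. by rewrite /c; move: a00 a01 a12 a21 => ? ? ? ? /andP[? ?]; apply/andP; split; lra. Qed.
Let b01 a : a0 <= a <= a1 -> 0 < a2 - a <= 1.
Proof. by move=> /cb /andP[/(lt_le_trans c0) -> ->]. Qed.
Let a_pos a : a0 <= a <= a1 -> 0 < a < 1.
Proof. by move: a00 a01 a12 a21 => ? ? ? ? /andP[? ?]; apply/andP; split; lra. Qed.
Let a_lt a : a0 <= a <= a1 -> a < a2.
Proof. by move=> /andP[_ /le_lt_trans]; apply. Qed.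

Let g a := volterra (rl_kernel (a2 - a)) g2.
Let Iga a : a0 <= a <= a1 -> bochner_integrable `]0, T[ (g a).
Proof. by move=> ha; exact: bochner_integrable_volterra (weakly_singular_rl_kernel T (b01 ha)) (b01 ha) Ig2. Qed.

Let lower a (ha : a0 <= a <= a1) : ac_derivable 0 T (RL_integral (1 - a) f) /\
  {ae mu, forall t, t \in `]0, T[ -> RL_derivative a f t = g a t}.
Proof.
have /andP[ap _] := a_pos ha; have [acf _] := gL.
exact: RL_derivative_lower ap (a_lt ha) a21 If acf Ig2.
Qed.

(** A bound for J^b on L^p, uniform over the orders b = a2 - a >= c: 1/Gamma(b) <= e, T^b <= 1 + T
    and 1/b <= 1/c. *)
Let A := expR 1 * ((1 + T) / c).
Let A0 : 0 <= A. Proof.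
apply: mulr_ge0; first exact: expR_ge0.
by apply: divr_ge0; [apply: addr_ge0 => //; exact: ltW T0|exact: ltW c0].
Qed.

Lemma LpN_fractional_le a : a0 <= a <= a1 -> (LpN T p (volterra (rl_kernel (a2 - a)) g2) <= A%:E * LpN T p g2)%E.
Proof.
move=> ha; apply: le_trans (LpN_volterra T0 p1 (b01 ha) (weakly_singular_rl_kernel T (b01 ha)) Ig2) _.
have /andP[cb1 cb2] := cb ha; have /andP[bp _] := b01 ha.
apply: lee_wpmul2r; first exact: Lnorm_ge0.
rewrite lee_fin; apply: ler_pM.
- by rewrite invGamma_ge0// itv01_le2// b01.
- by rewrite divr_ge0 ?powR_ge0 ?ltW.
- exact: invGamma_le (b01 ha).
- apply: ler_pM; rewrite ?powR_ge0 ?invr_ge0 ?(ltW bp)//; last by rewrite lef_pV2// posrE.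
  by apply: powR_le1D; rewrite ?T0 ?lexx ?(ltW bp).
Qed.

Lemma LpN_fractional_lty a : a0 <= a <= a1 -> (LpN T p (volterra (rl_kernel (a2 - a)) g2) < +oo)%E.
Proof.
move=> ha; apply: le_lt_trans (LpN_fractional_le ha) _.
by apply: lte_mul_pinfty; [rewrite lee_fin; exact: A0|by []|by case: gL => _ []].
Qed.

Lemma RL_derivative_in_Lp_lower a : a0 <= a <= a1 -> RL_derivative_in_Lp T p a f.
Proof.
move=> ha; have [acF Fg] := lower ha; split => //.
have e : {ae mu, forall t, `]0, T[%classic t -> g a t = RL_derivative a f t}.
  by apply: (ae_impl Fg) => t h tT; rewrite h.
have [sF _] := bochner_integrable_ae (measurable_itv _) e (Iga ha).
apply: in_Lp_oo => //; apply: le_lt_trans (LpN_fractional_lty ha).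
by apply: LpN_le_ae => //; apply: (ae_impl e) => t h tT; rewrite -(h tT).
Qed.

Lemma solution_volterra a (M : R) kap h u : a0 <= a <= a1 -> regular_kernel T M kap h ->
  abel_solution T p a kap f u -> bochner_integrable `]0, T[ u /\
  {ae mu, forall t, `]0, T[%classic t -> u t = g a t + volterra (abel_Lh a h) u t}.
Proof.
move=> ha rk [uL /eq_on_sub uf]; have Iu := LpN_integrable p1 uL; split => //.
have [acF Fg] := lower ha.
by have [H _] := abel_equation_volterra (a_pos ha) rk acF Fg If (Iga ha) Iu; exact: H uf.
Qed.

(** The difference u' - u solves the equation with the kernel of u' and two source terms: the change
    of D^a f, and the change of kernel applied to u. The a priori bound with kernel-independent
    constant S then applies. *)
Lemma solutions_lipschitz (M : R) : exists2 Cb : R, 0 <= Cb &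
  forall (a a' d : R) kap kap' h h' (u u' : R -> X),
  a0 <= a <= a1 -> a0 <= a' <= a1 -> 0 <= d ->
  regular_kernel T `|M| kap h -> regular_kernel T `|M| kap' h' ->
  (triangle_norm T (fun t s => derive1 (kap'^~ s) t - derive1 (kap^~ s) t)%R <= d%:E)%E ->
  abel_solution T p a kap f u -> abel_solution T p a' kap' f u' ->
  (LpN T p (u' \- u)%R <= (Cb * (`|a' - a| + d))%:E)%E.
Proof.
have M0 : 0 <= `|M| by [].
have a1lt : a1 < 1 by exact: lt_trans a21.
have [D D0 HD] := abel_Lh_lipschitz T a00 a01 a1lt M0.
have g2fin : LpN T p g2 \is a fin_num.
  by rewrite ge0_fin_numE ?Lnorm_ge0//; case: gL => _ [].
pose G2 := fine (LpN T p g2); have G20 : 0 <= G2 by rewrite fine_ge0// Lnorm_ge0.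
have G2E : LpN T p g2 = G2%:E by rewrite fineK.
pose N := volterra_cst T `|M|.
pose S := 1 + 2 * (N * T) * expR (2 * (N * T)).
pose J := rl_kernel_lip T c * (T `^ (c / 2) / (c / 2)).
have N0 : 0 < N by rewrite ltr_wpDl ?mulr_ge0 ?invr_gt0.
have S0 : 0 <= S by rewrite addr_ge0// !mulr_ge0 ?expR_ge0 ?ltW.
have J0 : 0 <= J by rewrite mulr_ge0 ?rl_kernel_lip_ge0 ?divr_ge0 ?powR_ge0 ?(ltW c0).
(* A bound on the norm of u, uniform in the parameters; it multiplies the variation of the kernel in
   [Cb]. *)
pose U := S * (A * G2); have U0 : 0 <= U by apply: mulr_ge0 => //; apply: mulr_ge0 => //; exact: A0.
pose Cb := S * (J * G2 + D * T * U).
have Cb0 : 0 <= Cb.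
  apply: mulr_ge0 => //; apply: addr_ge0; first exact: mulr_ge0.
  by apply: mulr_ge0 => //; apply: mulr_ge0 => //; exact: ltW T0.
exists Cb => // a a' d kap kap' h h1 u u' ha ha' d0 rk rk1 hd us us'.
(* The original [h1] is close to [h] almost everywhere only; it is exchanged for a version within d
   of [h] everywhere, as [abel_Lh_lipschitz] requires. *)
have [h' rk' hh'] := regular_kernel_close d0 rk rk1 hd.
have [Iu uE] := solution_volterra ha rk us.
have [Iu' uE'] := solution_volterra ha' rk' us'.
have [_ mh hM _] := rk; have [_ mh' hM' _] := rk'.
have wL := weakly_singular_abel_Lh_cst T0 (a_pos ha) rk; have wL' := weakly_singular_abel_Lh_cst T0 (a_pos ha') rk'.
have wd := HD a a' h h' d ha ha' mh mh' hM hM' d0 hh'.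
have one1 : 0 < (1 : R) <= 1 by rewrite ltr01 lexx.
have mT : measurable (`]0, T[ : set R) by [].
have uU : (LpN T p u <= U%:E)%E.
  have [sg _] := Iga ha.
  apply: le_trans (volterra_bound T0 p1 N0 wL Iu sg uE) _.
  rewrite EFinM; apply: lee_wpmul2l; first by rewrite lee_fin.
  by rewrite EFinM -G2E; exact: LpN_fractional_le.
pose w1 t := g a' t - g a t.
pose w2 := volterra (fun t s => abel_Lh a' h' t s - abel_Lh a h t s) u.
have Iw1 : bochner_integrable `]0, T[ w1 by exact: bochner_integrableB mT (Iga ha') (Iga ha).
have Iw2 : bochner_integrable `]0, T[ w2 by exact: bochner_integrable_volterra wd one1 Iu.
have [sw1 _] := Iw1; have [sw2 _] := Iw2.
have Iw := bochner_integrableD mT Iw1 Iw2; have [sw _] := Iw.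
have [b [mb b0 wb]] := strongly_measurable_norm sw.
have Iu2 := bochner_integrableB mT Iu' Iu.
have step1 : (LpN T p (u' \- u)%R <= S%:E * LpN T p (b : R -> R^o))%E.
  apply: (volterra_perturbed T0 p1 N0 wL' Iu2 mb b0).
  apply: (ae_impl2 (ae_impl2 uE uE' (fun t h1 h2 => conj h1 h2))
    (ae_impl2 wb (ae_volterra_sub_kernel wL wL' one1 one1 Iu) (fun t h1 h2 => conj h1 h2))) => t [e1 e2] [e3 e4] tT.
  have tT' : t <= T by move: tT; rewrite /= in_itv/= => /andP[_ /ltW].
  rewrite -(e3 tT) (volterraB_bounded wL' tT' Iu' Iu) {1}(e1 tT) {1}(e2 tT) /w1 /w2 -(e4 tT).
  move: (volterra (abel_Lh a' h') u' t) (volterra (abel_Lh a' h') u t) (volterra (abel_Lh a h) u t) (g a' t) (g a t) => x1 x2 x3 x4 x5.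
  suff -> : x4 + x1 - (x5 + x3) - (x1 - x2) = x4 - x5 + (x2 - x3) by [].
  by rewrite (opprD x5) (opprB x1) (addrACA x4 x1) -[in RHS](subrKA x1 x2) [LHS]addrAC [RHS]addrA.
have step2 : (LpN T p (b : R -> R^o) <= LpN T p w1 + LpN T p w2)%E.
  apply: (LpN_add_le p1 sw1 sw2); apply: (ae_impl wb) => t e tT.
  by rewrite ger0_norm// -(e tT) ler_normD.
have step3 : (LpN T p w1 <= (`|a' - a| * J * G2)%:E)%E.
  (* Both data are fractional integrals of the same [g2], so only the orders a2 - a and a2 - a'
     differ. *)
  have wj := weakly_singular_rl_kernel_lipschitz T0 c1 (cb ha) (cb ha').
  have c2 : 0 < c / 2 <= 1.
    rewrite divr_gt0//= ler_pdivrMr// mul1r (@le_trans _ _ 1)// ?ler1n//.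
    by case/andP: c1.
  have hh := LpN_volterra T0 p1 c2 wj Ig2; rewrite G2E -EFinM in hh.
  have nE : `|a2 - a' - (a2 - a)| = `|a' - a| by rewrite opprB addrC subrKA distrC.
  have JE : `|a2 - a' - (a2 - a)| * rl_kernel_lip T c * (T `^ (c / 2) / (c / 2)) * G2 = `|a' - a| * J * G2.
    by rewrite nE /J !mulrA.
  rewrite JE in hh; apply: le_trans hh; apply: LpN_le_ae => //.
  apply: (ae_impl (ae_volterra_sub_kernel (weakly_singular_rl_kernel T (b01 ha)) (weakly_singular_rl_kernel T (b01 ha')) (b01 ha) (b01 ha') Ig2)) => t e tT.
  by rewrite /w1 (e tT).
have step4 : (LpN T p w2 <= (D * (`|a' - a| + d) * T * U)%:E)%E.
  have := LpN_volterra T0 p1 one1 wd Iu; rewrite powRr1 ?(ltW T0)// divr1 => /le_trans; apply.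
  by rewrite [leRHS]EFinM; apply: lee_wpmul2l => //; rewrite lee_fin !mulr_ge0 ?addr_ge0 ?(ltW T0).
apply: le_trans step1 _.
apply: (@le_trans _ _ (S%:E * ((`|a' - a| * J * G2)%:E + (D * (`|a' - a| + d) * T * U)%:E))%E).
  apply: lee_wpmul2l; first by rewrite lee_fin.
  by apply: le_trans step2 _; exact: leeD.
rewrite -EFinD -EFinM lee_fin.
have -> : Cb * (`|a' - a| + d) = S * ((J * G2 + D * T * U) * (`|a' - a| + d)) by rewrite /Cb mulrA.
rewrite ler_wpM2l// mulrDl; apply: lerD.
  rewrite -mulrA [`|_| * _]mulrC; apply: ler_wpM2l; first exact: mulr_ge0.
  by rewrite lerDl.
have -> : D * (`|a' - a| + d) * T * U = D * T * U * (`|a' - a| + d); last exact: lexx.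
by rewrite -!mulrA; congr (_ * _); rewrite mulrC -!mulrA.
Qed.

End part_b.

(** * Bounds on expectations *)

Section expectation.
Context d (Omega : measurableType d) (R : realType) (Pr : probability Omega R).
Local Open Scope ereal_scope.

(** [F] stands for the norm of the difference of solutions, whose measurability in the random point
    is not given; its expectation is compared with that of the Borel bound as a lower integral.
    Jensen's inequality is then applied to each summand separately. *)
Lemma expected_lipschitz (k : nat) (Cb nu : R) (mu : 'I_k -> R) (F : Omega -> R)
    (an : {RV Pr >-> R}) (zn : 'I_k -> {RV Pr >-> R}) (a : R) (z : 'rV[R]_k) (lambda rho : R) :
  (0 <= Cb)%R -> (0 < nu)%R -> (forall j, 0 < mu j)%R -> (nu <= lambda)%R -> (forall j, mu j <= rho)%R ->
  (forall w, 0 <= F w)%R ->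
  (forall w, F w <= Cb * (`|an w - a| `^ nu + distmu mu (\row_j zn j w) z))%R ->
  'E_Pr[F] <= Cb%:E *
    ('E_Pr[fun w => (`|an w - a| `^ lambda)%R] `^ (nu / lambda)
     + \sum_(j < k) 'E_Pr[fun w => (`|zn j w - z ord0 j| `^ rho)%R] `^ (mu j / rho)).
Proof.
move=> Cb0 nu0 mu0 nl mr F0 FC; rewrite unlock.
have ma : measurable_fun setT (fun w => `|an w - a|)%R.
  by apply: measurable_fun_normr; apply: measurable_funB.
have mz j : measurable_fun setT (fun w => `|zn j w - z ord0 j|)%R.
  by apply: measurable_fun_normr; apply: measurable_funB.
have man : measurable_fun setT (fun w => (`|an w - a| `^ nu)%:E).
  by apply: measurable_fun_EFin; exact: measurable_fun_powR.
have mzn j : measurable_fun setT (fun w => (`|zn j w - z ord0 j| `^ mu j)%:E).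
  by apply: measurable_fun_EFin; exact: measurable_fun_powR.
apply: (@le_trans _ _ (\int[Pr]_w (Cb%:E * ((`|an w - a| `^ nu)%:E +
    \sum_(j < k) (`|zn j w - z ord0 j| `^ mu j)%:E)))).
  apply: ge0_ae_le_integral => //; first by move=> w _; rewrite lee_fin.
    move=> w _; rewrite mule_ge0 ?adde_ge0// ?lee_fin ?powR_ge0//.
    by apply: sume_ge0 => j _; rewrite lee_fin powR_ge0.
  apply: nearW => w _; rewrite sumEFin -EFinD -EFinM lee_fin.
  apply: le_trans (FC w) _; rewrite /distmu.
  by under eq_bigr do rewrite mxE.
have ms : measurable_fun setT (fun w => \sum_(j < k) (`|zn j w - z ord0 j| `^ mu j)%:E).
  by apply: emeasurable_sum.
have s0 w : 0 <= \sum_(j < k) (`|zn j w - z ord0 j| `^ mu j)%:E.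
  by apply: sume_ge0 => j _; rewrite lee_fin powR_ge0.
have p0 w : 0 <= (`|an w - a| `^ nu)%:E by rewrite lee_fin powR_ge0.
rewrite ge0_integralZl//; last 2 first.
- exact: emeasurable_funD.
- by move=> w _; rewrite adde_ge0.
apply: lee_wpmul2l; first by rewrite lee_fin.
rewrite ge0_integralD//; apply: leeD.
  by apply: expectation_power_le => // w.
rewrite ge0_integral_sum//; apply: lee_sum => j _.
by apply: expectation_power_le.
Qed.

End expectation.

Theorem theorem3p4 (R : realType) :
  exists C : R -> \bar R -> R,
  forall (X : completeNormedModType R) (T : R) (p : \bar R) (a0 a1 : R)
    (k : nat) (P : set 'rV[R]_k) (nu : R) (mu : 'I_k -> R) (kappa1 M : R)
    (K0 : R -> R -> R -> 'rV[R]_k -> R),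
  0 < T -> (1 <= p)%E -> 0 < a0 -> a0 < a1 -> a1 < 1 -> compact P ->
  0 < nu <= 1 -> (forall j, 0 < mu j <= 1) -> 0 < kappa1 ->
  admissible_kernel T a0 a1 P nu mu kappa1 M K0 ->
  (* (a) *)
  (forall (a : R) (z : 'rV[R]_k) (f : R -> X),
     parameters a0 a1 P (a, z) ->
     in_Lp T 1%E f ->
     RL_derivative_in_Lp T p a f ->
     let kap := fun t s => K0 t s a z in
     exists u : R -> X,
       [/\ abel_solution T p a kap f u,
           forall v : R -> X, abel_solution T p a kap f v -> eq_on T v u,
           eq_on T u (fun t => RL_derivative a f t + abel_B a kap u t) &
           (LpN T p u <= (C (M * T) p)%:E * LpN T p (RL_derivative a f))%E])
  /\
  (* (b) *)
  (forall (f : R -> X) (a2 : R),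
     in_Lp T 1%E f ->
     a1 < a2 -> a2 < 1 ->
     RL_derivative_in_Lp T p a2 f ->
     (forall a, a0 <= a <= a1 -> RL_derivative_in_Lp T p a f) /\
     exists Cb : R,
     forall u : R -> 'rV[R]_k -> R -> X,
     (forall a z, parameters a0 a1 P (a, z) ->
        abel_solution T p a (fun t s => K0 t s a z) f (u a z)) ->
     (forall a z a' z',
        parameters a0 a1 P (a, z) -> parameters a0 a1 P (a', z') ->
        (LpN T p (u a' z' \- u a z)%R
         <= (Cb * (`|a' - a| `^ nu + distmu mu z' z))%R%:E)%E) /\
     (forall (d : measure_display) (Omega : measurableType d)
        (Pr : probability Omega R) (an : {RV Pr >-> R})
        (zn : 'I_k -> {RV Pr >-> R}),
        (forall w, parameters a0 a1 P (an w, \row_j zn j w)) ->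
      forall (a : R) (z : 'rV[R]_k) (lambda rho : R),
        parameters a0 a1 P (a, z) ->
        nu <= lambda -> (forall j, mu j <= rho) ->
        ('E_Pr[fun w => fine (LpN T p (u (an w) (\row_j zn j w) \- u a z))%R]
         <= Cb%:E *
            ('E_Pr[fun w => (`|an w - a| `^ lambda)%R] `^ (nu / lambda)
             + \sum_(j < k)
                 'E_Pr[fun w => (`|zn j w - z ord0 j| `^ rho)%R]
                   `^ (mu j / rho)))%E)).
Proof.
(* One constant serves every p, since the constants of Schur's test do not depend on the
   exponent. *)
exists (fun x _ => stability_cst x).
move=> X T p a0 a1 k P nu mu kappa1 M K0 T0 p1 a00 a01 a11 cP /andP[nu0 nu1] hmu k0 adm.
have in01 a z : parameters a0 a1 P (a, z) -> 0 < a < 1.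
  by move=> [/= h1 h2 _]; rewrite (lt_le_trans a00 h1) (le_lt_trans h2 a11).
have mid a z : parameters a0 a1 P (a, z) -> a0 <= a <= a1 by move=> [/= -> ->].
split=> [a z f az fL gL kap|f a2 fL a12 a21 gL].
  have [h rk] := admissible_regular adm az.
  exact: (abel_solution_exists T0 p1 (in01 _ _ az) rk fL gL).
split=> [a ha|]; first exact: (RL_derivative_in_Lp_lower T0 p1 a00 (ltW a01) a12 a21 fL gL ha).
have [Cb Cb0 HC] := solutions_lipschitz T0 p1 a00 (ltW a01) a12 a21 fL gL M.
(* [solutions_lipschitz] bounds the norm by |a' - a| plus kappa1 times the modulus. As |a' - a| <= 1
   and nu <= 1, the first term is at most |a' - a|^nu, which accounts for the 1. *)
exists (Cb * (1 + kappa1)) => u us.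
have CB0 : 0 <= Cb * (1 + kappa1) by rewrite mulr_ge0// addr_ge0// ltW.
have lip a z a' z' : parameters a0 a1 P (a, z) -> parameters a0 a1 P (a', z') ->
    (LpN T p (u a' z' \- u a z)%R
     <= (Cb * (1 + kappa1) * (`|a' - a| `^ nu + distmu mu z' z))%R%:E)%E.
  move=> az az'; have [h rk] := admissible_regular adm az; have [h' rk'] := admissible_regular adm az'.
  have dm0 : 0 <= distmu mu z' z by apply: sumr_ge0 => j _; exact: powR_ge0.
  have s0 : 0 <= `|a' - a| `^ nu + distmu mu z' z by rewrite addr_ge0// powR_ge0.
  have d0 : 0 <= kappa1 * (`|a' - a| `^ nu + distmu mu z' z) by rewrite mulr_ge0// ltW.
  have [_ _ _ _ Kd] := adm.
  apply: le_trans (HC _ _ _ _ _ _ _ _ _ (mid _ _ az) (mid _ _ az') d0 rk rk' (Kd _ _ _ _ az az')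
    (us _ _ az) (us _ _ az')) _.
  rewrite lee_fin -mulrA ler_wpM2l// [leRHS]mulrDl mul1r lerD2r.
  apply: (@le_trans _ _ (`|a' - a| `^ nu)); last by rewrite lerDl.
  have a'a1 : `|a' - a| <= 1.
    have /andP[l1 l2] := in01 _ _ az; have /andP[l3 l4] := in01 _ _ az'.
    by rewrite ler_norml; apply/andP; split; lra.
  have [->|an0] := eqVneq `|a' - a| 0; first exact: powR_ge0.
  have ap : 0 < `|a' - a| by rewrite lt_neqAle eq_sym an0 normr_ge0.
  rewrite -[leLHS]powRr1// /powR gt_eqF// ler_expR ler_wnM2r// ln_le0//.
split => // d Omega Pr an zn hw a z lambda rho az nl mr.
apply: expected_lipschitz => //; first by move=> j; case/andP: (hmu j).
  by move=> w; apply: fine_ge0; exact: Lnorm_ge0.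
(* The norm is finite by the Lipschitz bound, so [fine] does not replace it by a default value. *)
move=> w; have h := lip _ _ _ _ az (hw w).
rewrite -lee_fin fineK// ge0_fin_numE ?Lnorm_ge0//.
exact: le_lt_trans h (ltry _).
Qed.
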